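(* Let $\{\mu_n\}_{n=1}^\infty$ and $\{\nu_n\}_{n=1}^\infty$ be sequences of Borel probability measures on $\mathbb{R}^2$ and $\{k_n\}_{n=1}^\infty$ a sequence of positive integers with $\lim_{n\to\infty}k_n=\infty$. Assume there is a common domain $\Omega_{\alpha,\beta}$ and a Borel probability measure $\nu$ on $\mathbb{R}^2$ such that $\lim_{n\to\infty}k_n\phi_{\nu_n}=\phi_\nu$ pointwise on $\Omega_{\alpha,\beta}$ and the sequences $\{[\nu_n^{(1)}]^{\boxplus k_n}\}_{n=1}^\infty$ and $\{[\nu_n^{(2)}]^{\boxplus k_n}\}_{n=1}^\infty$ converge weakly to $\nu^{(1)}$ and $\nu^{(2)}$ respectively. Assume furthermore that the sequences $\{\zeta_n^{(1)}\}$ and $\{\zeta_n^{(2)}\}$ defined by $$\zeta_n^{(i)}=\underbrace{(\mu_n^{(i)},\nu_n^{(i)})\boxplus_{\mathrm{c}}\cdots\boxplus_{\mathrm{c}}(\mu_n^{(i)},\nu_n^{(i)})}_{k_n\text{ times}},\qquad i=1,2,\ n\ge1,$$ converge weakly to some Borel probability measures $\mu^{(1)}$ and $\mu^{(2)}$ on $\mathbb{R}$ respectively. The following are equivalent: (1) There exists a common domain $\Omega_{\alpha,\beta}$ such that the pointwise limits $\Phi(z,w):=\lim_{n\to\infty}k_n\Phi_{(\mu_n,\nu_n)}(z,w)$ exist for all $(z,w)\in\Omega_{\alpha,\beta}$. (2) The pointwise limits $$\widetilde\Phi(z,w):=\lim_{n\to\infty}k_n\int_{\mathbb{R}^2}\frac{st}{(z-s)(w-t)}\,d\mu_n(s,t)$$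 exist for all $(z,w)\in(\mathbb{C}\setminus\mathbb{R})^2$. (3) The finite signed Borel measures $$d\widetilde\rho_n(s,t)=k_n\frac{st}{\sqrt{1+s^2}\sqrt{1+t^2}}\,d\mu_n(s,t)$$ converge weakly to a finite signed Borel measure $\rho$ on $\mathbb{R}^2$. Moreover, if these assertions hold, then the function $\widetilde\Phi$ from assertion (2) has a unique integral representation $$\widetilde\Phi(z,w)=\int_{\mathbb{R}^2}\frac{\sqrt{1+s^2}\sqrt{1+t^2}}{(z-s)(w-t)}\,d\rho(s,t)$$ and the function $\Phi$ from assertion (1) can be written as $$\Phi(z,w)=\frac1z\Phi_{(\mu^{(1)},\nu^{(1)})}(z)+\frac1w\Phi_{(\mu^{(2)},\nu^{(2)})}(w)+\widetilde\Phi(z,w)$$ for all $(z,w)\in(\mathbb{C}\setminus\mathbb{R})^2$.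
   Context: **One variable.** For a finite positive Borel measure $\nu$ on $\mathbb{R}$, $G_\nu(z)=\int\frac{1}{z-s}\,d\nu(s)$ and $F_\nu=1/G_\nu$ on $\mathbb{C}\setminus\mathbb{R}$. For $\alpha,\beta>0$: $\Gamma_\alpha=\{x+iy\in\mathbb{C}^+:|x|<\alpha y\}$, $\Gamma_{\alpha,\beta}=\{x+iy\in\Gamma_\alpha:y>\beta\}$, $\overline{\Gamma_{\alpha,\beta}}$ its set of complex conjugates, and $\Omega_{\alpha,\beta}=\{(z,w):z,w\in\Gamma_{\alpha,\beta}\cup\overline{\Gamma_{\alpha,\beta}}\}$. For a probability measure $\nu$ on $\mathbb{R}$ and every $\alpha>0$ there is $\beta>0$ such that the compositional inverse $F_\nu^{-1}$ (with $F_\nu^{-1}(z)=z(1+o(1))$ at infinity, non-tangentially) is defined on $\Gamma_{\alpha,\beta}\cup\overline{\Gamma_{\alpha,\beta}}$. The free Voiculescu transform is $\phi_\nu(z)=F_\nu^{-1}(z)-z$; free convolution $\boxplus$ is characterized by $\phi_{\nu_1\boxplus\nu_2}=\phi_{\nu_1}+\phi_{\nu_2}$ on common domains. For a pair $(\mu,\nu)$ of Borel probability measures on $\mathbb{R}$, the c-free Voiculescu transform is $\Phi_{(\mu,\nu)}(z)=F_\nu^{-1}(z)-F_\mu(F_\nu^{-1}(z))$ (and its analytic continuation). $(\mu_1,\nu_1)\boxplus_{\mathrm{c}}(\mu_2,\nu_2)$ is the pair $(\mu,\nu)$ with $\nu=\nu_1\boxplus\nu_2$ and $\mu$ the unique measure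 with $\Phi_{(\mu,\nu)}=\Phi_{(\mu_1,\nu_1)}+\Phi_{(\mu_2,\nu_2)}$; by abuse of notation it also denotes the first component $\mu$ (as in the definition of $\zeta_n^{(i)}$). **Two variables.** For a Borel probability measure $\sigma$ on $\mathbb{R}^2$, $\sigma^{(1)}(B)=\sigma(B\times\mathbb{R})$ and $\sigma^{(2)}(B)=\sigma(\mathbb{R}\times B)$ are its marginals and $G_\sigma(z,w)=\int_{\mathbb{R}^2}\frac{1}{(z-s)(w-t)}\,d\sigma(s,t)$. The bi-free partial Voiculescu transform of $\nu$ is $$\phi_\nu(z,w)=\frac1z\phi_{\nu^{(1)}}(z)+\frac1w\phi_{\nu^{(2)}}(w)+1-\frac{1}{zwG_\nu(F_{\nu^{(1)}}^{-1}(z),F_{\nu^{(2)}}^{-1}(w))},$$ and the c-bi-free partial Voiculescu transform of a pair $(\mu,\nu)$ of Borel probability measures on $\mathbb{R}^2$ is $$\Phi_{(\mu,\nu)}(z,w)=\frac1z\Phi_{(\mu^{(1)},\nu^{(1)})}(z)+\frac1w\Phi_{(\mu^{(2)},\nu^{(2)})}(w)+\frac{F_{\mu^{(1)}}(F_{\nu^{(1)}}^{-1}(z))F_{\mu^{(2)}}(F_{\nu^{(2)}}^{-1}(w))G_\mu(F_{\nu^{(1)}}^{-1}(z),F_{\nu^{(2)}}^{-1}(w))-1}{zwG_\nu(F_{\nu^{(1)}}^{-1}(z),F_{\nu^{(2)}}^{-1}(w))},$$ both defined on some $\Omega_{\alpha,\beta}$ on which the inverses exist and $zwG_\nu(F_{\nu^{(1)}}^{-1}(z),F_{\nu^{(2)}}^{-1}(w))$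 does not vanish. A common domain $\Omega_{\alpha,\beta}$ is one on which all involved functions are defined. Weak convergence of finite signed measures means convergence of integrals of all bounded continuous functions. (In this statement $\mu^{(1)},\mu^{(2)}$ are just names for the weak limits of $\zeta_n^{(1)},\zeta_n^{(2)}$.) *)

(* Defs.v *)
From HB Require Import structures.
From mathcomp Require Import all_boot all_order all_algebra.
From mathcomp Require Import complex.
From mathcomp Require Import all_classical all_reals all_analysis.
From mathcomp Require Import measurable_realfun.

Set Implicit Arguments.
Unset Strict Implicit.
Unset Printing Implicit Defensive.

Import Order.TTheory GRing.Theory Num.Theory.
Import numFieldNormedType.Exports.

Local Open Scope classical_set_scope.
Local Open Scope ring_scope.
Local Open Scope complex_scope.

(* The alias [^o] gives the field [R[i]] its topology and its structure of
   normed space over itself. *)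
Notation "'CC' R" := ((complex R)^o) (at level 8, R at level 2) : type_scope.

Section integration.
Context {d : measure_display} {T : measurableType d} {R : realType}.

Definition cintegral (mu : {measure set T -> \bar R}) (f : T -> CC R) : CC R :=
  Rintegral mu setT (fun x => complex.Re (f x)) +i*
  Rintegral mu setT (fun x => complex.Im (f x)).

(* The Jordan parts below do not depend on the chosen Hahn decomposition. *)
Definition hahn_pos (rho : {charge set T -> \bar R}) : set T :=
  sval (cid (Hahn_decomposition rho)).

Definition hahn_neg (rho : {charge set T -> \bar R}) : set T :=
  sval (cid (svalP (cid (Hahn_decomposition rho)))).

Definition hahnP (rho : {charge set T -> \bar R}) :
    hahn_decomposition rho (hahn_pos rho) (hahn_neg rho) :=
  svalP (cid (svalP (cid (Hahn_decomposition rho)))).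

Definition charge_integral (rho : {charge set T -> \bar R}) (f : T -> R) : R :=
  Rintegral (jordan_pos (hahnP rho)) setT f -
  Rintegral (jordan_neg (hahnP rho)) setT f.

Definition charge_cintegral (rho : {charge set T -> \bar R}) (f : T -> CC R) :
    CC R :=
  charge_integral rho (fun x => complex.Re (f x)) +i*
  charge_integral rho (fun x => complex.Im (f x)).

End integration.

(* The product sigma-algebra and the product topology on [R * R] are the Borel
   sigma-algebra and the usual topology of the plane. *)
Definition weak_cvg {R : realType} (mu_ : nat -> probability R R)
    (mu : probability R R) : Prop :=
  forall f : R -> R, continuous f -> bounded_fun f ->
    Rintegral (mu_ n) setT f @[n --> \oo] --> Rintegral mu setT f.

Definition charge_weak_cvg {R : realType}
    (rho_ : nat -> {charge set (R * R)%type -> \bar R})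
    (rho : {charge set (R * R)%type -> \bar R}) : Prop :=
  forall f : R * R -> R, continuous f -> bounded_fun f ->
    charge_integral (rho_ n) f @[n --> \oo] --> charge_integral rho f.

(* Equality of the Borel measures, disregarding the values that MathComp set
   functions also take on non-measurable sets. *)
Definition eq_meas {d} {T : measurableType d} {R : realType}
    (m1 m2 : set T -> \bar R) : Prop :=
  forall A, measurable A -> m1 A = m2 A.

Section marginals.
Context {R : realType}.

HB.instance Definition _ := @isMeasurableFun.Build _ _ (R * R)%type R
  (@fst R R) measurable_fst.
HB.instance Definition _ := @isMeasurableFun.Build _ _ (R * R)%type R
  (@snd R R) measurable_snd.

Definition marg1 (sigma : probability (R * R)%type R) : probability R R :=
  distribution sigma (@fst R R).

Definition marg2 (sigma : probability (R * R)%type R) : probability R R :=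
  distribution sigma (@snd R R).

End marginals.

Section one_variable.
Context {R : realType}.
Implicit Types (mu nu lam : probability R R) (a b : R) (z w : CC R).

Definition nonreal : set (CC R) := [set z | complex.Im z != 0].

Definition Gtransform nu z : CC R := cintegral nu (fun s : R => (z - s%:C)^-1).

Definition Ftransform nu z : CC R := (Gtransform nu z)^-1.

Definition cone a b : set (CC R) :=
  [set z | [/\ 0 < complex.Im z, `|complex.Re z| < a * complex.Im z
             & b < complex.Im z]].

Definition cones a b : set (CC R) :=
  [set z | cone a b z \/ cone a b (conjc z)].

(* [H] is the compositional inverse of F_nu on [cones a b]; an analytic right
   inverse with this behaviour at infinity is unique on each of the two cones,
   because F_nu is injective near infinity in every cone. *)
Definition is_inverse nu a b (H : CC R -> CC R) : Prop :=
  [/\ forall z, cones a b z -> derivable H z 1,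
      forall z, cones a b z -> nonreal (H z) /\ Ftransform nu (H z) = z
    & forall e : R, 0 < e -> exists M : R, forall z,
        cones a b z -> M%:C <= `|z| -> `|H z - z| <= e%:C * `|z| ].

Definition inverse_defined nu a b : Prop := exists H, is_inverse nu a b H.

(* The value of F_nu^-1 at [z] does not depend on the cones containing [z] on
   which the inverse is considered, since two such cones intersect in a third
   one; it is [0] where F_nu^-1 is undefined. *)
Definition Finv nu z : CC R :=
  xget 0 [set w | exists a b H,
    [/\ 0 < a, 0 < b, is_inverse nu a b H, cones a b z & w = H z]].

Definition voiculescu nu z : CC R := Finv nu z - z.

Definition cvoiculescu mu nu z : CC R :=
  Finv nu z - Ftransform mu (Finv nu z).

Definition is_boxplus nu1 nu2 nu : Prop :=
  forall a b, 0 < a -> 0 < b ->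
    inverse_defined nu1 a b -> inverse_defined nu2 a b ->
    inverse_defined nu a b ->
    forall z, cones a b z -> voiculescu nu z = voiculescu nu1 z + voiculescu nu2 z.

Definition is_cboxplus mu1 nu1 mu2 nu2 mu nu : Prop :=
  is_boxplus nu1 nu2 nu /\
  forall a b, 0 < a -> 0 < b ->
    inverse_defined nu1 a b -> inverse_defined nu2 a b ->
    inverse_defined nu a b ->
    forall z, cones a b z ->
      cvoiculescu mu nu z = cvoiculescu mu1 nu1 z + cvoiculescu mu2 nu2 z.

(* [lam] is the free convolution of m.+1 copies of [nu]. *)
Fixpoint boxplus_iter nu (m : nat) lam : Prop :=
  if m is m'.+1 then
    exists lam', boxplus_iter nu m' lam' /\ is_boxplus lam' nu lam
  else eq_meas lam nu.

(* [(zeta, lam)] is the c-free convolution of m.+1 copies of [(mu, nu)]. *)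
Fixpoint cboxplus_iter mu nu (m : nat) (zeta lam : probability R R) : Prop :=
  if m is m'.+1 then
    exists zeta' lam', cboxplus_iter mu nu m' zeta' lam' /\
      is_cboxplus zeta' lam' mu nu zeta lam
  else eq_meas zeta mu /\ eq_meas lam nu.

(* For k > 0, the k-fold powers. *)
Definition boxplus_pow nu (k : nat) lam : Prop := boxplus_iter nu k.-1 lam.

Definition cboxplus_pow mu nu (k : nat) zeta lam : Prop :=
  cboxplus_iter mu nu k.-1 zeta lam.

Definition cvoiculescu_continuation mu nu (Psi : CC R -> CC R) : Prop :=
  (forall z, nonreal z -> derivable Psi z 1) /\
  (forall a b, 0 < a -> 0 < b -> inverse_defined nu a b ->
     forall z, cones a b z -> Psi z = cvoiculescu mu nu z).

End one_variable.

Section two_variables.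
Context {R : realType}.
Implicit Types (mu nu : probability (R * R)%type R) (a b : R) (z w : CC R).
Implicit Types (rho : {charge set (R * R)%type -> \bar R}).

Definition Gtransform2 mu z w : CC R :=
  cintegral mu (fun p : R * R => ((z - p.1%:C) * (w - p.2%:C))^-1).

Definition G2_inverse mu nu z w : CC R :=
  Gtransform2 mu (Finv (marg1 nu) z) (Finv (marg2 nu) w).

(* The set Omega_(a,b) of pairs of points of [cones a b] is a domain of the
   bi-free transform of [nu], and of the c-bi-free transform of any pair
   [(mu, nu)]. *)
Definition transform_domain nu a b : Prop :=
  [/\ inverse_defined (marg1 nu) a b, inverse_defined (marg2 nu) a b
    & forall z w, cones a b z -> cones a b w ->
        z * w * G2_inverse nu nu z w != 0].

Definition voiculescu2 nu z w : CC R :=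
  z^-1 * voiculescu (marg1 nu) z + w^-1 * voiculescu (marg2 nu) w
  + 1 - (z * w * G2_inverse nu nu z w)^-1.

Definition cvoiculescu2 mu nu z w : CC R :=
  z^-1 * cvoiculescu (marg1 mu) (marg1 nu) z
  + w^-1 * cvoiculescu (marg2 mu) (marg2 nu) w
  + (Ftransform (marg1 mu) (Finv (marg1 nu) z)
     * Ftransform (marg2 mu) (Finv (marg2 nu) w)
     * G2_inverse mu nu z w - 1)
    / (z * w * G2_inverse nu nu z w).

Definition rho_density (k : nat) (p : R * R) : R :=
  k%:R * (p.1 * p.2 / (Num.sqrt (1 + p.1 ^+ 2) * Num.sqrt (1 + p.2 ^+ 2))).

Lemma rho_density_integrable (k : nat) mu :
  mu.-integrable setT (fun p => (rho_density k p)%:E).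
Proof.
have root_gt0 (x : R) : 0 < Num.sqrt (1 + x ^+ 2).
  by rewrite sqrtr_gt0 ltr_pwDl// sqr_ge0.
have mden : measurable_fun setT (rho_density k).
  pose h (x : R) := x * (Num.sqrt (1 + x ^+ 2))^-1.
  have mh : measurable_fun setT h.
    apply: continuous_measurable_fun => x; apply: cvgM; first exact: cvg_id.
    apply: cvgV; first by rewrite gt_eqF.
    apply: (continuous_comp (f := fun y : R => 1 + y ^+ 2)).
      by apply: cvgD; [exact: cvg_cst|exact: exprn_continuous].
    exact: sqrt_continuous.
  rewrite (_ : rho_density k = fun p => k%:R * (h p.1 * h p.2)).
    apply: measurable_funM; first exact: measurable_cst.
    apply: measurable_funM.
      exact: (measurableT_comp mh measurable_fst).
    exact: (measurableT_comp mh measurable_snd).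
  by apply/funext => p; rewrite /rho_density /h invfM mulrACA.
apply: measurable_bounded_integrable => //.
  exact: (le_lt_trans (probability_le1 _ _) (ltry _)).
exists k%:R; split; first exact: num_real.
move=> M kM p _ /=; apply: le_trans (ltW kM).
have le_root (x : R) : `|x| <= Num.sqrt (1 + x ^+ 2).
  by rewrite -sqrtr_sqr ler_wsqrtr// lerDr.
rewrite /rho_density normrM normr_nat ler_piMr// normrM normrV; last first.
  by rewrite unitfE mulf_neq0// gt_eqF.
rewrite [X in _ / X]gtr0_norm ?mulr_gt0//.
by rewrite ler_pdivrMr ?mulr_gt0// mul1r normrM ler_pM.
Qed.

Definition rho_tilde (k : nat) mu : {charge set (R * R)%type -> \bar R} :=
  induced_charge (rho_density_integrable k mu).

Definition limit_cvoiculescu2 (mu_ nu_ : nat -> probability (R * R)%type R)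
    (k : nat -> nat) a b (Phi : CC R -> CC R -> CC R) : Prop :=
  [/\ 0 < a, 0 < b, forall n, transform_domain (nu_ n) a b
    & forall z w, cones a b z -> cones a b w ->
        (k n)%:R * cvoiculescu2 (mu_ n) (nu_ n) z w @[n --> \oo] --> Phi z w].

Definition limit_integrals (mu_ : nat -> probability (R * R)%type R)
    (k : nat -> nat) (Phit : CC R -> CC R -> CC R) : Prop :=
  forall z w, nonreal z -> nonreal w ->
    (k n)%:R * cintegral (mu_ n) (fun p : R * R =>
       (p.1 * p.2)%:C / ((z - p.1%:C) * (w - p.2%:C)))
    @[n --> \oo] --> Phit z w.

Definition limit_charges (mu_ : nat -> probability (R * R)%type R)
    (k : nat -> nat) rho : Prop :=
  charge_weak_cvg (fun n => rho_tilde (k n) (mu_ n)) rho.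

Definition represents rho (Phit : CC R -> CC R -> CC R) : Prop :=
  forall z w, nonreal z -> nonreal w ->
    Phit z w = charge_cintegral rho (fun p : R * R =>
      (Num.sqrt (1 + p.1 ^+ 2) * Num.sqrt (1 + p.2 ^+ 2))%:C
      / ((z - p.1%:C) * (w - p.2%:C))).

(* [Phih] is the analytic continuation to (C \ R)^2 of the function [Phi],
   considered on Omega_(a,b). *)
Definition continuation2 a b (Phi Phih : CC R -> CC R -> CC R) : Prop :=
  (forall z w, nonreal z -> nonreal w ->
     differentiable (fun p : CC R * CC R => Phih p.1 p.2) (z, w)) /\
  (forall z w, cones a b z -> cones a b w -> Phih z w = Phi z w).

End two_variables.

(* Main.v *)
From HB Require Import structures.
Require Import Defs.
From mathcomp Require Import all_boot all_order all_algebra.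
From mathcomp Require Import complex ring lra.
From mathcomp Require Import all_classical all_reals all_analysis.
From mathcomp Require Import measurable_realfun.

Set Implicit Arguments.
Unset Strict Implicit.
Unset Printing Implicit Defensive.

Import Order.TTheory GRing.Theory Num.Theory.
Import numFieldNormedType.Exports.

Local Open Scope classical_set_scope.
Local Open Scope ring_scope.
Local Open Scope complex_scope.

(* Write r_z(s) = 1/(z - s) and let u, v be the values of the inverses of the
   F-transforms of the marginals of nu_n at z, w.  With A, B the integrals of
   s r_u(s), t r_v(t) and C that of st r_u(s) r_v(t) with respect to mu_n, the
   transforms F, G of mu_n and its marginals satisfy

     F(u) F(v) G(u, v) - 1 = (C - A B) / ((1 + A) (1 + B)),

   while z w G_{nu_n}(u, v) -> 1 and u -> z, v -> w.  The one-variable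
   hypotheses make k_n A and k_n B converge, so the limit of k_n times the
   c-bi-free transform exists if and only if that of k_n C does, and u, v may be
   replaced by z, w.  Now k_n C is the integral of a bounded continuous kernel
   with respect to the charge in (3).  These charges have bounded total
   variation and are tight, because their densities are dominated by
   s^2 / (1 + s^2) + t^2 / (1 + t^2) and the scaled marginals are controlled by
   k_n A and k_n B.  Hence along every free ultrafilter they converge weakly to
   some charge, by a Daniell-type representation theorem, and the limits agree
   because the integrals of the kernel over a pair of cones determine a charge. *)

(** Two limitations of the data shape the proof. The identities for convolution powers are given
    only high up, on truncated cones that may move with n, whereas (1) concerns whatever common
    domain is chosen and (2) all non-real points. Analytic continuation bridges the gap. It rests on
    a maximum principle deduced from second-order Taylor expansions, which is why analyticity is
    carried as twice complex differentiability: integrals of resolvents have explicit derivatives,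
    and reciprocals, compositions and inverses of F inherit the property. The scaled one-variable
    limits are continued through a Levy-Khintchine decomposition, whose terms converge along
    ultrafilters, and the inverses are followed down rays to the points where they are wanted. In
    two variables the kernels with square roots are bounded but not closed under products, so they
    span no algebra to which an approximation theorem could be applied. Uniqueness goes through
    multipliers instead: functions that preserve a linear space closed under bounded limits, even
    though that space is not an algebra. *)

Notation nm := ComplexField.Normc.normc.

(** * Modulus and convergence in the complex plane *)

Section modulus.
Context {R : realType}.
Implicit Types z w : CC R.

Lemma nmE z : `|z| = (nm z)%:C.
Proof. by case: z. Qed.

Lemma nm_def z : nm z = Num.sqrt (complex.Re z ^+ 2 + complex.Im z ^+ 2).
Proof. by case: z. Qed.

Lemma nm_sqr z : nm z ^+ 2 = complex.Re z ^+ 2 + complex.Im z ^+ 2.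
Proof. by rewrite nm_def sqr_sqrtr// addr_ge0 ?sqr_ge0. Qed.

Lemma nm_ge0 z : 0 <= nm z.
Proof. by rewrite nm_def sqrtr_ge0. Qed.

Lemma nm0 : nm (0 : CC R) = 0.
Proof. exact: ComplexField.Normc.normc0. Qed.

Lemma nm_eq0 z : (nm z == 0) = (z == 0).
Proof.
apply/eqP/eqP => [|->]; last exact: nm0.
exact: ComplexField.Normc.eq0_normc.
Qed.

Lemma nm_gt0 z : (0 < nm z) = (z != 0).
Proof. by rewrite lt_def nm_eq0 nm_ge0 andbT. Qed.

Lemma nmM z w : nm (z * w) = nm z * nm w.
Proof. exact: ComplexField.Normc.normcM. Qed.

Lemma nmV z : nm z^-1 = (nm z)^-1.
Proof. exact: ComplexField.Normc.normcV. Qed.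

Lemma nmN z : nm (- z) = nm z.
Proof. exact: normcN. Qed.

Lemma nmD z w : nm (z + w) <= nm z + nm w.
Proof. exact: le_normcD. Qed.

Lemma nmB z w : nm (z - w) <= nm z + nm w.
Proof. by rewrite -(nmN w) nmD. Qed.

Lemma nm_dist z w : nm (z - w) = nm (w - z).
Proof. by rewrite -nmN opprB. Qed.

Lemma nm_triangle z w u : nm (z - u) <= nm (z - w) + nm (w - u).
Proof. by have := nmD (z - w) (w - u); rewrite addrA subrK. Qed.

Lemma nmB_ge z w : nm z - nm w <= nm (z - w).
Proof. by rewrite lerBlDr; have := nmD (z - w) w; rewrite subrK. Qed.

Lemma nm1 : nm (1 : CC R) = 1.
Proof. exact: ComplexField.Normc.normc1. Qed.

Lemma nmX z n : nm (z ^+ n) = nm z ^+ n.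
Proof.
by elim: n => [|n ih]; rewrite ?expr0 ?nm1// !exprS nmM ih.
Qed.

Lemma nmR (x : R) : nm (x%:C : CC R) = `|x|.
Proof. by rewrite nm_def /= expr0n/= addr0 sqrtr_sqr. Qed.

Lemma nm_nat n : nm (n%:R : CC R) = n%:R.
Proof. by rewrite -(rmorph_nat (real_complex R)) nmR normr_nat. Qed.

Lemma nm_Re z : `|complex.Re z| <= nm z.
Proof. by rewrite nm_def -sqrtr_sqr ler_wsqrtr// lerDl sqr_ge0. Qed.

Lemma nm_Im z : `|complex.Im z| <= nm z.
Proof. by rewrite nm_def -sqrtr_sqr ler_wsqrtr// lerDr sqr_ge0. Qed.

Lemma nm_le z : nm z <= `|complex.Re z| + `|complex.Im z|.
Proof.
have s0 : 0 <= `|complex.Re z| + `|complex.Im z| by rewrite addr_ge0.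
rewrite -(ler_pXn2r (ltn0Sn 1)) ?nnegrE ?nm_ge0// nm_sqr sqrrD !real_normK ?num_real//.
by rewrite -addrA lerD2l lerDr mulrn_wge0// mulr_ge0.
Qed.

Lemma nm_conj z : nm (conjc z) = nm z.
Proof. by rewrite !nm_def; case: z => x y /=; rewrite sqrrN. Qed.

Lemma cReB z w : complex.Re (z - w) = complex.Re z - complex.Re w.
Proof. by case: z; case: w. Qed.
Lemma cImB z w : complex.Im (z - w) = complex.Im z - complex.Im w.
Proof. by case: z; case: w. Qed.
Lemma cReD z w : complex.Re (z + w) = complex.Re z + complex.Re w.
Proof. by case: z; case: w. Qed.
Lemma cImD z w : complex.Im (z + w) = complex.Im z + complex.Im w.
Proof. by case: z; case: w. Qed.
Lemma cReM z w : complex.Re (z * w) =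
  complex.Re z * complex.Re w - complex.Im z * complex.Im w.
Proof. by case: z; case: w. Qed.
Lemma cImM z w : complex.Im (z * w) =
  complex.Re z * complex.Im w + complex.Im z * complex.Re w.
Proof. by case: z; case: w. Qed.
Lemma cReN z : complex.Re (- z) = - complex.Re z. Proof. by case: z. Qed.
Lemma cImN z : complex.Im (- z) = - complex.Im z. Proof. by case: z. Qed.

Lemma cReZ (x : R) z : complex.Re ((x%:C : CC R) * z) = x * complex.Re z.
Proof. by rewrite cReM /= mul0r subr0. Qed.
Lemma cImZ (x : R) z : complex.Im ((x%:C : CC R) * z) = x * complex.Im z.
Proof. by rewrite cImM /= mul0r addr0. Qed.

Lemma complex_eqP z w : complex.Re z = complex.Re w ->
  complex.Im z = complex.Im w -> z = w.
Proof. by case: z; case: w => /= ? ? ? ? -> ->. Qed.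

(** Balls of [CC R] have radii in [R[i]]; a positive one has zero imaginary part, so real radii form
    a base and all estimates can be made in [R]. *)
Lemma nbhsCP z (A : set (CC R)) :
  nbhs z A <-> exists2 e : R, 0 < e & forall w, nm (w - z) < e -> A w.
Proof.
split.
  move=> /nbhs_ballP[[e1 e2] /= e0 zA].
  move: e0; rewrite ltcE /= => /andP[/eqP e20 e10]; subst e2.
  exists e1 => // w wz; apply: zA; rewrite -ball_normE /= distrC nmE ltcR//.
move=> [e e0 zA]; apply/nbhs_ballP; exists e%:C; first by rewrite /= ltcR.
by move=> w; rewrite -ball_normE /= distrC nmE ltcR; exact: zA.
Qed.

Lemma cvgCP {T : Type} {F : set_system T} {FF : Filter F} (f : T -> CC R) z :
  f @ F --> z <-> forall e : R, 0 < e -> \forall x \near F, nm (f x - z) < e.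
Proof.
split=> [fz e e0|H A /nbhsCP[e e0 zA]].
  have : nbhs z [set w | nm (w - z) < e] by apply/nbhsCP; exists e.
  by move/fz.
by apply: filterS (H _ e0) => x; exact: zA.
Qed.

Lemma cvgRP {T : Type} {F : set_system T} {FF : Filter F} (f : T -> R) x :
  f @ F --> x <-> forall e : R, 0 < e -> \forall t \near F, `|f t - x| < e.
Proof.
split=> [/cvgrPdist_lt fx e e0|H].
  by apply: filterS (fx _ e0) => t; rewrite distrC.
by apply/cvgrPdist_lt => e e0; apply: filterS (H _ e0) => t; rewrite distrC.
Qed.

Lemma cvgC_nm {T : Type} {F : set_system T} {FF : Filter F} (f : T -> CC R) z :
  f @ F --> z <-> nm (f x - z) @[x --> F] --> 0.
Proof.
split=> [/cvgCP H|/cvgRP H].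
  by apply/cvgRP => e e0; apply: filterS (H _ e0) => t; rewrite subr0 ger0_norm// nm_ge0.
by apply/cvgCP => e e0; apply: filterS (H _ e0) => t; rewrite subr0 ger0_norm// nm_ge0.
Qed.

Lemma cvgC_le {T : Type} {F : set_system T} {FF : Filter F} (f : T -> CC R)
    (g : T -> R) z :
  (\forall x \near F, nm (f x - z) <= g x) -> g @ F --> 0 -> f @ F --> z.
Proof.
move=> fg /cvgRP g0; apply/cvgCP => e e0.
apply: filterS2 fg (g0 _ e0) => x fgx; rewrite subr0 => gx.
by rewrite (le_lt_trans fgx)// (le_lt_trans (ler_norm _)).
Qed.

Lemma cvg_Re {T : Type} {F : set_system T} {FF : Filter F} (f : T -> CC R) z :
  f @ F --> z -> complex.Re (f x) @[x --> F] --> complex.Re z.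
Proof.
move=> /cvgCP H; apply/cvgRP => e e0; apply: filterS (H _ e0) => x.
by apply: le_lt_trans; rewrite -cReB nm_Re.
Qed.

Lemma cvg_Im {T : Type} {F : set_system T} {FF : Filter F} (f : T -> CC R) z :
  f @ F --> z -> complex.Im (f x) @[x --> F] --> complex.Im z.
Proof.
move=> /cvgCP H; apply/cvgRP => e e0; apply: filterS (H _ e0) => x.
by apply: le_lt_trans; rewrite -cImB nm_Im.
Qed.

Lemma cvg_ReIm {T : Type} {F : set_system T} {FF : Filter F} (f : T -> CC R) z :
  complex.Re (f x) @[x --> F] --> complex.Re z ->
  complex.Im (f x) @[x --> F] --> complex.Im z -> f @ F --> z.
Proof.
move=> fr fi.
apply: (@cvgC_le _ _ _ _ (fun x => `|complex.Re (f x) - complex.Re z| +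
  `|complex.Im (f x) - complex.Im z|)).
  by apply: nearW => x; rewrite -cReB -cImB nm_le.
rewrite -[X in _ --> X]addr0; apply: cvgD.
  by rewrite -(@normr0 _ R) -(subrr (complex.Re z)); apply: cvg_norm; apply: cvgB => //; exact: cvg_cst.
by rewrite -(@normr0 _ R) -(subrr (complex.Im z)); apply: cvg_norm; apply: cvgB => //; exact: cvg_cst.
Qed.

Lemma cvg_nm {T : Type} {F : set_system T} {FF : Filter F} (f : T -> CC R) z :
  f @ F --> z -> nm (f x) @[x --> F] --> nm z.
Proof.
move=> /cvgCP H; apply/cvgRP => e e0; apply: filterS (H _ e0) => x.
apply: le_lt_trans; rewrite ler_norml nmB_ge andbT.
by have := nmB_ge z (f x); rewrite nm_dist; lra.
Qed.

Lemma cvgC_unique {T : Type} {F : set_system T} {FF : ProperFilter F} (f : T -> CC R) z w :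
  f @ F --> z -> f @ F --> w -> z = w.
Proof. exact: (cvg_unique (T := CC R)). Qed.

Lemma cvg_realC {T : Type} {F : set_system T} {FF : Filter F} (f : T -> R) (x : R) :
  f @ F --> x -> ((f t)%:C : CC R) @[t --> F] --> (x%:C : CC R).
Proof.
by move=> fx; apply: cvg_ReIm => //=; exact: cvg_cst.
Qed.

Lemma cvgCD {T : Type} {F : set_system T} {FF : Filter F} (f g : T -> CC R) z w :
  f @ F --> z -> g @ F --> w -> (fun x => f x + g x) @ F --> z + w.
Proof. exact: cvgD. Qed.

Lemma cvgCN {T : Type} {F : set_system T} {FF : Filter F} (f : T -> CC R) z :
  f @ F --> z -> (fun x => - f x) @ F --> - z.
Proof. exact: cvgN. Qed.

Lemma cvgCB {T : Type} {F : set_system T} {FF : Filter F} (f g : T -> CC R) z w :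
  f @ F --> z -> g @ F --> w -> (fun x => f x - g x) @ F --> z - w.
Proof. exact: cvgB. Qed.

Lemma cvgCM {T : Type} {F : set_system T} {FF : Filter F} (f g : T -> CC R) z w :
  f @ F --> z -> g @ F --> w -> (fun x => f x * g x) @ F --> z * w.
Proof. exact: cvgM. Qed.

Lemma cvgCV {T : Type} {F : set_system T} {FF : Filter F} (f : T -> CC R) z :
  z != 0 -> f @ F --> z -> (fun x => (f x)^-1) @ F --> z^-1.
Proof. exact: cvgV. Qed.

Lemma cvgC_cst {T : Type} {F : set_system T} {FF : Filter F} z :
  (fun _ : T => z) @ F --> z.
Proof. exact: cvg_cst. Qed.

Lemma cvgC_id z : (fun w : CC R => w) @ z --> z.
Proof. exact: cvg_id. Qed.

Definition cdisc z (r : R) : set (CC R) := [set w | nm (w - z) <= r].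

(** A disc is a closed part of the continuous image of a square, which is compact as a product of
    segments. *)
Lemma compact_cdisc z r : compact (cdisc z r).
Proof.
pose K := [set x : R | complex.Re z - r <= x <= complex.Re z + r] `*`
          [set x : R | complex.Im z - r <= x <= complex.Im z + r].
have cK : compact K.
  by apply: compact_setX; rewrite -set_itvcc; exact: segment_compact.
pose f (p : R * R) : CC R := p.1 +i* p.2.
have cf : continuous f.
  move=> p; apply: cvg_ReIm => /=; [exact: cvg_fst|exact: cvg_snd].
have cfK : compact (f @` K).
  by apply: continuous_compact => //; apply: continuous_subspaceT.
apply: (subclosed_compact _ cfK).
  have -> : cdisc z r = (fun w => nm (w - z)) @^-1` [set x | x <= r] by [].
  apply: closed_comp; last exact: closed_le.
  move=> w _; apply: (@cvg_nm _ (nbhs w) _ (fun w => w - z)).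
  by apply: cvgB; [exact: cvg_id|exact: cvg_cst].
move=> w wr; exists (complex.Re w, complex.Im w); last by case: (w).
have h1 := nm_Re (w - z); have h2 := nm_Im (w - z).
rewrite /cdisc /= in wr.
have := le_trans h1 wr; have := le_trans h2 wr; rewrite cReB cImB !ler_norml.
by move=> /andP[? ?] /andP[? ?]; split => /=; apply/andP; split; lra.
Qed.

End modulus.

(** * Continuity and complex differentiation *)

Section continuity.
Context {R : realType}.
Implicit Types (f g q : CC R -> CC R) (z : CC R).

(* Wrapping the convergence statement keeps [done] from unfolding it. *)
Variant ccont f z : Prop := Ccont of f @ nbhs z --> f z.

Lemma ccont_cvg f z : ccont f z -> f @ nbhs z --> f z.
Proof. by case. Qed.

Lemma ccont_cst (c : CC R) z : ccont (fun=> c) z.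
Proof. split; exact (@cvgC_cst _ _ (nbhs z) _ c). Qed.

Lemma ccont_id z : ccont id z.
Proof. split; exact (@cvgC_id R z). Qed.

Lemma ccontD f g z : ccont f z -> ccont g z -> ccont (fun w => f w + g w) z.
Proof. move=> [cf] [cg]; split; exact (@cvgCD R _ (nbhs z) _ f g _ _ cf cg). Qed.

Lemma ccontN f z : ccont f z -> ccont (fun w => - f w) z.
Proof. move=> [cf]; split; exact (@cvgCN R _ (nbhs z) _ f _ cf). Qed.

Lemma ccontB f g z : ccont f z -> ccont g z -> ccont (fun w => f w - g w) z.
Proof. move=> cf cg; exact (ccontD cf (ccontN cg)). Qed.

Lemma ccontM f g z : ccont f z -> ccont g z -> ccont (fun w => f w * g w) z.
Proof. move=> [cf] [cg]; split; exact (@cvgCM R _ (nbhs z) _ f g _ _ cf cg). Qed.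

Lemma ccontV f z : f z != 0 -> ccont f z -> ccont (fun w => (f w)^-1) z.
Proof. move=> f0 [cf]; split; exact (@cvgCV R _ (nbhs z) _ f _ f0 cf). Qed.

Lemma ccont_comp f g z : ccont g z -> ccont f (g z) -> ccont (fun w => f (g w)) z.
Proof. move=> [cg] [cf]; split; exact (cvg_comp _ _ cg cf). Qed.

Lemma ccontP f z : ccont f z <-> forall e : R, 0 < e ->
  exists2 d : R, 0 < d & forall w, nm (w - z) < d -> nm (f w - f z) < e.
Proof.
split => [[/cvgCP H] e /H/nbhsCP//|H]; split.
by apply/(@cvgCP _ _ (nbhs z)) => e /H /nbhsCP.
Qed.

Lemma ccont_nbhs f z (A : set (CC R)) : ccont f z -> nbhs (f z) A ->
  \forall w \near z, A (f w).
Proof. by move=> [cf] fA; exact: cf. Qed.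

End continuity.

Section derivation.
Context {R : realType}.
Implicit Types (f g : CC R -> CC R) (z w d : CC R) (D : set (CC R)).

Lemma near_all z (P : CC R -> Prop) : (forall w, P w) -> \forall w \near z, P w.
Proof. by move=> H; apply/nbhsCP; exists 1. Qed.

(* Caratheodory's form of complex differentiability. *)
Definition cderiv f z d := exists q : CC R -> CC R,
  [/\ q z = d, ccont q z & \forall w \near z, f w - f z = q w * (w - z)].

Lemma scaleC1 (h : CC R) : h *: (1 : CC R) = h.
Proof. exact: mulr1. Qed.

Lemma cderivP f z d : cderiv f z d <-> is_derive z 1 f d.
Proof.
split.
  case=> q [qz cq fq].
  have H : (fun h => h^-1 *: ((f \o shift z) (h *: (1 : CC R)) - f z)) @ (0 : CC R)^' --> d.
    have -> : (fun h : CC R => h^-1 *: ((f \o shift z) (h *: (1 : CC R)) - f z)) =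
      (fun h : CC R => h^-1 * (f (h + z) - f z)).
      by apply/funext => h /=; rewrite (scaleC1 h).
    apply/cvgCP => e e0.
    move/ccontP : cq => /(_ _ e0)[e1 e10 h1].
    move/nbhsCP : fq => [e2 e20 h2].
    have m0 : 0 < Num.min e1 e2 by rewrite lt_min e10.
    apply/nbhsCP; exists (Num.min e1 e2) => // h; rewrite subr0 => hm h0.
    have hz : nm (h + z - z : CC R) < Num.min e1 e2 by rewrite addrK.
    rewrite h2 ?addrK; last by rewrite addrK in hz; rewrite (lt_le_trans hz)// ge_min lexx orbT.
    rewrite mulrCA mulVf// mulr1 -qz h1// addrK.
    by rewrite (lt_le_trans hm)// ge_min lexx.
  split; first by apply/cvg_ex; exists d.
  by rewrite /derive; apply: (cvg_lim _ H); exact: norm_hausdorff.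
move=> [df fd].
pose q w := if w == z then d else (f w - f z) / (w - z).
exists q; split; first by rewrite /q eqxx.
  apply/ccontP => e e0.
  have H : (fun h => h^-1 *: ((f \o shift z) (h *: (1 : CC R)) - f z)) @ (0 : CC R)^' --> d.
    by move: df; rewrite /derivable -fd.
  move: H => /cvgCP /(_ _ e0) /nbhsCP[e1 e10 h1].
  exists e1 => // w wz; rewrite /q eqxx.
  case: eqP => [_|/eqP wz0]; first by rewrite subrr nm0.
  have wz1 : w - z != 0 by rewrite subr_eq0.
  have := h1 (w - z); rewrite subr0 => /(_ wz wz1) /=.
  by rewrite scaleC1 subrK [_ *: _]mulrC.
apply: near_all => w; rewrite /q; case: eqP => [->|/eqP wz]; first by rewrite !subrr mulr0.
by rewrite divfK// subr_eq0.
Qed.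

Lemma cderiv_derivable f z d : cderiv f z d -> derivable f z 1.
Proof. by move/cderivP => []. Qed.

Lemma derivable_cderiv f z : derivable f z 1 -> exists d, cderiv f z d.
Proof. by move=> fz; exists ('D_1 f z); apply/cderivP; exact: derivableP. Qed.

Lemma cderiv_unique f z d e : cderiv f z d -> cderiv f z e -> d = e.
Proof. by move=> /cderivP[_ <-] /cderivP[_ <-]. Qed.

Lemma cderiv_cvg f z d : cderiv f z d -> ccont f z.
Proof.
case=> q [qz cq fq].
have : ccont (fun w => f z + q w * (w - z)) z.
  apply: ccontD; first exact: ccont_cst.
  by apply: ccontM => //; apply: ccontB; [exact: ccont_id|exact: ccont_cst].
case; rewrite subrr mulr0 addr0 => h; split; apply: cvg_trans h.
apply: near_eq_cvg; apply: filterS fq => w <-; by rewrite addrC subrK.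
Qed.

Lemma cderiv_near f g z d : (\forall w \near z, f w = g w) ->
  cderiv f z d -> cderiv g z d.
Proof.
move=> fg [q [qz cq fq]]; exists q; split=> //.
have fgz : f z = g z by exact: nbhs_singleton fg.
by apply: filterS2 fg fq => w <-; rewrite fgz.
Qed.

Lemma cderiv_cst (c z : CC R) : cderiv (fun=> c) z 0.
Proof.
exists (fun=> 0); split=> //; first exact: ccont_cst.
by apply: near_all => w; rewrite subrr mul0r.
Qed.

Lemma cderiv_id z : cderiv id z 1.
Proof.
exists (fun=> 1); split=> //; first exact: ccont_cst.
by apply: near_all => w; rewrite mul1r.
Qed.

Lemma cderivD f g z d e : cderiv f z d -> cderiv g z e ->
  cderiv (fun w => f w + g w) z (d + e).
Proof.
move=> [q [<- cq fq]] [p [<- cp gp]]; exists (fun w => q w + p w); split=> //.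
  exact: ccontD.
by apply: filterS2 fq gp => w h1 h2; rewrite mulrDl -h1 -h2; ring.
Qed.

Lemma cderivM f g z d e : cderiv f z d -> cderiv g z e ->
  cderiv (fun w => f w * g w) z (d * g z + f z * e).
Proof.
move=> fd ge; have cg := cderiv_cvg ge.
move: fd ge => [q [<- cq fq]] [p [<- cp gp]].
exists (fun w => q w * g w + f z * p w); split=> //.
  by apply: ccontD; apply: ccontM => //; exact: ccont_cst.
apply: filterS2 fq gp => w h1 h2.
by rewrite mulrDl mulrAC -h1 -mulrA -h2; ring.
Qed.

Lemma cderivN f z d : cderiv f z d -> cderiv (fun w => - f w) z (- d).
Proof.
move=> [q [<- cq fq]]; exists (fun w => - q w); split=> //; first exact: ccontN.
by apply: filterS fq => w h; rewrite mulNr -h; ring.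
Qed.

Lemma cderivB f g z d e : cderiv f z d -> cderiv g z e ->
  cderiv (fun w => f w - g w) z (d - e).
Proof. by move=> fd /cderivN; exact: cderivD. Qed.

Lemma cvg_neq0 f z : ccont f z -> f z != 0 -> \forall w \near z, f w != 0.
Proof.
move=> [/cvgCP cf] fz; have := cf (nm (f z)); rewrite nm_gt0 => /(_ fz).
apply: filterS => w; apply: contraTneq => ->; by rewrite sub0r nmN ltxx.
Qed.

Lemma cderivV f z d : f z != 0 -> cderiv f z d ->
  cderiv (fun w => (f w)^-1) z (- d / f z ^+ 2).
Proof.
move=> fz fd; have cf := cderiv_cvg fd.
have nf := cvg_neq0 cf fz.
move: fd => [q [<- cq fq]].
exists (fun w => - q w / (f w * f z)); split; first by rewrite expr2.
  apply: ccontM; first exact: ccontN.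
  apply: ccontV; first by rewrite mulf_neq0.
  by apply: ccontM => //; exact: ccont_cst.
apply: filterS2 fq nf => w h fw.
have -> : - q w / (f w * f z) * (w - z) = - (q w * (w - z)) / (f w * f z) by ring.
by rewrite -h; field; rewrite fw fz.
Qed.

Lemma cderiv_comp f g z d e : cderiv g z e -> cderiv f (g z) d ->
  cderiv (fun w => f (g w)) z (d * e).
Proof.
move=> ge; have cg := cderiv_cvg ge.
move: ge => [q [<- cq gq]] [p [<- cp fp]].
exists (fun w => p (g w) * q w); split=> //.
  apply: ccontM => //; exact: ccont_comp.
have fp' : \forall w \near z, f (g w) - f (g z) = p (g w) * (g w - g z) by exact: (ccont_nbhs cg fp).
by apply: filterS2 fp' gq => w -> ->; rewrite mulrA.
Qed.

(** Resolvent expansions come with explicit quadratic remainders; after division by [w - z] these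
    show that the difference quotient extends continuously by [d]. *)
Lemma cderiv_quad f z d (K : R) :
  (\forall w \near z, nm (f w - f z - d * (w - z)) <= K * nm (w - z) ^+ 2) ->
  cderiv f z d.
Proof.
move=> H; pose q w := if w == z then d else (f w - f z) / (w - z).
exists q; split; first by rewrite /q eqxx.
  split; rewrite {2}/q eqxx.
  apply: (@cvgC_le _ _ (nbhs z) _ _ (fun w => K * nm (w - z))); last first.
    rewrite -[X in _ --> X](mulr0 K) -[X in K * X]nm0 -[in X in nm X](subrr z).
    apply: cvgM; first exact: cvg_cst.
    apply: (@cvg_nm _ _ (nbhs z) _ (fun w => w - z)).
    exact: (ccont_cvg (ccontB (ccont_id z) (ccont_cst z z))).
  apply: filterS H => w h; rewrite /q; case: eqP => [->|/eqP wz].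
    by rewrite !subrr nm0 mulr0.
  have wz0 : w - z != 0 by rewrite subr_eq0.
  have -> : (f w - f z) / (w - z) - d = (f w - f z - d * (w - z)) / (w - z).
    by field.
  rewrite nmM nmV ler_pdivrMr ?nm_gt0//.
  by rewrite -mulrA -expr2.
apply: near_all => w; rewrite /q; case: eqP => [->|/eqP wz]; first by rewrite !subrr mulr0.
by rewrite divfK// subr_eq0.
Qed.

(** This stands in for analyticity. A second derivative at each point, without continuity of it,
    suffices for the second-order expansion behind the maximum principle, and the class is stable
    under algebraic operations, reciprocals and composition. *)
Definition twice_deriv D f := exists f1 : CC R -> CC R,
  (forall z, D z -> cderiv f z (f1 z)) /\
  (forall z, D z -> exists d, cderiv f1 z d).

Lemma twice_derivP D f f1 f2 : (forall z, D z -> cderiv f z (f1 z)) ->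
  (forall z, D z -> cderiv f1 z (f2 z)) -> twice_deriv D f.
Proof. by move=> h1 h2; exists f1; split=> // z /h2; exists (f2 z). Qed.

Lemma twice_deriv_sub D E f : E `<=` D -> twice_deriv D f -> twice_deriv E f.
Proof. by move=> ED [f1 [h1 h2]]; exists f1; split => z /ED; [exact: h1|exact: h2]. Qed.

Lemma twice_deriv_cst D c : twice_deriv D (fun=> c).
Proof.
by apply: (@twice_derivP _ _ (fun=> 0) (fun=> 0)) => z _; exact: cderiv_cst.
Qed.

Lemma twice_deriv_id D : twice_deriv D id.
Proof.
by apply: (@twice_derivP _ _ (fun=> 1) (fun=> 0)) => z _;
  [exact: cderiv_id|exact: cderiv_cst].
Qed.

Lemma twice_derivD D f g : twice_deriv D f -> twice_deriv D g ->
  twice_deriv D (fun z => f z + g z).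
Proof.
move=> [f1 [h1 h2]] [g1 [k1 k2]]; exists (fun z => f1 z + g1 z); split => z Dz.
  by apply: cderivD; [exact: h1|exact: k1].
have [d hd] := h2 z Dz; have [e he] := k2 z Dz.
by exists (d + e); exact: cderivD.
Qed.

Lemma twice_derivN D f : twice_deriv D f -> twice_deriv D (fun z => - f z).
Proof.
move=> [f1 [h1 h2]]; exists (fun z => - f1 z); split => z Dz.
  by apply: cderivN; exact: h1.
by have [d hd] := h2 z Dz; exists (- d); exact: cderivN.
Qed.

Lemma twice_derivB D f g : twice_deriv D f -> twice_deriv D g ->
  twice_deriv D (fun z => f z - g z).
Proof. by move=> hf hg; apply: twice_derivD => //; exact: twice_derivN. Qed.

Lemma twice_derivM D f g : twice_deriv D f -> twice_deriv D g ->
  twice_deriv D (fun z => f z * g z).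
Proof.
move=> [f1 [h1 h2]] [g1 [k1 k2]].
exists (fun z => f1 z * g z + f z * g1 z); split => z Dz.
  by apply: cderivM; [exact: h1|exact: k1].
have [d hd] := h2 z Dz; have [e he] := k2 z Dz.
eexists; apply: cderivD; apply: cderivM; [exact: hd|exact: k1|exact: h1|exact: he].
Qed.

Lemma twice_derivV D f : (forall z, D z -> f z != 0) -> twice_deriv D f ->
  twice_deriv D (fun z => (f z)^-1).
Proof.
move=> f0 [f1 [h1 h2]].
exists (fun z => - f1 z * (f z * f z)^-1); split => z Dz.
  by rewrite -expr2; apply: cderivV; [exact: f0|exact: h1].
have [d hd] := h2 z Dz.
eexists; apply: cderivM; first exact: cderivN hd.
apply: cderivV; first by rewrite mulf_neq0 ?f0.
by apply: cderivM; exact: h1.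
Qed.

Lemma twice_deriv_comp D E f g : (forall z, D z -> E (g z)) ->
  twice_deriv D g -> twice_deriv E f -> twice_deriv D (fun z => f (g z)).
Proof.
move=> DE [g1 [k1 k2]] [f1 [h1 h2]].
exists (fun z => f1 (g z) * g1 z); split => z Dz.
  by apply: cderiv_comp; [exact: k1|apply: h1; exact: DE].
have [e he] := k2 z Dz; have [d hd] := h2 _ (DE z Dz).
eexists; apply: cderivM; last exact: he.
by apply: cderiv_comp; [exact: k1|exact: hd].
Qed.

Lemma twice_derivX D f n : twice_deriv D f -> twice_deriv D (fun z => f z ^+ n).
Proof.
move=> hf; elim: n => [|n ih].
  have -> : (fun z => f z ^+ 0) = fun=> 1 by apply/funext => z; rewrite expr0.
  exact: twice_deriv_cst.
have -> : (fun z => f z ^+ n.+1) = fun z => f z * f z ^+ n.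
  by apply/funext => z; rewrite exprS.
exact: twice_derivM.
Qed.

Lemma twice_deriv_eq D f g : open D -> (forall z, D z -> f z = g z) ->
  twice_deriv D f -> twice_deriv D g.
Proof.
move=> oD fg [f1 [h1 h2]]; exists f1; split => z Dz; last exact: h2.
apply: cderiv_near (h1 z Dz).
by have := open_nbhs_nbhs (conj oD Dz); apply: filterS; exact: fg.
Qed.

End derivation.

(** * Analytic functions of one complex variable *)

Section identity_theorem.
Context {R : realType}.
Implicit Types (f g : CC R -> CC R) (z w d p h : CC R) (D : set (CC R)).

Lemma cderiv_global f z d : cderiv f z d -> exists q : CC R -> CC R,
  [/\ q z = d, ccont q z & forall w, f w - f z = q w * (w - z)].
Proof.
move=> [q [qz cq fq]].
pose p w := if w == z then d else (f w - f z) / (w - z).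
have qp : \forall w \near z, q w = p w.
  apply: filterS fq => w h; rewrite /p; case: eqP => [->//|/eqP wz].
  by rewrite h mulfK// subr_eq0.
exists p; split; first by rewrite /p eqxx.
  case: cq => cq; split; have -> : p z = q z by rewrite /p eqxx.
  by apply: cvg_trans cq; apply: near_eq_cvg.
move=> w; rewrite /p; case: eqP => [->|/eqP wz]; first by rewrite !subrr mulr0.
by rewrite divfK// subr_eq0.
Qed.

Lemma is_derive_Re_line f p h (t : R) d : cderiv f (p + t%:C * h) d ->
  is_derive t 1 (fun s : R => complex.Re (f (p + s%:C * h))) (complex.Re (d * h)).
Proof.
move=> /cderiv_global[q [qz cq fq]].
apply/is_derive1_caratheodory.
exists (fun s => complex.Re (q (p + s%:C * h) * h)); split.
- move=> s; rewrite -cReB fq.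
  have -> : q (p + s%:C * h) * (p + s%:C * h - (p + t%:C * h)) =
     ((s - t)%:C : CC R) * (q (p + s%:C * h) * h) by rewrite rmorphB/=; ring.
  by rewrite cReZ mulrC.
- apply: (@cvg_Re _ _ (nbhs t)); apply: (@cvgCM _ _ (nbhs t)); last exact: (@cvgC_cst _ _ (nbhs t)).
  apply: (cvg_comp (fun s : R => p + s%:C * h) q _ (ccont_cvg cq)).
  apply: (@cvgCD _ _ (nbhs t)); first exact: (@cvgC_cst _ _ (nbhs t)).
  apply: (@cvgCM _ _ (nbhs t)); last exact: (@cvgC_cst _ _ (nbhs t)).
  apply: (@cvg_realC _ _ (nbhs t)); exact: cvg_id.
- by rewrite qz.
Qed.

Lemma mean_value_Re f f1 p h (M : R) :
  (forall t : R, 0 <= t <= 1 -> cderiv f (p + t%:C * h) (f1 (p + t%:C * h))) ->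
  (forall t : R, 0 <= t <= 1 -> nm (f1 (p + t%:C * h)) <= M) ->
  `|complex.Re (f (p + h) - f p)| <= M * nm h.
Proof.
move=> fd fM.
have der (t : R) : 0 <= t <= 1 ->
    is_derive t 1 (fun s : R => complex.Re (f (p + s%:C * h)))
      (complex.Re (f1 (p + t%:C * h) * h)).
  by move=> t01; apply: is_derive_Re_line; exact: fd.
have [||c c01] := @MVT_segment R (fun s : R => complex.Re (f (p + s%:C * h)))
   (fun t => complex.Re (f1 (p + t%:C * h) * h)) 0 1 ler01.
- by move=> t; rewrite in_itv/= => /andP[t0 t1]; apply: der; rewrite !ltW.
- apply: derivable_within_continuous => t; rewrite in_itv/= => t01.
  by have [] := der t t01.
rewrite rmorph1 mul1r rmorph0 mul0r addr0 subr0 mulr1 -cReB => ->.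
rewrite (le_trans (nm_Re _))// nmM ler_wpM2r ?nm_ge0//.
by apply: fM; move: c01; rewrite in_itv.
Qed.

(** The real mean value theorem applies to the real part of [f] along a segment, and to its
    imaginary part as the real part of -i f; adding both costs the factor 2. *)
Lemma mean_value_ineq f f1 p h (M : R) :
  (forall t : R, 0 <= t <= 1 -> cderiv f (p + t%:C * h) (f1 (p + t%:C * h))) ->
  (forall t : R, 0 <= t <= 1 -> nm (f1 (p + t%:C * h)) <= M) ->
  nm (f (p + h) - f p) <= 2 * M * nm h.
Proof.
move=> fd fM.
have h1 := mean_value_Re fd fM.
have fd' (t : R) : 0 <= t <= 1 -> cderiv (fun w => - 'i * f w) (p + t%:C * h) (- 'i * f1 (p + t%:C * h)).
  move=> t01; have := cderivM (cderiv_cst (- 'i) (p + t%:C * h)) (fd t t01).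
  by rewrite mul0r add0r.
have ni : nm (- 'i : CC R) = 1 by rewrite nmN nm_def /= expr0n/= add0r expr1n sqrtr1.
have fM' (t : R) : 0 <= t <= 1 -> nm (- 'i * f1 (p + t%:C * h)) <= M.
  by move=> t01; rewrite nmM ni mul1r; exact: fM.
have h2 := mean_value_Re (f1 := fun w => - 'i * f1 w) fd' fM'.
rewrite (le_trans (nm_le _))//.
have -> : 2 * M * nm h = M * nm h + M * nm h by ring.
apply: lerD => //; apply: le_trans h2.
suff -> : complex.Re (- 'i * f (p + h) - - 'i * f p) = complex.Im (f (p + h) - f p) by [].
by rewrite -mulrBr cReM /=; ring.
Qed.

(** The second-order remainder has derivative f1(w) - f1(p) - d (w - p), which is o(|w - p|) because
    [f1] is differentiable at [p]; the mean value inequality integrates this bound. *)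
Lemma taylor2 D f p : open D -> D p -> twice_deriv D f ->
  exists d1 d2, forall e : R, 0 < e -> exists2 dl : R, 0 < dl &
   forall h, nm h < dl -> nm (f (p + h) - f p - d1 * h - d2 * h ^+ 2) <= e * nm h ^+ 2.
Proof.
move=> oD Dp [f1 [h1 h2]]; have [d hd] := h2 p Dp.
exists (f1 p), (d / 2) => e e0.
have [q [qp /ccontP cq fq]] := cderiv_global hd.
have e20 : 0 < e / 2 by rewrite divr_gt0.
have [dl1 dl10 H1] := cq _ e20.
have /nbhsCP[dl2 dl20 H2] : nbhs p D by exact: open_nbhs_nbhs.
exists (Num.min dl1 dl2); first by rewrite lt_min dl10.
move=> h; rewrite lt_min => /andP[hd1 hd2].
pose g w := f w - f1 p * (w - p) - d / 2 * (w - p) ^+ 2.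
pose g1 w := f1 w - f1 p - d * (w - p).
have seg (t : R) : 0 <= t <= 1 -> nm (p + t%:C * h - p) <= nm h.
  move=> /andP[t0 t1]; rewrite [p + _]addrC addrK nmM nmR ger0_norm//.
  by rewrite ler_piMl// nm_ge0.
have gd w : D w -> cderiv g w (g1 w).
  move=> Dw; have -> : g1 w = f1 w - (0 * (w - p) + f1 p * (1 - 0)) -
     (0 * (w - p) ^+ 2 + d / 2 * ((1 - 0) * (w - p) + (w - p) * (1 - 0))).
    by rewrite /g1; field.
  have cw : cderiv (fun v => v - p) w (1 - 0).
    by apply: cderivB; [exact: cderiv_id|exact: cderiv_cst].
  apply: cderivB; first apply: cderivB; first exact: h1.
    by apply: cderivM => //; exact: cderiv_cst.
  by apply: cderivM; [exact: cderiv_cst|exact: cderivM].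
have -> : f (p + h) - f p - f1 p * h - d / 2 * h ^+ 2 = g (p + h) - g p.
  by rewrite /g subrr; ring.
have gM (t : R) : 0 <= t <= 1 -> nm (g1 (p + t%:C * h)) <= e / 2 * nm h.
  move=> t01; rewrite /g1 fq -mulrBl nmM.
  apply: ler_pM; rewrite ?nm_ge0 ?seg//.
  by rewrite -qp ltW// H1// (le_lt_trans (seg t t01)).
have := @mean_value_ineq g g1 p h (e / 2 * nm h) _ gM.
have -> : 2 * (e / 2 * nm h) * nm h = e * nm h ^+ 2 by field.
apply => t t01; apply: gd; apply: H2.
by rewrite (le_lt_trans (seg t t01)).
Qed.

Lemma nm_real (t : R) : 0 <= t -> nm (t%:C : CC R) = t.
Proof. by move=> t0; rewrite nmR ger0_norm. Qed.

(** If |f| exceeds [M] somewhere, the penalised modulus [phi] has a maximum [c] inside the disc.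
    Averaging over c + h with h in {t, it, -t, -it} cancels the terms in h and h^2 of the expansion
    at [c], while the mean of the penalty grows by [ep * t ^+ 2], more than the Taylor remainder can
    offset. *)
Lemma max_principle D f z0 (r M : R) : open D -> 0 < r ->
  (forall w, nm (w - z0) <= r -> D w) -> twice_deriv D f ->
  (forall w, nm (w - z0) = r -> nm (f w) <= M) ->
  forall w, nm (w - z0) <= r -> nm (f w) <= M.
Proof.
move=> oD r0 rD fD fM z1 z1r; rewrite leNgt; apply/negP => Mz1.
(* With this [ep] the penalty on the circle is half the excess of [nm (f z1)] over [M], so [phi] is
   not maximal on the circle. *)
pose ep := (nm (f z1) - M) / (2 * r ^+ 2).
have ep0 : 0 < ep by rewrite divr_gt0 ?subr_gt0// mulr_gt0// exprn_gt0.
pose phi w := nm (f w) + ep * nm (w - z0) ^+ 2.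
have cphi w : D w -> phi @ nbhs w --> phi w.
  move=> Dw; have cf : ccont f w by have [f1 [h1 _]] := fD; exact: cderiv_cvg (h1 w Dw).
  apply: cvgD; first exact: (@cvg_nm _ _ (nbhs w) _ f _ (ccont_cvg cf)).
  apply: cvgM; first exact: cvg_cst.
  apply: (cvg_comp (fun w => nm (w - z0)) (fun x : R => x ^+ 2)); last exact: exprn_continuous.
  apply: (@cvg_nm _ _ (nbhs w) _ (fun w => w - z0)).
  exact: (ccont_cvg (ccontB (ccont_id w) (ccont_cst z0 w))).
have [||c] := @compact_EVT_max _ R phi (cdisc z0 r) _ (@compact_cdisc R z0 r) _.
- by exists z1.
- by apply: continuous_in_subspaceT => w; rewrite inE => wr; apply: cphi; exact: rD.
rewrite inE => cr cmax.
have cm w : nm (w - z0) <= r -> phi w <= phi c by move=> wr; apply: cmax; rewrite inE.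
have [cr1|cr1] := eqVneq (nm (c - z0)) r.
  have := cm z1 z1r; rewrite /phi cr1 => h.
  have h1 := fM c cr1.
  have h2 : ep * r ^+ 2 = (nm (f z1) - M) / 2.
    by rewrite /ep; field; rewrite gt_eqF.
  have h3 : 0 <= ep * nm (z1 - z0) ^+ 2 by rewrite mulr_ge0 ?sqr_ge0 ?(ltW ep0).
  by rewrite h2 in h; lra.
have crlt : nm (c - z0) < r by rewrite lt_neqAle cr1.
have [d1 [d2 H]] := taylor2 oD (rD c cr) fD.
have e40 : 0 < ep / 4 by rewrite divr_gt0.
have [dl dl0 {}H] := H _ e40.
pose t := Num.min (dl / 2) ((r - nm (c - z0)) / 2).
have t0 : 0 < t by rewrite lt_min !divr_gt0// subr_gt0.
have tdl : t < dl by rewrite (@le_lt_trans _ _ (dl / 2))// ?ge_min ?lexx//; lra.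
have tr : t <= r - nm (c - z0).
  by rewrite (@le_trans _ _ ((r - nm (c - z0)) / 2))// ?ge_min ?lexx ?orbT//; lra.
pose T : CC R := t%:C.
have nT : nm T = t by rewrite nm_real// ltW.
have nI : nm ('i : CC R) = 1 by rewrite nm_def /= expr0n/= add0r expr1n sqrtr1.
have nIT : nm ('i * T : CC R) = t by rewrite nmM nI mul1r.
have use h : nm h = t -> phi (c + h) <= phi c /\
   nm (f (c + h) - f c - d1 * h - d2 * h ^+ 2) <= ep / 4 * t ^+ 2.
  move=> ht; split; last by rewrite -ht H// ht.
  apply: cm; have -> : c + h - z0 = (c - z0) + h by ring.
  by rewrite (le_trans (nmD _ _))// ht; lra.
have [a1 b1] := use T nT.
have [a2 b2] := use ('i * T) nIT.
have [a3 b3] := use (- T) (etrans (nmN _) nT).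
have [a4 b4] := use (- ('i * T)) (etrans (nmN _) nIT).
have i2 : ('i : CC R) ^+ 2 = -1 by rewrite sqr_i.
set X1 := f (c + T) - f c - d1 * T - d2 * T ^+ 2 in b1.
set X2 := f (c + 'i * T) - f c - d1 * ('i * T) - d2 * ('i * T) ^+ 2 in b2.
set X3 := f (c - T) - f c - d1 * - T - d2 * (- T) ^+ 2 in b3.
set X4 := f (c - 'i * T) - f c - d1 * - ('i * T) - d2 * (- ('i * T)) ^+ 2 in b4.
have sumX : 4 * f c = (f (c + T) + f (c + 'i * T) + f (c - T) + f (c - 'i * T)) -
   (X1 + X2 + X3 + X4).
  rewrite /X1 /X2 /X3 /X4 !sqrrN !exprMn i2; ring.
have nS : 4 * nm (f c) <= nm (f (c + T)) + nm (f (c + 'i * T)) + nm (f (c - T)) +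
     nm (f (c - 'i * T)) + ep * t ^+ 2.
  have -> : 4 * nm (f c) = nm (4 * f c) by rewrite nmM nm_nat.
  rewrite sumX (le_trans (nmB _ _))// lerD//.
    by do 3 (rewrite (le_trans (nmD _ _))// lerD2r).
  have -> : ep * t ^+ 2 = ep / 4 * t ^+ 2 + ep / 4 * t ^+ 2 + ep / 4 * t ^+ 2 + ep / 4 * t ^+ 2.
    by field.
  rewrite (le_trans (nmD _ _))// lerD// (le_trans (nmD _ _))// lerD//.
  by rewrite (le_trans (nmD _ _))// lerD.
have nsq : nm (c + T - z0) ^+ 2 + nm (c + 'i * T - z0) ^+ 2 + nm (c - T - z0) ^+ 2 +
   nm (c - 'i * T - z0) ^+ 2 = 4 * nm (c - z0) ^+ 2 + 4 * t ^+ 2.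
  rewrite !nm_sqr !(cReB, cReD, cImB, cImD) !(cReM, cImM, cReN, cImN) /=; ring.
have t20 : 0 < ep * t ^+ 2 by rewrite mulr_gt0// exprn_gt0.
have : phi (c + T) + phi (c + 'i * T) + phi (c - T) + phi (c - 'i * T) <= 4 * phi c by lra.
rewrite /phi => h.
have h' := congr1 (fun x => ep * x) nsq; rewrite /= in h'.
by nra.
Qed.

Lemma twice_derivU A B f : open A -> open B -> twice_deriv A f ->
  twice_deriv B f -> twice_deriv (A `|` B) f.
Proof.
move=> oA oB [a1 [ha1 ha2]] [b1 [hb1 hb2]].
(* The canonical derivative agrees with both given first derivatives, and so glues them. *)
pose f1 w : CC R := 'D_1 f w.
have fE w d : cderiv f w d -> f1 w = d by move=> /cderivP[_ <-].
exists f1; split => z [Az|Bz].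
- by rewrite (fE _ _ (ha1 z Az)); exact: ha1.
- by rewrite (fE _ _ (hb1 z Bz)); exact: hb1.
- have [d hd] := ha2 z Az; exists d; apply: cderiv_near hd.
  have := open_nbhs_nbhs (conj oA Az); apply: filterS => w Aw.
  by rewrite (fE _ _ (ha1 w Aw)).
- have [d hd] := hb2 z Bz; exists d; apply: cderiv_near hd.
  have := open_nbhs_nbhs (conj oB Bz); apply: filterS => w Bw.
  by rewrite (fE _ _ (hb1 w Bw)).
Qed.

Lemma open_neq z0 : open [set w : CC R | w != z0].
Proof.
rewrite openE => w /= wz; apply/nbhsCP; exists (nm (w - z0)).
  by rewrite nm_gt0 subr_eq0.
by move=> v; apply: contraTneq => ->; rewrite nm_dist ltxx.
Qed.

Lemma open_disc z0 (r : R) : open [set w : CC R | nm (w - z0) < r].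
Proof.
rewrite openE => w /= wz; apply/nbhsCP; exists (r - nm (w - z0)).
  by rewrite subr_gt0.
by move=> v vw; have := nm_triangle v w z0; move=> /= ?; lra.
Qed.

(** Schwarz's argument: since [f] vanishes near [z0], dividing by [(v - z0) ^+ N] keeps it analytic
    on the disc. The maximum principle then bounds |f w| by the maximum of |f| times
    [(nm (w - z0) / r) ^+ N], for every [N]. *)
Lemma identity_disc D f z0 (r : R) : open D -> 0 < r ->
  (forall w, nm (w - z0) <= r -> D w) -> twice_deriv D f ->
  (\forall w \near z0, f w = 0) ->
  forall w, nm (w - z0) < r -> f w = 0.
Proof.
move=> oD r0 rD fD /nbhsCP[dl dl0 f0] w wr.
have [c cr cmax] : exists2 c, nm (c - z0) <= r &
    forall v, nm (v - z0) <= r -> nm (f v) <= nm (f c).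
  have [||c] := @compact_EVT_max _ R (fun w => nm (f w)) (cdisc z0 r) _ (@compact_cdisc R z0 r) _.
  - by exists w; exact: ltW.
  - apply: continuous_in_subspaceT => v; rewrite inE => vr.
    apply: (@cvg_nm _ _ (nbhs v)); have [f1 [h1 _]] := fD.
    by apply: ccont_cvg; apply: cderiv_cvg (h1 v _); exact: rD.
  rewrite inE => cr cmax; exists c => // v vr.
  by apply: cmax; rewrite inE.
have key N : nm (f w) <= nm (f c) * (nm (w - z0) / r) ^+ N.
  have [wz|wz] := eqVneq w z0.
    rewrite wz f0 ?subrr ?nm0// mulr_ge0 ?nm_ge0// exprn_ge0//.
    by rewrite mul0r.
  pose g v := f v * ((v - z0)^-1) ^+ N.
  have gD : twice_deriv (D `&` [set v | v != z0] `|` [set v | nm (v - z0) < dl]) g.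
    apply: twice_derivU.
    - by apply: openI => //; exact: open_neq.
    - exact: open_disc.
    - apply: twice_derivM; first by apply: twice_deriv_sub fD => v [].
      apply: twice_derivX; apply: twice_derivV; first by move=> v [_ /=]; rewrite subr_eq0.
      by apply: twice_derivB; [exact: twice_deriv_id|exact: twice_deriv_cst].
    - apply: (twice_deriv_eq _ _ (twice_deriv_cst _ 0)); first exact: open_disc.
      by move=> v vd; rewrite /g f0// mul0r.
  have gM : nm (g w) <= nm (f c) * r ^- N.
    apply: (@max_principle _ g z0 r _ _ r0 _ gD) => //.
    - apply: openU; last exact: open_disc.
      by apply: openI => //; exact: open_neq.
    - move=> v vr; have [->|vz] := eqVneq v z0; first by right => /=; rewrite subrr nm0.
      by left; split => //; exact: rD.
    - move=> v vr; rewrite /g nmM nmX nmV vr -exprVn ler_wpM2r ?exprn_ge0 ?invr_ge0 ?(ltW r0)//.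
      by apply: cmax; rewrite vr.
    - exact: ltW.
  have wz0 : w - z0 != 0 by rewrite subr_eq0.
  have -> : f w = g w * (w - z0) ^+ N.
    by rewrite /g -mulrA -exprMn mulVf// expr1n mulr1.
  rewrite nmM nmX exprMn exprVn mulrA mulrAC.
  by rewrite ler_wpM2r ?exprn_ge0 ?nm_ge0.
apply/eqP; rewrite -nm_eq0 eq_le nm_ge0 andbT.
have lim0 : (fun N => nm (f c) * (nm (w - z0) / r) ^+ N) @ \oo --> nm (f c) * 0.
  apply: cvgM; first exact: cvg_cst.
  apply: cvg_expr; rewrite ger0_norm ?divr_ge0 ?nm_ge0 ?(ltW r0)//.
  by rewrite ltr_pdivrMr// mul1r.
rewrite mulr0 in lim0.
rewrite -(cvg_lim _ lim0)//; apply: limr_ge; first by apply/cvg_ex; exists 0.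
exact: nearW.
Qed.

Definition cconvex D := forall z w (t : R), D z -> D w -> 0 <= t <= 1 ->
  D ((1 - t)%:C * z + t%:C * w).

Lemma identity_theorem D f z0 : open D -> cconvex D -> twice_deriv D f ->
  D z0 -> (\forall w \near z0, f w = 0) -> forall w, D w -> f w = 0.
Proof.
move=> oD cD fD Dz0 f0 w Dw.
have /nbhsCP[r1 r10 h1] : nbhs z0 D by exact: open_nbhs_nbhs.
have /nbhsCP[r2 r20 h2] : nbhs w D by exact: open_nbhs_nbhs.
pose r := Num.min r1 r2 / 2.
have r0 : 0 < r by rewrite divr_gt0// lt_min r10.
have rr1 : r < r1 by rewrite /r (@lt_le_trans _ _ (Num.min r1 r2)) ?ge_min ?lexx// gtr_pMr ?lt_min ?r10// invf_lt1// ltr1n.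
have rr2 : r < r2 by rewrite /r (@lt_le_trans _ _ (Num.min r1 r2)) ?ge_min ?lexx ?orbT// gtr_pMr ?lt_min ?r10// invf_lt1// ltr1n.
pose c (t : R) : CC R := (1 - t)%:C * z0 + t%:C * w.
(* By convexity one radius serves along the whole segment: a disc around one of its points is a
   convex combination of the discs of the same radius around its two ends. The discs can then be
   chained in finitely many steps. *)
have cr (t : R) (v : CC R) : 0 <= t <= 1 -> nm (v - c t) <= r -> D v.
  move=> t01 vr.
  have -> : v = (1 - t)%:C * (z0 + (v - c t)) + t%:C * (w + (v - c t)).
    by rewrite /c rmorphB/= rmorph1; ring.
  apply: cD => //.
    by apply: h1; rewrite addrC addKr (le_lt_trans vr).
  by apply: h2; rewrite addrC addKr (le_lt_trans vr).
have [N hN] : exists N : nat, nm (w - z0) / r < N.+1%:R.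
  have := archi_boundP (x := nm (w - z0) / r).
  rewrite divr_ge0 ?nm_ge0 ?(ltW r0)// => /(_ isT) h.
  by exists (Num.bound (nm (w - z0) / r)); rewrite (lt_trans h)// ltr_nat.
have step j : (j <= N.+1)%N -> \forall v \near (c (j%:R / N.+1%:R)), f v = 0.
  elim: j => [|j ih] jN.
    by rewrite mul0r /c subr0 rmorph1 mul1r rmorph0 mul0r addr0.
  have j01 : 0 <= (j%:R / N.+1%:R : R) <= 1.
    by rewrite divr_ge0 ?ler0n//= ler_pdivrMr ?ltr0n// mul1r ler_nat ltnW.
  have fz := identity_disc oD r0 (fun v => cr _ v j01) fD (ih (ltnW jN)).
  have od := @open_disc (c (j%:R / N.+1%:R)) r.
  have : nbhs (c (j.+1%:R / N.+1%:R)) [set v | nm (v - c (j%:R / N.+1%:R)) < r].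
    apply: open_nbhs_nbhs; split => //=.
    have -> : c (j.+1%:R / N.+1%:R) - c (j%:R / N.+1%:R) = (N.+1%:R^-1)%:C * (w - z0).
      have -> : (j.+1%:R / N.+1%:R : R) = j%:R / N.+1%:R + N.+1%:R^-1.
        by rewrite -[j.+1]addn1 natrD mulrDl mul1r.
      by rewrite /c !rmorphB/= rmorphD/= rmorph1; ring.
    rewrite nmM nm_real ?invr_ge0 ?ler0n// mulrC ltr_pdivrMr ?ltr0n// mulrC.
    by rewrite -ltr_pdivrMr.
  by apply: filterS => v; exact: fz.
have := step N.+1 (leqnn _).
rewrite divff ?pnatr_eq0// /c subrr rmorph0 mul0r add0r rmorph1 mul1r.
by move/nbhs_singleton.
Qed.

End identity_theorem.

(** * Bounded measurable functions and their integrals *)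

Section bounded_measurable.
Context {d : measure_display} {T : measurableType d} {R : realType}.
Implicit Types (f g : T -> R) (u v : T -> CC R).

Definition bmeas f := measurable_fun setT f /\ exists M : R, forall x, `|f x| <= M.

Lemma bmeas_integrable (m : {finite_measure set T -> \bar R}) f :
  bmeas f -> m.-integrable setT (EFin \o f).
Proof.
move=> [mf [M fM]]; apply: measurable_bounded_integrable => //.
  exact: fin_num_fun_lty (fin_num_measure m).
exists M; split; first exact: num_real.
by move=> N MN x _ /=; rewrite (le_trans (fM x))// ltW.
Qed.

Lemma bmeas_cst (c : R) : bmeas (fun=> c).
Proof. by split; [exact: measurable_cst|exists `|c|]. Qed.

Lemma bmeasD f g : bmeas f -> bmeas g -> bmeas (fun x => f x + g x).
Proof.
move=> [mf [M fM]] [mg [N gN]]; split; first exact: measurable_funD.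
by exists (M + N) => x; rewrite (le_trans (ler_normD _ _))// lerD.
Qed.

Lemma bmeasN f : bmeas f -> bmeas (fun x => - f x).
Proof.
move=> [mf [M fM]]; split; first exact: measurableT_comp.
by exists M => x; rewrite normrN.
Qed.

Lemma bmeasB f g : bmeas f -> bmeas g -> bmeas (fun x => f x - g x).
Proof. by move=> bf bg; apply: bmeasD => //; exact: bmeasN. Qed.

Lemma bmeasM f g : bmeas f -> bmeas g -> bmeas (fun x => f x * g x).
Proof.
move=> [mf [M fM]] [mg [N gN]]; split; first exact: measurable_funM.
by exists (M * N) => x; rewrite normrM ler_pM.
Qed.

Lemma bmeasZ (c : R) f : bmeas f -> bmeas (fun x => c * f x).
Proof. by move=> bf; apply: bmeasM => //; exact: bmeas_cst. Qed.

Lemma bmeas_norm f : bmeas f -> bmeas (fun x => `|f x|).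
Proof.
move=> [mf [M fM]]; split; first exact: measurableT_comp.
by exists M => x; rewrite normr_id.
Qed.

Lemma bmeas_max f g : bmeas f -> bmeas g -> bmeas (fun x => Num.max (f x) (g x)).
Proof.
move=> [mf [M fM]] [mg [N gN]]; split; first exact: measurable_maxr.
exists (M + N) => x.
have M0 : 0 <= M := le_trans (normr_ge0 _) (fM x).
have N0 : 0 <= N := le_trans (normr_ge0 _) (gN x).
rewrite maxEle; case: ifP => _; first by rewrite (le_trans (gN x))// lerDr.
by rewrite (le_trans (fM x))// lerDl.
Qed.

Lemma bmeas_indic (A : set T) : measurable A -> bmeas (\1_A : T -> R).
Proof.
move=> mA; split; first exact: measurable_indic.
by exists 1 => x; rewrite indicE; case: (x \in A); rewrite ?normr1// normr0.
Qed.

Lemma bmeas_comp {d' : measure_display} {S : measurableType d'} (c : S -> T) f :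
  measurable_fun setT c -> bmeas f ->
  measurable_fun setT (fun x => f (c x)) /\ exists M : R, forall x, `|f (c x)| <= M.
Proof.
move=> mc [mf [M fM]]; split; last by exists M.
exact: (measurableT_comp mf mc).
Qed.

Section integral.
Context (m : {finite_measure set T -> \bar R}).

Lemma RintD f g : bmeas f -> bmeas g ->
  Rintegral m setT (fun x => f x + g x) = Rintegral m setT f + Rintegral m setT g.
Proof. by move=> bf bg; apply: RintegralD => //; exact: bmeas_integrable. Qed.

Lemma RintB f g : bmeas f -> bmeas g ->
  Rintegral m setT (fun x => f x - g x) = Rintegral m setT f - Rintegral m setT g.
Proof. by move=> bf bg; apply: RintegralB => //; exact: bmeas_integrable. Qed.

Lemma RintZ (c : R) f : bmeas f ->
  Rintegral m setT (fun x => c * f x) = c * Rintegral m setT f.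
Proof. by move=> bf; apply: RintegralZl => //; exact: bmeas_integrable. Qed.

Lemma RintN f : bmeas f ->
  Rintegral m setT (fun x => - f x) = - Rintegral m setT f.
Proof.
move=> bf; rewrite -mulN1r -RintZ//; congr Rintegral.
by apply/funext => x; rewrite mulN1r.
Qed.

Lemma Rint_cst (c : R) : Rintegral m setT (fun=> c) = c * fine (m setT).
Proof. exact: Rintegral_cst. Qed.

Lemma Rint_le f g : bmeas f -> bmeas g -> (forall x, f x <= g x) ->
  Rintegral m setT f <= Rintegral m setT g.
Proof.
by move=> bf bg fg; apply: le_Rintegral => //; exact: bmeas_integrable.
Qed.

Lemma Rint_ge0 f : (forall x, 0 <= f x) -> 0 <= Rintegral m setT f.
Proof. by move=> f0; exact: Rintegral_ge0. Qed.

Lemma Rint_indic (A : set T) : measurable A ->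
  Rintegral m setT (\1_A : T -> R) = fine (m A).
Proof. by move=> mA; rewrite /Rintegral integral_indic// setIT. Qed.

Lemma Rint_dominated (f_ : nat -> T -> R) f (M : R) :
  (forall n, measurable_fun setT (f_ n)) -> (forall n x, `|f_ n x| <= M) ->
  (forall x, f_ n x @[n --> \oo] --> f x) ->
  Rintegral m setT (f_ n) @[n --> \oo] --> Rintegral m setT f.
Proof.
move=> mf fM ff.
have mfl : measurable_fun setT f.
  by apply: (@measurable_fun_cvg _ _ _ _ f_) => // x _; exact: ff.
have bl : bmeas f.
  split => //; exists M => x.
  rewrite -(cvg_lim _ (cvg_norm (ff x)))//.
  apply: limr_le; first by apply/cvg_ex; exists `|f x|; exact: cvg_norm (ff x).
  by apply: nearW => n; exact: fM.
have [|||||_ _ H] := @dominated_convergence _ _ _ m setT measurableT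
   (fun n => EFin \o f_ n) (EFin \o f) (fun=> M%:E).
- by move=> n; exact/measurable_EFinP.
- exact/measurable_EFinP.
- by apply: aeW => x _; apply: cvg_EFin => //; [exact: nearW|exact: ff].
- exact: (bmeas_integrable m (bmeas_cst M)).
- by apply: aeW => x n _ /=; rewrite lee_fin.
apply: fine_cvg.
rewrite /Rintegral fineK//; exact: integrable_fin_num (bmeas_integrable m bl).
Qed.

End integral.

Definition cbmeas u := bmeas (fun x => complex.Re (u x)) /\
  bmeas (fun x => complex.Im (u x)).

Lemma cbmeas_cst (c : CC R) : cbmeas (fun=> c).
Proof. by split; exact: bmeas_cst. Qed.

Lemma cbmeasD u v : cbmeas u -> cbmeas v -> cbmeas (fun x => u x + v x).
Proof.
move=> [u1 u2] [v1 v2]; split.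
  by under [X in bmeas X]eq_fun do rewrite cReD; exact: bmeasD.
by under [X in bmeas X]eq_fun do rewrite cImD; exact: bmeasD.
Qed.

Lemma cbmeasN u : cbmeas u -> cbmeas (fun x => - u x).
Proof.
move=> [u1 u2]; split.
  by under [X in bmeas X]eq_fun do rewrite cReN; exact: bmeasN.
by under [X in bmeas X]eq_fun do rewrite cImN; exact: bmeasN.
Qed.

Lemma cbmeasB u v : cbmeas u -> cbmeas v -> cbmeas (fun x => u x - v x).
Proof. by move=> cu cv; exact: (cbmeasD cu (cbmeasN cv)). Qed.

Lemma cbmeasM u v : cbmeas u -> cbmeas v -> cbmeas (fun x => u x * v x).
Proof.
move=> [u1 u2] [v1 v2]; split.
  by under [X in bmeas X]eq_fun do rewrite cReM; apply: bmeasB; exact: bmeasM.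
by under [X in bmeas X]eq_fun do rewrite cImM; apply: bmeasD; exact: bmeasM.
Qed.

Lemma cbmeasX u n : cbmeas u -> cbmeas (fun x => u x ^+ n).
Proof.
move=> cu; elim: n => [|n ih].
  by under [X in cbmeas X]eq_fun do rewrite expr0; exact: cbmeas_cst.
by under [X in cbmeas X]eq_fun do rewrite exprS; exact: cbmeasM.
Qed.

Lemma cbmeas_real f : bmeas f -> cbmeas (fun x => (f x)%:C).
Proof. by move=> bf; split => //=; exact: bmeas_cst. Qed.

Lemma cbmeas_bounded u : cbmeas u -> exists M : R, forall x, nm (u x) <= M.
Proof.
move=> [[_ [M uM]] [_ [N uN]]]; exists (M + N) => x.
by rewrite (le_trans (nm_le _))// lerD.
Qed.

Lemma cbmeas_nm u : cbmeas u -> bmeas (fun x => nm (u x)).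
Proof.
move=> cu; have [M uM] := cbmeas_bounded cu; move: cu => [[u1 _] [u2 _]].
split; last by exists M => x; rewrite ger0_norm ?nm_ge0.
under eq_fun do rewrite nm_def.
apply: (measurableT_comp (f := @Num.sqrt R)).
  by apply: continuous_measurable_fun; exact: sqrt_continuous.
by apply: measurable_funD; exact: measurable_funX.
Qed.

Section cintegral.
Context (m : {finite_measure set T -> \bar R}).

Lemma cintD u v : cbmeas u -> cbmeas v ->
  cintegral m (fun x => u x + v x) = cintegral m u + cintegral m v.
Proof.
move=> [u1 u2] [v1 v2]; apply: complex_eqP; rewrite ?cReD ?cImD /=.
  by under eq_Rintegral do rewrite cReD; exact: RintD.
by under eq_Rintegral do rewrite cImD; exact: RintD.
Qed.

Lemma cintZ (c : CC R) u : cbmeas u ->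
  cintegral m (fun x => c * u x) = c * cintegral m u.
Proof.
move=> [u1 u2]; apply: complex_eqP; rewrite ?cReM ?cImM /=.
  under eq_Rintegral do rewrite cReM.
  by rewrite RintB ?RintZ//; exact: bmeasZ.
under eq_Rintegral do rewrite cImM.
by rewrite RintD ?RintZ//; exact: bmeasZ.
Qed.

Lemma cintN u : cbmeas u -> cintegral m (fun x => - u x) = - cintegral m u.
Proof.
move=> [u1 u2]; apply: complex_eqP; rewrite ?cReN ?cImN /=.
  by under eq_Rintegral do rewrite cReN; exact: RintN.
by under eq_Rintegral do rewrite cImN; exact: RintN.
Qed.

Lemma cintB u v : cbmeas u -> cbmeas v ->
  cintegral m (fun x => u x - v x) = cintegral m u - cintegral m v.
Proof. by move=> cu cv; rewrite (cintD cu (cbmeasN cv)) cintN. Qed.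

Lemma cint_cst (c : CC R) : cintegral m (fun=> c) = c * (fine (m setT))%:C.
Proof.
by apply: complex_eqP; rewrite /= Rint_cst mulrC ?(cReZ, cImZ) mulrC ?cReM ?cImM /=; ring.
Qed.

Lemma cint_real f : cintegral m (fun x => (f x)%:C) = (Rintegral m setT f)%:C.
Proof. by apply: complex_eqP => //=; rewrite Rint_cst mul0r. Qed.

(* With [c] the conjugate of the integral, |I|^2 = Re (c I) <= |I| * int |u|. *)
Lemma nm_cint u : cbmeas u -> nm (cintegral m u) <= Rintegral m setT (fun x => nm (u x)).
Proof.
move=> cu; set I := cintegral m u.
have [I0|I0] := eqVneq (nm I) 0.
  by rewrite I0; apply: Rint_ge0 => x; exact: nm_ge0.
have Ip : 0 < nm I by rewrite lt_def I0 nm_ge0.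
rewrite -(ler_pM2l Ip) -RintZ; last exact: cbmeas_nm.
have -> : nm I * nm I = complex.Re (conjc I * I).
  by rewrite -expr2 nm_sqr cReM; case: (I) => x y /=; ring.
rewrite -cintZ//.
have cc := cbmeasM (cbmeas_cst (conjc I)) cu.
apply: Rint_le; first by case: cc.
  by apply: bmeasZ; exact: cbmeas_nm.
move=> x; rewrite (le_trans (ler_norm _))// (le_trans (nm_Re _))//.
by rewrite nmM nm_conj.
Qed.

Lemma nm_cint_le u (g : T -> R) : cbmeas u -> bmeas g -> (forall x, nm (u x) <= g x) ->
  nm (cintegral m u) <= Rintegral m setT g.
Proof.
move=> cu bg ug; apply: le_trans (nm_cint cu) _.
by apply: Rint_le => //; exact: cbmeas_nm.
Qed.

End cintegral.

Lemma nm_resolvent (z : CC R) (s : R) : nonreal z ->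
  nm (z - s%:C)^-1 <= `|complex.Im z|^-1.
Proof.
rewrite /nonreal /= => z0; rewrite nmV lef_pV2 ?posrE ?normr_gt0//.
  by apply: le_trans (nm_Im _); rewrite cImB /= subr0.
rewrite nm_gt0 subr_eq0; apply: contra z0 => /eqP ->; by rewrite /= eqxx.
Qed.

Lemma subrC_neq0 (z : CC R) (s : R) : nonreal z -> z - s%:C != 0.
Proof.
rewrite /nonreal /= => z0; rewrite subr_eq0; apply: contra z0 => /eqP ->.
by rewrite /= eqxx.
Qed.

Lemma cvg_resolvent (z : CC R) (s : R) : nonreal z ->
  (fun t : R => (z - t%:C)^-1 : CC R) @ nbhs s --> ((z - s%:C)^-1 : CC R).
Proof.
move=> z0; apply: (@cvgCV _ _ (nbhs s)); first exact: subrC_neq0.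
apply: (@cvgCB _ _ (nbhs s)); first exact: (@cvgC_cst _ _ (nbhs s)).
exact: (@cvg_realC _ _ (nbhs s) _ id).
Qed.

Lemma cbmeas_resolvent (c : T -> R) (z : CC R) : measurable_fun setT c ->
  nonreal z -> cbmeas (fun x => (z - (c x)%:C)^-1).
Proof.
move=> mc z0.
have bnd (x : T) : nm ((z - (c x)%:C)^-1 : CC R) <= `|complex.Im z|^-1.
  exact: nm_resolvent.
split; split; try (exists `|complex.Im z|^-1 => x; apply: le_trans (bnd x);
  by [exact: nm_Re|exact: nm_Im]).
  apply: (measurableT_comp (f := fun s : R => complex.Re ((z - s%:C)^-1 : CC R))) => //.
  apply: continuous_measurable_fun => s.
  by apply: (@cvg_Re _ _ (nbhs s)); exact: cvg_resolvent.
apply: (measurableT_comp (f := fun s : R => complex.Im ((z - s%:C)^-1 : CC R))) => //.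
apply: continuous_measurable_fun => s.
by apply: (@cvg_Im _ _ (nbhs s)); exact: cvg_resolvent.
Qed.

End bounded_measurable.

(** * Cauchy transforms and their reciprocals *)

Section cauchy_transform.
Context {R : realType}.
Implicit Types (z w u v : CC R) (s : R).

(** Besides integrals against finite measures this covers the ultrafilter limits [Elim] of such
    integrals, for which no countable additivity is claimed; boundedness in the supremum norm is all
    that differentiating the resolvent requires. *)
Definition bfunct (E : (R -> CC R) -> CC R) := [/\
  forall u v : R -> CC R, cbmeas u -> cbmeas v -> E (fun s => u s + v s) = E u + E v,
  forall (c : CC R) (u : R -> CC R), cbmeas u -> E (fun s => c * u s) = c * E u &
  exists K : R, forall (u : R -> CC R) (M : R), cbmeas u -> (forall s, nm (u s) <= M) ->
    nm (E u) <= K * M].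

Lemma bfunct_cintegral (m : {finite_measure set R -> \bar R}) : bfunct (cintegral m).
Proof.
split => [u v|c u|]; [exact: cintD|exact: cintZ|].
exists (fine (m setT)) => u M cu uM.
rewrite mulrC -Rint_cst; apply: nm_cint_le => //; exact: bmeas_cst.
Qed.

Lemma nonreal_near z w : nonreal z -> nm (w - z) <= `|complex.Im z| / 2 ->
  nonreal w /\ `|complex.Im z| / 2 <= `|complex.Im w|.
Proof.
rewrite /nonreal /= => z0 wz.
have h : `|complex.Im z| - `|complex.Im w| <= `|complex.Im z| / 2.
  apply: le_trans (lerB_dist _ _) _; rewrite -cImB (le_trans (nm_Im _))//.
  by rewrite nm_dist.
have h2 : `|complex.Im z| / 2 <= `|complex.Im w| by lra.
split => //; rewrite -normr_gt0 (lt_le_trans _ h2)// divr_gt0// normr_gt0//.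
Qed.

Lemma cbmeas_res z : nonreal z -> cbmeas (fun s : R => (z - s%:C)^-1 : CC R).
Proof. by move=> z0; exact: (@cbmeas_resolvent _ R R id). Qed.

Lemma resolvent_sub z w s : nonreal z -> nonreal w ->
  (w - s%:C)^-1 - (z - s%:C)^-1 = - (w - z) * ((z - s%:C)^-1 * (w - s%:C)^-1).
Proof.
move=> /(subrC_neq0 s) z0 /(subrC_neq0 s) w0; field.
by rewrite z0 w0.
Qed.

Lemma bfunct_sum E (u v w : R -> CC R) (c : CC R) : bfunct E -> cbmeas u -> cbmeas v -> cbmeas w ->
  E (fun s => u s - v s - c * w s) = E u - E v - c * E w.
Proof.
move=> [ED EZ _] cu cv cw.
have -> : (fun s => u s - v s - c * w s) = fun s => u s + ((-1) * v s + (- c) * w s).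
  by apply/funext => s; ring.
have c1 := cbmeasM (cbmeas_cst (-1)) cv; have c2 := cbmeasM (cbmeas_cst (- c)) cw.
by rewrite ED ?ED ?EZ//; [ring|exact: cbmeasD].
Qed.

Lemma resolvent_quad (h a b : CC R) : b - a = - h * (a * b) ->
  b - a - (- h) * a ^+ 2 = h ^+ 2 * (a ^+ 2 * b).
Proof.
move=> e; have e2 : a - b = h * (a * b) by rewrite -opprB e; ring.
rewrite e; have -> : - h * (a * b) - - h * a ^+ 2 = h * a * (a - b) by ring.
by rewrite e2; ring.
Qed.

Lemma resolvent_quad2 (h a b : CC R) : b - a = - h * (a * b) ->
  b ^+ 2 - a ^+ 2 - (- 2 * h) * a ^+ 3 = h ^+ 2 * (a ^+ 2 * b * (2 * a + b)).
Proof.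
move=> e; have e2 : a - b = h * (a * b) by rewrite -opprB e; ring.
have -> : b ^+ 2 - a ^+ 2 - (- 2 * h) * a ^+ 3 = (b - a) * (a + b) + 2 * h * a ^+ 3 by ring.
rewrite e; have -> : - h * (a * b) * (a + b) + 2 * h * a ^+ 3 = h * a * (a - b) * (2 * a + b) by ring.
by rewrite e2; ring.
Qed.

(** The derivatives of the resolvent in [z] are multiples of its powers, and the resolvent identity
    bounds the remainders by a multiple of |w - z|^2 uniformly in [s]; linearity and boundedness
    carry this through [E]. *)
Lemma bfunct_twice_deriv E : bfunct E ->
  twice_deriv (@nonreal R) (fun z => E (fun s => (z - s%:C)^-1)).
Proof.
move=> bE; have [K EK] := let: And3 _ _ h := bE in h.
have bnd z w : nonreal z -> nm (w - z) <= `|complex.Im z| / 2 ->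
  [/\ nonreal w, forall s : R, nm ((z - s%:C)^-1 : CC R) <= `|complex.Im z|^-1 &
      forall s : R, nm ((w - s%:C)^-1 : CC R) <= 2 * `|complex.Im z|^-1].
  move=> z0 wz; have [w0 wy] := nonreal_near z0 wz; split => // s; first exact: nm_resolvent.
  apply: le_trans (nm_resolvent s w0) _.
  have zp : 0 < `|complex.Im z| by rewrite normr_gt0.
  have -> : 2 * `|complex.Im z|^-1 = (`|complex.Im z| / 2)^-1 by rewrite invfM invrK mulrC.
  by rewrite lef_pV2// posrE ?divr_gt0// (lt_le_trans _ wy)// divr_gt0.
apply: (@twice_derivP _ _ _ (fun z => - E (fun s => (z - s%:C)^-1 ^+ 2))
   (fun z => 2 * E (fun s => (z - s%:C)^-1 ^+ 3))) => z z0.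
  set y := `|complex.Im z|; have y0 : 0 < y by rewrite normr_gt0.
  apply: (@cderiv_quad _ _ _ _ (K * (y^-1 ^+ 2 * (2 * y^-1)))).
  apply/nbhsCP; exists (y / 2); first by rewrite divr_gt0.
  move=> w /ltW wz; have [w0 rz rw] := bnd z w z0 wz.
  have cz := cbmeas_res z0; have cw := cbmeas_res w0.
  have -> : E (fun s => (w - s%:C)^-1) - E (fun s => (z - s%:C)^-1) -
     - E (fun s => (z - s%:C)^-1 ^+ 2) * (w - z) =
     E (fun s => (w - s%:C)^-1 - (z - s%:C)^-1 - (- (w - z)) * (z - s%:C)^-1 ^+ 2).
    rewrite (bfunct_sum _ bE cw cz (cbmeasX 2 cz)).
    by ring.
  rewrite -mulrA; apply: EK.
    apply: cbmeasB; first exact: cbmeasB.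
    by apply: cbmeasM; [exact: cbmeas_cst|exact: cbmeasX].
  move=> s; rewrite (resolvent_quad (resolvent_sub s z0 w0)) nmM nmX [leLHS]mulrC nmM nmX.
  apply: ler_wpM2r; first by rewrite exprn_ge0 ?nm_ge0.
  apply: ler_pM; rewrite ?exprn_ge0 ?nm_ge0//.
  by rewrite lerXn2r ?nnegrE ?nm_ge0 ?invr_ge0 ?(ltW y0).
set y := `|complex.Im z|; have y0 : 0 < y by rewrite normr_gt0.
apply: (@cderiv_quad _ _ _ _ (K * (y^-1 ^+ 2 * (2 * y^-1) * (4 * y^-1)))).
apply/nbhsCP; exists (y / 2); first by rewrite divr_gt0.
move=> w /ltW wz; have [w0 rz rw] := bnd z w z0 wz.
have cz := cbmeas_res z0; have cw := cbmeas_res w0.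
rewrite -nmN.
have -> : - (- E (fun s => (w - s%:C)^-1 ^+ 2) - - E (fun s => (z - s%:C)^-1 ^+ 2) -
   2 * E (fun s => (z - s%:C)^-1 ^+ 3) * (w - z)) =
   E (fun s => (w - s%:C)^-1 ^+ 2 - (z - s%:C)^-1 ^+ 2 - (- 2 * (w - z)) * (z - s%:C)^-1 ^+ 3).
  rewrite (bfunct_sum _ bE (cbmeasX 2 cw) (cbmeasX 2 cz) (cbmeasX 3 cz)).
  by ring.
rewrite -mulrA; apply: EK.
  apply: cbmeasB; first by apply: cbmeasB; exact: cbmeasX.
  by apply: cbmeasM; [exact: cbmeas_cst|exact: cbmeasX].
move=> s; rewrite (resolvent_quad2 (resolvent_sub s z0 w0)) nmM nmX [leLHS]mulrC nmM [X in X * _ * _ <= _]nmM nmX.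
apply: ler_wpM2r; first by rewrite exprn_ge0 ?nm_ge0.
apply: ler_pM; rewrite ?mulr_ge0 ?exprn_ge0 ?nm_ge0//.
  apply: ler_pM; rewrite ?exprn_ge0 ?nm_ge0//.
  by rewrite lerXn2r ?nnegrE ?nm_ge0 ?invr_ge0 ?(ltW y0).
apply: le_trans (nmD _ _) _; rewrite nmM nm_nat.
by have := rz s; have := rw s; rewrite -/y; lra.
Qed.

Lemma Rint_gt0 {d} {T : measurableType d} (m : {finite_measure set T -> \bar R}) (f : T -> R) :
  bmeas f -> (forall x, 0 < f x) -> m setT != 0%E -> 0 < Rintegral m setT f.
Proof.
move=> bf f0 mT.
rewrite lt_def Rint_ge0 ?andbT => [|x]; last exact: ltW.
apply: contra mT => /eqP H.
have mf := measurable_int _ (bmeas_integrable m bf).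
have H2 : (\int[m]_x `|(EFin \o f) x|)%E = 0%E.
  have -> : (\int[m]_x `|(EFin \o f) x|)%E = (\int[m]_x (f x)%:E)%E.
    by apply: eq_integral => x _ /=; rewrite gtr0_norm.
  rewrite -[LHS]fineK; first by congr EFin.
  exact: integrable_fin_num (bmeas_integrable m bf).
have := (ae_eq_integral_abs m measurableT mf).1 H2.
move=> [N [mN N0 sN]]; apply/eqP.
apply: (subset_measure0 _ _ _ N0) => // x _; apply: sN => /= /(_ I) [] /eqP.
by rewrite gt_eqF.
Qed.

Lemma complexV z : z^-1 = (nm z ^+ 2)^-1%:C * conjc z.
Proof.
have [->|z0] := eqVneq z 0; first by rewrite invr0 [conjc _]conjc0 mulr0.
have h : nm z ^+ 2 != 0 by rewrite expf_neq0// nm_eq0.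
apply: (mulfI z0); rewrite divff// mulrCA.
have -> : z * conjc z = (nm z ^+ 2)%:C.
  by rewrite nm_sqr; apply: complex_eqP; rewrite ?cReM ?cImM; case: (z) => x y /=; ring.
by rewrite -rmorphM/= mulVf// rmorph1.
Qed.

Lemma cImV z : complex.Im z^-1 = - complex.Im z / nm z ^+ 2.
Proof. by rewrite complexV cImZ mulrC; case: (z). Qed.

Lemma cReV z : complex.Re z^-1 = complex.Re z / nm z ^+ 2.
Proof. by rewrite complexV cReZ mulrC; case: (z). Qed.

(** The imaginary part is [- complex.Im z] times the integral of the strictly positive function |z -
    s|^-2. *)
Lemma Gtransform_neq0 (nu : probability R R) z : nonreal z -> Gtransform nu z != 0.
Proof.
move=> z0; apply/eqP => /(congr1 (fun w : CC R => complex.Im w)) /=.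
have cz := cbmeas_res z0.
have -> : (fun s : R => complex.Im ((z - s%:C)^-1 : CC R)) =
    fun s => - complex.Im z * nm ((z - s%:C)^-1 : CC R) ^+ 2.
  by apply/funext => s; rewrite cImV cImB /= subr0 nmV exprVn.
have bf : bmeas (fun s => nm ((z - s%:C)^-1 : CC R) ^+ 2).
  by have b := cbmeas_nm cz; under [X in bmeas X]eq_fun do rewrite expr2; exact: bmeasM.
rewrite RintZ// => /eqP; rewrite mulf_eq0 oppr_eq0 (negbTE z0)/= gt_eqF//.
apply: Rint_gt0 => // [s|]; last by have -> : (nu : {finite_measure set _ -> \bar R}) setT = 1%E by [exact: probability_setT]; rewrite eqe oner_eq0.
by rewrite exprn_gt0// nm_gt0 invr_eq0 subrC_neq0.
Qed.

Lemma Gtransform_twice_deriv (nu : probability R R) :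
  twice_deriv (@nonreal R) (Gtransform nu).
Proof. exact: bfunct_twice_deriv (bfunct_cintegral nu). Qed.

Lemma Ftransform_twice_deriv (nu : probability R R) :
  twice_deriv (@nonreal R) (Ftransform nu).
Proof.
apply: twice_derivV; first by move=> z; exact: Gtransform_neq0.
exact: Gtransform_twice_deriv.
Qed.

End cauchy_transform.

(** * Asymptotics of F and its inverse *)

Section nontangential.
Context {R : realType}.
Implicit Types (nu : probability R R) (z w u v : CC R) (s c eta M kap : R).

Definition outside M : set R := [set s | M < `|s|].

Lemma measurable_outside M : measurable (outside M).
Proof.
have : measurable ((fun s : R => `|s|) @^-1` `]M, +oo[).
  by rewrite -[X in measurable X]setTI; exact: normr_measurable.
by congr measurable; apply/seteqP; split => s /=; rewrite in_itv/= ?andbT.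
Qed.

Definition tail nu M : R := fine (nu (outside M)).

Lemma tail_ge0 nu M : 0 <= tail nu M.
Proof. by rewrite fine_ge0. Qed.

Lemma tailE nu M : tail nu M = Rintegral nu setT (\1_(outside M) : R -> R).
Proof. by rewrite Rint_indic//; exact: measurable_outside. Qed.

Lemma tail_le nu M N : M <= N -> tail nu N <= tail nu M.
Proof.
move=> MN; rewrite fine_le ?fin_num_measure//; try exact: measurable_outside.
apply: le_measure; rewrite ?inE; try exact: measurable_outside.
by move=> s; rewrite /outside /=; exact: le_lt_trans.
Qed.

Lemma tail_small nu (e : R) : 0 < e -> exists2 M : R, 0 < M & tail nu M <= e.
Proof.
move=> e0.
have H : tail nu n%:R @[n --> \oo] --> (0 : R).
  under eq_fun do rewrite tailE.
  have -> : (0 : R) = Rintegral nu setT (fun=> (0:R)) by rewrite (Rint_cst nu) mul0r.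
  apply: (@Rint_dominated _ _ _ nu (fun n : nat => \1_(outside n%:R) : R -> R) _ 1).
  - by move=> n; exact: measurable_indic (measurable_outside _).
  - by move=> n x; rewrite indicE; case: (_ \in _); rewrite ?normr1// normr0.
  - move=> x; apply: cvg_near_cst; exists (Num.bound `|x|) => // n /= xn.
    rewrite indicE memNset//= /outside /=; apply/negP; rewrite -leNgt.
    by rewrite ltW// (lt_le_trans (archi_boundP _))// ler_nat.
move/cvgRP : H => /(_ _ e0)[N _ hN].
exists N.+1%:R => //; have := hN N.+1 (leqnSn N).
by rewrite /= subr0 ger0_norm ?tail_ge0// => /ltW.
Qed.

(** A closed truncated sector in both half-planes, [c] bounding the reciprocal of the sine of the
    angle with the real axis. Values of the inverses are located in such sectors, while their
    arguments range over [cones]. *)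
Definition region c eta : set (CC R) :=
  [set u | nm u <= c * `|complex.Im u| /\ eta <= `|complex.Im u|].

Lemma region_nonreal c eta u : 0 < eta -> region c eta u -> nonreal u.
Proof. by move=> e0 [_ h]; rewrite /nonreal /= -normr_gt0 (lt_le_trans e0). Qed.

Lemma region_neq0 c eta u : 0 < eta -> region c eta u -> u != 0.
Proof.
by move=> e0 /(region_nonreal e0); rewrite /nonreal /=; apply: contraNneq => ->.
Qed.

(** The quantity is s/(u - s), at most M/eta for |s| <= M; farther out only the crude bound 1 + c
    remains, which after integration is multiplied by the mass outside [-M, M]. *)
Lemma resolvent_bound c eta M u s : 0 <= c -> 0 < eta -> 0 < M -> region c eta u ->
  nm (u * (u - s%:C)^-1 - 1) <= M / eta + (1 + c) * \1_(outside M) s.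
Proof.
move=> c0 e0 M0 ru; have u0 := region_nonreal e0 ru; move: ru => [uc ue].
have us := subrC_neq0 s u0.
have Ip : 0 < `|complex.Im u| by rewrite normr_gt0.
have rI := nm_resolvent s u0.
have h0 : nm (u * (u - s%:C)^-1) <= c.
  rewrite nmM (le_trans (ler_wpM2l (nm_ge0 _) rI))//.
  by rewrite ler_pdivrMr.
rewrite indicE; have [sM|sM] := boolP (s \in outside M).
  rewrite mulr1 (le_trans (nmB _ _))// nm1.
  by have : 0 <= M / eta by [rewrite divr_ge0// ltW]; lra.
rewrite mulr0 addr0.
have -> : u * (u - s%:C)^-1 - 1 = s%:C * (u - s%:C)^-1 by field.
have {}sM : `|s| <= M by move: sM; rewrite notin_setE /outside /= => /negP; rewrite -leNgt.
rewrite nmM nmR; apply: ler_pM; rewrite ?nm_ge0// (le_trans rI)//.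
by rewrite lef_pV2.
Qed.

Lemma resolvent_bound1 c eta u s : 0 < eta -> region c eta u ->
  nm (u * (u - s%:C)^-1) <= c.
Proof.
move=> e0 ru; have u0 := region_nonreal e0 ru; move: ru => [uc ue].
have Ip : 0 < `|complex.Im u| by rewrite normr_gt0.
rewrite nmM (le_trans (ler_wpM2l (nm_ge0 _) (nm_resolvent s u0)))//.
by rewrite ler_pdivrMr.
Qed.

Definition ntbound nu c eta M : R := M / eta + (1 + c) * tail nu M.

Lemma bmeas_ntbound c eta M :
  bmeas (fun s : R => M / eta + (1 + c) * \1_(outside M) s).
Proof.
apply: bmeasD; first exact: bmeas_cst.
by apply: bmeasZ; apply: bmeas_indic; exact: measurable_outside.
Qed.

Lemma fine_probT nu : fine ((nu : {finite_measure set _ -> \bar R}) setT) = 1.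
Proof. by have -> : (nu : {finite_measure set _ -> \bar R}) setT = 1%E by exact: probability_setT. Qed.

Lemma Rint_ntbound nu c eta M :
  Rintegral nu setT (fun s : R => M / eta + (1 + c) * \1_(outside M) s) = ntbound nu c eta M.
Proof.
have bi : bmeas (\1_(outside M) : R -> R) by apply: bmeas_indic; exact: measurable_outside.
rewrite RintD; [|exact: bmeas_cst|exact: bmeasZ].
by rewrite (Rint_cst nu) RintZ// fine_probT mulr1 /ntbound tailE.
Qed.

Lemma cbmeas_ures u : nonreal u -> cbmeas (fun s : R => u * (u - s%:C)^-1).
Proof. by move=> u0; exact: (cbmeasM (cbmeas_cst u) (cbmeas_res u0)). Qed.

Lemma cint1 nu (c : CC R) : cintegral nu (fun=> c) = c.
Proof. by rewrite (cint_cst nu) fine_probT rmorph1 mulr1. Qed.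

Lemma Rint_resolvent_bound nu c eta M u : 0 <= c -> 0 < eta -> 0 < M -> region c eta u ->
  Rintegral nu setT (fun s => nm (u * (u - s%:C)^-1 - 1)) <= ntbound nu c eta M.
Proof.
move=> c0 e0 M0 ru; have u0 := region_nonreal e0 ru.
rewrite -Rint_ntbound; apply: Rint_le.
- by apply: cbmeas_nm; apply: cbmeasB; [exact: cbmeas_ures|exact: cbmeas_cst].
- exact: bmeas_ntbound.
- by move=> s; exact: resolvent_bound.
Qed.

Lemma uG_sub1 nu u : nonreal u ->
  u * Gtransform nu u - 1 = cintegral nu (fun s => u * (u - s%:C)^-1 - 1).
Proof.
move=> u0; rewrite cintB; [|exact: cbmeas_ures|exact: cbmeas_cst].
by rewrite cint1 cintZ//; exact: cbmeas_res.
Qed.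

Lemma nontangential1 nu c eta M u : 0 <= c -> 0 < eta -> 0 < M -> region c eta u ->
  nm (u * Gtransform nu u - 1) <= ntbound nu c eta M.
Proof.
move=> c0 e0 M0 ru; have u0 := region_nonreal e0 ru.
rewrite uG_sub1// (le_trans (nm_cint _ _))//; last exact: Rint_resolvent_bound.
by apply: cbmeasB; [exact: cbmeas_ures|exact: cbmeas_cst].
Qed.

Definition G11 nu u v : CC R :=
  cintegral nu (fun s : R => (u - s%:C)^-1 * (v - s%:C)^-1).

Lemma nontangential2 nu c eta M u v : 0 <= c -> 0 < eta -> 0 < M ->
  region c eta u -> region c eta v ->
  nm (u * v * G11 nu u v - 1) <= (1 + c) * ntbound nu c eta M.
Proof.
move=> c0 e0 M0 ru rv; have u0 := region_nonreal e0 ru; have v0 := region_nonreal e0 rv.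
have cu := cbmeas_ures u0; have cv := cbmeas_ures v0.
have -> : u * v * G11 nu u v - 1 =
    cintegral nu (fun s => u * (u - s%:C)^-1 * (v * (v - s%:C)^-1) - 1).
  rewrite cintB; [|exact: cbmeasM|exact: cbmeas_cst].
  rewrite cint1 -cintZ; last by apply: cbmeasM; exact: cbmeas_res.
  by congr (cintegral _ _ - _); apply/funext => s; ring.
rewrite -Rint_ntbound -RintZ; last exact: bmeas_ntbound.
apply: nm_cint_le.
- by apply: cbmeasB; [exact: cbmeasM|exact: cbmeas_cst].
- by apply: bmeasZ; exact: bmeas_ntbound.
move=> s; set a := u * _; set b := v * _.
have -> : a * b - 1 = (a - 1) * b + (b - 1) by ring.
rewrite (le_trans (nmD _ _))// nmM mulrDl mul1r addrC lerD//.
  exact: resolvent_bound.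
rewrite mulrC; apply: ler_pM; rewrite ?nm_ge0//.
  exact: (resolvent_bound1 s e0 rv).
exact: resolvent_bound.
Qed.

(** Closeness of F to the identity in the form needed to invert it: the Lipschitz clause makes z -
    (F(u) - u) a contraction in [u], and the first clause keeps its values near [z]. Differences are
    bounded directly because [u] and [v] may lie in opposite half-planes. *)
Definition good nu c eta kap := forall u, region c eta u ->
  nm (Ftransform nu u - u) <= kap * nm u /\
  forall v, region c eta v ->
    nm ((Ftransform nu u - u) - (Ftransform nu v - v)) <= kap * nm (u - v).

Lemma Gtransform_sub nu u v : nonreal u -> nonreal v ->
  Gtransform nu v - Gtransform nu u = (u - v) * G11 nu u v.
Proof.
move=> u0 v0; have cu := cbmeas_res u0; have cv := cbmeas_res v0.
rewrite /Gtransform /G11 -cintB// -cintZ; last exact: cbmeasM.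
congr cintegral; apply/funext => s; rewrite resolvent_sub//; ring.
Qed.

Lemma Ftransform_sub nu u v : nonreal u -> nonreal v ->
  Ftransform nu u - Ftransform nu v =
  (G11 nu u v / (Gtransform nu u * Gtransform nu v)) * (u - v).
Proof.
move=> u0 v0; rewrite /Ftransform.
have gu := Gtransform_neq0 nu u0; have gv := Gtransform_neq0 nu v0.
have -> : (Gtransform nu u)^-1 - (Gtransform nu v)^-1 =
   (Gtransform nu v - Gtransform nu u) / (Gtransform nu u * Gtransform nu v).
  by field; rewrite gu gv.
by rewrite Gtransform_sub//; ring.
Qed.

Lemma good_criterion nu c eta M kap : 0 <= c -> 0 < eta -> 0 < M ->
  kap <= 2 / 5 -> (1 + c) * ntbound nu c eta M <= kap / 4 -> good nu c eta kap.
Proof.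
move=> c0 e0 M0 k1 hk u ru.
(* The three normalised integrals are within [th] of 1, so the difference quotient of F - id is at
   most (3 th + th^2)/(1 - th)^2. This is below 4 th = kap once th <= 1/10, whence the bound 2/5 on
   [kap]. *)
set th := kap / 4 in hk.
have nt0 : 0 <= ntbound nu c eta M.
  by rewrite addr_ge0 ?divr_ge0 ?(ltW M0) ?(ltW e0)// mulr_ge0 ?tail_ge0// addr_ge0.
have th10 : th <= 1 / 10 by rewrite /th; lra.
have hnt : ntbound nu c eta M <= th.
  by apply: le_trans hk; rewrite ler_peMl// lerDl.
have kth : kap = 4 * th by rewrite /th; field.
have th0 : 0 <= th by apply: le_trans hnt.
have u1 := le_trans (nontangential1 nu c0 e0 M0 ru) hnt.
have base x : region c eta x -> [/\ nonreal x, x != 0,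
   nm (x * Gtransform nu x - 1) <= th, Gtransform nu x != 0 & 1 - th <= nm (x * Gtransform nu x)].
  move=> rx; have x0 := region_nonreal e0 rx.
  have x1 := le_trans (nontangential1 nu c0 e0 M0 rx) hnt.
  split => //; [exact: region_neq0 e0 rx|exact: Gtransform_neq0|].
  have := nmB_ge 1 (1 - x * Gtransform nu x); rewrite nm1 nm_dist.
  have -> : 1 - x * Gtransform nu x - 1 = - (x * Gtransform nu x) by ring.
  by rewrite nmN [nm (1 - _)]nm_dist; lra.
have [u0 un hu gu lu] := base u ru.
split.
  have -> : Ftransform nu u - u = u * (- (u * Gtransform nu u - 1) / (u * Gtransform nu u)).
    by rewrite /Ftransform; field; rewrite un gu.
  rewrite nmM mulrC ler_wpM2r ?nm_ge0// nmM nmN nmV ler_pdivrMr; last by lra.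
  apply: le_trans hu _; rewrite kth; nra.
move=> v rv; have [v0 vn hv gv lv] := base v rv.
set A := u * Gtransform nu u in hu lu; set B := v * Gtransform nu v in hv lv.
set Q := u * v * G11 nu u v.
have hQ : nm (Q - 1) <= th := le_trans (nontangential2 nu c0 e0 M0 ru rv) hk.
have -> : Ftransform nu u - u - (Ftransform nu v - v) =
   ((Q - 1 - ((A - 1) * (B - 1) + (A - 1) + (B - 1))) / (A * B)) * (u - v).
  have -> : Ftransform nu u - u - (Ftransform nu v - v) =
     (Ftransform nu u - Ftransform nu v) - (u - v) by ring.
  rewrite Ftransform_sub// /Q /A /B; field.
  by rewrite un gu vn gv.
rewrite nmM ler_wpM2r ?nm_ge0// nmM nmV nmM.
have AB : (1 - th) * (1 - th) <= nm A * nm B by apply: ler_pM => //; lra.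
rewrite ler_pdivrMr; last by nra.
have N1 : nm (Q - 1 - ((A - 1) * (B - 1) + (A - 1) + (B - 1))) <= th + (th * th + th + th).
  rewrite (le_trans (nmB _ _))// lerD// (le_trans (nmD _ _))// lerD//.
  by rewrite (le_trans (nmD _ _))// lerD// nmM ler_pM ?nm_ge0.
apply: le_trans N1 _; rewrite kth.
have : 4 * th * ((1 - th) * (1 - th)) <= 4 * th * (nm A * nm B) by rewrite ler_wpM2l// mulr_ge0.
nra.
Qed.

(* Membership in a truncated sector makes [F] close to the identity as soon as
   the mass far from the origin, relative to the height, is small. *)
Lemma good_tight c kap : 0 <= c -> 0 < kap -> kap <= 2 / 5 ->
  exists2 e : R, 0 < e & forall M, 0 < M -> exists2 eta : R, 0 < eta &
    forall nu, tail nu M <= e -> good nu c eta kap.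
Proof.
move=> c0 k0 k1; have c1 : 0 < 1 + c by rewrite ltr_pwDl.
exists (kap / 8 / (1 + c) ^+ 2); first by rewrite !divr_gt0// exprn_gt0.
move=> M M0; exists (8 * (1 + c) * M / kap); first by rewrite divr_gt0// !mulr_gt0.
move=> nu tM; apply: (good_criterion (M := M)) => //; first by rewrite divr_gt0// !mulr_gt0.
rewrite /ntbound mulrDr.
have -> : (1 + c) * (M / (8 * (1 + c) * M / kap)) = kap / 8.
  by field; rewrite !gt_eqF.
have -> : kap / 4 = kap / 8 + (1 + c) * ((1 + c) * (kap / 8 / (1 + c) ^+ 2)).
  by field; rewrite gt_eqF.
by rewrite lerD2l ler_pM2l// ler_pM2l.
Qed.

Lemma good_exists nu c kap : 0 <= c -> 0 < kap -> kap <= 2 / 5 ->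
  exists2 eta : R, 0 < eta & good nu c eta kap.
Proof.
move=> c0 k0 k1; have [e e0 H] := good_tight c0 k0 k1.
have [M M0 tM] := tail_small nu e0; have [eta eta0 {}H] := H M M0.
by exists eta => //; exact: H.
Qed.

(** The order of choices is opposite to that of [good_tight]: the height [eta] is prescribed,
    possibly small, and the measures have to concentrate near the origin accordingly. *)
Lemma good_atom c eta kap : 0 <= c -> 0 < eta -> 0 < kap -> kap <= 2 / 5 ->
  exists M e : R, [/\ 0 < M, 0 < e & forall nu, tail nu M <= e -> good nu c eta kap].
Proof.
move=> c0 e0 k0 k1; have c1 : 0 < 1 + c by rewrite ltr_pwDl.
exists (kap / 8 / (1 + c) * eta), (kap / 8 / (1 + c) ^+ 2).
split; [by rewrite mulr_gt0// !divr_gt0|by rewrite !divr_gt0// exprn_gt0|].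
move=> nu tM; apply: (good_criterion (M := (kap / 8 / (1 + c) * eta))) => //.
  by rewrite mulr_gt0// !divr_gt0.
rewrite /ntbound mulrDr.
have -> : (1 + c) * (kap / 8 / (1 + c) * eta / eta) = kap / 8.
  by field; rewrite !gt_eqF.
have -> : kap / 4 = kap / 8 + (1 + c) * ((1 + c) * (kap / 8 / (1 + c) ^+ 2)).
  by field; rewrite gt_eqF.
by rewrite lerD2l ler_pM2l// ler_pM2l.
Qed.

Lemma good_sub nu c c' eta eta' kap : c' <= c -> eta <= eta' ->
  good nu c eta kap -> good nu c' eta' kap.
Proof.
move=> cc ee g.
have sub u : region c' eta' u -> region c eta u.
  move=> [h1 h2]; split; last exact: le_trans h2.
  by rewrite (le_trans h1)// ler_wpM2r.
by move=> u /sub/g[h1 h2]; split => // v /sub; exact: h2.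
Qed.

End nontangential.

(** * Inverses of F on truncated cones *)

Section inverse.
Context {R : realType}.
Implicit Types (nu : probability R R) (z w u v : CC R) (a b c eta kap sg : R)
  (H : CC R -> CC R).

(* The two components of [cones a b] are obtained for [sg = 1] and [sg = -1]. *)
Definition hcone sg a b : set (CC R) :=
  [set z | `|complex.Re z| < a * (sg * complex.Im z) /\ b < sg * complex.Im z].

Lemma conesP a b z : 0 <= b ->
  cones a b z <-> exists2 sg : R, `|sg| = 1 & hcone sg a b z.
Proof.
move=> b0; split.
  move=> [[z1 z2 z3]|[]]; first by exists 1; rewrite ?normr1// /hcone /= !mul1r.
  move=> z1 z2 z3; exists (-1); first by rewrite normrN1.
  by case: z z1 z2 z3 => x y /= z1 z2 z3; rewrite /hcone /= !mulN1r.
move=> [sg sg1 [z1 z2]].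
have /orP[/eqP s1|/eqP s1] : (sg == 1) || (sg == -1).
  by have := eqr_norml sg 1; rewrite sg1 eqxx ler01 andbT => <-.
  move: z1 z2; rewrite s1 !mul1r => z1 z2.
  by left; split => //; exact: le_lt_trans z2.
move: z1 z2; rewrite s1 !mulN1r => z1 z2; right.
case: z z1 z2 => x y /= z1 z2; split => //=.
exact: le_lt_trans z2.
Qed.

Lemma hcone_cones sg a b z : `|sg| = 1 -> 0 <= b -> hcone sg a b z -> cones a b z.
Proof. by move=> s1 b0 zs; apply/conesP => //; exists sg. Qed.

Lemma normM1 sg (x : R) : `|sg| = 1 -> 0 <= sg * x -> sg * x = `|x|.
Proof. by move=> s1 h; rewrite -(ger0_norm h) normrM s1 mul1r. Qed.

Lemma cones_bounds a b z : 0 <= b -> cones a b z ->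
  [/\ `|complex.Re z| < a * `|complex.Im z|, b < `|complex.Im z| &
      nm z <= (1 + a) * `|complex.Im z|].
Proof.
move=> b0 /(conesP _ _ b0)[sg s1 [h1 h2]].
have h3 : sg * complex.Im z = `|complex.Im z|.
  by apply: normM1 => //; rewrite ltW// (le_lt_trans b0).
rewrite h3 in h1 h2; split => //; rewrite (le_trans (nm_le _))// mulrDl mul1r.
by rewrite addrC lerD2l ltW.
Qed.

Lemma cones_nonreal a b z : 0 <= b -> cones a b z -> nonreal z.
Proof.
by move=> b0 /(cones_bounds b0)[_ h _]; rewrite /nonreal /= -normr_gt0 (le_lt_trans b0).
Qed.

Lemma hcone_open sg a b : open (hcone sg a b).
Proof.
rewrite openE => z [z1 z2].
have cr : (fun w : CC R => complex.Re w) @ nbhs z --> complex.Re z.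
  by apply: (@cvg_Re _ _ (nbhs z)); exact: cvg_id.
have ci : (fun w : CC R => sg * complex.Im w) @ nbhs z --> sg * complex.Im z.
  apply: cvgM; first exact: cvg_cst.
  by apply: (@cvg_Im _ _ (nbhs z)); exact: cvg_id.
have h1 : (fun w : CC R => a * (sg * complex.Im w) - `|complex.Re w|) @ nbhs z -->
    a * (sg * complex.Im z) - `|complex.Re z|.
  apply: cvgB; last exact: cvg_norm.
  by apply: cvgM => //; exact: cvg_cst.
have p1 : \forall w \near nbhs z, 0 < a * (sg * complex.Im w) - `|complex.Re w|.
  by apply: (cvgr_gt _ h1); rewrite subr_gt0.
have p2 : \forall w \near nbhs z, b < sg * complex.Im w by exact: (cvgr_gt _ ci).
by apply: filterS2 p1 p2 => w; rewrite subr_gt0.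
Qed.

Lemma hcone_convex sg a b : cconvex (hcone sg a b).
Proof.
move=> z w t [z1 z2] [w1 w2] /andP[t0 t1].
rewrite /hcone /= cReD cImD !cReZ !cImZ.
have [->|t1'] := eqVneq t 1.
  by rewrite subrr !mul0r !add0r !mul1r.
have t2 : 0 < 1 - t by rewrite subr_gt0 lt_neqAle t1'.
split.
  rewrite (le_lt_trans (ler_normD _ _))// !normrM (ger0_norm t0) (gtr0_norm t2).
  have -> : a * (sg * ((1 - t) * complex.Im z + t * complex.Im w)) =
    (1 - t) * (a * (sg * complex.Im z)) + t * (a * (sg * complex.Im w)) by ring.
  by rewrite ltr_leD// ?ltr_pM2l// ler_wpM2l// ltW.
have -> : sg * ((1 - t) * complex.Im z + t * complex.Im w) =
    (1 - t) * (sg * complex.Im z) + t * (sg * complex.Im w) by ring.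
have -> : b = (1 - t) * b + t * b by ring.
by rewrite ltr_leD// ?ltr_pM2l// ler_wpM2l// ltW.
Qed.

Lemma cones_open a b : 0 <= b -> open (cones a b : set (CC R)).
Proof.
move=> b0; have -> : cones a b = hcone 1 a b `|` hcone (-1) a b :> set (CC R).
  apply/seteqP; split => z.
    move=> [[z1 z2 z3]|[]]; first by left; rewrite /hcone /= !mul1r.
    by move=> z1 z2 z3; right; case: z z1 z2 z3 => x y /= z1 z2 z3; rewrite /hcone /= !mulN1r.
  by move=> [|] h; apply: hcone_cones h => //; rewrite ?normrN1 ?normr1.
by apply: openU; exact: hcone_open.
Qed.

Lemma hcone_sub sg a a' b b' : `|sg| = 1 -> 0 <= b -> a <= a' -> b <= b' ->
  hcone sg a b' `<=` hcone sg a' b.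
Proof.
move=> s1 b0 aa bb z [z1 z2]; split; last exact: le_lt_trans z2.
by rewrite (lt_le_trans z1)// ler_wpM2r// ltW// (le_lt_trans b0)// (le_lt_trans bb).
Qed.

Lemma cones_sub a a' b b' : 0 <= b -> a <= a' -> b <= b' ->
  cones a b' `<=` (cones a' b : set (CC R)).
Proof.
move=> b0 aa bb z /(conesP _ _ (le_trans b0 bb))[sg s1 zs].
by apply: (hcone_cones s1 b0); exact: hcone_sub zs.
Qed.

Lemma hcone_axis sg a b (y : R) : `|sg| = 1 -> 0 < a -> 0 < y -> b < y ->
  hcone sg a b (0 +i* (sg * y)).
Proof.
move=> s1 a0 y0 yb; have ss : sg * sg = 1 by rewrite -expr2 -real_normK ?num_real// s1 expr1n.
have e : sg * (sg * y) = y by rewrite mulrA ss mul1r.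
by rewrite /hcone /= normr0 e mulr_gt0.
Qed.

Definition cone_width a : R := 4 * (1 + a).
Definition cone_slack a : R := (4 * (1 + a))^-1.

Lemma cone_slack_bounds a : 0 < a -> 0 < cone_slack a /\ cone_slack a <= 1 / 4.
Proof.
move=> a0; rewrite /cone_slack; split; first by rewrite invr_gt0; lra.
by rewrite div1r lef_pV2 ?posrE; lra.
Qed.

(* Points at relative distance [1 / (2 (1 + a))] from a point of the cone stay
   in a truncated sector of width [4 (1 + a)] and of half the height. *)
Lemma region_near a eta z u : 0 < a ->
  nm z <= (1 + a) * `|complex.Im z| -> 2 * eta <= `|complex.Im z| ->
  nm (u - z) <= 2 * cone_slack a * nm z ->
  [/\ region (cone_width a) eta u, nm u <= 2 * nm z &
     `|complex.Im z| / 2 <= `|complex.Im u|].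
Proof.
move=> a0 za ze uz.
have s0 : 0 < 1 + a by lra.
have e1 : 2 * cone_slack a * nm z <= `|complex.Im z| / 2.
  rewrite /cone_slack; have -> : 2 * (4 * (1 + a))^-1 * nm z = nm z / (1 + a) / 2.
    by field; rewrite gt_eqF.
  by rewrite ler_pM2r// ler_pdivrMr// mulrC.
have hI : `|complex.Im z| / 2 <= `|complex.Im u|.
  have : `|complex.Im z| - `|complex.Im u| <= nm (u - z).
    rewrite (le_trans (lerB_dist _ _))// distrC -cImB; exact: nm_Im.
  by lra.
have hz : nm u <= 2 * nm z.
  have := nmB_ge u z; have [k0 k1] := cone_slack_bounds a0.
  have := nm_ge0 z; nra.
split => //; split; last by lra.
rewrite (le_trans hz)// /cone_width.
have : (1 + a) * `|complex.Im z| <= (1 + a) * (2 * `|complex.Im u|).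
  by rewrite ler_pM2l//; lra.
by lra.
Qed.

Lemma good_lipschitz nu c eta kap u v : good nu c eta kap ->
  region c eta u -> region c eta v ->
  (1 - kap) * nm (u - v) <= nm (Ftransform nu u - Ftransform nu v).
Proof.
move=> g ru rv; have [_ /(_ _ rv)] := g u ru.
have -> : Ftransform nu u - u - (Ftransform nu v - v) =
   (Ftransform nu u - Ftransform nu v) - (u - v) by ring.
have := nmB_ge (u - v) (Ftransform nu u - Ftransform nu v).
by rewrite [nm (u - v - _)]nm_dist; lra.
Qed.

Lemma Ftransform_ccont nu u : nonreal u -> ccont (Ftransform nu) u.
Proof.
move=> u0; have [f1 [h _]] := Ftransform_twice_deriv nu.
exact: cderiv_cvg (h u u0).
Qed.

(** Replacing a minimiser [u] of |F(u) - z| over the disc by the Picard iterate t = z - (F(u) - u)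
    shrinks the distance by the factor [cone_slack a], so the minimum is zero: the contraction
    principle, with compactness in place of iteration. *)
Lemma good_preimage nu a eta z : 0 < a -> 0 < eta ->
  good nu (cone_width a) eta (cone_slack a) ->
  nm z <= (1 + a) * `|complex.Im z| -> 2 * eta <= `|complex.Im z| ->
  exists2 u, nm (u - z) <= 2 * cone_slack a * nm z & Ftransform nu u = z.
Proof.
move=> a0 eta0 g za ze; have [k0 k1] := cone_slack_bounds a0.
set r := 2 * cone_slack a * nm z.
have r0 : 0 <= r by rewrite !mulr_ge0 ?nm_ge0 ?(ltW k0).
have near u : nm (u - z) <= r -> [/\ region (cone_width a) eta u, nm u <= 2 * nm z & nonreal u].
  move=> ur; have [ru hu _] := region_near a0 za ze ur.
  by split => //; exact: region_nonreal eta0 ru.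
have [||u] := @compact_EVT_min _ R (fun u => nm (Ftransform nu u - z)) (cdisc z r) _ (@compact_cdisc R z r) _.
- by exists z; rewrite /cdisc /= subrr nm0.
- apply: continuous_in_subspaceT => u; rewrite inE => /near[_ _ u0].
  apply: (@cvg_nm _ _ (nbhs u) _ (fun u => Ftransform nu u - z)).
  exact: (ccont_cvg (ccontB (Ftransform_ccont nu u0) (ccont_cst z u))).
rewrite inE => ur umin; have [ru hu u0] := near u ur.
exists u => //; pose t := z - (Ftransform nu u - u).
have tr : nm (t - z) <= r.
  have -> : t - z = - (Ftransform nu u - u) by rewrite /t; ring.
  rewrite nmN; have [gu _] := g u ru; rewrite (le_trans gu)// /r.
  by rewrite [2 * _]mulrC -mulrA ler_pM2l.
have [rt ht t0] := near t tr.
have := umin t; rewrite inE => /(_ tr) h1.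
have [_ /(_ t rt) h2] := g u ru.
have e1 : Ftransform nu u - u - (Ftransform nu t - t) = - (Ftransform nu t - z).
  by rewrite {2}/t; ring.
have e2 : u - t = Ftransform nu u - z by rewrite /t; ring.
rewrite e1 e2 nmN in h2.
have := nm_ge0 (Ftransform nu u - z) => h3.
have h4 : nm (Ftransform nu u - z) = 0 by nra.
by apply/eqP; rewrite -subr_eq0 -nm_eq0 h4.
Qed.

Lemma cderiv_inverse (F H : CC R -> CC R) z d : ccont H z ->
  (\forall w \near z, F (H w) = w) -> cderiv F (H z) d -> d != 0 ->
  cderiv H z d^-1.
Proof.
move=> cH FH /cderiv_global[q [<- cq Fq]] d0.
have cqH : ccont (fun w => q (H w)) z by exact: ccont_comp cH cq.
have FHz := nbhs_singleton FH.
exists (fun w => (q (H w))^-1); split => //; first exact: ccontV cqH.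
apply: filterS2 FH (cvg_neq0 cqH d0) => w Fw qw.
by have := Fq (H w); rewrite Fw FHz => ->; rewrite mulKf.
Qed.

(** Values of [H] are chosen pointwise. The lower Lipschitz bound makes the choice continuous, and a
    continuous right inverse is differentiable where the derivative of F does not vanish. *)
Lemma good_inverse nu a b : 0 < a -> 0 < b ->
  good nu (cone_width a) (b / 2) (cone_slack a) ->
  exists H, is_inverse nu a b H /\
    forall z, cones a b z -> nm (H z - z) <= 2 * cone_slack a * nm z.
Proof.
move=> a0 b0 g; have [k0 k1] := cone_slack_bounds a0.
have e0 : 0 < b / 2 by rewrite divr_gt0.
have zb z : cones a b z -> nm z <= (1 + a) * `|complex.Im z| /\ 2 * (b / 2) <= `|complex.Im z|.
  by move=> /(cones_bounds (ltW b0))[_ h1 h2]; split => //; lra.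
have ex z : cones a b z -> exists u, nm (u - z) <= 2 * cone_slack a * nm z /\ Ftransform nu u = z.
  by move=> /zb[h1 h2]; have [u] := good_preimage a0 e0 g h1 h2; exists u.
pose H z : CC R := xget (0 : CC R) [set u | nm (u - z) <= 2 * cone_slack a * nm z /\ Ftransform nu u = z].
have HP z : cones a b z -> nm (H z - z) <= 2 * cone_slack a * nm z /\ Ftransform nu (H z) = z.
  by move=> /ex[u hu]; rewrite /H; case: xgetP => [x _ []//|/(_ u)].
have HR z : cones a b z -> [/\ region (cone_width a) (b / 2) (H z), nm (H z) <= 2 * nm z &
     `|complex.Im z| / 2 <= `|complex.Im (H z)|].
  by move=> zc; have [h1 h2] := zb z zc; have [h3 _] := HP z zc; exact: region_near h3.
have Hnr z : cones a b z -> nonreal (H z).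
  by move=> /HR[rz _ _]; exact: region_nonreal e0 rz.
have nearz z : cones a b z -> \forall w \near z, cones a b w.
  by move=> zc; have := open_nbhs_nbhs (conj (cones_open (ltW b0)) zc); apply: filterS.
exists H; split; last by move=> z /HP[].
split.
- move=> z zc.
  have cH : ccont H z.
    apply/ccontP => e ee.
    have /nbhsCP[e1 e10 h1] := nearz z zc.
    exists (Num.min e1 (e / 2)); first by rewrite lt_min e10 divr_gt0.
    move=> w; rewrite lt_min => /andP[we1 we2].
    have wc := h1 w we1; have [rw _ _] := HR w wc; have [rz _ _] := HR z zc.
    have := good_lipschitz g rw rz; rewrite (HP w wc).2 (HP z zc).2.
    by have := nm_ge0 (H w - H z); nra.
  have [F1 [hF _]] := Ftransform_twice_deriv nu.
  have FH : \forall w \near z, Ftransform nu (H w) = w.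
    by apply: filterS (nearz z zc) => w /HP[].
  apply: (cderiv_derivable (d := (F1 (H z))^-1)).
  apply: (cderiv_inverse cH FH (hF _ (Hnr z zc))).
  have q0 : 0 < 1 - cone_slack a by lra.
  (* The Lipschitz bound only holds inside the sector, hence the detour by the
     images [H w], among which a neighbourhood of [H z] is found in [reg']. *)
  have := hF _ (Hnr z zc) => /cderiv_global[q [<- cq Fq]].
  apply/eqP => qz.
  have cqH : ccont (fun w => q (H w)) z by exact: ccont_comp cH cq.
  move/ccontP : cqH => /(_ _ q0)[e1 e10 h1].
  have /nbhsCP[e2 e20 h2] := nearz z zc.
  pose t := Num.min e1 e2 / 2.
  have t0 : 0 < t by rewrite divr_gt0// lt_min e10.
  have : t < Num.min e1 e2 by rewrite /t gtr_pMr ?lt_min ?e10// invf_lt1// ltr1n.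
  rewrite lt_min => /andP[t1 t2].
  have nt : nm (z + t%:C - z) = t by rewrite addrC addKr nm_real// ltW.
  have wc : cones a b (z + t%:C) by apply: h2; rewrite nt.
  have [rw _ _] := HR _ wc; have [rz _ _] := HR z zc.
  have lip := good_lipschitz g rw rz.
  have Fw := Fq (H (z + t%:C)).
  have qs : nm (q (H (z + t%:C))) < 1 - cone_slack a.
    by have := h1 (z + t%:C); rewrite nt qz subr0; exact.
  have d0 : 0 < nm (H (z + t%:C) - H z).
    rewrite lt_def nm_ge0 andbT; apply/eqP => d0.
    move: Fw; rewrite (HP _ wc).2 (HP z zc).2 => /(congr1 (@nm R)).
    by rewrite nmM d0 mulr0 nt => /eqP; rewrite gt_eqF.
  by move: lip; rewrite Fw nmM ler_pM2r// leNgt qs.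
- by move=> z zc; split; [exact: Hnr|have [] := HP z zc].
- move=> e ee.
  (* For |z| large, [H z] lies in a region where F is close to the identity with this smaller
     constant; the factor 1/2 absorbs |H z| <= 2 |z|. *)
  pose kap := Num.min (e / 2) (2 / 5).
  have kap0 : 0 < kap by rewrite lt_min !divr_gt0.
  have kap1 : kap <= 2 / 5 by rewrite ge_min lexx orbT.
  have kap2 : kap <= e / 2 by rewrite ge_min lexx.
  have c0 : 0 <= cone_width a by rewrite /cone_width; lra.
  have [eta eta0 g'] := good_exists nu c0 kap0 kap1.
  exists ((1 + a) * (2 * eta)) => z zc.
  rewrite !nmE -rmorphM/= !lecR => Mz.
  have [h1 h2] := zb z zc; have [h3 h4 h5] := HR z zc.
  have [Hz FHz] := HP z zc.
  have r2 : region (cone_width a) eta (H z).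
    split; first by case: h3.
    have : (1 + a) * (2 * eta) <= (1 + a) * `|complex.Im z| by exact: le_trans h1.
    by rewrite ler_pM2l; lra.
  have [gz _] := g' _ r2; move: gz; rewrite FHz nm_dist => gz.
  rewrite (le_trans gz)//; have := nm_ge0 z; have := nm_ge0 (H z); nra.
Qed.

End inverse.

(** * Uniqueness of the inverse and convolution powers *)

Section Finv_theory.
Context {R : realType}.
Implicit Types (nu : probability R R) (z w u v : CC R) (a b c eta kap sg : R)
  (H : CC R -> CC R).

Lemma inverse_defined_exists nu a : 0 < a ->
  exists2 b : R, 0 < b & inverse_defined nu a b.
Proof.
move=> a0; have [k0 k1] := cone_slack_bounds a0.
have c0 : 0 <= cone_width a by rewrite /cone_width; lra.
have k2 : cone_slack a <= 2 / 5 by lra.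
have [eta eta0 g] := good_exists nu c0 k0 k2.
exists (2 * eta); first by rewrite mulr_gt0.
have g' : good nu (cone_width a) (2 * eta / 2) (cone_slack a).
  by rewrite mulrAC divff ?pnatr_eq0// mul1r.
have b0 : 0 < 2 * eta by rewrite mulr_gt0.
by have [H [h _]] := good_inverse a0 b0 g'; exists H.
Qed.

Lemma is_inverse_sub nu a b a' b' H : 0 <= b -> a' <= a -> b <= b' ->
  is_inverse nu a b H -> is_inverse nu a' b' H.
Proof.
move=> b0 aa bb [h1 h2 h3]; have sub := cones_sub b0 aa bb.
split => [z /sub|z /sub|e /h3[M hM]]; [exact: h1|exact: h2|].
by exists M => z /sub; exact: hM.
Qed.

Lemma inverse_defined_sub nu a b a' b' : 0 <= b -> a' <= a -> b <= b' ->
  inverse_defined nu a b -> inverse_defined nu a' b'.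
Proof. by move=> b0 aa bb [H h]; exists H; exact: is_inverse_sub h. Qed.

Lemma cones_near a b z : 0 <= b -> cones a b z -> \forall w \near z, cones a b w.
Proof.
by move=> b0 zc; have := open_nbhs_nbhs (conj (cones_open b0) zc); apply: filterS.
Qed.

(** Differentiating F(H(z)) = z shows both that F' does not vanish at [H z] and that H' = 1/F'(H),
    which is again differentiable. *)
Lemma is_inverse_twice_deriv nu a b H : 0 <= b -> is_inverse nu a b H ->
  twice_deriv (cones a b) H.
Proof.
move=> b0 [h1 h2 _]; have [F1 [hF hF2]] := Ftransform_twice_deriv nu.
have key z : cones a b z -> F1 (H z) != 0 /\ cderiv H z (F1 (H z))^-1.
  move=> zc; have [d hd] := derivable_cderiv (h1 z zc); have [Hz FHz] := h2 z zc.
  have hc : cderiv (fun w => Ftransform nu (H w)) z 1.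
    apply: cderiv_near (cderiv_id z).
    by apply: filterS (cones_near b0 zc) => w /h2[].
  have e := cderiv_unique (cderiv_comp hd (hF _ Hz)) hc.
  have n0 : F1 (H z) != 0.
    by apply/eqP => e0; move/eqP: e; rewrite e0 mul0r eq_sym oner_eq0.
  split => //; suff -> : (F1 (H z))^-1 = d by [].
  by apply: (mulfI n0); rewrite divff.
exists (fun z => (F1 (H z))^-1); split => z zc; first by have [] := key z zc.
have [n0 hd] := key z zc; have [Hz _] := h2 z zc; have [e he] := hF2 _ Hz.
by eexists; apply: cderivV => //; apply: cderiv_comp hd he.
Qed.

Lemma deep_region nu a b H (eta : R) : 0 < a -> 0 < b -> is_inverse nu a b H ->
  exists2 y : R, b <= y & forall z, cones a y z -> region (cone_width a) eta (H z).
Proof.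
move=> a0 b0 [_ _ h3]; have [k0 k1] := cone_slack_bounds a0.
have [|M hM] := h3 (2 * cone_slack a); first by rewrite mulr_gt0.
exists (Num.max b (Num.max M (2 * eta))); first by rewrite le_max lexx.
move=> z zc; have y0 : 0 <= Num.max b (Num.max M (2 * eta)).
  by rewrite le_max ltW.
have [z1 z2 z3] := cones_bounds y0 zc.
move: z2; rewrite !gt_max => /andP[z2 /andP[z4 z5]].
have zb : cones a b z by apply: cones_sub zc; rewrite ?(ltW b0)// le_max lexx.
have := hM z zb; rewrite !nmE -rmorphM/= !lecR.
rewrite (le_trans (ltW z4) (nm_Im _)) => /(_ isT) zH.
by have [] := region_near a0 z3 (ltW z5) zH.
Qed.

(** The cones may differ in width and height, but a point of the imaginary axis beyond both heights
    has a neighbourhood in both; a single component is convex, so the identity theorem spreads the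
    agreement over it. *)
Lemma half_eq (f g : CC R -> CC R) sg a b a' b' : `|sg| = 1 -> 0 < a -> 0 <= b -> 0 < a' ->
  twice_deriv (cones a b) f -> twice_deriv (cones a b) g ->
  (forall z, cones a' b' z -> f z = g z) -> forall z, hcone sg a b z -> f z = g z.
Proof.
move=> s1 a0 b0 a'0 fD gD fg z zs; apply/eqP; rewrite -subr_eq0; apply/eqP.
pose y := Num.max b (Num.max b' 0) + 1.
have yb : b < y by rewrite /y ltr_pwDr// le_max lexx.
have yb' : b' < y by rewrite /y ltr_pwDr// !le_max lexx orbT.
have y0 : 0 < y by rewrite /y ltr_pwDr// !le_max lexx !orbT.
have sub w : hcone sg a b w -> cones a b w by exact: hcone_cones.
apply: (@identity_theorem _ (hcone sg a b) (fun w => f w - g w) (0 +i* (sg * y))) => //.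
- exact: hcone_open.
- exact: hcone_convex.
- by apply: twice_derivB; apply: twice_deriv_sub sub _.
- exact: hcone_axis.
pose m := Num.max b' 0.
have : nbhs (0 +i* (sg * y) : CC R) (hcone sg a' m).
  apply: open_nbhs_nbhs; split; first exact: hcone_open.
  by apply: hcone_axis => //; rewrite /m gt_max yb'.
apply: filterS => w wm; rewrite fg ?subrr//.
move: wm => [w1 w2]; move: w2; rewrite /m gt_max => /andP[w2 w3].
have wc : hcone sg a' 0 w by split.
have := hcone_cones s1 (lexx 0) wc.
have e := normM1 s1 (ltW w3).
move=> [[c1 c2 c3]|[c1 c2 c3]]; [left|right]; split => //.
  by move: w2; rewrite e gtr0_norm.
by move: c1 c2 c3 w2; rewrite e; case: (w) => x v /= c1 _ _; rewrite -normrN gtr0_norm.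
Qed.

Lemma cones_eq (f g : CC R -> CC R) a b a' b' : 0 < a -> 0 <= b -> 0 < a' ->
  twice_deriv (cones a b) f -> twice_deriv (cones a b) g ->
  (forall z, cones a' b' z -> f z = g z) -> forall z, cones a b z -> f z = g z.
Proof.
move=> a0 b0 a'0 fD gD fg z /(conesP _ _ b0)[sg s1].
exact: half_eq s1 a0 b0 a'0 fD gD fg z.
Qed.

(** High in the intersection of the two cones, both inverses take values in a region where F is
    injective, so they agree there; continuation brings the equality down to [z]. *)
Lemma is_inverse_unique nu a1 b1 H1 a2 b2 H2 z :
  0 < a1 -> 0 < b1 -> 0 < a2 -> 0 < b2 ->
  is_inverse nu a1 b1 H1 -> is_inverse nu a2 b2 H2 ->
  cones a1 b1 z -> cones a2 b2 z -> H1 z = H2 z.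
Proof.
move=> a10 b10 a20 b20 i1 i2 z1 z2.
pose a := Num.min a1 a2; pose b := Num.max b1 b2.
have a0 : 0 < a by rewrite lt_min a10.
have b0 : 0 < b by rewrite lt_max b10.
have j1 : is_inverse nu a b H1.
  by apply: is_inverse_sub i1; rewrite ?(ltW b10)// ?ge_min ?le_max lexx.
have j2 : is_inverse nu a b H2.
  by apply: is_inverse_sub i2; rewrite ?(ltW b20)// ?ge_min ?le_max lexx ?orbT.
have zc : cones a b z.
  have [r1 i1' _] := cones_bounds (ltW b10) z1; have [r2 i2' _] := cones_bounds (ltW b20) z2.
  move: z1 => [[c1 c2 c3]|[c1 c2 c3]]; [left|right]; split => //.
  - by rewrite /a minEle; case: ifP => // _; rewrite -[complex.Im z]gtr0_norm.
  - by rewrite /b gt_max c3 -[complex.Im z]gtr0_norm.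
  - move: c1 c2 c3 r1 r2 i1' i2'; case: (z) => x v /= c1 c2 c3 r1 r2 i1' i2'.
    by rewrite /a minEle; case: ifP => // _; rewrite -[- v]gtr0_norm// normrN.
  - move: c1 c2 c3 r1 r2 i1' i2'; case: (z) => x v /= c1 c2 c3 r1 r2 i1' i2'.
    by rewrite /b gt_max c3 -[- v]gtr0_norm// normrN.
have c0 : 0 <= cone_width a by rewrite /cone_width; lra.
have k0 : (0 : R) < 1 / 4 by rewrite divr_gt0.
have k2 : (1 / 4 : R) <= 2 / 5 by lra.
have [eta eta0 g] := good_exists nu c0 k0 k2.
have [y1 y1b d1] := deep_region eta a0 b0 j1; have [y2 y2b d2] := deep_region eta a0 b0 j2.
apply: (@cones_eq H1 H2 a b a (Num.max y1 y2)) => //; try exact: ltW.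
- exact: is_inverse_twice_deriv (ltW b0) j1.
- exact: is_inverse_twice_deriv (ltW b0) j2.
move=> w wc.
have w1 : cones a y1 w.
  by apply: cones_sub wc; rewrite ?(le_trans (ltW b0) y1b)// le_max lexx.
have w2 : cones a y2 w.
  by apply: cones_sub wc; rewrite ?(le_trans (ltW b0) y2b)// le_max lexx orbT.
have w3 : cones a b w by apply: cones_sub w1; rewrite ?(ltW b0).
have := good_lipschitz g (d1 w w1) (d2 w w2).
have [_ p1 _] := j1; have [_ p2 _] := j2.
rewrite (p1 w w3).2 (p2 w w3).2 subrr nm0 => h.
have h0 := nm_ge0 (H1 w - H2 w).
have : nm (H1 w - H2 w) = 0 by lra.
by move=> /eqP; rewrite nm_eq0 subr_eq0 => /eqP.
Qed.

Lemma FinvE nu a b H z : 0 < a -> 0 < b -> is_inverse nu a b H -> cones a b z ->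
  Finv nu z = H z.
Proof.
move=> a0 b0 iH zc; rewrite /Finv; case: xgetP => [_ _ [a' [b' [H' [a'0 b'0 iH' zc' ->]]]]|/(_ (H z))].
  exact: is_inverse_unique iH' iH zc' zc.
by case; exists a, b, H.
Qed.

Lemma Finv_is_inverse nu a b : 0 < a -> 0 < b -> inverse_defined nu a b ->
  is_inverse nu a b (Finv nu).
Proof.
move=> a0 b0 [H iH]; have E z : cones a b z -> Finv nu z = H z by exact: FinvE.
have [h1 h2 h3] := iH; split.
- move=> z zc; have [d hd] := derivable_cderiv (h1 z zc).
  apply: (cderiv_derivable (d := d)); apply: cderiv_near hd.
  by apply: filterS (cones_near (ltW b0) zc) => w /E.
- by move=> z zc; rewrite E//; exact: h2.
- by move=> e /h3[M hM]; exists M => z zc; rewrite E//; exact: hM.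
Qed.

Lemma Finv_twice_deriv nu a b : 0 < a -> 0 < b -> inverse_defined nu a b ->
  twice_deriv (cones a b) (Finv nu).
Proof.
by move=> a0 b0 /(Finv_is_inverse a0 b0); exact: is_inverse_twice_deriv (ltW b0).
Qed.

Lemma FinvP nu a b z : 0 < a -> 0 < b -> inverse_defined nu a b -> cones a b z ->
  nonreal (Finv nu z) /\ Ftransform nu (Finv nu z) = z.
Proof. by move=> a0 b0 /(Finv_is_inverse a0 b0)[_ h _]; exact: h. Qed.

Lemma voiculescu_twice_deriv nu a b : 0 < a -> 0 < b -> inverse_defined nu a b ->
  twice_deriv (cones a b) (voiculescu nu).
Proof.
move=> a0 b0 h; apply: twice_derivB; first exact: Finv_twice_deriv.
exact: twice_deriv_id.
Qed.

Lemma cvoiculescu_twice_deriv (mu nu : probability R R) a b : 0 < a -> 0 < b ->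
  inverse_defined nu a b -> twice_deriv (cones a b) (cvoiculescu mu nu).
Proof.
move=> a0 b0 h; apply: twice_derivB; first exact: Finv_twice_deriv.
apply: (@twice_deriv_comp _ _ (@nonreal R)); last exact: Ftransform_twice_deriv.
  by move=> z /(FinvP a0 b0 h)[].
exact: Finv_twice_deriv.
Qed.

Lemma eq_meas_Gtransform (nu nu' : probability R R) : eq_meas nu nu' ->
  Gtransform nu = Gtransform nu'.
Proof.
move=> e; apply/funext => z; rewrite /Gtransform /cintegral /Rintegral.
by congr (_ +i* _); congr fine; apply: eq_measure_integral => A mA _; exact: e.
Qed.

Lemma eq_meas_Ftransform (nu nu' : probability R R) : eq_meas nu nu' ->
  Ftransform nu = Ftransform nu'.
Proof. by move=> e; rewrite /Ftransform (eq_meas_Gtransform e). Qed.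

Lemma eq_meas_Finv (nu nu' : probability R R) : eq_meas nu nu' -> Finv nu = Finv nu'.
Proof.
move=> e; have E : is_inverse nu = is_inverse nu'.
  by rewrite /is_inverse (eq_meas_Ftransform e).
by rewrite /Finv E.
Qed.

(** Each convolution step is usable only where three inverses exist, so the height [b] may increase
    with [m]; nothing is claimed about its size. *)
Lemma boxplus_iter_voiculescu nu m lam a : 0 < a -> boxplus_iter nu m lam ->
  exists2 b : R, 0 < b & forall z, cones a b z ->
    voiculescu lam z = m.+1%:R * voiculescu nu z.
Proof.
move=> a0; elim: m lam => [|m ih] lam /=.
  move=> e; exists 1 => // z _; by rewrite mul1r /voiculescu (eq_meas_Finv e).
move=> [lam' [/ih[b b0 hb] add]].
have [b1 b10 d1] := inverse_defined_exists lam' a0.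
have [b2 b20 d2] := inverse_defined_exists nu a0.
have [b3 b30 d3] := inverse_defined_exists lam a0.
pose B := Num.max (Num.max b b1) (Num.max b2 b3).
have B0 : 0 < B by rewrite !lt_max b0.
have le1 : b1 <= B by rewrite !le_max lexx ?orbT.
have le2 : b2 <= B by rewrite !le_max lexx ?orbT.
have le3 : b3 <= B by rewrite !le_max lexx ?orbT.
have le0 : b <= B by rewrite !le_max lexx ?orbT.
exists B => // z zc.
rewrite (add a B a0 B0) //.
- rewrite hb; last by apply: cones_sub zc => //; exact: ltW.
  by rewrite -[m.+2]addn1 natrD; ring.
- exact: inverse_defined_sub (ltW b10) (lexx _) le1 d1.
- exact: inverse_defined_sub (ltW b20) (lexx _) le2 d2.
- exact: inverse_defined_sub (ltW b30) (lexx _) le3 d3.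
Qed.

Lemma cboxplus_iter_cvoiculescu (mu nu zeta lam : probability R R) m a : 0 < a ->
  cboxplus_iter mu nu m zeta lam ->
  exists2 b : R, 0 < b & forall z, cones a b z ->
    cvoiculescu zeta lam z = m.+1%:R * cvoiculescu mu nu z.
Proof.
move=> a0; elim: m zeta lam => [|m ih] zeta lam /=.
  move=> [e1 e2]; exists 1 => // z _.
  by rewrite mul1r /cvoiculescu (eq_meas_Finv e2) (eq_meas_Ftransform e1).
move=> [zeta' [lam' [/ih[b b0 hb] [_ add]]]].
have [b1 b10 d1] := inverse_defined_exists lam' a0.
have [b2 b20 d2] := inverse_defined_exists nu a0.
have [b3 b30 d3] := inverse_defined_exists lam a0.
pose B := Num.max (Num.max b b1) (Num.max b2 b3).
have B0 : 0 < B by rewrite !lt_max b0.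
have le1 : b1 <= B by rewrite !le_max lexx ?orbT.
have le2 : b2 <= B by rewrite !le_max lexx ?orbT.
have le3 : b3 <= B by rewrite !le_max lexx ?orbT.
have le0 : b <= B by rewrite !le_max lexx ?orbT.
exists B => // z zc.
rewrite (add a B a0 B0) //.
- rewrite hb; last by apply: cones_sub zc => //; exact: ltW.
  by rewrite -[m.+2]addn1 natrD; ring.
- exact: inverse_defined_sub (ltW b10) (lexx _) le1 d1.
- exact: inverse_defined_sub (ltW b20) (lexx _) le2 d2.
- exact: inverse_defined_sub (ltW b30) (lexx _) le3 d3.
Qed.

(* The identities for convolution powers hold on every cone on which the
   inverses are defined, by analytic continuation from a truncated one. *)
Lemma boxplus_pow_voiculescu nu k lam a b : (0 < k)%N -> 0 < a -> 0 < b ->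
  inverse_defined nu a b -> inverse_defined lam a b -> boxplus_pow nu k lam ->
  forall z, cones a b z -> voiculescu lam z = k%:R * voiculescu nu z.
Proof.
move=> k0 a0 b0 dn dl /(boxplus_iter_voiculescu a0)[b' _ hb].
rewrite prednK// in hb.
apply: (@cones_eq _ (fun z => k%:R * voiculescu nu z) a b a b') => //; first exact: ltW.
  exact: voiculescu_twice_deriv.
by apply: twice_derivM; [exact: twice_deriv_cst|exact: voiculescu_twice_deriv].
Qed.

Lemma cboxplus_pow_cvoiculescu (mu nu zeta lam : probability R R) k a b :
  (0 < k)%N -> 0 < a -> 0 < b ->
  inverse_defined nu a b -> inverse_defined lam a b -> cboxplus_pow mu nu k zeta lam ->
  forall z, cones a b z -> cvoiculescu zeta lam z = k%:R * cvoiculescu mu nu z.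
Proof.
move=> k0 a0 b0 dn dl /(cboxplus_iter_cvoiculescu a0)[b' _ hb].
rewrite prednK// in hb.
apply: (@cones_eq _ (fun z => k%:R * cvoiculescu mu nu z) a b a b') => //; first exact: ltW.
  exact: cvoiculescu_twice_deriv.
by apply: twice_derivM; [exact: twice_deriv_cst|exact: cvoiculescu_twice_deriv].
Qed.

End Finv_theory.

(** * Weak convergence, tightness and convergence of inverses *)

Section weak_limits.
Context {R : realType}.
Implicit Types (m nu mu : probability R R) (z w u v : CC R) (a b c eta kap e M : R).

Lemma weak_cvg_cintegral (m_ : nat -> probability R R) m (f : R -> CC R) :
  weak_cvg m_ m -> (forall s : R, f t @[t --> s] --> f s) ->
  (exists K : R, forall s, nm (f s) <= K) ->
  cintegral (m_ n) f @[n --> \oo] --> cintegral m f.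
Proof.
move=> mm cf [K fK].
have bnd (g : R -> R) : (forall s, `|g s| <= nm (f s)) -> bounded_fun g.
  move=> gf; exists K; split; first exact: num_real.
  by move=> x Kx s _ /=; rewrite (le_trans (gf s))// (le_trans (fK s))// ltW.
apply: cvg_ReIm => /=; apply: mm.
- by move=> s; apply: (@cvg_Re _ _ (nbhs s)); exact: cf.
- by apply: bnd => s; exact: nm_Re.
- by move=> s; apply: (@cvg_Im _ _ (nbhs s)); exact: cf.
- by apply: bnd => s; exact: nm_Im.
Qed.

Lemma weak_cvg_Gtransform (m_ : nat -> probability R R) m z :
  weak_cvg m_ m -> nonreal z -> Gtransform (m_ n) z @[n --> \oo] --> Gtransform m z.
Proof.
move=> mm z0; apply: (weak_cvg_cintegral mm).
  by move=> s; exact: cvg_resolvent.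
by exists `|complex.Im z|^-1 => s; exact: nm_resolvent.
Qed.

Lemma Gtransform_lipschitz m u v : nonreal u -> nonreal v ->
  nm (Gtransform m u - Gtransform m v) <=
  nm (u - v) * (`|complex.Im u|^-1 * `|complex.Im v|^-1).
Proof.
move=> u0 v0; rewrite Gtransform_sub// nmM nm_dist ler_wpM2l ?nm_ge0//.
rewrite -[leRHS]mulr1 -(fine_probT m) -(Rint_cst m).
apply: nm_cint_le; first by apply: cbmeasM; exact: cbmeas_res.
  exact: bmeas_cst.
move=> s; rewrite nmM mulrC; apply: ler_pM; rewrite ?nm_ge0//; exact: nm_resolvent.
Qed.

Lemma cvg_nonreal_near (u_ : nat -> CC R) u : u_ @ \oo --> u -> nonreal u ->
  \forall n \near \oo, nonreal (u_ n) /\ `|complex.Im u| / 2 <= `|complex.Im (u_ n)|.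
Proof.
move=> uu u0; have y0 : 0 < `|complex.Im u| / 2 by rewrite divr_gt0// normr_gt0.
move/cvgCP: uu => /(_ _ y0); apply: filterS => n /ltW; exact: nonreal_near.
Qed.

Lemma cvg_dist0 (u_ : nat -> CC R) u : u_ @ \oo --> u -> nm (u_ n - u) @[n --> \oo] --> (0 : R).
Proof. by move/cvgC_nm. Qed.

(* Cauchy transforms are equicontinuous away from the real axis. *)
Lemma Gtransform_shift (m_ : nat -> probability R R) (u_ : nat -> CC R) u (l : CC R) :
  u_ @ \oo --> u -> nonreal u -> Gtransform (m_ n) u @[n --> \oo] --> l ->
  Gtransform (m_ n) (u_ n) @[n --> \oo] --> l.
Proof.
move=> uu u0 ml; set y := `|complex.Im u|.
have y0 : 0 < y by rewrite normr_gt0.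
have -> : (fun n => Gtransform (m_ n) (u_ n)) = (fun n =>
  (Gtransform (m_ n) (u_ n) - Gtransform (m_ n) u) + Gtransform (m_ n) u).
  by apply/funext => n; rewrite subrK.
suff h0 : (fun n => Gtransform (m_ n) (u_ n) - Gtransform (m_ n) u) @ \oo --> (0 : CC R).
  have e : 0 + l = l := add0r l.
  rewrite -e. exact (cvgCD h0 ml).
apply: (@cvgC_le _ _ _ _ _ (fun n => nm (u_ n - u) * (2 / y * y^-1))).
  apply: filterS (cvg_nonreal_near uu u0) => n [n0 ny]; rewrite subr0.
  rewrite (le_trans (Gtransform_lipschitz _ n0 u0))// ler_wpM2l ?nm_ge0// ler_wpM2r ?invr_ge0 ?(ltW y0)//.
  have -> : 2 / y = (y / 2)^-1 by rewrite invfM invrK mulrC.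
  by rewrite lef_pV2 ?posrE ?divr_gt0// (lt_le_trans _ ny)// divr_gt0.
rewrite -[X in _ --> X](mul0r (2 / y * y^-1)); apply: cvgM; first exact: cvg_dist0.
exact: cvg_cst.
Qed.

Lemma weak_cvg_Ftransform (m_ : nat -> probability R R) m (u_ : nat -> CC R) u :
  weak_cvg m_ m -> u_ @ \oo --> u -> nonreal u ->
  Ftransform (m_ n) (u_ n) @[n --> \oo] --> Ftransform m u.
Proof.
move=> mm uu u0; apply: cvgCV; first exact: Gtransform_neq0.
exact: (Gtransform_shift uu u0 (weak_cvg_Gtransform mm u0)).
Qed.

(** With s/(u - s) as integrand, the combination of real and imaginary parts that cancels the terms
    linear in [s] leaves s^2/|u - s|^2. Hence |u G(u) - 1|, a single modulus, controls the integral
    of a nonnegative function. *)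
Lemma second_moment m u : nonreal u ->
  Rintegral m setT (fun s => s ^+ 2 * nm ((u - s%:C)^-1 : CC R) ^+ 2) <=
  (1 + `|complex.Re u| / `|complex.Im u|) * nm (u * Gtransform m u - 1).
Proof.
move=> u0; have cu : cbmeas (fun s : R => u * (u - s%:C)^-1 - 1).
  by apply: cbmeasB; [exact: cbmeas_ures|exact: cbmeas_cst].
set A := u * Gtransform m u - 1.
have -> : (fun s : R => s ^+ 2 * nm ((u - s%:C)^-1 : CC R) ^+ 2) =
  fun s => - complex.Re (u * (u - s%:C)^-1 - 1) -
    (complex.Re u / complex.Im u) * complex.Im (u * (u - s%:C)^-1 - 1).
  apply/funext => s; have us := subrC_neq0 s u0.
  have -> : u * (u - s%:C)^-1 - 1 = s%:C * (u - s%:C)^-1 by field.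
  rewrite cReZ cImZ cImV cReV cImB cReB /= subr0 nmV exprVn.
  have : nm (u - s%:C) ^+ 2 != 0 by rewrite expf_neq0// nm_eq0.
  move: (nm _ ^+ 2) => N N0; have y0 : complex.Im u != 0 by [].
  by field; rewrite N0 y0.
have b1 : bmeas (fun s : R => complex.Re (u * (u - s%:C)^-1 - 1)) by case: cu.
have b2 : bmeas (fun s : R => complex.Im (u * (u - s%:C)^-1 - 1)) by case: cu.
rewrite RintB ?RintN ?RintZ//; [|exact: bmeasN|exact: bmeasZ].
have eA : A = cintegral m (fun s => u * (u - s%:C)^-1 - 1) by rewrite /A uG_sub1.
have -> : Rintegral m setT (fun s : R => complex.Re (u * (u - s%:C)^-1 - 1)) = complex.Re A.
  by rewrite eA.
have -> : Rintegral m setT (fun s : R => complex.Im (u * (u - s%:C)^-1 - 1)) = complex.Im A.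
  by rewrite eA.
rewrite mulrDl mul1r lerD//.
  by rewrite (le_trans (ler_norm _))// normrN nm_Re.
rewrite (le_trans (ler_norm _))// normrN normrM normrM normfV.
by rewrite ler_wpM2l ?nm_Im// divr_ge0.
Qed.

Lemma bmeas_second_moment u : nonreal u ->
  bmeas (fun s : R => s ^+ 2 * nm ((u - s%:C)^-1 : CC R) ^+ 2).
Proof.
move=> u0; have cu : cbmeas (fun s : R => u * (u - s%:C)^-1 - 1).
  by apply: cbmeasB; [exact: cbmeas_ures|exact: cbmeas_cst].
have -> : (fun s : R => s ^+ 2 * nm ((u - s%:C)^-1 : CC R) ^+ 2) =
   fun s => nm (u * (u - s%:C)^-1 - 1) * nm (u * (u - s%:C)^-1 - 1).
  apply/funext => s; have us := subrC_neq0 s u0.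
  have -> : u * (u - s%:C)^-1 - 1 = s%:C * (u - s%:C)^-1 by field.
  by rewrite nmM nmR -expr2 exprMn real_normK ?num_real.
by apply: bmeasM; exact: cbmeas_nm.
Qed.

Lemma tail_second_moment m u M : nonreal u -> 0 < M ->
  tail m M <= ((nm u + M) / M) ^+ 2 *
    Rintegral m setT (fun s => s ^+ 2 * nm ((u - s%:C)^-1 : CC R) ^+ 2).
Proof.
move=> u0 M0; have bq := bmeas_second_moment u0.
rewrite tailE -RintZ//; apply: Rint_le.
- by apply: bmeas_indic; exact: measurable_outside.
- exact: bmeasZ.
move=> s; have us := subrC_neq0 s u0.
have nus : 0 < nm (u - s%:C) by rewrite nm_gt0.
rewrite indicE; have [|_] := boolP (s \in outside M); last first.
  by apply: mulr_ge0; [exact: sqr_ge0|apply: mulr_ge0; exact: sqr_ge0].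
rewrite inE /outside /= => sM.
rewrite nmV -(real_normK (num_real s)) -!exprMn exprn_ege1//.
have h : nm (u - s%:C) <= nm u + `|s| by rewrite (le_trans (nmB _ _))// nmR.
have -> : (nm u + M) / M * (`|s| * (nm (u - s%:C))^-1) =
   ((nm u + M) * `|s|) / (M * nm (u - s%:C)) by field; rewrite !gt_eqF.
rewrite ler_pdivlMr ?mulr_gt0// mul1r.
have := nm_ge0 u; nra.
Qed.

Lemma tail_le_G m u M : nonreal u -> 0 < M ->
  tail m M <= ((nm u + M) / M) ^+ 2 *
    ((1 + `|complex.Re u| / `|complex.Im u|) * nm (u * Gtransform m u - 1)).
Proof.
move=> u0 M0; apply: le_trans (tail_second_moment m u0 M0) _.
by rewrite ler_wpM2l ?sqr_ge0// second_moment.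
Qed.

Definition vertical (y : R) : CC R := 0 +i* y.

Lemma vertical_nonreal (y : R) : 0 < y -> nonreal (vertical y).
Proof. by move=> y0; rewrite /nonreal /= gt_eqF. Qed.

Lemma nm_vertical (y : R) : 0 < y -> nm (vertical y) = y.
Proof. by move=> y0; rewrite nm_def /= expr0n/= add0r sqrtr_sqr gtr0_norm. Qed.

Lemma vertical_region c eta (y : R) : 1 <= c -> 0 < y -> eta <= y -> region c eta (vertical y).
Proof.
by move=> c1 y0 ey; split; rewrite ?nm_vertical//= gtr0_norm// ler_peMl// ltW.
Qed.

Lemma vertical_cones a b (y : R) : 0 < a -> 0 < y -> b < y -> cones a b (vertical y).
Proof. by move=> a0 y0 yb; left; split => //=; rewrite normr0 mulr_gt0. Qed.

(** Tightness is read off from Cauchy transforms: at height [M] on the imaginary axis the mass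
    outside [-M, M] is at most 4 |u G(u) - 1|, and this number converges to its value for [m]. *)
Lemma weak_cvg_tight (m_ : nat -> probability R R) m e : weak_cvg m_ m -> 0 < e ->
  exists2 M : R, 0 < M & \forall n \near \oo, tail (m_ n) M <= e.
Proof.
move=> mm e0.
have e80 : 0 < e / 16 by rewrite divr_gt0.
have e320 : 0 < e / 32 by rewrite divr_gt0.
have [M1 M10 tM1] := tail_small m e320.
(* The second entry makes M1/M at most e/16, so that [ntbound] for the limit is at most e/8. Another
   e/8 is left for the convergence, and the factor 4 of the tail estimate gives e. *)
pose M := Num.max M1 (M1 / (e / 16)).
have M0 : 0 < M by rewrite lt_max M10.
have [u0 uM] := (vertical_nonreal M0, nm_vertical M0).
exists M => //.
have rM : region 1 M (vertical M) by exact: vertical_region.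
have nt : ntbound m 1 M M1 <= e / 8.
  rewrite /ntbound; have -> : e / 8 = e / 16 + (1 + 1) * (e / 32) by field.
  rewrite lerD ?ler_pM2l// ler_pdivrMr// mulrC -ler_pdivrMr//.
  by rewrite /M le_max lexx orbT.
have h := le_trans (nontangential1 m ler01 M0 M10 rM) nt.
have hG : vertical M * Gtransform (m_ n) (vertical M) - 1 @[n --> \oo] -->
   vertical M * Gtransform m (vertical M) - 1.
  apply: cvgCB; last exact: cvgC_cst; apply: cvgCM; first exact: cvgC_cst.
  exact: weak_cvg_Gtransform.
have e8 : 0 < e / 8 by rewrite divr_gt0.
have h1 : nm (vertical M * Gtransform (m_ n) (vertical M) - 1) @[n --> \oo] -->
  nm (vertical M * Gtransform m (vertical M) - 1) by exact: cvg_nm.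
move/cvgRP : h1 => /(_ _ e8); apply: filterS => n hn.
rewrite (le_trans (tail_le_G (m_ n) u0 M0))// uM.
have -> : complex.Re (vertical M) = 0 by []; rewrite normr0 mul0r addr0 mul1r.
have -> : (M + M) / M = 2 by field; rewrite gt_eqF.
set X := nm _ in hn *; have : X <= e / 4.
  have := ler_norm (X - nm (vertical M * Gtransform m (vertical M) - 1)); lra.
lra.
Qed.

(** Tightness provides one region on which eventually all the F-transforms are close to the
    identity. There the lower Lipschitz bound turns F_n(H(z)) -> F(H(z)) = z into convergence of the
    inverses. *)
Lemma weak_cvg_Finv (lam_ : nat -> probability R R) nu a : 0 < a -> weak_cvg lam_ nu ->
  exists2 B0 : R, 0 < B0 & forall B, B0 <= B ->
   [/\ \forall n \near \oo, inverse_defined (lam_ n) a B, inverse_defined nu a B &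
     forall z, cones a B z -> Finv (lam_ n) z @[n --> \oo] --> Finv nu z].
Proof.
move=> a0 ln; have [k0 k1] := cone_slack_bounds a0.
have c0 : 0 <= cone_width a by rewrite /cone_width; lra.
have k2 : cone_slack a <= 2 / 5 by lra.
have [e e0 he] := good_tight c0 k0 k2.
have [M1 M10 t1] := weak_cvg_tight ln e0; have [M2 M20 t2] := tail_small nu e0.
have M0 : 0 < Num.max M1 M2 by rewrite lt_max M10.
have [eta eta0 {}he] := he _ M0.
exists (2 * eta); first by rewrite mulr_gt0.
move=> B B0; have Bp : 0 < B by apply: lt_le_trans B0; rewrite mulr_gt0.
have eB : eta <= B / 2 by lra.
have gn : \forall n \near \oo, good (lam_ n) (cone_width a) (B / 2) (cone_slack a).
  apply: filterS t1 => n t1; apply: good_sub (lexx _) eB _; apply: he.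
  by apply: le_trans t1; apply: tail_le; rewrite le_max lexx.
have g : good nu (cone_width a) (B / 2) (cone_slack a).
  apply: good_sub (lexx _) eB _; apply: he.
  by apply: le_trans t2; apply: tail_le; rewrite le_max lexx orbT.
split.
- by apply: filterS gn => n gn; have [H [h _]] := good_inverse a0 Bp gn; exists H.
- by have [H [h _]] := good_inverse a0 Bp g; exists H.
move=> z zc; have [H [hH hHz]] := good_inverse a0 Bp g.
have EH : Finv nu z = H z by exact: FinvE hH zc.
have [z1 z2 z3] := cones_bounds (ltW Bp) zc.
have z4 : 2 * (B / 2) <= `|complex.Im z| by lra.
have [rH _ _] := region_near a0 z3 z4 (hHz z zc).
have B20 : 0 < B / 2 by rewrite divr_gt0.
have H0 := region_nonreal B20 rH.
have FH : Ftransform nu (H z) = z by case: hH => _ /(_ z zc)[].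
have FnH : Ftransform (lam_ n) (H z) @[n --> \oo] --> z.
  rewrite -[X in _ --> X]FH; apply: weak_cvg_Ftransform ln _ H0; exact: cvgC_cst.
apply: (@cvgC_le _ _ _ _ _ (fun n => (1 - cone_slack a)^-1 * nm (Ftransform (lam_ n) (H z) - z))).
  apply: filterS gn => n gn; have [Hn [hn hnz]] := good_inverse a0 Bp gn.
  rewrite EH (FinvE a0 Bp hn zc) mulrC ler_pdivlMr; last by lra.
  have [rn _ _] := region_near a0 z3 z4 (hnz z zc).
  have := good_lipschitz gn rn rH; have -> : Ftransform (lam_ n) (Hn z) = z.
    by case: hn => _ /(_ z zc)[].
  by rewrite [nm (z - _)]nm_dist mulrC.
rewrite -[X in _ --> X](mulr0 (1 - cone_slack a)^-1); apply: cvgM; first exact: cvg_cst.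
exact: cvg_dist0.
Qed.

(* Along the ray from [z] to infinity the relative distance of the inverse to
   the identity avoids an interval and ends below it, hence stays below it. *)
Lemma ray_argument nu a b kap z : 0 < a -> 0 < b -> 0 < kap -> 2 * kap < cone_slack a ->
  good nu (cone_width a) (b / 2) kap -> inverse_defined nu a b -> cones a b z ->
  nm (Finv nu z - z) <= 2 * kap * nm z.
Proof.
move=> a0 b0 kap0 kap1 g dn zc; have [s0 s1] := cone_slack_bounds a0.
have iH := Finv_is_inverse a0 b0 dn; set H := Finv nu in iH *.
have [z1 z2 z3] := cones_bounds (ltW b0) zc.
have zp : 0 < nm z by rewrite nm_gt0; apply: contraTneq z2 => ->; rewrite /= normr0 -leNgt ltW.
have tz (t : R) : 1 <= t -> cones a b (t%:C * z).
  move=> t1; have t0 : 0 < t by apply: lt_le_trans t1.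
  have /(conesP _ _ (ltW b0))[sg sg1 [c1 c2]] := zc.
  apply: (hcone_cones sg1 (ltW b0)); rewrite /hcone /= cReZ cImZ.
  have e : sg * (t * complex.Im z) = t * (sg * complex.Im z) by ring.
  rewrite e normrM (gtr0_norm t0) mulrCA ltr_pM2l//; split => //.
  by rewrite (lt_le_trans c2)// ler_peMl// ltW// (lt_trans b0).
have ntz (t : R) : 1 <= t -> nm (t%:C * z) = t * nm z.
  by move=> t1; rewrite nmM nm_real// (le_trans ler01).
pose r (t : R) := nm (H (t%:C * z) - t%:C * z) / (t * nm z).
have rgap t : 1 <= t -> r t <= 2 * cone_slack a -> r t <= 2 * kap.
  move=> t1; have t0 : 0 < t by apply: lt_le_trans t1.
  have tn : 0 < t * nm z by rewrite mulr_gt0.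
  rewrite /r !ler_pdivrMr// -!(ntz t t1) => h.
  have [w1 w2 w3] := cones_bounds (ltW b0) (tz t t1).
  have w4 : 2 * (b / 2) <= `|complex.Im (t%:C * z)| by lra.
  have [rH h2 _] := region_near a0 w3 w4 h.
  have [gH _] := g _ rH; move: gH; rewrite /H (FinvP a0 b0 dn (tz t t1)).2 nm_dist => gH.
  by rewrite (le_trans gH)// [2 * kap]mulrC -mulrA ler_pM2l.
have [_ _ /(_ (2 * cone_slack a))[|M hM]] := iH; first by rewrite mulr_gt0.
pose T := Num.max 1 (M / nm z).
have T1 : 1 <= T by rewrite le_max lexx.
have rT : r T <= 2 * cone_slack a.
  have T0 : 0 < T by apply: lt_le_trans T1.
  rewrite /r ler_pdivrMr ?mulr_gt0// -(ntz T T1).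
  have := hM _ (tz T T1); rewrite !nmE -rmorphM/= !lecR; apply.
  by rewrite ntz// -ler_pdivrMr// le_max lexx orbT.
have cr : {within `[1, T], continuous r}.
  apply: continuous_in_subspaceT => t; rewrite inE /= in_itv/= => /andP[t1 _].
  have t0 : 0 < t by apply: lt_le_trans t1.
  have ct : (fun s : R => s%:C * z : CC R) @ nbhs t --> (t%:C * z : CC R).
    apply: (@cvgCM _ _ (nbhs t)); last exact: (@cvgC_cst _ _ (nbhs t)).
    by apply: (@cvg_realC _ _ (nbhs t)); exact: cvg_id.
  apply: cvgM.
    apply: (@cvg_nm _ _ (nbhs t)); apply: (@cvgCB _ _ (nbhs t)); last exact: ct.
    have [f1 [hf _]] := Finv_twice_deriv a0 b0 dn.
    have cH := ccont_cvg (cderiv_cvg (hf _ (tz t t1))).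
    exact (cvg_comp _ _ ct cH).
  apply: cvgV; first by rewrite mulf_neq0 ?gt_eqF.
  by apply: cvgM; [exact: cvg_id|exact: cvg_cst].
suff : r 1 <= 2 * kap by rewrite /r rmorph1 !mul1r ler_pdivrMr.
apply: (rgap 1); rewrite // leNgt; apply/negP => r1.
have := rgap T T1 rT => rT2.
(* The level lies strictly between [2 * kap] and [2 * cone_slack a], an interval that [rgap]
   excludes. *)
have [|c c1 rc] := @IVT R r 1 T (cone_slack a + kap) T1 cr.
- rewrite ge_min le_max; apply/andP; split; apply/orP; [right|left]; lra.
move: c1; rewrite in_itv/= => /andP[c1 _].
by have := rgap c c1; rewrite rc; lra.
Qed.

End weak_limits.

(** * Free ultrafilters *)

Section ultralimits.
Context {R : realType}.

Definition free_ultra (U : set_system nat) := UltraFilter U /\ \oo `<=` U.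

Lemma free_ultra_exists : exists U, free_ultra U.
Proof. by have [U [hU sU]] := @ultraFilterLemma nat \oo _; exists U. Qed.

Lemma free_ultra_proper U : free_ultra U -> ProperFilter U.
Proof. by case=> [[]]. Qed.

Lemma free_ultra_near U (P : nat -> Prop) : free_ultra U ->
  (\forall n \near \oo, P n) -> \forall n \near U, P n.
Proof. by move=> [_ sU] /sU. Qed.

Lemma free_ultra_cvg {T : topologicalType} U (x : nat -> T) (l : T) : free_ultra U ->
  x @ \oo --> l -> x @ U --> l.
Proof. by move=> [_ sU] xl A /xl; exact: sU. Qed.

Lemma fmap_ultra {S T : Type} (x : S -> T) (U : set_system S) :
  UltraFilter U -> UltraFilter (x @ U).
Proof.
move=> UU; split; first by apply: fmap_proper_filter; case: UU.
move=> G GF sG; apply/seteqP; split => A; last exact: sG.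
move=> GA; have [//|UA] := in_ultra_setVsetC (x @^-1` A) UU.
have GnA : G (~` A) by exact: sG.
have := @filterI _ _ GF _ _ GA GnA; rewrite setICr => G0.
by have [] := @filter_ex _ G GF _ G0.
Qed.

Lemma free_ultra_bounded U (x : nat -> R) (K : R) : free_ultra U ->
  (\forall n \near U, `|x n| <= K) -> exists l : R, x @ U --> l.
Proof.
move=> [UU sU] xK.
have cK : compact (`[- K, K]%classic : set R) by exact: segment_compact.
have uU : UltraFilter (x @ U) by exact: fmap_ultra.
rewrite compact_ultra in cK.
have [|l [_ lx]] := cK (x @ U) uU; last by exists l.
have FF : Filter U by case: UU => [[]].
by apply: filterS xK => n; rewrite /= in_itv/= ler_norml.
Qed.

Lemma free_ultra_boundedC U (x : nat -> CC R) (K : R) : free_ultra U ->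
  (\forall n \near U, nm (x n) <= K) -> exists l : CC R, x @ U --> l.
Proof.
move=> fU xK; have FF := free_ultra_proper fU.
have [|l1 h1] := @free_ultra_bounded U (fun n => complex.Re (x n)) K fU.
  by apply: filterS xK => n; exact: le_trans (nm_Re _).
have [|l2 h2] := @free_ultra_bounded U (fun n => complex.Im (x n)) K fU.
  by apply: filterS xK => n; exact: le_trans (nm_Im _).
by exists (l1 +i* l2); exact: cvg_ReIm.
Qed.

(** If [x] leaves a neighbourhood of the limit infinitely often, the cofinite sets and the set of
    those indices generate a proper filter; an ultrafilter above it is free and violates the
    hypothesis. *)
Lemma cvg_free_ultra {T : topologicalType} (x : nat -> T) (l : T) :
  (forall U, free_ultra U -> x @ U --> l) -> x @ \oo --> l.
Proof.
move=> H A lA; apply: contrapT => nA.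
pose B := [set n | ~ A (x n)].
pose F := within B (\oo : set_system nat).
have FP : ProperFilter F.
  apply: Build_ProperFilter_ex.
  move=> P FPp; apply: contrapT => nP; apply: nA.
  have {}FPp : \forall n \near \oo, B n -> P n := FPp.
  apply: filterS FPp => n BP; apply: contrapT => An; apply: nP; exists n; exact: BP.
have [U [hU sU]] := @ultraFilterLemma nat F FP.
have fU : free_ultra U.
  by split => // P oP; apply: sU; apply: filterS oP => n Pn _.
have UP := free_ultra_proper fU.
have UA : U (fun n => A (x n)) by exact: (H U fU A lA).
have UB : U B by apply: sU; exists 0%N.
have [n [h1 h2]] := @filter_ex _ U UP _ (filterI UA UB).
exact: h2 h1.
Qed.

End ultralimits.

(** * One-variable limit theorem *)

Section scaled_sequences.
Context {R : realType} {k : nat -> nat} (k_gt0 : forall n, (0 < k n)%N)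
  (k_cvg : k n @[n --> \oo] --> \oo).

Lemma cvg_kinv : ((k n)%:R^-1 : R) @[n --> \oo] --> (0 : R).
Proof.
apply/cvgRP => e e0.
have H : \forall n \near \oo, (Num.bound e^-1 <= k n)%N.
  have : \forall m \near \oo, (Num.bound e^-1 <= m)%N by exists (Num.bound e^-1).
  by move/k_cvg.
apply: filterS H => n hn; rewrite subr0 ger0_norm ?invr_ge0 ?ler0n//.
rewrite -[e]invrK ltf_pV2 ?posrE ?invr_gt0 ?ltr0n ?k_gt0//.
rewrite (lt_le_trans (archi_boundP _)) ?ler_nat//.
by rewrite invr_ge0 ltW.
Qed.

Lemma cvg_unscale (x : nat -> CC R) (l : CC R) :
  (k n)%:R * x n @[n --> \oo] --> l -> x @ \oo --> (0 : CC R).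
Proof.
move=> kx.
apply: (@cvgC_le _ _ _ _ _ (fun n => (k n)%:R^-1 * nm ((k n)%:R * x n))).
  apply: nearW => n; rewrite subr0 nmM nm_nat mulKf//.
  by rewrite pnatr_eq0 -lt0n.
rewrite -(mul0r (nm l)); apply: cvgM; first exact: cvg_kinv.
exact: cvg_nm.
Qed.

End scaled_sequences.

Section one_dim.
Context {R : realType} {k : nat -> nat} (k_gt0 : forall n, (0 < k n)%N)
  (k_cvg : k n @[n --> \oo] --> \oo)
  {nu_ m_ lam_ zeta_ : nat -> probability R R} {nu mu : probability R R}
  {a b : R} (a0 : 0 < a) (b0 : 0 < b)
  (dn : forall n, inverse_defined (nu_ n) a b)
  (lam_pow : forall n, boxplus_pow (nu_ n) (k n) (lam_ n))
  (lam_cvg : weak_cvg lam_ nu)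
  (zeta_pow : forall n, cboxplus_pow (m_ n) (nu_ n) (k n) (zeta_ n) (lam_ n))
  (zeta_cvg : weak_cvg zeta_ mu).

(* The integral of [s / (u - s)] with respect to [m]. *)
Definition uG1 (m : probability R R) (u : CC R) : CC R := u * Gtransform m u - 1.

(** At heights where the inverses of the limit and eventually of all [lam_] exist, the k_n-fold
    transforms are those of [lam_] and [zeta_] and converge with them; dividing by k_n leaves an
    infinitesimal Voiculescu transform. *)
Lemma limit_on_cone : exists2 B : R, b <= B & [/\ inverse_defined nu a B,
  forall z, cones a B z -> Finv (nu_ n) z @[n --> \oo] --> z &
  forall z, cones a B z ->
    (k n)%:R * cvoiculescu (m_ n) (nu_ n) z @[n --> \oo] --> cvoiculescu mu nu z].
Proof.
have [B0 B00 HB] := weak_cvg_Finv a0 lam_cvg.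
exists (Num.max b B0); first by rewrite le_max lexx.
set B := Num.max b B0; have bB : b <= B by rewrite le_max lexx.
have B0B : B0 <= B by rewrite le_max lexx orbT.
have Bp : 0 < B by apply: lt_le_trans bB.
have [lamd nud lamc] := HB B B0B.
have dnB n : inverse_defined (nu_ n) a B by exact: inverse_defined_sub (ltW b0) (lexx _) bB (dn n).
split; [exact: nud| |]; move=> z zc.
  have h : (k n)%:R * voiculescu (nu_ n) z @[n --> \oo] --> Finv nu z - z.
    have h1 : Finv (lam_ n) z - z @[n --> \oo] --> Finv nu z - z.
      apply: cvgCB; [exact: lamc|exact: cvgC_cst].
    apply: cvg_trans h1; apply: near_eq_cvg; apply: filterS lamd => n ln.
    by rewrite -(boxplus_pow_voiculescu (k_gt0 n) a0 Bp (dnB n) ln (lam_pow n)).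
  have h2 := cvg_unscale k_gt0 k_cvg h.
  have h3 : voiculescu (nu_ n) z + z @[n --> \oo] --> 0 + z.
    by apply: cvgCD; [exact: h2|exact: cvgC_cst].
  have e0 : 0 + z = z := add0r z.
  rewrite e0 in h3; apply: cvg_trans h3; apply: near_eq_cvg; apply: nearW => n.
  by rewrite /voiculescu subrK.
have [L0 FL] := FinvP a0 Bp nud zc.
have h1 : cvoiculescu (zeta_ n) (lam_ n) z @[n --> \oo] --> cvoiculescu mu nu z.
  apply: cvgCB; first exact: lamc.
  exact: (weak_cvg_Ftransform zeta_cvg (lamc z zc) L0).
apply: cvg_trans h1; apply: near_eq_cvg; apply: filterS lamd => n ln.
by rewrite -(cboxplus_pow_cvoiculescu (k_gt0 n) a0 Bp (dnB n) ln (zeta_pow n)).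
Qed.

Lemma uG1E (m : probability R R) u : nonreal u ->
  uG1 m u = (u - Ftransform m u) / Ftransform m u.
Proof.
move=> u0; have G0 := Gtransform_neq0 m u0.
by rewrite /uG1 /Ftransform; field.
Qed.

(** For u_n the inverse at z, F(u_n) = z gives u_n G(u_n) - 1 = (u_n - z)/z -> 0, and this number
    controls the mass outside any fixed interval [-M, M]. *)
Lemma atom_limit (M e : R) : 0 < M -> 0 < e -> \forall n \near \oo, tail (nu_ n) M <= e.
Proof.
move=> M0 e0; have [B bB [nud Hc _]] := limit_on_cone.
have Bp : 0 < B by apply: lt_le_trans bB.
pose y := B + 1; have y0 : 0 < y by rewrite /y addr_gt0.
have zc : cones a B (vertical y) by apply: vertical_cones => //; rewrite /y ltrDl.
have uz := Hc _ zc; set u := (fun n => Finv (nu_ n) (vertical y)) in uz.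
have z0 := vertical_nonreal y0; have nz := nm_vertical y0.
have zn0 : vertical y != 0 by rewrite -nm_eq0 nz gt_eqF.
have dnB n : inverse_defined (nu_ n) a B by exact: inverse_defined_sub (ltW b0) (lexx _) bB (dn n).
have uP n : nonreal (u n) /\ Ftransform (nu_ n) (u n) = vertical y by exact: (FinvP a0 Bp (dnB n) zc).
have hA : uG1 (nu_ n) (u n) @[n --> \oo] --> (0 : CC R).
  have h : (u n - vertical y) * (vertical y)^-1 @[n --> \oo] --> (vertical y - vertical y) * (vertical y)^-1.
    by apply: cvgCM; [apply: cvgCB; [exact: uz|exact: cvgC_cst]|exact: cvgC_cst].
  rewrite subrr mul0r in h; apply: cvg_trans h; apply: near_eq_cvg; apply: nearW => n.
  by have [n0 Fn] := uP n; rewrite uG1E// Fn.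
have h1 : (nm (u n) + M) / M @[n --> \oo] --> (y + M) / M.
  apply: cvgM; last exact: cvg_cst; apply: cvgD; last exact: cvg_cst.
  by rewrite -nz; exact: cvg_nm.
have h2 : 1 + `|complex.Re (u n)| / `|complex.Im (u n)| @[n --> \oo] --> 1 + `|(0:R)| / `|y|.
  apply: cvgD; first exact: cvg_cst.
  apply: cvgM; first by apply: cvg_norm; exact: cvg_Re uz.
  apply: cvgV; first by rewrite normr_eq0 gt_eqF.
  by apply: cvg_norm; exact: cvg_Im uz.
have h3 : ((nm (u n) + M) / M) ^+ 2 * ((1 + `|complex.Re (u n)| / `|complex.Im (u n)|) * nm (uG1 (nu_ n) (u n))) @[n --> \oo] --> ((y + M) / M) ^+ 2 * ((1 + `|(0:R)| / `|y|) * nm (0 : CC R)).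
  apply: cvgM; first by apply: cvgM.
  by apply: cvgM => //; exact: cvg_nm.
rewrite nm0 !mulr0 in h3; move/cvgRP : h3 => /(_ _ e0); apply: filterS => n hn.
have [n0 _] := uP n; apply: le_trans (tail_le_G _ n0 M0) _.
by rewrite ltW// (le_lt_trans (ler_norm _))// -[X in `|X|]subr0.
Qed.

(** The cone is an arbitrary one on which the inverses exist, possibly lower or wider than that of
    [limit_on_cone]. Concentration at 0 brings F close to the identity down to height b'/2, and
    [ray_argument] shows that the given branch of the inverse stays there. *)
Lemma near_identity (a' b' : R) : 0 < a' -> 0 < b' ->
  (forall n, inverse_defined (nu_ n) a' b') ->
  forall z, cones a' b' z -> Finv (nu_ n) z @[n --> \oo] --> z.
Proof.
move=> a'0 b'0 dn' z zc; have [s0 s1] := cone_slack_bounds a'0.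
have [_ z2 _] := cones_bounds (ltW b'0) zc.
have zp : 0 < nm z.
  by rewrite nm_gt0; apply: contraTneq z2 => ->; rewrite /= normr0 -leNgt ltW.
apply/cvgCP => e e0.
pose kap := Num.min (e / nm z / 4) (cone_slack a' / 4).
have kap0 : 0 < kap by rewrite lt_min !divr_gt0.
have kap1 : kap <= cone_slack a' / 4 by rewrite ge_min lexx orbT.
have kap2 : kap <= e / nm z / 4 by rewrite ge_min lexx.
have c0 : 0 <= cone_width a' by rewrite /cone_width; lra.
have b20 : 0 < b' / 2 by rewrite divr_gt0.
have kap3 : kap <= 2 / 5 by lra.
have [M [t [M0 t0 Hg]]] := good_atom c0 b20 kap0 kap3.
apply: filterS (atom_limit M0 t0) => n /Hg gn.
have kap4 : 2 * kap < cone_slack a' by lra.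
apply: le_lt_trans (ray_argument a'0 b'0 kap0 kap4 gn (dn' n) zc) _.
have : 2 * (e / nm z / 4) * nm z < e.
  have -> : 2 * (e / nm z / 4) * nm z = e / 2 by field; rewrite gt_eqF.
  by lra.
by apply: le_lt_trans; rewrite ler_pM2r// ler_pM2l.
Qed.

(** With u the inverse at z, the c-free transform is u - F(u), while u G(u) - 1 = (u - F(u))/F(u).
    The denominator tends to z because the transform tends to 0 before scaling. *)
Lemma scaled_uG1 : exists2 B : R, b <= B & inverse_defined nu a B /\
  forall z, cones a B z -> Finv (nu_ n) z @[n --> \oo] --> z /\
    (k n)%:R * uG1 (m_ n) (Finv (nu_ n) z) @[n --> \oo] --> cvoiculescu mu nu z / z.
Proof.
have [B bB [nud Hc HP]] := limit_on_cone; exists B; [exact: bB|split; [exact: nud|]]; move=> z zc.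
have Bp : 0 < B by apply: lt_le_trans bB.
have dnB n : inverse_defined (nu_ n) a B by exact: inverse_defined_sub (ltW b0) (lexx _) bB (dn n).
have uz := Hc z zc; split; first exact: uz.
have z0 : z != 0.
  have := cones_nonreal (ltW Bp) zc; rewrite /nonreal /=.
  by apply: contraNneq => ->.
have P0 := cvg_unscale k_gt0 k_cvg (HP z zc).
have hF : Ftransform (m_ n) (Finv (nu_ n) z) @[n --> \oo] --> z.
  have h : Finv (nu_ n) z - cvoiculescu (m_ n) (nu_ n) z @[n --> \oo] --> z - 0.
    by apply: cvgCB; [exact: uz|exact: P0].
  rewrite subr0 in h; apply: cvg_trans h; apply: near_eq_cvg; apply: nearW => n.
  by rewrite /cvoiculescu; ring.
have h : (k n)%:R * cvoiculescu (m_ n) (nu_ n) z * (Ftransform (m_ n) (Finv (nu_ n) z))^-1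
    @[n --> \oo] --> cvoiculescu mu nu z * z^-1.
  by apply: cvgCM; [exact: HP|exact: cvgCV].
apply: cvg_trans h; apply: near_eq_cvg; apply: nearW => n.
have [n0 _] := FinvP a0 Bp (dnB n) zc.
by rewrite uG1E// mulrA.
Qed.

Definition sqweight (s : R) : R := s ^+ 2 / (1 + s ^+ 2).

Lemma sqweight_bounds s : 0 <= sqweight s <= 1.
Proof.
have h : 0 < 1 + s ^+ 2 by rewrite ltr_pwDl// sqr_ge0.
by rewrite divr_ge0 ?sqr_ge0 ?(ltW h)//= ler_pdivrMr// mul1r lerDr.
Qed.

Lemma continuous_rational (p : R -> R) : continuous p ->
  continuous (fun s : R => p s / (1 + s ^+ 2)).
Proof.
move=> cp s; apply: cvgM; first exact: cp.
apply: cvgV; first by rewrite gt_eqF// ltr_pwDl// sqr_ge0.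
by apply: cvgD; [exact: cvg_cst|exact: exprn_continuous].
Qed.

Lemma bmeas_sqweight : bmeas sqweight.
Proof.
split; last by exists 1 => s; have /andP[h1 h2] := sqweight_bounds s; rewrite ger0_norm.
apply: continuous_measurable_fun; apply: continuous_rational.
exact: exprn_continuous.
Qed.

Definition sqmass (m : probability R R) : R := Rintegral m setT sqweight.

(** From |u - s|^2 <= 2 |u|^2 + 2 s^2, the weight s^2/(1 + s^2) is at most a constant times s^2/|u -
    s|^2, to which [second_moment] applies. *)
Lemma sqmass_le (m : probability R R) u : nonreal u ->
  sqmass m <= (2 * nm u ^+ 2 + 2) *
    ((1 + `|complex.Re u| / `|complex.Im u|) * nm (uG1 m u)).
Proof.
move=> u0; have bq := bmeas_second_moment u0.
apply: (@le_trans _ _ ((2 * nm u ^+ 2 + 2) *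
    Rintegral m setT (fun s => s ^+ 2 * nm ((u - s%:C)^-1 : CC R) ^+ 2))); last first.
  by rewrite ler_wpM2l ?second_moment// addr_ge0// mulr_ge0// sqr_ge0.
rewrite -RintZ//; apply: Rint_le; [exact: bmeas_sqweight|exact: bmeasZ|].
move=> s; have us := subrC_neq0 s u0.
have n0 : 0 < nm (u - s%:C) by rewrite nm_gt0.
rewrite /sqweight nmV exprVn mulrCA ler_wpM2l ?sqr_ge0//.
have h : 0 < 1 + s ^+ 2 by rewrite ltr_pwDl// sqr_ge0.
rewrite ler_pdivlMr ?exprn_gt0// mulrC ler_pdivrMr//.
have h1 : nm (u - s%:C) <= nm u + `|s| by rewrite (le_trans (nmB _ _))// nmR.
have h2 : nm (u - s%:C) ^+ 2 <= (nm u + `|s|) ^+ 2.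
  by rewrite lerXn2r ?nnegrE ?nm_ge0// addr_ge0// nm_ge0.
apply: le_trans h2 _.
have : `|s| ^+ 2 = s ^+ 2 by rewrite real_normK ?num_real.
have := sqr_ge0 (nm u - `|s|); have := sqr_ge0 (nm u * s); nra.
Qed.

Lemma vertical_limits (y : R) : 0 < y -> forall u : nat -> CC R, u @ \oo --> vertical y ->
  \forall n \near \oo, [/\ nonreal (u n), nm (u n) <= 2 * y &
    1 + `|complex.Re (u n)| / `|complex.Im (u n)| <= 2].
Proof.
move=> y0 u uz.
have z0 := vertical_nonreal y0; have nz := nm_vertical y0.
have h1 := cvg_nonreal_near uz z0.
have y20 : 0 < y / 2 by rewrite divr_gt0.
move/cvgCP : uz => /(_ _ y20); apply: filterS2 h1 => n [n0 ny] nu1.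
have ey : `|complex.Im (vertical y)| = y by rewrite /= gtr0_norm.
rewrite ey in ny; split => //.
  by have := nmB_ge (u n) (vertical y); rewrite nz; lra.
have hi : 0 < `|complex.Im (u n)| by rewrite normr_gt0.
have : `|complex.Re (u n)| <= y / 2.
  rewrite (le_trans _ (ltW nu1))// (le_trans _ (nm_Re _))// cReB /= subr0//.
have e : `|complex.Re (u n)| / `|complex.Im (u n)| <= 1 <-> `|complex.Re (u n)| <= `|complex.Im (u n)|.
  by rewrite ler_pdivrMr// mul1r.
move=> h; have := e.2 (le_trans h ny); lra.
Qed.

Lemma scaled_sqmass_bounded : exists K : R, \forall n \near \oo, (k n)%:R * sqmass (m_ n) <= K.
Proof.
have [B bB [nud H]] := scaled_uG1.
have Bp : 0 < B by apply: lt_le_trans bB.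
pose y := B + 1; have y0 : 0 < y by rewrite /y addr_gt0.
have zc : cones a B (vertical y) by apply: vertical_cones => //; rewrite /y ltrDl.
have [uz kA] := H _ zc.
pose P := nm (cvoiculescu mu nu (vertical y) / vertical y).
exists ((2 * (2 * y) ^+ 2 + 2) * (2 * (P + 1))).
have hP : \forall n \near \oo, nm ((k n)%:R * uG1 (m_ n) (Finv (nu_ n) (vertical y))) <= P + 1.
  have hn : nm ((k n)%:R * uG1 (m_ n) (Finv (nu_ n) (vertical y))) @[n --> \oo] -->
    nm (cvoiculescu mu nu (vertical y) / vertical y) by exact: cvg_nm.
  move/cvgRP : hn => /(_ _ ltr01); apply: filterS => n hn.
  by have := ler_norm (nm ((k n)%:R * uG1 (m_ n) (Finv (nu_ n) (vertical y))) - P); rewrite -/P in hn; lra.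
apply: filterS2 hP (vertical_limits y0 uz) => n hP [n0 n1 n2].
apply: (@le_trans _ _ ((2 * nm (Finv (nu_ n) (vertical y)) ^+ 2 + 2) *
   ((1 + `|complex.Re (Finv (nu_ n) (vertical y))| / `|complex.Im (Finv (nu_ n) (vertical y))|) *
   nm ((k n)%:R * uG1 (m_ n) (Finv (nu_ n) (vertical y)))))).
  rewrite nmM nm_nat.
  have -> (x v w t : R) : x * (v * (w * t)) = w * (x * (v * t)) by ring.
  by rewrite ler_wpM2l ?ler0n// sqmass_le.
apply: ler_pM.
- by rewrite addr_ge0// mulr_ge0// sqr_ge0.
- by rewrite mulr_ge0 ?nm_ge0// addr_ge0// divr_ge0.
- by rewrite lerD2r ler_pM2l// lerXn2r ?nnegrE ?nm_ge0// mulr_ge0// ltW.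
- by apply: ler_pM; rewrite ?nm_ge0// addr_ge0// divr_ge0.
Qed.

(** High on the imaginary axis F_mu differs from the identity by a small multiple of |u|, so
    Phi(z)/z tends to 0. This decay is what prevents scaled mass from escaping to infinity in
    [scaled_tail]. *)
Lemma cvoiculescu_vertical_small (B : R) (e : R) : 0 < B -> inverse_defined nu a B -> 0 < e ->
  exists2 y : R, B < y & nm (cvoiculescu mu nu (vertical y) / vertical y) <= e.
Proof.
move=> Bp nud e0; have c0 : 0 <= cone_width a by rewrite /cone_width; have := a0; lra.
pose kap := Num.min (e / 2) (2 / 5).
have kap0 : 0 < kap by rewrite lt_min !divr_gt0.
have kap1 : kap <= 2 / 5 by rewrite ge_min lexx orbT.
have kap2 : kap <= e / 2 by rewrite ge_min lexx.
have [eta eta0 g] := good_exists mu c0 kap0 kap1.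
have iH := Finv_is_inverse a0 Bp nud.
have [s0 s1] := cone_slack_bounds a0.
have [_ _ /(_ (2 * cone_slack a))[|M hM]] := iH; first by rewrite mulr_gt0.
pose y := Num.max (Num.max M (2 * eta)) B + 1.
have yM : M <= y by rewrite (@le_trans _ _ (Num.max (Num.max M (2 * eta)) B)) ?lerDl// !le_max lexx.
have ye : 2 * eta <= y by rewrite (@le_trans _ _ (Num.max (Num.max M (2 * eta)) B)) ?lerDl// !le_max lexx orbT.
have yB : B < y by rewrite ltr_pwDr// !le_max lexx orbT.
have y0 : 0 < y by apply: lt_trans yB.
have nz := nm_vertical y0.
exists y => //.
have zc : cones a B (vertical y) by exact: vertical_cones.
have ey : `|complex.Im (vertical y)| = y by rewrite /= gtr0_norm.
have hL : nm (Finv nu (vertical y) - vertical y) <= 2 * cone_slack a * nm (vertical y).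
  by rewrite nz; have := hM _ zc; rewrite !nmE nz -rmorphM/= !lecR; apply.
have za : nm (vertical y) <= (1 + a) * `|complex.Im (vertical y)|.
  by rewrite ey nz ler_peMl ?(ltW y0)// lerDl ltW.
have [|rL hL2 _] := region_near a0 za _ hL (eta := eta); first by rewrite ey.
have [gL _] := g _ rL.
rewrite nmM nmV nz ler_pdivrMr// /cvoiculescu nm_dist (le_trans gL)//.
rewrite nz in hL2; have := nm_ge0 (Finv nu (vertical y)); nra.
Qed.

Lemma scaled_tail (e : R) : 0 < e -> exists2 M : R, 0 < M &
  \forall n \near \oo, (k n)%:R * tail (m_ n) M <= e.
Proof.
move=> e0; have [B bB [nud H]] := scaled_uG1.
have Bp : 0 < B by apply: lt_le_trans bB.
have e1 : 0 < e / 36 by rewrite divr_gt0.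
have [y yB hy] := cvoiculescu_vertical_small Bp nud e1.
have y0 : 0 < y by apply: lt_trans yB.
have zc : cones a B (vertical y) by exact: vertical_cones.
have [uz kA] := H _ zc.
exists y => //.
have hP : \forall n \near \oo, nm ((k n)%:R * uG1 (m_ n) (Finv (nu_ n) (vertical y))) <= e / 18.
  have hn : nm ((k n)%:R * uG1 (m_ n) (Finv (nu_ n) (vertical y))) @[n --> \oo] -->
    nm (cvoiculescu mu nu (vertical y) / vertical y) by exact: cvg_nm.
  move/cvgRP : hn => /(_ _ e1); apply: filterS => n hn.
  set X := nm ((k n)%:R * _) in hn *; set Y := nm _ in hy hn.
  by have := ler_norm (X - Y); lra.
apply: filterS2 hP (vertical_limits y0 uz) => n hP [n0 n1 n2].
apply: (@le_trans _ _ (((nm (Finv (nu_ n) (vertical y)) + y) / y) ^+ 2 *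
   ((1 + `|complex.Re (Finv (nu_ n) (vertical y))| / `|complex.Im (Finv (nu_ n) (vertical y))|) *
   nm ((k n)%:R * uG1 (m_ n) (Finv (nu_ n) (vertical y)))))).
  rewrite nmM nm_nat.
  have -> (x v w t : R) : x * (v * (w * t)) = w * (x * (v * t)) by ring.
  by rewrite ler_wpM2l ?ler0n// tail_le_G.
(* Eventually |u_n| <= 2 y, so the quotient is at most 3; the angular factor is at most 2, and e/18
   is the bound of [hP]. *)
have -> : e = 3 ^+ 2 * (2 * (e / 18)) by field.
apply: ler_pM.
- exact: sqr_ge0.
- by rewrite mulr_ge0 ?nm_ge0// addr_ge0// divr_ge0.
- rewrite lerXn2r ?nnegrE// ?divr_ge0 ?addr_ge0 ?nm_ge0 ?(ltW y0)//.
  by rewrite ler_pdivrMr//; lra.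
- by apply: ler_pM; rewrite ?nm_ge0// addr_ge0// divr_ge0.
Qed.

End one_dim.

(** * Continuation of the one-variable limit to non-real points *)

Section continuation.
Context {R : realType} {k : nat -> nat} {m_ : nat -> probability R R}
  {a B : R} {Phi : CC R -> CC R} {u_ : nat -> CC R -> CC R}
  (a0 : 0 < a) (B0 : 0 < B)
  (bd : exists K : R, \forall n \near \oo, (k n)%:R * sqmass (m_ n) <= K)
  (lim : forall z, cones a B z -> (u_ n z @[n --> \oo] --> z) /\
    ((k n)%:R * uG1 (m_ n) (u_ n z) @[n --> \oo] --> Phi z / z)).

(** The weight s^2/(1 + s^2) makes these scaled functionals eventually uniformly bounded. The
    truncated mean [gam] is kept apart because no bound on it is assumed. *)
Definition kap n (f : R -> CC R) : CC R :=
  (k n)%:R * cintegral (m_ n) (fun s => (sqweight s)%:C * f s).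

Definition gam n : CC R :=
  (k n)%:R * (Rintegral (m_ n) setT (fun s => s / (1 + s ^+ 2)))%:C.

Lemma bmeas_ratio : bmeas (fun s : R => s / (1 + s ^+ 2)).
Proof.
split; first by apply: continuous_measurable_fun; apply: continuous_rational => s; exact: cvg_id.
exists 1 => s; have h : 0 < 1 + s ^+ 2 by rewrite ltr_pwDl// sqr_ge0.
rewrite normrM normfV (gtr0_norm h) ler_pdivrMr// mul1r -(real_normK (num_real s)).
by have := sqr_ge0 (`|s| - 1); nra.
Qed.

Lemma cbmeas_sq f : cbmeas f -> cbmeas (fun s : R => (sqweight s)%:C * f s).
Proof. by move=> cf; apply: cbmeasM => //; apply: cbmeas_real; exact: bmeas_sqweight. Qed.

Lemma kapD n f g : cbmeas f -> cbmeas g -> kap n (fun s => f s + g s) = kap n f + kap n g.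
Proof.
move=> cf cg; rewrite /kap -mulrDr -cintD; [|exact: cbmeas_sq|exact: cbmeas_sq].
by congr (_ * cintegral _ _); apply/funext => s; rewrite mulrDr.
Qed.

Lemma kapZ n (c : CC R) f : cbmeas f -> kap n (fun s => c * f s) = c * kap n f.
Proof.
move=> cf; rewrite /kap [RHS]mulrCA -(@cintZ _ _ _ (m_ n) c _ (cbmeas_sq cf)).
by congr (_ * cintegral _ _); apply/funext => s; rewrite mulrCA.
Qed.

Lemma kap_bound n f (M : R) : cbmeas f -> (forall s, nm (f s) <= M) ->
  nm (kap n f) <= (k n)%:R * sqmass (m_ n) * M.
Proof.
move=> cf fM; rewrite /kap nmM nm_nat -mulrA ler_wpM2l ?ler0n//.
rewrite mulrC -RintZ; last exact: bmeas_sqweight.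
apply: nm_cint_le; first exact: cbmeas_sq.
  by apply: bmeasZ; exact: bmeas_sqweight.
move=> s; have /andP[w0 _] := sqweight_bounds s.
by rewrite nmM nm_real// mulrC ler_wpM2r.
Qed.

(** The Levy-Khintchine form of u s/(u - s): it is s/(1 + s^2) plus s^2/(1 + s^2) times (1 + u s)/(u
    - s), and the last quotient equals - u + (1 + u^2)/(u - s). *)
Lemma uG1_decomposition n u : nonreal u ->
  (k n)%:R * uG1 (m_ n) u * u =
  gam n - u * kap n (fun=> 1) + (1 + u ^+ 2) * kap n (fun s => (u - s%:C)^-1).
Proof.
move=> u0; have cu := cbmeas_res u0.
have c1 : cbmeas (fun _ : R => (1 : CC R)) by exact: cbmeas_cst.
have cA : cbmeas (fun s : R => u * (u - s%:C)^-1 - 1).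
  by apply: cbmeasB; [exact: cbmeas_ures|exact: cbmeas_cst].
have e2 : - u * kap n (fun=> 1) + (1 + u ^+ 2) * kap n (fun s => (u - s%:C)^-1) =
   kap n (fun s => - u * 1 + (1 + u ^+ 2) * (u - s%:C)^-1).
  rewrite kapD; [|exact: cbmeas_cst|by apply: cbmeasM => //; exact: cbmeas_cst].
  by rewrite kapZ// kapZ.
rewrite -addrA -mulNr e2 /gam /kap -mulrDr -mulrA; congr (_ * _).
rewrite -cint_real -cintD; last first.
- apply: cbmeas_sq; apply: cbmeasD; first exact: cbmeas_cst.
  by apply: cbmeasM => //; exact: cbmeas_cst.
- by apply: cbmeas_real; exact: bmeas_ratio.
rewrite /uG1 uG_sub1// mulrC -(@cintZ _ _ _ (m_ n) u _ cA); congr cintegral; apply/funext => s.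
have us := subrC_neq0 s u0.
have s1 : (1 + s%:C ^+ 2 : CC R) != 0.
  by rewrite -(rmorph1 (real_complex R)) -rmorphXn -rmorphD fmorph_eq0 gt_eqF// ltr_pwDl// sqr_ge0.
rewrite /sqweight !fmorph_div rmorphD rmorphXn rmorph1.
by field; rewrite us s1.
Qed.

Lemma kap_near U : free_ultra U -> exists2 K : R, 0 <= K & \forall n \near U,
  forall f M, 0 <= M -> cbmeas f -> (forall s, nm (f s) <= M) -> nm (kap n f) <= K * M.
Proof.
move=> fU; have [K hK] := bd; exists (Num.max K 0); first by rewrite le_max lexx orbT.
have FU := free_ultra_proper fU.
apply: filterS (free_ultra_near fU hK) => n hn f M M0 cf fM.
apply: le_trans (kap_bound n cf fM) _.
by rewrite ler_wpM2r// (le_trans hn)// le_max lexx.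
Qed.

Section along_ultrafilter.
Context {U : set_system nat} (fU : free_ultra U).
#[local] Instance along_proper : ProperFilter U := free_ultra_proper fU.
Let FU : Filter U := @filter_filter _ _ along_proper.

Definition Elim (f : R -> CC R) : CC R := get [set l : CC R | kap n f @[n --> U] --> l].

Lemma Elim_cvg f : cbmeas f -> kap n f @[n --> U] --> Elim f.
Proof.
move=> cf; have [K K0 hK] := kap_near fU; have [M fM] := cbmeas_bounded cf.
have [|l hl] := @free_ultra_boundedC _ U (fun n => kap n f) (K * M) fU.
  by apply: filterS hK => n; apply => //; exact: le_trans (nm_ge0 _) (fM 0).
by apply: (@getPex _ [set l : CC R | kap n f @[n --> U] --> l]); exists l.
Qed.

Lemma Elim_bfunct : bfunct Elim.
Proof.
split => [f g cf cg|c f cf|].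
- apply: (@cvgC_unique _ _ U along_proper (fun n => kap n (fun s => f s + g s))).
    by apply: Elim_cvg; exact: cbmeasD.
  have -> : (fun n => kap n (fun s => f s + g s)) = fun n => kap n f + kap n g.
    by apply/funext => n; rewrite kapD.
  exact (@cvgCD _ _ U FU _ _ _ _ (Elim_cvg cf) (Elim_cvg cg)).
- apply: (@cvgC_unique _ _ U along_proper (fun n => kap n (fun s => c * f s))).
    by apply: Elim_cvg; apply: cbmeasM => //; exact: cbmeas_cst.
  have -> : (fun n => kap n (fun s => c * f s)) = fun n => c * kap n f.
    by apply/funext => n; rewrite kapZ.
  exact (@cvgCM _ _ U FU _ _ _ _ (@cvgC_cst _ _ U FU c) (Elim_cvg cf)).
- have [K K0 hK] := kap_near fU; exists K => f M cf fM.
  have hn := @cvg_nm _ _ U FU _ _ (Elim_cvg cf).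
  rewrite -(cvg_lim _ hn)//; apply: limr_le; first by apply/cvg_ex; eexists; exact: hn.
  by apply: filterS hK => n; apply => //; exact: le_trans (nm_ge0 _) (fM 0).
Qed.

Lemma kap_res_cvg (z_ : nat -> CC R) z : z_ @ U --> z -> nonreal z ->
  kap n (fun s => (z_ n - s%:C)^-1) @[n --> U] --> Elim (fun s => (z - s%:C)^-1).
Proof.
move=> zz z0; have cz := cbmeas_res z0; have Ez := Elim_cvg cz.
have [K K0 hK] := kap_near fU.
set y := `|complex.Im z|; have y0 : 0 < y by rewrite normr_gt0.
have hd : kap n (fun s => (z_ n - s%:C)^-1) - kap n (fun s => (z - s%:C)^-1) @[n --> U] --> (0 : CC R).
  apply: (@cvgC_le _ _ U FU _ (fun n => K * (2 * y^-1 * y^-1) * nm (z_ n - z))).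
    have y20 : 0 < y / 2 by rewrite divr_gt0.
    have /cvgCP/(_ _ y20) nz := zz.
    apply: filterS2 hK nz => n hK /ltW nz; have [n0 ny] := nonreal_near z0 nz.
    have cn := cbmeas_res n0; rewrite subr0.
    have -> : kap n (fun s => (z_ n - s%:C)^-1) - kap n (fun s => (z - s%:C)^-1) =
       kap n (fun s => (z_ n - s%:C)^-1 + (-1) * (z - s%:C)^-1).
      rewrite kapD//; last by apply: cbmeasM => //; exact: cbmeas_cst.
      by rewrite kapZ// mulN1r.
    rewrite -mulrA; apply: hK.
    - by rewrite mulr_ge0 ?nm_ge0// mulr_ge0 ?mulr_ge0 ?invr_ge0 ?(ltW y0).
    - by apply: cbmeasD => //; apply: cbmeasM => //; exact: cbmeas_cst.
    - move=> s; rewrite mulN1r resolvent_sub// nmM nmN nmM mulrC.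
      rewrite ler_wpM2r ?nm_ge0// mulrC; apply: ler_pM; rewrite ?nm_ge0//.
        apply: le_trans (nm_resolvent s n0) _.
        have -> : 2 * y^-1 = (y / 2)^-1 by rewrite invfM invrK mulrC.
        by rewrite lef_pV2 ?posrE// (lt_le_trans _ ny).
      exact: nm_resolvent.
  rewrite -[X in _ --> X](mulr0 (K * (2 * y^-1 * y^-1))); apply: cvgM; first exact: cvg_cst.
  exact: (cvgC_nm _ _).1 zz.
have := @cvgCD _ _ U FU _ _ _ _ hd Ez; rewrite add0r; apply: cvg_trans.
by apply: near_eq_cvg; apply: nearW => n; rewrite subrK.
Qed.

(** The limit is obtained by solving the decomposition for [gam] at one point of the cone, where all
    other terms converge. *)
Lemma gam_cvg : exists g : CC R, gam n @[n --> U] --> g.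
Proof.
pose y := B + 1; have y0 : 0 < y by rewrite /y addr_gt0.
have zc : cones a B (vertical y) by apply: vertical_cones => //; rewrite /y ltrDl.
have [uz kA] := lim zc; have z0 := vertical_nonreal y0.
have uzU := free_ultra_cvg fU uz; have kAU := free_ultra_cvg fU kA.
have h1 := @cvgCM _ _ U FU _ _ _ _ kAU uzU.
have c1 : cbmeas (fun _ : R => (1 : CC R)) by exact: cbmeas_cst.
have h2 := @cvgCM _ _ U FU _ _ _ _ uzU (Elim_cvg c1).
have h3 := @cvgCM _ _ U FU _ _ _ _ (@cvgCD _ _ U FU _ _ _ _ (@cvgC_cst _ _ U FU 1)
   (@cvgCM _ _ U FU _ _ _ _ uzU uzU)) (kap_res_cvg uzU z0).
have h := @cvgCB _ _ U FU _ _ _ _ (@cvgCD _ _ U FU _ _ _ _ h1 h2) h3.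
eexists; apply: cvg_trans h; apply: near_eq_cvg.
apply: filterS (free_ultra_near fU (cvg_nonreal_near uz z0)) => n [n0 _].
by rewrite uG1_decomposition// -expr2; ring.
Qed.

Definition Psi_ultra z : CC R :=
  get [set g : CC R | gam n @[n --> U] --> g] - z * Elim (fun=> 1) +
  (1 + z * z) * Elim (fun s => (z - s%:C)^-1).

Lemma Psi_ultra_twice_deriv : twice_deriv (@nonreal R) Psi_ultra.
Proof.
apply: twice_derivD; first apply: twice_derivB; first exact: twice_deriv_cst.
  by apply: twice_derivM; [exact: twice_deriv_id|exact: twice_deriv_cst].
apply: twice_derivM; last exact: bfunct_twice_deriv Elim_bfunct.
apply: twice_derivD; first exact: twice_deriv_cst.
by apply: twice_derivM; exact: twice_deriv_id.
Qed.

Lemma Psi_ultra_cvg (z_ : nat -> CC R) z : z_ @ \oo --> z -> nonreal z ->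
  (k n)%:R * uG1 (m_ n) (z_ n) @[n --> U] --> Psi_ultra z / z.
Proof.
move=> zz z0; have zU := free_ultra_cvg fU zz.
have zn0 : z != 0 by apply: contraNneq z0 => ->; rewrite /nonreal /=.
have c1 : cbmeas (fun _ : R => (1 : CC R)) by exact: cbmeas_cst.
have hg : gam n @[n --> U] --> get [set g : CC R | gam n @[n --> U] --> g].
  by have [g hg] := gam_cvg; apply: (@getPex _ [set g : CC R | gam n @[n --> U] --> g]); exists g.
have h2 := @cvgCM _ _ U FU _ _ _ _ zU (Elim_cvg c1).
have h3 := @cvgCM _ _ U FU _ _ _ _ (@cvgCD _ _ U FU _ _ _ _ (@cvgC_cst _ _ U FU 1)
   (@cvgCM _ _ U FU _ _ _ _ zU zU)) (kap_res_cvg zU z0).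
have h := @cvgCD _ _ U FU _ _ _ _ (@cvgCB _ _ U FU _ _ _ _ hg h2) h3.
have h' := @cvgCM _ _ U FU _ _ _ _ h (@cvgCV _ _ U FU _ _ zn0 zU).
apply: cvg_trans h'; apply: near_eq_cvg.
apply: filterS (free_ultra_near fU (cvg_nonreal_near zz z0)) => n [n0 _].
have nn0 : z_ n != 0 by apply: contraNneq n0 => ->; rewrite /nonreal /=.
by rewrite -expr2 -uG1_decomposition// mulfK.
Qed.

Lemma Psi_ultra_cone z : cones a B z -> Psi_ultra z = Phi z.
Proof.
move=> zc; have [uz kA] := lim zc; have z0 := cones_nonreal (ltW B0) zc.
have zn0 : z != 0 by apply: contraNneq z0 => ->; rewrite /nonreal /=.
have h1 := Psi_ultra_cvg uz z0; have h2 := free_ultra_cvg fU kA.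
have := @cvgC_unique _ _ U along_proper _ _ _ h1 h2.
by move/(mulIf (invr_neq0 zn0)).
Qed.

End along_ultrafilter.

Lemma nonreal_cones z : nonreal z -> exists a' b' : R, [/\ 0 < a', 0 < b' & cones a' b' z].
Proof.
move=> z0; have y0 : 0 < `|complex.Im z| by rewrite normr_gt0.
exists ((`|complex.Re z| + 1) / `|complex.Im z|), (`|complex.Im z| / 2).
split; [by rewrite divr_gt0// ltr_pwDr|by rewrite divr_gt0|].
apply/conesP; first by rewrite divr_ge0.
have [zp|zp] := leP 0 (complex.Im z).
  exists 1; rewrite ?normr1// /hcone /= mul1r; rewrite (ger0_norm zp) in y0 *.
  by rewrite divfK ?gt_eqF// ltrDl ltr01 gtr_pMr// invf_lt1// ltr1n.
exists (-1); rewrite ?normrN1// /hcone /= mulN1r; rewrite (ltr0_norm zp) in y0 *.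
by rewrite divfK ?gt_eqF// ltrDl ltr01 gtr_pMr// invf_lt1// ltr1n.
Qed.

(** Along each free ultrafilter the decomposition passes to the limit at every non-real point. All
    these limits agree with [Phi] on the cone, hence everywhere by the identity theorem, so the
    convergence holds along the integers. *)
Lemma continuation_limit : exists Psi : CC R -> CC R,
  [/\ twice_deriv (@nonreal R) Psi, forall z, cones a B z -> Psi z = Phi z &
   forall (z_ : nat -> CC R) z, z_ @ \oo --> z -> nonreal z ->
     (k n)%:R * uG1 (m_ n) (z_ n) @[n --> \oo] --> Psi z / z].
Proof.
have [U0 fU0] := free_ultra_exists.
exists (@Psi_ultra U0); split; [exact: Psi_ultra_twice_deriv|exact: Psi_ultra_cone|].
move=> z_ z zz z0; apply: cvg_free_ultra => U fU.
suff -> : @Psi_ultra U0 z = @Psi_ultra U z by exact: Psi_ultra_cvg.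
have [a' [b' [a'0 b'0 zc]]] := nonreal_cones z0.
have sub : cones a' b' `<=` @nonreal R by move=> w; exact: cones_nonreal (ltW b'0).
apply: (@cones_eq _ _ _ a' b' a B) zc => //.
- exact: ltW.
- exact: (twice_deriv_sub sub (Psi_ultra_twice_deriv fU0)).
- exact: (twice_deriv_sub sub (Psi_ultra_twice_deriv fU)).
- by move=> w wc; rewrite !Psi_ultra_cone.
Qed.

End continuation.

(** * Limits of measures on the plane *)

Section plane.
Context {R : realType}.
Local Notation T := (R * R)%type.

(** An open set is a countable union of products of balls with rational centres and radii 1/(r+1),
    which belong to the product sigma-algebra. *)
Lemma open_plane_measurable (U : set T) : open U -> measurable U.
Proof.
move=> oU.
pose Q (q1 q2 : rat) (r : nat) : set T :=
  fst @^-1` ball (ratr q1 : R) r.+1%:R^-1 `&` snd @^-1` ball (ratr q2 : R) r.+1%:R^-1.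
have mQ q1 q2 r : measurable (Q q1 q2 r).
  apply: measurableI.
    by rewrite -[X in measurable X]setTI; apply: (measurable_fst _) => //; exact: measurable_ball.
  by rewrite -[X in measurable X]setTI; apply: (measurable_snd _) => //; exact: measurable_ball.
have -> : U = \bigcup_(q1 in [set: rat]) \bigcup_(q2 in [set: rat])
    \bigcup_(r in [set: nat]) (if `[< Q q1 q2 r `<=` U >] then Q q1 q2 r else set0).
  apply/seteqP; split => [[s t] Ust|p [q1 _ [q2 _ [r _]]]]; last first.
    by case: asboolP => // QU; exact: QU.
  have : nbhs (s, t) U by exact: open_nbhs_nbhs.
  move=> /nbhs_ballP[e /= e0 eU].
  pose r := Num.bound (2 / e).
  have r0 : (0 : R) < r.+1%:R^-1 by rewrite invr_gt0.
  have re : r.+1%:R^-1 + r.+1%:R^-1 < e.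
    have h : 2 / e < r.+1%:R.
      rewrite (lt_le_trans (archi_boundP _))//; first by rewrite divr_ge0// ltW.
      by rewrite ler_nat.
    rewrite ltr_pdivrMr// in h.
    by rewrite -mulr2n -[_ *+ 2]mulr_natl ltr_pdivrMr// mulrC.
  have [q1 /itvP hq1] := @rat_in_itvoo R s (s + r.+1%:R^-1) ltac:(by rewrite ltrDl).
  have [q2 /itvP hq2] := @rat_in_itvoo R t (t + r.+1%:R^-1) ltac:(by rewrite ltrDl).
  have b1 : ball (ratr q1 : R) r.+1%:R^-1 s.
    by rewrite /ball /= gtr0_norm ?subr_gt0 ?hq1// ltrBlDr addrC hq1.
  have b2 : ball (ratr q2 : R) r.+1%:R^-1 t.
    by rewrite /ball /= gtr0_norm ?subr_gt0 ?hq2// ltrBlDr addrC hq2.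
  exists q1 => //; exists q2 => //; exists r => //.
  rewrite asboolT => [|[s' t'] [/= h1 h2]]; first by split.
  apply: eU; split => /=.
    by apply: le_ball (ltW re) _ _; apply: ball_triangle (ball_sym b1) h1.
  by apply: le_ball (ltW re) _ _; apply: ball_triangle (ball_sym b2) h2.
apply: bigcupT_measurable_rat => q1; apply: bigcupT_measurable_rat => q2.
apply: bigcupT_measurable => r; case: ifP => // _; exact: mQ.
Qed.

Lemma continuous_plane_measurable (f : T -> R) : continuous f -> measurable_fun setT f.
Proof.
move=> cf; apply: (measurability _ (RGenOpens.measurableE R)) => _ [_ [a [b ->]] <-].
rewrite setTI; apply: open_plane_measurable.
by move/continuousP : cf; apply; exact: interval_open.
Qed.

Definition cbound (f : T -> R) := continuous f /\ exists M : R, forall x, `|f x| <= M.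

Lemma cbound_bmeas f : cbound f -> bmeas f.
Proof. by move=> [cf bf]; split => //; exact: continuous_plane_measurable. Qed.

Lemma cbound_cst (c : R) : cbound (fun=> c).
Proof. by split; [move=> x; exact: cvg_cst|exists `|c|]. Qed.

Lemma cboundD f g : cbound f -> cbound g -> cbound (fun x => f x + g x).
Proof.
move=> [cf [M fM]] [cg [N gN]]; split; first by move=> x; apply: cvgD; [exact: cf|exact: cg].
by exists (M + N) => x; rewrite (le_trans (ler_normD _ _))// lerD.
Qed.

Lemma cboundM f g : cbound f -> cbound g -> cbound (fun x => f x * g x).
Proof.
move=> [cf [M fM]] [cg [N gN]]; split; first by move=> x; apply: cvgM; [exact: cf|exact: cg].
by exists (M * N) => x; rewrite normrM ler_pM.
Qed.

Lemma cboundZ (c : R) f : cbound f -> cbound (fun x => c * f x).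
Proof. by move=> cf; apply: cboundM => //; exact: cbound_cst. Qed.

Lemma cboundB f g : cbound f -> cbound g -> cbound (fun x => f x - g x).
Proof.
move=> cf cg; have -> : (fun x => f x - g x) = fun x => f x + (-1) * g x.
  by apply/funext => x; rewrite mulN1r.
by apply: cboundD => //; exact: cboundZ.
Qed.

Lemma cbound_min (f : T -> R) (c : R) : continuous f -> (forall x, 0 <= f x) -> 0 <= c ->
  cbound (fun x => Num.min c (f x)).
Proof.
move=> cf f0 c0; split.
  by move=> x; apply: (@continuous_min R T (fun=> c) f); [exact: cvg_cst|exact: cf].
exists c => x; rewrite ger0_norm; first by rewrite ge_min lexx.
by rewrite le_min c0 f0.
Qed.

Lemma continuous_pospart (f : T -> R) (c : R) : continuous f -> continuous (fun x => Num.max 0 (f x - c)).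
Proof.
move=> cf x; apply: (@continuous_max R T (fun=> 0) (fun x => f x - c)); first exact: cvg_cst.
by apply: cvgB; [exact: cf|exact: cvg_cst].
Qed.

Lemma cbound_sum (I : Type) (r : seq I) (F : I -> T -> R) :
  (forall i, cbound (F i)) -> cbound (fun x => \sum_(i <- r) F i x).
Proof.
move=> cF; elim: r => [|i r ih].
  have -> : (fun x => \sum_(i <- [::]) F i x) = fun=> 0 by apply/funext => x; rewrite big_nil.
  exact: cbound_cst.
have -> : (fun x => \sum_(j <- i :: r) F j x) = fun x => F i x + \sum_(j <- r) F j x.
  by apply/funext => x; rewrite big_cons.
exact: cboundD.
Qed.

End plane.

(** * A Daniell representation theorem on the plane *)

Section daniell.
Context {R : realType}.
Local Notation T := (R * R)%type.
Context {L : (T -> R) -> R}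
  (LD : forall f g, cbound f -> cbound g -> L (fun x => f x + g x) = L f + L g)
  (LZ : forall (c : R) f, cbound f -> L (fun x => c * f x) = c * L f)
  (L_ge0 : forall f, cbound f -> (forall x, 0 <= f x) -> 0 <= L f)
  (L_dini : forall f_ : nat -> T -> R, (forall n, cbound (f_ n)) ->
    (forall n x, f_ n.+1 x <= f_ n x) -> (forall x, f_ n x @[n --> \oo] --> (0 : R)) ->
    L (f_ n) @[n --> \oo] --> (0 : R)).

Lemma Lle f g : cbound f -> cbound g -> (forall x, f x <= g x) -> L f <= L g.
Proof.
move=> cf cg fg; have c1 := cboundZ (-1) cf.
have := L_ge0 (cboundD cg c1); rewrite LD// LZ// mulN1r subr_ge0; apply => x.
by rewrite mulN1r subr_ge0.
Qed.

Lemma L0 : L (fun=> 0) = 0.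
Proof.
have -> : (fun _ : T => (0 : R)) = (fun x : T => 0 * (fun=> 1) x) by apply/funext => x; rewrite mul0r.
by rewrite LZ ?mul0r//; exact: cbound_cst.
Qed.

Lemma Lsum (I : Type) (r : seq I) (F : I -> T -> R) : (forall i, cbound (F i)) ->
  L (fun x => \sum_(i <- r) F i x) = \sum_(i <- r) L (F i).
Proof.
move=> cF; elim: r => [|i r ih].
  rewrite big_nil -[RHS]L0; congr L; apply/funext => x; by rewrite big_nil.
rewrite big_cons -ih -LD//; last exact: cbound_sum.
by congr L; apply/funext => x; rewrite big_cons.
Qed.

(* Witnesses that the outer measure of [A] determined by [L] is at most [c]. *)
Definition dominates (A : set T) (f_ : nat -> T -> R) (c : R) := [/\
  forall n, cbound (f_ n), forall n x, 0 <= f_ n x,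
  forall n m x, (n <= m)%N -> f_ n x <= f_ m x,
  forall x, A x -> exists n, 1 <= f_ n x & forall n, L (f_ n) <= c].

Definition costs (A : set T) : set R := [set c | exists f_, dominates A f_ c].

Definition outerR (A : set T) : R := inf (costs A).

Lemma costs_ge0 A c : costs A c -> 0 <= c.
Proof.
move=> [f_ [cf f0 _ _ fc]]; apply: le_trans (fc 0%N); apply: L_ge0; [exact: cf|exact: f0].
Qed.

Lemma dominates_cst A (f : T -> R) : cbound f -> (forall x, 0 <= f x) ->
  (forall x, A x -> 1 <= f x) -> dominates A (fun=> f) (L f).
Proof. by move=> cf f0 Af; split => // x Ax; exists 0%N; exact: Af. Qed.

Lemma costs_neq0 A : costs A !=set0.
Proof.
exists (L (fun=> 1)), (fun=> fun=> 1).
by apply: dominates_cst => //; exact: cbound_cst.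
Qed.

Lemma costs_has_lbound A : has_lbound (costs A).
Proof. by exists 0 => c; exact: costs_ge0. Qed.

Lemma outerR_ge0 A : 0 <= outerR A.
Proof. by apply: lb_le_inf; [exact: costs_neq0|move=> c; exact: costs_ge0]. Qed.

Lemma outerR_le A f_ c : dominates A f_ c -> outerR A <= c.
Proof. by move=> h; apply: ge_inf; [exact: costs_has_lbound|exists f_]. Qed.

Lemma outerR_adherent A (e : R) : 0 < e -> exists f_, dominates A f_ (outerR A + e).
Proof.
move=> e0; have [|c [f_ hf] ce] := @inf_adherent _ (costs A) e e0.
  by split; [exact: costs_neq0|exact: costs_has_lbound].
exists f_; case: hf => h1 h2 h3 h4 h5; split => // n.
by rewrite (le_trans (h5 n))// ltW.
Qed.

Definition outer (A : set T) : \bar R := (outerR A)%:E.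

Lemma outer0 : outer set0 = 0%E.
Proof.
congr EFin; apply/eqP; rewrite eq_le outerR_ge0 andbT -L0.
by apply: outerR_le; apply: dominates_cst => //; exact: cbound_cst.
Qed.

Lemma outer_ge0 A : (0 <= outer A)%E.
Proof. by rewrite lee_fin outerR_ge0. Qed.

Lemma outer_le : {homo outer : A B / A `<=` B >-> (A <= B)%E}.
Proof.
move=> A B AB; rewrite lee_fin; apply: lb_le_inf; first exact: costs_neq0.
move=> c [f_ [h1 h2 h3 h4 h5]]; apply: outerR_le (f_) _ _.
by split => // x /AB; exact: h4.
Qed.

Lemma outer_sigma_subadditive : sigma_subadditive outer.
Proof.
move=> A; apply/lee_addgt0Pr => e e0.
have A0 n : (0 <= outer (A n))%E by exact: outer_ge0.
apply: le_trans (epsilon_trick xpredT A0 (ltW e0)).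
have ei (i : nat) : 0 < e / (2 ^ i.+1)%:R by rewrite divr_gt0// ltr0n expn_gt0.
have /choice[F hF] : forall i, exists f_, dominates (A i) f_ (outerR (A i) + e / (2 ^ i.+1)%:R).
  by move=> i; exact: outerR_adherent.
have s0 i : (0 <= outer (A i) + (e / (2 ^ i.+1)%:R)%:E)%E.
  by rewrite adde_ge0 ?outer_ge0// lee_fin ltW.
have [S_fin|S_inf] := boolP ((\sum_(i <oo) (outer (A i) + (e / (2 ^ i.+1)%:R)%:E))%E \is a fin_num); last first.
  move: S_inf; rewrite fin_numE negb_and !negbK => /orP[/eqP h|/eqP ->]; last exact: leey.
  have := nneseries_ge0 (fun i (_ : (0 <= i)%N) (_ : xpredT i) => s0 i).
  by rewrite h.
rewrite -(fineK S_fin) lee_fin.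
(* Diagonal sums are finite, hence bounded and continuous, and they increase both through new terms
   and within each term, so every point of the union is eventually dominated. *)
apply: (@outerR_le _ (fun n x => \sum_(i <- iota 0 n.+1) F i n x)).
split.
- by move=> n; apply: cbound_sum => i; case: (hF i).
- by move=> n x; apply: sumr_ge0 => i _; case: (hF i).
- move=> n m x nm.
  have -> : iota 0 m.+1 = iota 0 n.+1 ++ iota n.+1 (m - n).
    by rewrite -iotaD addSn subnKC.
  rewrite big_cat /= -[leLHS]addr0 lerD//.
    by apply: ler_sum => i _; case: (hF i) => _ _ h _ _; exact: h.
  by apply: sumr_ge0 => i _; case: (hF i).
- move=> x [i _ Aix]; case: (hF i) => _ f0 mono hx _; have [n hn] := hx x Aix.
  exists (maxn i n); rewrite (le_trans hn)// (le_trans (mono n (maxn i n) x (leq_maxr _ _)))//.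
  have im : i \in iota 0 (maxn i n).+1 by rewrite mem_iota add0n ltnS leq_maxl.
  rewrite (bigD1_seq i im (iota_uniq _ _)).
  by rewrite lerDl; apply: sumr_ge0 => j _; case: (hF j).
- move=> n; rewrite Lsum; last by move=> i; case: (hF i).
  rewrite -lee_fin fineK// -sumEFin.
  apply: le_trans (nneseries_lim_ge n.+1 (fun i (_ : (0 <= i)%N) (_ : xpredT i) => s0 i)).
  rewrite /index_iota subn0; apply: lee_sum => i _.
  by rewrite -EFinD lee_fin; case: (hF i).
Qed.

HB.instance Definition _ := isOuterMeasure.Build R T outer outer0 outer_ge0 outer_le
  outer_sigma_subadditive.

(** A sequence dominating [X] splits as f b + f (1 - b). With [b_ N] fixed, f (1 - b_N) dominates
    the part of [X] outside [B] at cost c - L(f_N b_N); with both indices growing, f_n b_n dominates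
    the part inside. *)
Lemma caratheodory_indicator (B : set T) (b_ : nat -> T -> R) :
  (forall n, cbound (b_ n)) -> (forall n x, 0 <= b_ n x <= 1) ->
  (forall n m x, (n <= m)%N -> b_ n x <= b_ m x) ->
  (forall x, B x -> exists n, b_ n x = 1) -> (forall n x, ~ B x -> b_ n x = 0) ->
  outer.-caratheodory B.
Proof.
move=> cb b01 bmono B1 B0; apply: le_caratheodory_measurable => X.
rewrite -EFinD lee_fin; apply: lb_le_inf; first exact: costs_neq0.
move=> c [f_ [cf f0 fmono fX fc]].
have cfb n m : cbound (fun x => f_ n x * b_ m x) by exact: cboundM.
have cfb' n m : cbound (fun x => f_ n x * (1 - b_ m x)).
  by apply: cboundM => //; apply: cboundB => //; exact: cbound_cst.
have b0 n x : 0 <= b_ n x by case/andP: (b01 n x).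
have b1 n x : 0 <= 1 - b_ n x by rewrite subr_ge0; case/andP: (b01 n x).
have split n m : L (fun x => f_ n x * b_ m x) + L (fun x => f_ n x * (1 - b_ m x)) <= c.
  rewrite -LD//; apply: le_trans (fc n); apply: Lle => //; first exact: cboundD.
  by move=> x; rewrite -mulrDr addrC subrK mulr1.
have out N : outerR (X `&` ~` B) <= c - L (fun x => f_ N x * b_ N x).
  apply: (@outerR_le _ (fun k x => f_ k x * (1 - b_ N x))); split => //.
  - by move=> n x; rewrite mulr_ge0.
  - by move=> n m x nm; rewrite ler_wpM2r// fmono.
  - by move=> x [Xx nBx]; have [n hn] := fX x Xx; exists n; rewrite B0// subr0 mulr1.
  - move=> n; rewrite lerBrDl; apply: le_trans (split (maxn n N) N); apply: lerD.
      by apply: Lle => // x; rewrite ler_wpM2r// fmono// leq_maxr.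
    by apply: Lle => // x; rewrite ler_wpM2r// fmono// leq_maxl.
rewrite -lerBrDr; apply: (@outerR_le _ (fun n x => f_ n x * b_ n x)); split => //.
- by move=> n x; rewrite mulr_ge0.
- by move=> n m x nm; apply: ler_pM => //; [exact: fmono|exact: bmono].
- move=> x [Xx Bx]; have [n hn] := fX x Xx; have [m hm] := B1 x Bx.
  exists (maxn n m); rewrite (le_trans hn)//.
  have bm : b_ (maxn n m) x = 1.
    apply/eqP; rewrite eq_le; case/andP: (b01 (maxn n m) x) => _ -> /=.
    by rewrite -hm bmono// leq_maxr.
  by rewrite bm mulr1 fmono// leq_maxl.
- by move=> n; rewrite lerBrDr addrC -lerBrDr; exact: out.
Qed.

Lemma caratheodory_superlevel (f : T -> R) (c : R) : continuous f ->
  outer.-caratheodory [set x | c < f x].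
Proof.
move=> cf; pose h x := Num.max 0 (f x - c).
have ch : continuous h by exact: continuous_pospart.
have h0 x : 0 <= h x by rewrite le_max lexx.
apply: (@caratheodory_indicator _ (fun n x => Num.min 1 (n%:R * h x))).
- move=> n; apply: cbound_min => //; last by move=> x; rewrite mulr_ge0.
  by move=> x; apply: cvgM; [exact: cvg_cst|exact: ch].
- by move=> n x; rewrite ge_min lexx le_min ler01 mulr_ge0.
- move=> n m x nm; rewrite le_min ge_min lexx /= ge_min; apply/orP; right.
  by rewrite ler_wpM2r// ler_nat.
- move=> x /= cx; have hx : 0 < h x by rewrite lt_max subr_gt0 cx orbT.
  exists (Num.bound (h x)^-1); apply/min_idPl.
  rewrite -ler_pdivrMr// div1r ltW//; apply: archi_boundP.
  by rewrite invr_ge0.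
- move=> n x /negP; rewrite -leNgt => fc.
  have -> : h x = 0 by apply/max_idPl; rewrite subr_le0.
  by rewrite mulr0; apply/min_idPr.
Qed.

Let C := caratheodory_type outer.

Lemma measurable_fst_caratheodory : measurable_fun [set: C] (fst : C -> R).
Proof.
apply: (measurability _ (RGenOInfty.measurableE R)) => _ [_ [x ->] <-].
rewrite setTI.
have -> : (fst : C -> R) @^-1` `]x, +oo[ = [set p | x < p.1].
  by apply/seteqP; split => p /=; rewrite in_itv/= andbT.
by apply: caratheodory_superlevel => p; exact: cvg_fst.
Qed.

Lemma measurable_snd_caratheodory : measurable_fun [set: C] (snd : C -> R).
Proof.
apply: (measurability _ (RGenOInfty.measurableE R)) => _ [_ [x ->] <-].
rewrite setTI.
have -> : (snd : C -> R) @^-1` `]x, +oo[ = [set p | x < p.2].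
  by apply/seteqP; split => p /=; rewrite in_itv/= andbT.
by apply: caratheodory_superlevel => p; exact: cvg_snd.
Qed.

Lemma measurable_id_caratheodory : measurable_fun [set: C] (id : C -> T).
Proof.
by apply/measurable_fun_pairP; split;
  [exact: measurable_fst_caratheodory|exact: measurable_snd_caratheodory].
Qed.

Lemma measurable_caratheodory (A : set T) : measurable A -> measurable (A : set C).
Proof.
by move=> mA; rewrite -[A]setTI; exact: (measurable_id_caratheodory measurableT mA).
Qed.

(** The set function of [outer] under a second name, which carries the measure structure on the
    Borel sets of the plane. *)
Definition daniell (A : set T) : \bar R := outer A.

Lemma daniell0 : daniell set0 = 0%E. Proof. exact: outer0. Qed.

Lemma daniell_ge0 A : (0 <= daniell A)%E. Proof. exact: outer_ge0. Qed.

Lemma daniell_sigma_additive : semi_sigma_additive daniell.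
Proof.
move=> F mF tF mUF; apply: (@caratheodory_measure_sigma_additive R T outer) => //.
- by move=> n; exact: measurable_caratheodory.
- exact: measurable_caratheodory.
Qed.

HB.instance Definition _ := isMeasure.Build _ T R daniell daniell0 daniell_ge0
  daniell_sigma_additive.

Lemma daniell_fin : fin_num_fun daniell. Proof. by []. Qed.

HB.instance Definition _ := Measure_isFinite.Build _ T R daniell daniell_fin.

(** This is where [L_dini] enters: if [f_] dominates the whole plane, the positive parts of 1 - f_n
    decrease to 0, so no cost is below L(1). *)
Lemma daniell_setT : outerR setT = L (fun=> 1).
Proof.
have c1 : cbound (fun _ : T => (1 : R)) by exact: cbound_cst.
apply/eqP; rewrite eq_le; apply/andP; split.
  by apply: (outerR_le (f_ := fun=> fun=> 1)); exact: dominates_cst.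
apply: lb_le_inf; first exact: costs_neq0.
move=> c [f_ [cf f0 fmono fT fc]].
pose g n x := Num.max 0 (1 - f_ n x).
have cg n : cbound (g n).
  have c2 : cbound (fun x => 1 - f_ n x) by exact: cboundB.
  split; last first.
    exists 1 => x; rewrite ger0_norm ?le_max ?lexx// ge_max ler01/=.
    by rewrite gerBl f0.
  by move=> x; apply: (@continuous_max R T (fun=> 0)); [exact: cvg_cst|exact: c2.1].
have gL : L (g n) @[n --> \oo] --> (0 : R).
  apply: L_dini => //.
    move=> n x; rewrite /g ge_max le_max lexx/= le_max; apply/orP; right.
    by rewrite lerB// fmono.
  move=> x; have [n hn] := fT x I; apply: cvg_near_cst; exists n => // m /= nm.
  by apply/max_idPl; rewrite subr_le0 (le_trans hn)// fmono.
have h n : L (fun=> 1) - c <= L (g n).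
  rewrite lerBlDr (le_trans _ (lerD (lexx _) (fc n)))// -LD//.
  apply: Lle => //; first exact: cboundD.
  by move=> x; rewrite -lerBlDr le_max lexx orbT.
rewrite -subr_le0 -(cvg_lim _ gL)//; apply: limr_ge; first by apply/cvg_ex; exists 0.
exact: nearW.
Qed.

(** Cut [f] into slices of height 1/(N+1). Slice j+1 vanishes unless f > (j+1)/(N+1), and there
    (N+1) times slice j equals 1, so L of slice j bounds the integral of slice j+1. The shift leaves
    over the first slice, which costs L(1)/(N+1). *)
Lemma daniell_layer (f : T -> R) (N j : nat) : cbound f -> (forall x, 0 <= f x) ->
  Rintegral daniell setT (fun x => Num.min (j.+1%:R / N.+1%:R) (f x)) <=
  L (fun=> 1) / N.+1%:R + L (fun x => Num.min (j%:R / N.+1%:R) (f x)).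
Proof.
move=> cf f0; have N0 : 0 < (N.+1%:R : R) by rewrite ltr0n.
have cm (i : nat) : cbound (fun x => Num.min (i%:R / N.+1%:R) (f x)).
  by apply: cbound_min; [exact: cf.1|exact: f0|rewrite divr_ge0].
have i1 (i : nat) : i.+1%:R / N.+1%:R = i%:R / N.+1%:R + N.+1%:R^-1 :> R.
  by rewrite -[i.+1]addn1 natrD mulrDl mul1r.
elim: j => [|j ih].
  have -> : (fun x => Num.min (0%:R / N.+1%:R) (f x)) = fun=> 0.
    by apply/funext => x; rewrite mul0r; apply/min_idPl.
  rewrite L0 addr0; apply: (@le_trans _ _ (Rintegral daniell setT (fun=> N.+1%:R^-1))).
    apply: Rint_le; [exact: cbound_bmeas|exact: bmeas_cst|].
    by move=> x; rewrite ge_min mul1r lexx.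
  by rewrite (Rint_cst daniell) mulrC /= daniell_setT.
pose g i x := Num.min (i.+1%:R / N.+1%:R) (f x) - Num.min (i%:R / N.+1%:R) (f x).
have cg i : cbound (g i) by exact: cboundB.
have g0 i x : 0 <= g i x.
  rewrite subr_ge0 le_min; apply/andP; split; rewrite ge_min ?lexx ?orbT//.
  by apply/orP; left; rewrite i1 lerDl invr_ge0 ltW.
pose S : set T := [set x | j.+1%:R / N.+1%:R < f x].
have mS : measurable S.
  have -> : S = f @^-1` `]j.+1%:R / N.+1%:R, +oo[.
    by apply/seteqP; split => x /=; rewrite in_itv/= andbT.
  rewrite -[X in measurable X]setTI.
  by apply: (continuous_plane_measurable cf.1).
have -> : (fun x => Num.min (j.+2%:R / N.+1%:R) (f x)) =
    fun x => Num.min (j.+1%:R / N.+1%:R) (f x) + g j.+1 x.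
  by apply/funext => x; rewrite /g addrC subrK.
rewrite RintD; [|exact: cbound_bmeas|exact: cbound_bmeas].
have -> : L (fun x => Num.min (j.+1%:R / N.+1%:R) (f x)) =
    L (fun x => Num.min (j%:R / N.+1%:R) (f x)) + L (g j).
  by rewrite -LD//; congr L; apply/funext => x; rewrite /g addrC subrK.
rewrite addrA; apply: lerD => //.
apply: (@le_trans _ _ (Rintegral daniell setT (fun x => N.+1%:R^-1 * \1_S x))).
  apply: Rint_le; [exact: cbound_bmeas|by apply: bmeasZ; exact: bmeas_indic|].
  move=> x; rewrite indicE /g; have [|] := boolP (x \in S).
    rewrite inE /S /= => xS; rewrite mulr1 [X in _ - X](min_idPl (ltW xS)).
    by rewrite lerBlDl -i1 ge_min lexx.
  rewrite notin_setE /S /= => /negP; rewrite -leNgt => xS.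
  by rewrite mulr0 [X in _ - X](min_idPr xS) subr_le0 ge_min lexx orbT.
rewrite RintZ; last exact: bmeas_indic.
rewrite Rint_indic// ler_pdivrMl//.
rewrite -LZ//=; apply: (outerR_le (f_ := fun=> fun x => N.+1%:R * g j x)).
apply: dominates_cst; first exact: cboundZ.
  by move=> x; rewrite mulr_ge0.
move=> x; rewrite /S /= => xS; rewrite /g (min_idPl (ltW xS)).
have -> : Num.min (j%:R / N.+1%:R) (f x) = j%:R / N.+1%:R.
  by apply/min_idPl; rewrite (le_trans _ (ltW xS))// ler_pM2r ?invr_gt0// ler_nat leqnSn.
by rewrite i1 addrAC subrr add0r divff// gt_eqF.
Qed.

Lemma daniell_integral_le (f : T -> R) : cbound f -> (forall x, 0 <= f x <= 1) ->
  Rintegral daniell setT f <= L f.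
Proof.
move=> cf f01; have f0 x : 0 <= f x by case/andP: (f01 x).
have h (N : nat) : Rintegral daniell setT f - L f <= L (fun=> 1) / N.+1%:R.
  have := @daniell_layer f N N cf f0; rewrite divff ?pnatr_eq0//.
  have -> : (fun x => Num.min 1 (f x)) = f.
    by apply/funext => x; apply/min_idPr; case/andP: (f01 x).
  move=> h; rewrite lerBlDr (le_trans h)// lerD2l; apply: Lle => //.
    by apply: cbound_min; [exact: cf.1|exact: f0|rewrite divr_ge0].
  by move=> x; rewrite ge_min lexx orbT.
rewrite -subr_le0.
have lim0 : (fun N : nat => L (fun=> 1) / N.+1%:R) @ \oo --> (L (fun=> 1) * 0).
  by apply: cvgM; [exact: cvg_cst|exact: cvg_harmonic].
rewrite mulr0 in lim0; rewrite -(cvg_lim _ lim0)//; apply: limr_ge.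
  by apply/cvg_ex; exists 0.
exact: nearW.
Qed.

(** The one-sided bound for g and for 1 - g, together with equal total masses, gives equality when 0
    <= g <= 1; an affine change reduces bounded functions to this case. *)
Lemma daniell_representation : exists m : {finite_measure set T -> \bar R},
  forall f, cbound f -> L f = Rintegral m setT f.
Proof.
exists daniell => f cf; have [_ [M fM]] := cf.
have c1 (c : R) : cbound (fun _ : T => c) by exact: cbound_cst.
have key (g : T -> R) : cbound g -> (forall x, 0 <= g x <= 1) -> L g = Rintegral daniell setT g.
  move=> cg g01; apply/eqP; rewrite eq_le daniell_integral_le// andbT.
  have cg' : cbound (fun x => 1 - g x) by exact: cboundB.
  have := daniell_integral_le cg'.
  rewrite RintB; [|exact: bmeas_cst|exact: cbound_bmeas].
  have -> : L (fun x => 1 - g x) = L (fun=> 1) - L g.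
    rewrite -mulN1r -LZ// -LD//; last exact: cboundZ.
    by congr L; apply/funext => x; rewrite mulN1r.
  rewrite (Rint_cst daniell) mul1r /= daniell_setT => h.
  rewrite -lerN2 -(lerD2l (L (fun=> 1))); apply: h => x.
  by rewrite subr_ge0 gerBl; case/andP: (g01 x) => -> ->.
pose K := `|M| + 1; have K0 : 0 < K by rewrite ltr_pwDr.
have fK x : - K <= f x <= K.
  by rewrite -ler_norml (le_trans (fM x))// (le_trans (ler_norm _))// lerDl.
pose g x := (2 * K)^-1 * (f x + K).
have cfK : cbound (fun x => f x + K) by exact: cboundD.
have cg : cbound g by exact: cboundZ.
have g01 x : 0 <= g x <= 1.
  have /andP[h1 h2] := fK x.
  rewrite /g mulr_ge0 ?invr_ge0 ?mulr_ge0 ?(ltW K0)//=; last by rewrite -lerBlDr sub0r.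
  by rewrite ler_pdivrMl ?mulr_gt0// mulr1; lra.
have := key g cg g01; rewrite /g LZ// LD// RintZ; last exact: cbound_bmeas.
rewrite RintD; [|exact: cbound_bmeas|exact: bmeas_cst].
have -> : L (fun=> K) = Rintegral daniell setT (fun=> K).
  rewrite (Rint_cst daniell) /= daniell_setT -LZ//; congr L.
  by apply/funext => x; rewrite mulr1.
have K2 : (2 * K)^-1 != 0 by rewrite invr_eq0 mulf_neq0// gt_eqF.
by move=> /(mulfI K2) /addIr.
Qed.

End daniell.

(** * Ultrafilter limits of tight weighted measures *)

Section limit_measure.
Context {R : realType}.
Local Notation T := (R * R)%type.
Context {mu_ : nat -> probability T R} {w_ : nat -> T -> R} {U : set_system nat}
  (bw : forall n, bmeas (w_ n)) (w0 : forall n x, 0 <= w_ n x) (fU : free_ultra U)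
  {K : R} (wK : \forall n \near U, Rintegral (mu_ n) setT (w_ n) <= K).

Definition outbox (M : R) : set T := fst @^-1` outside M `|` snd @^-1` outside M.

Context (wtight : forall e : R, 0 < e -> exists M : R, \forall n \near U,
  Rintegral (mu_ n) setT (fun x => w_ n x * \1_(outbox M) x) <= e).

#[local] Instance limit_measure_proper : ProperFilter U := free_ultra_proper fU.

Lemma measurable_outbox (M : R) : measurable (outbox M).
Proof.
apply: measurableU; rewrite -[X in measurable X]setTI.
  by apply: (measurable_fst _) => //; exact: measurable_outside.
by apply: (measurable_snd _) => //; exact: measurable_outside.
Qed.

Lemma compact_inbox (M : R) : compact (~` outbox M).
Proof.
have -> : ~` outbox M = [set x : R | - M <= x <= M] `*` [set x : R | - M <= x <= M].
  apply/seteqP; split => p.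
    rewrite /outbox /outside /= => h; split => /=; rewrite -ler_norml leNgt; apply/negP => h'; apply: h.
      by left.
    by right.
  move=> [/= h1 h2] [] /=; rewrite /outside /= ltNge ler_norml; [by rewrite h1|by rewrite h2].
by apply: compact_setX; rewrite -set_itvcc; exact: segment_compact.
Qed.

Let I n (f : T -> R) := Rintegral (mu_ n) setT (fun x => f x * w_ n x).

Lemma wint_bound n f (M : R) : bmeas f -> (forall x, `|f x| <= M) ->
  `|I n f| <= M * Rintegral (mu_ n) setT (w_ n).
Proof.
move=> bf fM; have bfw := bmeasM bf (bw n).
rewrite -RintZ// ler_norml -RintN; last exact: bmeasZ.
have bM := bmeasZ M (bw n).
apply/andP; split; (apply: Rint_le => //; first try exact: bmeasN) => x;
  have := fM x; rewrite ler_norml => /andP[h1 h2].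
  by rewrite -mulNr ler_wpM2r.
by rewrite ler_wpM2r.
Qed.

Lemma wint_cvg f : bmeas f -> exists l : R, I n f @[n --> U] --> l.
Proof.
move=> bf; have [_ [M fM]] := bf.
apply: (@free_ultra_bounded _ U _ (M * K) fU); apply: filterS wK => n hn.
apply: le_trans (wint_bound n bf fM) _; rewrite ler_wpM2l//.
exact: le_trans (normr_ge0 _) (fM (0, 0)).
Qed.

Definition wlim (f : T -> R) : R := get [set l : R | I n f @[n --> U] --> l].

Lemma wlimP f : bmeas f -> I n f @[n --> U] --> wlim f.
Proof.
by move=> /wint_cvg[l hl]; apply: (@getPex _ [set l : R | I n f @[n --> U] --> l]); exists l.
Qed.

Lemma wlim_eq f (l : R) : I n f @[n --> U] --> l -> wlim f = l.
Proof.
move=> fl; have fl' : I n f @[n --> U] --> wlim f.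
  by apply: (@getPex _ [set l : R | I n f @[n --> U] --> l]); exists l.
exact: (cvg_unique _ fl' fl).
Qed.

Lemma wlimD f g : cbound f -> cbound g -> wlim (fun x => f x + g x) = wlim f + wlim g.
Proof.
move=> /cbound_bmeas bf /cbound_bmeas bg; apply: wlim_eq.
have -> : (fun n => I n (fun x => f x + g x)) = fun n => I n f + I n g.
  apply/funext => n; rewrite /I -RintD; [|exact: bmeasM|exact: bmeasM].
  by congr Rintegral; apply/funext => x; rewrite mulrDl.
by apply: cvgD; exact: wlimP.
Qed.

Lemma wlimZ (c : R) f : cbound f -> wlim (fun x => c * f x) = c * wlim f.
Proof.
move=> /cbound_bmeas bf; apply: wlim_eq.
have -> : (fun n => I n (fun x => c * f x)) = fun n => c * I n f.
  apply/funext => n; rewrite /I -RintZ; last exact: bmeasM.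
  by congr Rintegral; apply/funext => x; rewrite mulrA.
by apply: cvgM; [exact: cvg_cst|exact: wlimP].
Qed.

Lemma wlim_ge0 f : cbound f -> (forall x, 0 <= f x) -> 0 <= wlim f.
Proof.
move=> /cbound_bmeas bf f0; have h := wlimP bf.
rewrite -(cvg_lim _ h)//; apply: limr_ge; first by apply/cvg_ex; exists (wlim f).
by apply: nearW => n; apply: Rint_ge0 => x; rewrite mulr_ge0.
Qed.

(** Points of [A] where [f_ n] exceeds [e] have a limit [l] along an ultrafilter; monotonicity in n
    and continuity of each f_m give f_m(l) >= e for all m. *)
Lemma dini (f_ : nat -> T -> R) (A : set T) (e : R) : compact A ->
  (forall n, continuous (f_ n)) -> (forall n x, f_ n.+1 x <= f_ n x) ->
  (forall x, f_ n x @[n --> \oo] --> (0 : R)) -> 0 < e ->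
  exists n, forall x, A x -> f_ n x <= e.
Proof.
move=> cA cf mono f0 e0; apply: contrapT => /forallNP nex.
have mono' n m x : (n <= m)%N -> f_ m x <= f_ n x.
  move=> /subnK <-; elim: (m - n)%N => [|j ih]; first by rewrite add0n.
  by rewrite addSn (le_trans (mono _ _)).
have /choice[x hx] : forall n, exists x, A x /\ e < f_ n x.
  move=> n; apply: contrapT => /forallNP h; apply: (nex n) => y Ay.
  by rewrite leNgt; apply/negP => fy; apply: (h y).
have [V fV] := free_ultra_exists; have PV := free_ultra_proper fV.
have UV : UltraFilter (x @ V) by apply: fmap_ultra; case: fV.
rewrite compact_ultra in cA.
have [|l [Al xl]] := cA (x @ V) UV; first by apply: nearW => n; case: (hx n).
have h m : e <= f_ m l.
  have fm : f_ m (x n) @[n --> V] --> f_ m l by exact: (cvg_comp _ _ xl (cf m l)).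
  rewrite -(cvg_lim _ fm)//; apply: limr_ge; first by apply/cvg_ex; exists (f_ m l).
  apply: (free_ultra_near fV); exists m => // n /= mn.
  by rewrite (le_trans (ltW (hx n).2))// mono'.
have : e <= 0.
  rewrite -(cvg_lim _ (f0 l))//; apply: limr_ge; first by apply/cvg_ex; exists 0.
  exact: nearW.
by rewrite leNgt e0.
Qed.

(** Tightness replaces compactness of the plane: Dini's theorem handles a box, where the weights
    have mass at most [K], and outside it the bound [M] of the first function meets a small mass. *)
Lemma wlim_dini (f_ : nat -> T -> R) : (forall n, cbound (f_ n)) ->
  (forall n x, f_ n.+1 x <= f_ n x) -> (forall x, f_ n x @[n --> \oo] --> (0 : R)) ->
  wlim (f_ n) @[n --> \oo] --> (0 : R).
Proof.
move=> cf mono f0.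
have mono' n m x : (n <= m)%N -> f_ m x <= f_ n x.
  move=> /subnK <-; elim: (m - n)%N => [|j ih]; first by rewrite add0n.
  by rewrite addSn (le_trans (mono _ _)).
have fge0 n x : 0 <= f_ n x.
  rewrite -(cvg_lim _ (f0 x))//; apply: limr_le; first by apply/cvg_ex; exists 0.
  by exists n => // m /= nm; exact: mono'.
have [_ [M fM]] := cf 0%N.
have M0 : 0 <= M := le_trans (normr_ge0 _) (fM (0, 0)).
have K0 : 0 <= K.
  have [n hn] := filter_ex wK; apply: le_trans hn; exact: Rint_ge0.
apply/cvgRP => e e0.
have e1 : 0 < e / (4 * (K + 1)) by rewrite divr_gt0// mulr_gt0// ltr_wpDl.
have e2 : 0 < e / (4 * (M + 1)) by rewrite divr_gt0// mulr_gt0// ltr_wpDl.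
have [B hB] := wtight e2.
have [N hN] := dini (@compact_inbox B) (fun n => (cf n).1) mono f0 e1.
exists N => // n /= Nn; rewrite subr0 ger0_norm; last exact: wlim_ge0.
have bf := cbound_bmeas (cf n); have h := wlimP bf.
apply: (@le_lt_trans _ _ (e / 2)); last by lra.
rewrite -(cvg_lim _ h)//; apply: limr_le; first by apply/cvg_ex; exists (wlim (f_ n)).
apply: filterS2 wK hB => j hK hB'.
have bo : bmeas (\1_(outbox B) : T -> R) by apply: bmeas_indic; exact: measurable_outbox.
have bwo := bmeasM (bw j) bo.
apply: (@le_trans _ _ (Rintegral (mu_ j) setT
    (fun x => e / (4 * (K + 1)) * w_ j x + M * (w_ j x * \1_(outbox B) x)))).
  apply: Rint_le; [exact: bmeasM|by apply: bmeasD; exact: bmeasZ|].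
  move=> x; rewrite indicE; have [|] := boolP (x \in outbox B).
    move=> _; rewrite mulr1; apply: ler_wpDl; first by rewrite mulr_ge0// ltW.
    rewrite ler_wpM2r// (le_trans (mono' 0%N n x _))//.
    by rewrite (le_trans (ler_norm _)).
  rewrite notin_setE => xB; rewrite mulr0 mulr0 addr0 ler_wpM2r//.
  by rewrite (le_trans (mono' N n x _))// hN.
rewrite RintD; [|exact: bmeasZ|exact: bmeasZ].
rewrite !RintZ//.
apply: (@le_trans _ _ (e / (4 * (K + 1)) * K + M * (e / (4 * (M + 1))))).
  by apply: lerD; [rewrite ler_wpM2l// ltW|rewrite ler_wpM2l].
have h1 : e / (4 * (K + 1)) * K <= e / 4.
  rewrite -[leRHS]mulr1 invfM mulrA -mulrA ler_wpM2l ?divr_ge0 ?(ltW e0)//.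
  by rewrite mulrC ler_pdivrMr ?mul1r ?lerDl// ltr_wpDl.
have h2 : M * (e / (4 * (M + 1))) <= e / 4.
  have Mp : 0 < M + 1 by rewrite ltr_wpDl.
  have -> : M * (e / (4 * (M + 1))) = e / 4 * (M / (M + 1)) by field; rewrite gt_eqF.
  by rewrite ler_piMr ?divr_ge0 ?(ltW e0)// ler_pdivrMr// mul1r lerDl.
by lra.
Qed.

Lemma limit_measure : exists m : {finite_measure set T -> \bar R},
  forall f, cbound f ->
    Rintegral (mu_ n) setT (fun x => f x * w_ n x) @[n --> U] --> Rintegral m setT f.
Proof.
have [m hm] := daniell_representation wlimD wlimZ wlim_ge0 wlim_dini.
by exists m => f cf; rewrite -hm//; apply: wlimP; exact: cbound_bmeas.
Qed.

End limit_measure.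

(** * Uniqueness of the representing charge *)

Section real_sequences.
Context {R : realType}.

Lemma bernoulli (x : R) n : 0 <= x -> 1 + n%:R * x <= (1 + x) ^+ n.
Proof.
move=> x0; elim: n => [|n ih]; first by rewrite mul0r addr0 expr0.
rewrite exprS; apply: le_trans (ler_wpM2l _ ih); last by rewrite addr_ge0.
have : 0 <= x * (n%:R * x) by rewrite !mulr_ge0.
rewrite -(natr1 n); nra.
Qed.

Lemma bernoulli_sub (x : R) n : 0 <= x <= 1 -> 1 - n%:R * x <= (1 - x) ^+ n.
Proof.
move=> /andP[x0 x1]; elim: n => [|n ih]; first by rewrite mul0r subr0 expr0.
rewrite exprS; apply: le_trans (ler_wpM2l _ ih); last by rewrite subr_ge0.
have : 0 <= x * (n%:R * x) by rewrite !mulr_ge0.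
rewrite -(natr1 n); nra.
Qed.

Lemma expr_sub_le (x : R) n : 0 <= x <= 1 -> (1 - x) ^+ n <= (1 + n%:R * x)^-1.
Proof.
move=> /andP[x0 x1]; have p : 0 < 1 + n%:R * x by rewrite ltr_wpDr// mulr_ge0.
rewrite -(ler_pM2r p) mulVf ?gt_eqF//.
apply: le_trans (ler_wpM2l _ (bernoulli n x0)) _; first by rewrite exprn_ge0// subr_ge0.
rewrite -exprMn exprn_ile1//; nra.
Qed.

Lemma cvg_natr_geometric (x : R) : 0 <= x < 1 -> n%:R * x ^+ n @[n --> \oo] --> (0 : R).
Proof.
move=> /andP[x0 x1]; have [->|xn] := eqVneq x 0.
  apply/cvgrPdist_lt => e e0; exists 1%N => // -[//|n] _ /=.
  by rewrite exprS mul0r mulr0 subrr normr0.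
have xp : 0 < x by rewrite lt_def xn.
(* With x^n = y^n y^n, Bernoulli's inequality bounds n y^n and the other factor tends to 0. *)
pose y := Num.sqrt x; have y0 : 0 < y by rewrite sqrtr_gt0.
have y1 : y < 1 by rewrite -sqrtr1 ltr_sqrt.
have yx : x = y * y by rewrite -expr2 sqr_sqrtr.
pose e := y^-1 - 1; have e0 : 0 < e by rewrite subr_gt0 invf_gt1.
have bnd n : n%:R * y ^+ n <= e^-1.
  have := bernoulli n (ltW e0).
  have -> : 1 + e = y^-1 by rewrite /e addrC subrK.
  rewrite exprVn => h.
  have p : 0 < y ^+ n by rewrite exprn_gt0.
  rewrite -(ler_pM2r e0) mulVf ?gt_eqF// mulrAC -(ler_pM2r (x := (y ^+ n)^-1)) ?invr_gt0//.
  rewrite mulfK ?gt_eqF// mul1r; lra.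
apply: (@squeeze_cvgr _ _ _ _ (fun=> 0) (fun n => e^-1 * y ^+ n)).
- apply: nearW => n; rewrite mulr_ge0 ?exprn_ge0//=.
  by rewrite yx exprMn mulrA ler_wpM2r// exprn_ge0// ltW.
- exact: cvg_cst.
- rewrite -[X in _ --> X](mulr0 e^-1); apply: cvgM; first exact: cvg_cst.
  by apply: cvg_expr; rewrite ger0_norm// ltW.
Qed.

(* The exponent makes [p ^+ n] times it tend to [0] for [p < 1/2], and to infinity
   otherwise, the factor [n] settling the case [p = 1/2]. *)
Lemma cvg_threshold (p : R) : 0 <= p <= 1 ->
  (1 - p ^+ n) ^+ (2 ^ n * n) @[n --> \oo] --> ((p < 2^-1)%R%:R : R).
Proof.
move=> /andP[p0 p1].
have b n : 0 <= p ^+ n <= 1 by rewrite exprn_ge0// exprn_ile1.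
have e n : (2 ^ n * n)%:R * p ^+ n = n%:R * (2 * p) ^+ n.
  by rewrite natrM natrX exprMn; ring.
have b' n : 0 <= 1 - p ^+ n <= 1.
  by have /andP[h1 h2] := b n; apply/andP; split; lra.
case: ltP => ph.
  apply: (@squeeze_cvgr _ _ _ _ (fun n => 1 - n%:R * (2 * p) ^+ n) (fun=> 1)).
  - apply: nearW => n; have /andP[h1 h2] := b' n.
    by rewrite exprn_ile1// andbT -e; exact: bernoulli_sub.
  - rewrite -[X in _ --> X]subr0; apply: cvgB; first exact: cvg_cst.
    apply: cvg_natr_geometric; apply/andP; split; lra.
  - exact: cvg_cst.
apply: (@squeeze_cvgr _ _ _ _ (fun=> 0) (fun n => (n.+1%:R)^-1)).
- apply: nearW => n; have /andP[h1 h2] := b' n; rewrite exprn_ge0//=.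
  apply: le_trans (expr_sub_le _ (b n)) _.
  rewrite lef_pV2 ?posrE ?ltr0n//; last first.
    by rewrite ltr_wpDr// mulr_ge0//; case/andP: (b n).
  rewrite e -nat1r lerD2l ler_peMr// exprn_ege1//; lra.
- exact: cvg_cst.
- exact: cvg_harmonic.
Qed.

Lemma sum_ltn_trunc (x : R) n : 0 <= x -> x <= n%:R ->
  \sum_(i < n) ((i.+1%:R <= x)%R%:R : R) = (Num.truncn x)%:R.
Proof.
move=> x0 xn; have h i : (i.+1%:R <= x) = (i < Num.truncn x)%N.
  by rewrite -truncn_ge_nat.
under eq_bigr do rewrite h; rewrite -natr_sum; congr (_%:R).
have tn : (Num.truncn x <= n)%N.
  by have /andP[h1 _] := truncn_itv x0; rewrite -(ler_nat R) (le_trans h1).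
rewrite -(big_mkord xpredT (fun i => (i < Num.truncn x)%N : nat)).
rewrite (big_cat_nat (leq0n _) tn) //= big_mkord [X in (X + _)%N](eq_bigr (fun=> 1%N)); last first.
  by case=> i /= -> _.
rewrite sum1_card card_ord big_nat big1 ?addn0// => i /andP[h1 _].
by rewrite ltnNge h1.
Qed.

End real_sequences.

(** * Multipliers of spaces closed under bounded limits *)

Section bounded_closed.
Context {d : measure_display} {T : measurableType d} {R : realType}.
Implicit Types (u v f g : T -> CC R) (V : (T -> CC R) -> Prop).

Lemma cbmeas_nm_le u (M : R) : measurable_fun setT (fun x => complex.Re (u x)) ->
  measurable_fun setT (fun x => complex.Im (u x)) -> (forall x, nm (u x) <= M) -> cbmeas u.
Proof.
move=> m1 m2 uM; split; split => //; exists M => x; apply: le_trans (uM x).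
  exact: nm_Re.
exact: nm_Im.
Qed.

Lemma cbmeas_lim (u_ : nat -> T -> CC R) u (M : R) :
  (forall n, cbmeas (u_ n)) -> (forall n x, nm (u_ n x) <= M) ->
  (forall x, u_ n x @[n --> \oo] --> u x) -> cbmeas u.
Proof.
move=> cu uM uu; apply: (@cbmeas_nm_le u M).
- apply: (@measurable_fun_cvg _ _ _ _ (fun n x => complex.Re (u_ n x))).
    by move=> n; have [[]] := cu n.
  by move=> x _; exact: cvg_Re (uu x).
- apply: (@measurable_fun_cvg _ _ _ _ (fun n x => complex.Im (u_ n x))).
    by move=> n; have [_ []] := cu n.
  by move=> x _; exact: cvg_Im (uu x).
- move=> x; have h : nm (u_ n x) @[n --> \oo] --> nm (u x) by exact: cvg_nm (uu x).
  rewrite -(cvg_lim _ h)//; apply: limr_le; first by apply/cvg_ex; exists (nm (u x)).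
  by apply: nearW => n; exact: uM.
Qed.

Definition bclosed V := [/\ forall u, V u -> cbmeas u,
  forall u v, V u -> V v -> V (fun x => u x + v x),
  forall (c : CC R) u, V u -> V (fun x => c * u x) &
  forall (u_ : nat -> T -> CC R) u (M : R), (forall n, V (u_ n)) ->
    (forall n x, nm (u_ n x) <= M) -> (forall x, u_ n x @[n --> \oo] --> u x) -> V u].

(* The multipliers of [V] form an algebra closed under bounded limits, even though
   [V] is not closed under products; hence the sets whose indicators are
   multipliers form a sigma-algebra. *)
Definition multiplier V f := cbmeas f /\ forall g, V g -> V (fun x => f x * g x).

Section multipliers.
Context (V : (T -> CC R) -> Prop) (Vc : bclosed V).

Lemma multiplier_cst (c : CC R) : multiplier V (fun=> c).
Proof. by have [_ _ VZ _] := Vc; split; [exact: cbmeas_cst|move=> g; exact: VZ]. Qed.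

Lemma multiplierD f g : multiplier V f -> multiplier V g ->
  multiplier V (fun x => f x + g x).
Proof.
have [_ VD _ _] := Vc; move=> [cf fV] [cg gV]; split; first exact: cbmeasD.
move=> u Vu; under eq_fun do rewrite mulrDl; apply: VD; [exact: fV|exact: gV].
Qed.

Lemma multiplierM f g : multiplier V f -> multiplier V g ->
  multiplier V (fun x => f x * g x).
Proof.
move=> [cf fV] [cg gV]; split; first exact: cbmeasM.
by move=> u Vu; under eq_fun do rewrite -mulrA; apply: fV; exact: gV.
Qed.

Lemma multiplierZ (c : CC R) f : multiplier V f -> multiplier V (fun x => c * f x).
Proof. by move=> mf; apply: multiplierM => //; exact: multiplier_cst. Qed.

Lemma multiplierB f g : multiplier V f -> multiplier V g ->
  multiplier V (fun x => f x - g x).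
Proof.
move=> mf mg; under eq_fun do rewrite -mulN1r.
by apply: multiplierD => //; exact: multiplierZ.
Qed.

Lemma multiplierX f n : multiplier V f -> multiplier V (fun x => f x ^+ n).
Proof.
move=> mf; elim: n => [|n ih].
  by under eq_fun do rewrite expr0; exact: multiplier_cst.
by under eq_fun do rewrite exprS; exact: multiplierM.
Qed.

Lemma multiplier_sum n (f_ : nat -> T -> CC R) : (forall i, multiplier V (f_ i)) ->
  multiplier V (fun x => \sum_(i < n) f_ i x).
Proof.
move=> mf; elim: n => [|n ih].
  by under eq_fun do rewrite big_ord0; exact: multiplier_cst.
by under eq_fun do rewrite big_ord_recr; exact: multiplierD.
Qed.

Lemma multiplier_lim (u_ : nat -> T -> CC R) u (M : R) :
  (forall n, multiplier V (u_ n)) -> (forall n x, nm (u_ n x) <= M) ->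
  (forall x, u_ n x @[n --> \oo] --> u x) -> multiplier V u.
Proof.
move=> mu uM uu; split.
  by apply: (cbmeas_lim _ uM uu) => n; have [] := mu n.
move=> g Vg; have [Vb _ _ Vl] := Vc; have [N gN] := cbmeas_bounded (Vb _ Vg).
apply: (Vl (fun n x => u_ n x * g x) _ (M * N)).
- by move=> n; have [_] := mu n; apply.
- by move=> n x; rewrite nmM ler_pM ?nm_ge0.
- by move=> x; apply: (cvgCM (uu x)); exact: cvgC_cst.
Qed.

Lemma multiplier_real_lim (u_ : nat -> T -> R) (u : T -> R) (M : R) :
  (forall n, multiplier V (fun x => (u_ n x)%:C)) -> (forall n x, `|u_ n x| <= M) ->
  (forall x, u_ n x @[n --> \oo] --> u x) -> multiplier V (fun x => (u x)%:C).
Proof.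
move=> mu uM uu; apply: (multiplier_lim mu (M := M)).
  by move=> n x; rewrite nmR.
by move=> x; exact: (cvg_realC (uu x)).
Qed.

(** The polynomials of [cvg_threshold] in [p] take values in [0, 1] and converge pointwise to the
    indicator, as closure under bounded limits requires. *)
Lemma multiplier_threshold (p : T -> R) : (forall x, 0 <= p x <= 1) ->
  multiplier V (fun x => (p x)%:C) ->
  multiplier V (fun x => (\1_[set y | p y < 2^-1] x)%:C).
Proof.
move=> pb mp.
apply: (@multiplier_real_lim (fun n x => (1 - p x ^+ n) ^+ (2 ^ n * n)) _ 1).
- move=> n; under eq_fun do rewrite rmorphXn rmorphB rmorph1 rmorphXn.
  apply: multiplierX; apply: multiplierB; first exact: multiplier_cst.
  exact: multiplierX.
- move=> n x; have /andP[p0 p1] := pb x.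
  have h1 := exprn_ge0 n p0; have h2 : p x ^+ n <= 1 by rewrite exprn_ile1.
  have h3 : 0 <= 1 - p x ^+ n by lra.
  by rewrite ger0_norm ?exprn_ge0// exprn_ile1//; lra.
- move=> x; rewrite indicE [_ \in _](_ : _ = (p x < 2^-1)); first exact: cvg_threshold.
  by apply/idP/idP; rewrite inE.
Qed.

Definition multiplier_set (A : set T) :=
  measurable A /\ multiplier V (fun x => (\1_A x)%:C).

Lemma multiplier_setT : multiplier_set setT.
Proof.
by split => //; rewrite indicT; exact: (multiplier_cst 1).
Qed.

Lemma multiplier_setC (A : set T) : multiplier_set A -> multiplier_set (~` A).
Proof.
move=> [mA hA]; split; first exact: measurableC.
rewrite (_ : (fun x => _) = fun x => 1 - (\1_A x)%:C); last first.
  apply/funext => x; rewrite !indicE in_setC.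
  by case: (x \in A); rewrite /= ?subrr ?subr0.
by apply: multiplierB => //; exact: multiplier_cst.
Qed.

Lemma multiplier_setI (A B : set T) : multiplier_set A -> multiplier_set B ->
  multiplier_set (A `&` B).
Proof.
move=> [mA hA] [mB hB]; split; first exact: measurableI.
rewrite indicI; under eq_fun do rewrite /GRing.mul /= -/(GRing.mul _ _) rmorphM.
exact: multiplierM.
Qed.

Lemma multiplier_bigcap (F : nat -> set T) : (forall n, multiplier_set (F n)) ->
  multiplier_set (\bigcap_n F n).
Proof.
move=> hF; split; first by apply: bigcapT_measurable => n; case: (hF n).
pose G n := \big[setI/setT]_(i < n) F i.
have hG n : multiplier_set (G n).
  rewrite /G; elim: n => [|n ih]; first by rewrite big_ord0; exact: multiplier_setT.
  by rewrite big_ord_recr; exact: multiplier_setI.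
apply: (@multiplier_real_lim (fun n => \1_(G n)) _ 1).
- by move=> n; case: (hG n).
- by move=> n x; rewrite indicE; case: (_ \in _); rewrite ?normr1 ?normr0.
- move=> x; have [h|/existsNP[i h]] := pselect (forall i, F i x).
    rewrite indicE mem_set//; apply: cvg_near_cst; apply: nearW => n.
    rewrite indicE mem_set// /G.
    by elim: n => [|n ih]; [rewrite big_ord0|rewrite big_ord_recr].
  rewrite indicE memNset; last by move=> /(_ i I).
  apply: cvg_near_cst; exists i.+1 => // n /= ni.
  rewrite indicE memNset// /G => hn; apply: h.
  move: hn; rewrite (bigD1 (Ordinal ni)) //= => -[]; exact.
Qed.

Lemma multiplier_sigma_algebra : sigma_algebra setT multiplier_set.
Proof.
split.
- by rewrite -setCT; apply: multiplier_setC; exact: multiplier_setT.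
- by move=> A mA; rewrite setTD; exact: multiplier_setC.
- move=> A mA; rewrite -[\bigcup_k _]setCK setC_bigcup; apply: multiplier_setC.
  by apply: multiplier_bigcap => n; exact: multiplier_setC.
Qed.

(** The number of i < n with n f >= i + 1 is the integer part of n f, so the averages of these
    indicators are within 1/n of [f]. *)
Lemma multiplier_measurable (f : T -> R) :
  (forall A, measurable A -> multiplier_set A) ->
  measurable_fun setT f -> (forall x, 0 <= f x <= 1) -> multiplier V (fun x => (f x)%:C).
Proof.
move=> hA mf fb.
pose A (n i : nat) := [set x | i.+1%:R <= n%:R * f x].
have mA n i : measurable (A n i).
  have mg : measurable_fun setT (fun x => n%:R * f x) by apply: measurable_funM.
  have := mg measurableT _ (measurable_itv `[i.+1%:R, +oo[); rewrite setTI.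
  by congr measurable; apply/seteqP; split => x; rewrite /A /= in_itv /= andbT.
have E n x : \sum_(i < n) (\1_(A n i) x : R) = (Num.truncn (n%:R * f x))%:R.
  have /andP[f0 f1] := fb x.
  rewrite -(@sum_ltn_trunc _ _ n) ?mulr_ge0//; last by rewrite ler_piMr.
  apply: eq_bigr => i _; rewrite indicE; congr (nat_of_bool _)%:R.
  by apply/idP/idP; rewrite inE.
apply: (@multiplier_real_lim (fun n x => n%:R^-1 * \sum_(i < n) \1_(A n i) x) _ 1).
- move=> n; under eq_fun do rewrite rmorphM rmorph_sum /=.
  apply: multiplierZ; apply: (@multiplier_sum n (fun i x => (\1_(A n i) x)%:C)) => i.
  by case: (hA _ (mA n i)).
- move=> n x; have /andP[f0 f1] := fb x.
  rewrite E ger0_norm ?mulr_ge0 ?invr_ge0//.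
  have /andP[h _] := truncn_itv (mulr_ge0 (ler0n R n) f0).
  case: n h => [|n] h; first by rewrite invr0 mul0r ler01.
  by rewrite ler_pdivrMl ?ltr0n// mulr1 (le_trans h)// ler_piMr.
- move=> x; have /andP[f0 f1] := fb x.
  (* The shift discards n = 0, where the inverse takes its default value 0. *)
  rewrite -cvg_shiftS; apply/cvgrPdist_le => e e0.
  apply: filterS (near_infty_natSinv_lt (PosNum e0)) => n /= h; rewrite E.
  have /andP[h1 h2] := truncn_itv (mulr_ge0 (ler0n R n.+1) f0).
  apply: le_trans (ltW h); have n0 : 0 < (n.+1)%:R :> R by rewrite ltr0n.
  rewrite -(ler_pM2l n0) -{1}(gtr0_norm n0) -normrM mulrBr mulVKf ?gt_eqF// mulfV ?gt_eqF//.
  by rewrite ger0_norm ?subr_ge0// lerBlDr addrC natr1 ltW.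
Qed.

End multipliers.

End bounded_closed.

(** * Functionals continuous under bounded convergence *)

Section bounded_functionals.
Context {d : measure_display} {T : measurableType d} {R : realType}.
Implicit Types (f g : T -> R) (u v : T -> CC R) (L : (T -> R) -> R).

(** Continuity under bounded convergence is countable additivity for functionals that need not be
    positive; it survives differences and densities, and thus covers charges. *)
Definition bfunctional L := [/\
  forall f g, bmeas f -> bmeas g -> L (fun x => f x + g x) = L f + L g,
  forall (c : R) f, bmeas f -> L (fun x => c * f x) = c * L f &
  forall (f_ : nat -> T -> R) f (M : R), (forall n, bmeas (f_ n)) ->
    (forall n x, `|f_ n x| <= M) -> (forall x, f_ n x @[n --> \oo] --> f x) ->
    L (f_ n) @[n --> \oo] --> L f].

Lemma bfunctional_Rintegral (m : {finite_measure set T -> \bar R}) :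
  bfunctional (Rintegral m setT).
Proof.
split; [exact: RintD|exact: RintZ|] => f_ f M bf fM ff.
by apply: Rint_dominated fM ff => n; case: (bf n).
Qed.

Lemma bfunctionalB L1 L2 : bfunctional L1 -> bfunctional L2 ->
  bfunctional (fun f => L1 f - L2 f).
Proof.
move=> [D1 Z1 l1] [D2 Z2 l2]; split.
- by move=> f g bf bg; rewrite D1// D2//; ring.
- by move=> c f bf; rewrite Z1// Z2//; ring.
- by move=> f_ f M bf fM ff; apply: cvgB; [exact: l1 fM ff|exact: l2 fM ff].
Qed.

Lemma bfunctional_density (g : T -> R) L : bmeas g -> bfunctional L ->
  bfunctional (fun f => L (fun x => f x * g x)).
Proof.
move=> bg [LD LZ Ll]; split.
- move=> f h bf bh; rewrite -LD; [|exact: bmeasM|exact: bmeasM].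
  by congr L; apply/funext => x; rewrite mulrDl.
- move=> c f bf; rewrite -LZ; last exact: bmeasM.
  by congr L; apply/funext => x; rewrite mulrA.
- move=> f_ f M bf fM ff; have [_ [N gN]] := bg.
  apply: (Ll (fun n x => f_ n x * g x) _ (M * N)).
  + by move=> n; exact: bmeasM.
  + by move=> n x; rewrite normrM ler_pM.
  + by move=> x; apply: cvgM; [exact: ff|exact: cvg_cst].
Qed.

Definition cfunctional L u : CC R :=
  L (fun x => complex.Re (u x)) +i* L (fun x => complex.Im (u x)).

Lemma bclosed_cfunctional L1 L2 : bfunctional L1 -> bfunctional L2 ->
  bclosed (fun u => cbmeas u /\ cfunctional L1 u = cfunctional L2 u).
Proof.
move=> [D1 Z1 l1] [D2 Z2 l2].
have subE L (LD : forall f g, bmeas f -> bmeas g -> L (fun x => f x + g x) = L f + L g)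
  (LZ : forall (c : R) f, bmeas f -> L (fun x => c * f x) = c * L f)
  (c e : R) f g : bmeas f -> bmeas g -> L (fun x => c * f x + e * g x) = c * L f + e * L g.
  by move=> bf bg; rewrite LD ?LZ//; exact: bmeasZ.
split.
- by move=> u [].
- move=> u v [cu eu] [cv ev]; split; first exact: cbmeasD.
  move: cu cv eu ev => [u1 u2] [v1 v2] [e1 e2] [e3 e4].
  have E L : cfunctional L (fun x => u x + v x) = L (fun x => complex.Re (u x) + complex.Re (v x))
      +i* L (fun x => complex.Im (u x) + complex.Im (v x)).
    by congr (L _ +i* L _); apply/funext => x; rewrite ?cReD ?cImD.
  by rewrite !E D1// D2// D1// D2// e1 e2 e3 e4.
- move=> c u [cu eu]; split; first exact: (cbmeasM (cbmeas_cst c)).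
  move: cu eu => [u1 u2] [e1 e2].
  have E L : cfunctional L (fun x => c * u x) =
      L (fun x => complex.Re c * complex.Re (u x) + (- complex.Im c) * complex.Im (u x)) +i*
      L (fun x => complex.Re c * complex.Im (u x) + complex.Im c * complex.Re (u x)).
    rewrite /cfunctional; congr (L _ +i* L _); apply/funext => x; rewrite ?cReM ?cImM ?mulNr//.
  by rewrite !E !(subE L1)// !(subE L2)// e1 e2.
- move=> u_ u M hu uM uu; have cu n : cbmeas (u_ n) by case: (hu n).
  split; first exact: cbmeas_lim uM uu.
  have c1 L (Ll : forall (f_ : nat -> T -> R) f (M : R), (forall n, bmeas (f_ n)) ->
    (forall n x, `|f_ n x| <= M) -> (forall x, f_ n x @[n --> \oo] --> f x) ->
    L (f_ n) @[n --> \oo] --> L f) : cfunctional L (u_ n) @[n --> \oo] --> cfunctional L u.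
    apply: cvg_ReIm => /=.
      apply: (Ll _ _ M) => [n|n x|x]; first by case: (cu n).
        exact: le_trans (nm_Re _) (uM n x).
      exact: cvg_Re (uu x).
    apply: (Ll _ _ M) => [n|n x|x]; first by case: (cu n).
      exact: le_trans (nm_Im _) (uM n x).
    exact: cvg_Im (uu x).
  apply: (@cvgC_unique _ _ \oo _ (fun n => cfunctional L1 (u_ n))); first exact: c1 l1.
  have -> : (fun n => cfunctional L1 (u_ n)) = (fun n => cfunctional L2 (u_ n)).
    by apply/funext => n; case: (hu n).
  exact: c1 l2.
Qed.

(** A function whose multiplication maps the family [Q] into itself is a multiplier of the space
    formed here. In this way a space that is not an algebra yields one with many multipliers. *)
Lemma bclosed_family (V : (T -> CC R) -> Prop) (I : Type) (P : I -> Prop)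
    (Q : I -> T -> CC R) : bclosed V -> (forall i, P i -> cbmeas (Q i)) ->
  bclosed (fun u => cbmeas u /\ forall i, P i -> V (fun x => u x * Q i x)).
Proof.
move=> [Vb VD VZ Vl] cQ; split.
- by move=> u [].
- move=> u v [cu Vu] [cv Vv]; split; first exact: cbmeasD.
  by move=> i Pi; under eq_fun do rewrite mulrDl; apply: VD; [exact: Vu|exact: Vv].
- move=> c u [cu Vu]; split; first exact: (cbmeasM (cbmeas_cst c)).
  by move=> i Pi; under eq_fun do rewrite -mulrA; apply: VZ; exact: Vu.
- move=> u_ u M hu uM uu; split.
    by apply: (cbmeas_lim _ uM uu) => n; case: (hu n).
  move=> i Pi; have [N QN] := cbmeas_bounded (cQ i Pi).
  apply: (Vl (fun n x => u_ n x * Q i x) _ (M * N)).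
  + by move=> n; case: (hu n) => _; exact.
  + by move=> n x; rewrite nmM ler_pM ?nm_ge0.
  + by move=> x; apply: (cvgCM (uu x)); exact: cvgC_cst.
Qed.

Lemma cfunctional_real L f : bfunctional L -> cfunctional L (fun x => (f x)%:C) = (L f)%:C.
Proof.
move=> [_ LZ _]; apply: complex_eqP => //=.
by have := LZ 0 _ (bmeas_cst 0); rewrite !mul0r.
Qed.

(** [V] need not be stable under products with indicators. The space [W] of functions all of whose
    products with indicators lie in [V] is, because indicators multiply by intersecting sets; taking
    the whole space as the set returns to [V]. *)
Lemma bclosed_measurable (V : (T -> CC R) -> Prop) f : bclosed V ->
  (forall A, measurable A -> V (fun x => (\1_A x)%:C)) -> bmeas f -> V (fun x => (f x)%:C).
Proof.
move=> Vc VA [mf [M fM]]; have [_ VD VZ _] := Vc.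
pose W u := cbmeas u /\ forall A, measurable A -> V (fun x => u x * (\1_A x)%:C).
have Wc : bclosed W.
  by apply: (bclosed_family Vc) => A mA; apply: cbmeas_real; exact: bmeas_indic.
have iW A : measurable A -> multiplier_set W A.
  move=> mA; split => //; have cA := cbmeas_real (bmeas_indic (R := R) mA).
  split => // g [cg Wg]; split; first exact: cbmeasM.
  move=> B mB; have := Wg _ (measurableI _ _ mA mB); congr V; apply/funext => x.
  rewrite !indicE in_setI; case: (x \in A); case: (x \in B);
  by rewrite /= ?rmorph1 ?rmorph0 ?mulr1 ?mul1r ?mulr0 ?mul0r.
have W1 : W (fun=> 1).
  by split; [exact: cbmeas_cst|move=> A mA; under eq_fun do rewrite mul1r; exact: VA].
pose N := M + 1; have M0 : 0 <= M := le_trans (normr_ge0 _) (fM point).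
have N0 : 0 < N by rewrite /N ltr_pwDr.
pose g x := (f x + N) / (2 * N).
have Vg : V (fun x => (g x)%:C).
  have [|x|_ /(_ _ W1)[_ /(_ _ measurableT)]] := multiplier_measurable Wc iW (f := g).
  - by apply: measurable_funM => //; exact: measurable_funD.
  - have := fM x; rewrite ler_norml => /andP[h1 h2].
    rewrite /g ler_pdivlMr ?mulr_gt0// ler_pdivrMr ?mulr_gt0// mul0r mul1r /N.
    by apply/andP; split; lra.
  - by congr V; apply/funext => x; rewrite indicT !mulr1.
rewrite (_ : (fun x => _) = fun x => (2 * N)%:C * (g x)%:C + (- N)%:C * (\1_setT x)%:C); last first.
  apply/funext => x; rewrite indicT mulr1 -rmorphM -rmorphD; congr (_%:C).
  by rewrite /g mulrC divfK ?mulf_neq0 ?gt_eqF// addrK.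
by apply: VD; apply: VZ => //; exact: VA.
Qed.

Lemma bfunctional_eq L1 L2 f : bfunctional L1 -> bfunctional L2 ->
  (forall A, measurable A -> L1 \1_A = L2 \1_A) -> bmeas f -> L1 f = L2 f.
Proof.
move=> b1 b2 LA bf.
have [|_] := bclosed_measurable (bclosed_cfunctional b1 b2) _ bf.
  move=> A mA; split; first by apply: cbmeas_real; exact: bmeas_indic.
  by rewrite !cfunctional_real// LA.
by rewrite !cfunctional_real// => -[].
Qed.

End bounded_functionals.

(** * Resolvents as multipliers *)

Section resolvent_multipliers.
Context {d : measure_display} {T : measurableType d} {R : realType}.
Implicit Types (u v f g : T -> CC R) (z w : CC R) (c : T -> R).

Definition sqrt1p (s : R) : R := Num.sqrt (1 + s ^+ 2).

Lemma sqrt1p_gt0 s : 0 < sqrt1p s.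
Proof. by rewrite sqrtr_gt0 ltr_pwDl// sqr_ge0. Qed.

Lemma sqrt1p_le s : sqrt1p s <= 1 + `|s|.
Proof.
have h : 0 <= 1 + `|s| by rewrite addr_ge0.
rewrite -(ger0_norm h) -sqrtr_sqr ler_wsqrtr// sqrrD expr1n -[s ^+ 2]real_normK ?num_real//.
by rewrite lerD2r lerDl mulrn_wge0// mul1r.
Qed.

Lemma measurable_sqrt1p : measurable_fun setT (sqrt1p : R -> R).
Proof.
apply: continuous_measurable_fun => x.
apply: (continuous_comp (f := fun y : R => 1 + y ^+ 2)).
  by apply: cvgD; [exact: cvg_cst|exact: exprn_continuous].
exact: sqrt_continuous.
Qed.

(** One factor of the kernel in the integral representation. The square root occurs once per
    variable, so kernels are not closed under products, but their products with plain resolvents can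
    be treated by partial fractions. *)
Definition root_kernel z (s : R) : CC R := (sqrt1p s)%:C * (z - s%:C)^-1.

Lemma nm_root_kernel z s : nonreal z ->
  nm (root_kernel z s) <= (1 + nm z) / `|complex.Im z| + 1.
Proof.
move=> z0; have n0 := subrC_neq0 s z0; have h := nm_resolvent s z0.
rewrite nmM nmR ger0_norm ?(ltW (sqrt1p_gt0 s))//.
apply: le_trans (ler_wpM2r (nm_ge0 _) (sqrt1p_le s)) _; rewrite mulrDl mul1r mulrDl mul1r -addrA.
apply: lerD => //.
have -> : `|s| * nm ((z - s%:C)^-1 : CC R) = nm (z * (z - s%:C)^-1 - 1).
  by rewrite -nmR -nmM; congr nm; apply: (mulIf n0); rewrite mulrBl -!mulrA mulVf// !mulr1; ring.
apply: le_trans (nmB _ _) _; rewrite nm1 nmM lerD2r ler_wpM2l ?nm_ge0//.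
Qed.

Lemma cbmeas_root_kernel c z : measurable_fun setT c -> nonreal z ->
  cbmeas (fun x => root_kernel z (c x)).
Proof.
move=> mc z0; have [[m1 _] [m2 _]] := cbmeas_resolvent mc z0.
have mr := measurableT_comp measurable_sqrt1p mc.
apply: (@cbmeas_nm_le _ _ _ _ ((1 + nm z) / `|complex.Im z| + 1)).
- by under eq_fun do rewrite cReZ; exact: measurable_funM.
- by under eq_fun do rewrite cImZ; exact: measurable_funM.
- by move=> x; exact: nm_root_kernel.
Qed.

Definition resolvents c (zs : seq (CC R)) (x : T) : CC R :=
  \prod_(z <- zs) (z - (c x)%:C)^-1.

Lemma resolvents_cons c z zs x :
  resolvents c (z :: zs) x = (z - (c x)%:C)^-1 * resolvents c zs x.
Proof. by rewrite /resolvents big_cons. Qed.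

Definition all_in (D : set (CC R)) (zs : seq (CC R)) := forall z, z \in zs -> D z.

Lemma cbmeas_resolvents c zs : measurable_fun setT c -> all_in (@nonreal R) zs ->
  cbmeas (resolvents c zs).
Proof.
move=> mc; elim: zs => [|z zs ih] hz.
  by under [resolvents c [::]]eq_fun do rewrite /resolvents big_nil; exact: cbmeas_cst.
rewrite (funext (resolvents_cons c z zs)); apply: cbmeasM.
  by apply: cbmeas_resolvent => //; apply: hz; rewrite inE eqxx.
by apply: ih => w hw; apply: hz; rewrite inE hw orbT.
Qed.

Context (a b : R) (a0 : 0 < a) (b0 : 0 < b).

Lemma cones_scale (t : R) z : 1 <= t -> cones a b z -> cones a b (t%:C * z).
Proof.
have h (u : CC R) : 1 <= t -> cone a b u -> cone a b (t%:C * u).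
  move=> t1 [u1 u2 u3]; have t0 : 0 < t by lra.
  split; rewrite ?cImZ ?cReZ ?mulr_gt0//.
    by rewrite normrM gtr0_norm// mulrCA ltr_pM2l.
  by rewrite (lt_le_trans u3)// ler_peMl// ltW.
move=> t1 [zc|zc]; [left|right]; first exact: h.
by rewrite rmorphM /=; move: (h _ t1 zc); congr (cone _ _ (_ * _)); rewrite /= oppr0.
Qed.

(* Distinct poles are separated by partial fractions, and a multiple pole is a
   limit of distinct ones. *)
Lemma resolvent_chain (V : (T -> CC R) -> Prop) c (psi : T -> CC R) zs z :
  bclosed V -> measurable_fun setT c -> cbmeas psi ->
  (forall z, cones a b z -> V (fun x => root_kernel z (c x) * psi x)) ->
  cones a b z -> all_in (cones a b) zs ->
  V (fun x => root_kernel z (c x) * resolvents c zs x * psi x).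
Proof.
move=> Vc mc cpsi hV; have [Vb VD VZ Vl] := Vc.
have nr (u : CC R) : cones a b u -> nonreal u := cones_nonreal (ltW b0).
elim: zs z => [|z2 zs ih] z zc hz.
  under eq_fun do rewrite /resolvents big_nil mulr1; exact: hV.
have z2c : cones a b z2 by apply: hz; rewrite inE eqxx.
have hzs : all_in (cones a b) zs by move=> w hw; apply: hz; rewrite inE hw orbT.
have neq z1 : cones a b z1 -> z1 != z ->
    V (fun x => root_kernel z (c x) * resolvents c (z1 :: zs) x * psi x).
  move=> z1c zz; rewrite (_ : (fun x => _) = fun x => (z1 - z)^-1 *
      (root_kernel z (c x) * resolvents c zs x * psi x +
       (-1) * (root_kernel z1 (c x) * resolvents c zs x * psi x))); last first.
    apply/funext => x; rewrite resolvents_cons /root_kernel.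
    have z0 := subrC_neq0 (c x) (nr z zc); have z10 := subrC_neq0 (c x) (nr z1 z1c).
    have zz0 : z1 - z != 0 by rewrite subr_eq0.
    by field; rewrite z0 z10 zz0.
  by apply: (VZ); apply: VD; [exact: ih|apply: VZ; exact: ih].
have [ez|] := eqVneq z2 z; last exact: neq.
rewrite {}ez {z2 z2c hz}.
have z0 := nr z zc; have zi : 0 < `|complex.Im z| by rewrite normr_gt0.
have [K hK] := cbmeas_bounded (cbmeas_resolvents mc (fun w hw => nr w (hzs w hw))).
have [L hL] := cbmeas_bounded cpsi; have [N hN] := cbmeas_bounded (cbmeas_root_kernel mc z0).
(* Scaling by a factor greater than 1 stays in the cone and gives poles distinct from [z] that tend
   to it. *)
pose t n : R := 1 + n.+1%:R^-1.
have t1 n : 1 <= t n by rewrite lerDl.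
have tc n : cones a b ((t n)%:C * z) by exact: cones_scale.
apply: (Vl (fun n x => root_kernel z (c x) * resolvents c ((t n)%:C * z :: zs) x * psi x) _
  (N * (`|complex.Im z|^-1 * K) * L)).
- move=> n; apply: neq => //; rewrite -subr_eq0 -{2}(mul1r z) -mulrBl mulf_neq0//.
    have -> : (t n)%:C - 1 = (n.+1%:R^-1)%:C :> CC R by rewrite /t rmorphD addrC addKr.
    by rewrite -nm_gt0 nmR normr_gt0 invr_eq0 pnatr_eq0.
  by apply: contra z0 => /eqP ->; rewrite /= eqxx.
- move=> n x; rewrite !(nmM _ (psi x)) ler_pM ?nm_ge0// nmM ler_pM ?nm_ge0//.
  rewrite resolvents_cons nmM ler_pM ?nm_ge0//.
  apply: le_trans (nm_resolvent (c x) (nr _ (tc n))) _.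
  rewrite lef_pV2 ?posrE ?normr_gt0//; last exact: (nr _ (tc n)).
  by rewrite cImZ normrM ler_peMl// ger0_norm// (le_trans ler01).
- move=> x; apply: cvgCM; last exact: cvgC_cst.
  apply: cvgCM; first exact: cvgC_cst.
  have -> : resolvents c (z :: zs) x = (z - (c x)%:C)^-1 * resolvents c zs x.
    exact: resolvents_cons.
  under eq_fun do rewrite resolvents_cons.
  apply: cvgCM; last exact: cvgC_cst.
  apply: cvgCV; first exact: subrC_neq0.
  apply: cvgCB; last exact: cvgC_cst.
  rewrite -[X in _ --> X]mul1r; apply: cvgCM; last exact: cvgC_cst.
  apply: cvg_realC; rewrite -[X in _ --> X]addr0; apply: cvgD; first exact: cvg_cst.
  exact: cvg_harmonic.
Qed.

(** The function p = 1/2 + kap (c - s)/(c^2 + y^2) is below 1/2 exactly where c < s. It is a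
    polynomial in the resolvents at i y and - i y, which both lie in [cones], so thresholding it
    settles the open left rays, which generate the Borel sets. *)
Lemma multiplier_preimage (V : (T -> CC R) -> Prop) c (B : set R) :
  bclosed V -> measurable_fun setT c ->
  (forall z, cones a b z -> multiplier V (fun x => (z - (c x)%:C)^-1)) ->
  measurable B -> multiplier_set V (c @^-1` B).
Proof.
move=> Vc mc hr; pose y : R := b + 1; have y1 : 1 < y by rewrite /y ltrDr.
have yb : b < y by rewrite /y ltrDl.
have y0 : 0 < y := lt_trans ltr01 y1.
pose S := [set B : set R | measurable B /\ multiplier_set V (c @^-1` B)].
suff H : measurable `<=` S by move=> /H[].
have -> : measurable = <<s @RGenInftyO.G R >> by exact: (RGenInftyO.measurableE R).
have mray (s : R) : measurable `]-oo, s[%classic by exact: measurable_itv.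
apply: smallest_sub.
  have [h0 hC hU] := multiplier_sigma_algebra Vc; split.
  - by split => //; rewrite preimage_set0.
  - move=> A [mA hA]; rewrite setTD; split; first exact: measurableC.
    by rewrite preimage_setC -setTD; exact: hC.
  - move=> F hF; split; first by apply: bigcupT_measurable => n; case: (hF n).
    by rewrite preimage_bigcup; apply: hU => n; case: (hF n).
move=> A [s ->]; split => //; split.
  by rewrite -[X in measurable X]setTI; exact: mc.
pose z0 : CC R := 0 +i* y; pose zb : CC R := 0 +i* (- y).
have z0c : cones a b z0.
  by left; rewrite /cone /= normr0 !mulr_gt0 //; split.
have zbc : cones a b zb.
  by right; rewrite /cone /= normr0 opprK !mulr_gt0 //; split.
(* Since y > 1, the quotient in [p] is at most 1 + |s| in modulus, so this factor keeps [p] in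
   [0, 1]. *)
pose kap : R := (2 * (1 + `|s|))^-1.
have s0 : 0 < 1 + `|s| by rewrite ltr_pwDl.
have kap0 : 0 < kap by rewrite invr_gt0 mulr_gt0.
pose p x : R := 2^-1 + kap * ((c x - s) / (c x ^+ 2 + y ^+ 2)).
have den x : 0 < c x ^+ 2 + y ^+ 2 by rewrite ltr_wpDl ?sqr_ge0// exprn_gt0.
have pe x : (p x)%:C = 2^-1 + kap%:C * ((z0 - s%:C) * ((z0 - (c x)%:C)^-1 * (zb - (c x)%:C)^-1)
    - (zb - (c x)%:C)^-1) :> CC R.
  have n0 := subrC_neq0 (c x) (cones_nonreal (ltW b0) z0c).
  have n1 := subrC_neq0 (c x) (cones_nonreal (ltW b0) zbc).
  have e : (z0 - (c x)%:C) * (zb - (c x)%:C) = (c x ^+ 2 + y ^+ 2)%:C.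
    by apply: complex_eqP; rewrite ?cReM ?cImM ?cReB ?cImB /=; ring.
  have e2 : ((c x - s) / (c x ^+ 2 + y ^+ 2))%:C =
      ((c x)%:C - s%:C) / ((z0 - (c x)%:C) * (zb - (c x)%:C)) :> CC R.
    by rewrite e -rmorphB -fmorph_div.
  have e3 : (2^-1)%:C = 2^-1 :> CC R by rewrite fmorphV rmorph_nat.
  rewrite /p rmorphD rmorphM /= e2 e3.
  by congr (_ + _ * _); field; rewrite n0 n1.
have pb x : 0 <= p x <= 1.
  have h : `|(c x - s) / (c x ^+ 2 + y ^+ 2)| <= 1 + `|s|.
    rewrite normrM normfV (gtr0_norm (den x)) ler_pdivrMr//.
    apply: le_trans (ler_normB _ _) _.
    have -> : c x ^+ 2 = `|c x| ^+ 2 by rewrite real_normK ?num_real.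
    have u0 := normr_ge0 (c x); have v0 := normr_ge0 s.
    have y2 : 1 <= y ^+ 2 by rewrite exprn_ege1// ltW.
    have h1 : 0 <= (`|c x| - 1) ^+ 2 := sqr_ge0 _.
    have h2 : 0 <= `|s| * `|c x| ^+ 2 by rewrite mulr_ge0// exprn_ge0.
    nra.
  have h2 : `|kap * ((c x - s) / (c x ^+ 2 + y ^+ 2))| <= 2^-1.
    rewrite normrM gtr0_norm// /kap ler_pdivrMl ?mulr_gt0//.
    by rewrite mulrAC mulfV// mul1r.
  move: h2; rewrite ler_norml => /andP[h2 h3]; rewrite /p; apply/andP; split; lra.
rewrite (_ : c @^-1` _ = [set x | p x < 2^-1]).
  apply: multiplier_threshold => //.
  under eq_fun do rewrite pe.
  apply: multiplierD => //; first exact: multiplier_cst.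
  apply: multiplierZ => //; apply: multiplierB; [exact: Vc| |exact: hr].
  by apply: multiplierZ => //; apply: multiplierM; exact: hr.
apply/seteqP; split => x; rewrite /p /= in_itv /=.
  by rewrite gtrDl pmulr_rlt0// pmulr_llt0 ?invr_gt0// subr_lt0.
by rewrite gtrDl pmulr_rlt0// pmulr_llt0 ?invr_gt0// subr_lt0.
Qed.

End resolvent_multipliers.

Section plane_uniqueness.
Context {R : realType}.
Let T : measurableType _ := (R * R)%type.
Implicit Types (z w : CC R).

Definition plane_kernel z w (p : T) : CC R := root_kernel z p.1 * root_kernel w p.2.

Lemma plane_kernelE z w p : plane_kernel z w p =
  (Num.sqrt (1 + p.1 ^+ 2) * Num.sqrt (1 + p.2 ^+ 2))%:C
      / ((z - p.1%:C) * (w - p.2%:C)).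
Proof.
by rewrite /plane_kernel /root_kernel rmorphM invfM mulrACA.
Qed.

Lemma cbmeas_plane_kernel z w : nonreal z -> nonreal w -> cbmeas (plane_kernel z w).
Proof.
by move=> z0 w0; apply: cbmeasM; apply: cbmeas_root_kernel.
Qed.

Context (L1 L2 : (T -> R) -> R) (bL1 : bfunctional L1) (bL2 : bfunctional L2)
  (a b : R) (a0 : 0 < a) (b0 : 0 < b).
Context (m12 : forall z w, cones a b z -> cones a b w ->
  cfunctional L1 (plane_kernel z w) = cfunctional L2 (plane_kernel z w)).

Let V (u : T -> CC R) := cbmeas u /\ cfunctional L1 u = cfunctional L2 u.

Let Vc : bclosed V. Proof. exact: bclosed_cfunctional. Qed.

Let I := ((CC R * seq (CC R)) * (CC R * seq (CC R)))%type.

Let P (i : I) := all_in (cones a b) (i.1.1 :: i.1.2) /\ all_in (cones a b) (i.2.1 :: i.2.2).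

Let Q (i : I) (p : T) : CC R := (root_kernel i.1.1 p.1 * resolvents fst i.1.2 p) *
  (root_kernel i.2.1 p.2 * resolvents snd i.2.2 p).

(** Agreement of [L1] and [L2] is given on single kernels only. Testing against all [Q i] enlarges
    the set of multipliers: a resolvent merely lengthens one of the lists in [i], and so multiplies
    [W]. *)
Let W (e : T -> CC R) := cbmeas e /\ forall i, P i -> V (fun p => e p * Q i p).

Let nonreal_in zs : all_in (cones a b) zs -> all_in (@nonreal R) zs.
Proof. by move=> h z /h; exact: cones_nonreal (ltW b0). Qed.

Let consP (D : set (CC R)) z zs : all_in D (z :: zs) <-> D z /\ all_in D zs.
Proof.
split=> [h|[h1 h2] x]; last by rewrite inE => /orP[/eqP->|/h2].
by split=> [|x hx]; apply: h; rewrite inE ?eqxx// hx orbT.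
Qed.

Let cQ1 (c : T -> R) z zs : measurable_fun setT c -> cones a b z -> all_in (cones a b) zs ->
  cbmeas (fun p => root_kernel z (c p) * resolvents c zs p).
Proof.
move=> mc zc hz; apply: cbmeasM.
  by apply: cbmeas_root_kernel => //; exact: cones_nonreal (ltW b0) zc.
by apply: cbmeas_resolvents => //; exact: nonreal_in.
Qed.

Let Wc : bclosed W.
Proof.
apply: bclosed_family Vc _ => i [/consP[h1 h2] /consP[h3 h4]].
by apply: cbmeasM; apply: cQ1.
Qed.

Let W1 : W (fun=> 1).
Proof.
split=> [|[[z zs] [w ws]] [/consP[/= z1 z2] /consP[/= w1 w2]]]; first exact: cbmeas_cst.
under eq_fun do rewrite mul1r /Q /=.
(* The chain is applied in the first variable with the whole second factor as [psi], and then in the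
   second variable with a single kernel of the first. *)
apply: (@resolvent_chain _ T R a b b0 V fst
  (fun p => root_kernel w p.2 * resolvents snd ws p)) => //; first exact: (cQ1 (c := snd)).
move=> z' z'c; under eq_fun do rewrite mulrC.
apply: (@resolvent_chain _ T R a b b0 V snd (fun p => root_kernel z' p.1)) => //.
  by apply: cbmeas_root_kernel => //; exact: cones_nonreal (ltW b0) z'c.
move=> w' w'c; under eq_fun do rewrite mulrC; split; last exact: m12.
by apply: cbmeas_plane_kernel; [exact: cones_nonreal (ltW b0) z'c|exact: cones_nonreal (ltW b0) w'c].
Qed.

Let multiplier_fst z : cones a b z -> multiplier W (fun p => (z - p.1%:C)^-1).
Proof.
move=> zc; have z0 := cones_nonreal (ltW b0) zc.
have cr := cbmeas_resolvent (@measurable_fst _ _ R R) z0.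
split => // e [ce We]; split; first exact: cbmeasM.
move=> [[z1 zs] [w ws]] [/consP[/= h1 h2] h3].
have Pi : P ((z1, z :: zs), (w, ws)) by split => //; apply/consP; split => //; apply/consP.
have := We _ Pi; congr V; apply/funext => p; rewrite /Q /= resolvents_cons; ring.
Qed.

Let multiplier_snd z : cones a b z -> multiplier W (fun p => (z - p.2%:C)^-1).
Proof.
move=> zc; have z0 := cones_nonreal (ltW b0) zc.
have cr := cbmeas_resolvent (@measurable_snd _ _ R R) z0.
split => // e [ce We]; split; first exact: cbmeasM.
move=> [[z1 zs] [w ws]] [h3 /consP[/= h1 h2]].
have Pi : P ((z1, zs), (w, z :: ws)) by split => //; apply/consP; split => //; apply/consP.
have := We _ Pi; congr V; apply/funext => p; rewrite /Q /= resolvents_cons; ring.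
Qed.

Let multiplier_setW (A : set T) : measurable A -> multiplier_set W A.
Proof.
suff : measurable `<=` multiplier_set W by move=> h /h.
apply: smallest_sub; first exact: (multiplier_sigma_algebra Wc).
move=> B [[C mC <-]|[C mC <-]]; rewrite setTI.
  exact: (multiplier_preimage a0 b0 Wc (@measurable_fst _ _ R R) multiplier_fst mC).
exact: (multiplier_preimage a0 b0 Wc (@measurable_snd _ _ R R) multiplier_snd mC).
Qed.

(* The function [H], with values in ]0, 1], is a product of kernels, and the
   indicator of [A] is the limit of its products with [1 - (1 - H) ^+ n]. *)
Lemma plane_uniqueness (A : set T) : measurable A -> L1 \1_A = L2 \1_A.
Proof.
move=> mA; pose y : R := b + 1; have y1 : 1 < y by rewrite /y ltrDr.
have yb : b < y by rewrite /y ltrDl.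
have y0 : 0 < y := lt_trans ltr01 y1.
pose z0 : CC R := 0 +i* y; pose zb : CC R := 0 +i* (- y).
have z0c : cones a b z0 by left; rewrite /cone /= normr0 !mulr_gt0//; split.
have zbc : cones a b zb by right; rewrite /cone /= normr0 opprK !mulr_gt0//; split.
have den s : 1 < s ^+ 2 + y ^+ 2.
  by rewrite ltr_wpDl ?sqr_ge0// exprn_egt1.
pose h (s : R) := sqrt1p s / (s ^+ 2 + y ^+ 2).
have h0 s : 0 < h s by rewrite divr_gt0 ?sqrt1p_gt0// (lt_trans _ (den s)).
have h1 s : h s <= 1.
  rewrite ler_pdivrMr ?(lt_trans _ (den s))// mul1r /sqrt1p.
  have d0 : 0 <= s ^+ 2 + y ^+ 2 by rewrite ltW// (lt_trans _ (den s)).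
  rewrite -[leRHS]ger0_norm// -sqrtr_sqr ler_wsqrtr// [1 + _]addrC.
  have y2 : 1 <= y ^+ 2 by rewrite exprn_ege1// ltW.
  have s2 := sqr_ge0 s; nra.
pose H (p : T) := h p.1 * h p.2.
have H01 p : 0 < H p <= 1.
  by rewrite mulr_gt0//= mulr_ile1// ltW.
have he s : (h s)%:C = root_kernel z0 s * (zb - s%:C)^-1.
  have n0 := subrC_neq0 s (cones_nonreal (ltW b0) z0c).
  have n1 := subrC_neq0 s (cones_nonreal (ltW b0) zbc).
  have e : (z0 - s%:C) * (zb - s%:C) = (s ^+ 2 + y ^+ 2)%:C.
    by apply: complex_eqP; rewrite ?cReM ?cImM ?cReB ?cImB /=; ring.
  by rewrite /root_kernel -mulrA -invfM e /h rmorphM fmorphV.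
have HQ p : (H p)%:C = Q ((z0, [:: zb]), (z0, [:: zb])) p.
  by rewrite /H rmorphM /= !he /Q /= !resolvents_cons /resolvents !big_nil !mulr1.
have VH (f : T -> R) : multiplier W (fun p => (f p)%:C) -> V (fun p => (f p * H p)%:C).
  move=> [_ /(_ _ W1)[_ /(_ ((z0, [:: zb]), (z0, [:: zb])))]].
  have Pi : P (z0, [:: zb], (z0, [:: zb])).
    by split; apply/consP; split => //; apply/consP; split.
  move=> /(_ Pi); congr V; apply/funext => p.
  by rewrite -HQ mulr1 -rmorphM.
have mh : measurable_fun setT h.
  apply: measurable_funM; first exact: measurable_sqrt1p.
  apply: continuous_measurable_fun => s; apply: cvgV; first by rewrite gt_eqF// (lt_trans _ (den s)).
  by apply: cvgD; [exact: exprn_continuous|exact: cvg_cst].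
have mH : multiplier W (fun p => (1 - H p)%:C).
  apply: multiplier_measurable => //.
    apply: measurable_funB => //; apply: measurable_funM.
      exact: (measurableT_comp mh measurable_fst).
    exact: (measurableT_comp mh measurable_snd).
  by move=> p; have /andP[H0 H1] := H01 p; apply/andP; split; lra.
have [_ VD VZ Vl] := Vc.
(* Only products with [H] are known to lie in [V]; consecutive terms differ by the indicator times
   (1 - H)^n H, which is of this form. *)
have VA n : V (fun p => (\1_A p * (1 - (1 - H p) ^+ n))%:C).
  elim: n => [|n ih].
    under eq_fun do rewrite expr0 subrr mulr0.
    split; first exact: (cbmeas_cst 0).
    have z L : bfunctional L -> L (fun=> 0 : R) = 0.
      by move=> [_ LZ _]; have := LZ 0 _ (bmeas_cst 0); rewrite !mul0r.
    by rewrite !(cfunctional_real (fun=> 0 : R))// !z.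
  rewrite (_ : (fun p => _) = fun p => (\1_A p * (1 - (1 - H p) ^+ n))%:C +
     (\1_A p * (1 - H p) ^+ n * H p)%:C); last first.
    by apply/funext => p; rewrite -rmorphD exprS; congr (_%:C); ring.
  apply: VD => //; apply: VH.
  under eq_fun do rewrite rmorphM rmorphXn; apply: multiplierM.
    by case: (multiplier_setW mA).
  exact: multiplierX.
have [_] : V (fun p => (\1_A p)%:C).
  apply: (Vl _ _ 1 VA).
    move=> n p; have /andP[H0 H1] := H01 p.
    have k0 : 0 <= (1 - H p) ^+ n by rewrite exprn_ge0//; lra.
    have k1 : (1 - H p) ^+ n <= 1 by rewrite exprn_ile1//; lra.
    rewrite nmR indicE; case: (_ \in _); rewrite ?mul0r ?mul1r ?normr0//.
    by rewrite ger0_norm; lra.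
  move=> p; apply: cvg_realC; rewrite -[X in _ --> X]mulr1.
  apply: cvgM; first exact: cvg_cst.
  rewrite -[X in _ --> X]subr0; apply: cvgB; first exact: cvg_cst.
  have /andP[H0 H1] := H01 p.
  by apply: cvg_expr; rewrite ger0_norm; lra.
by rewrite !cfunctional_real// => -[].
Qed.

End plane_uniqueness.

(** * Integration against charges *)

Section charges.
Context {d : measure_display} {T : measurableType d} {R : realType}.
Implicit Types (rho : {charge set T -> \bar R}) (f g : T -> R).

Lemma bfunctional_charge rho : bfunctional (charge_integral rho).
Proof. by apply: bfunctionalB; exact: bfunctional_Rintegral. Qed.

Lemma charge_integral_indic rho (A : set T) : measurable A ->
  charge_integral rho \1_A = fine (rho A).
Proof.
move=> mA; rewrite (jordan_decomp (hahnP rho) mA) /cadd /= cscaleN1 /= fineB ?fin_num_measure//.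
by rewrite /charge_integral !Rint_indic.
Qed.

Lemma eq_meas_charge rho rho' :
  (forall A, measurable A -> charge_integral rho \1_A = charge_integral rho' \1_A) ->
  eq_meas rho rho'.
Proof.
move=> h A mA; have := h A mA; rewrite !charge_integral_indic// => e.
by rewrite -(@fineK _ (rho A)) ?fin_num_measure// e fineK// fin_num_measure.
Qed.

(** The Jordan parts of the difference need not be [m1] and [m2], which may overlap; the integrals
    agree because both sides are continuous under bounded convergence and equal on indicators. *)
Lemma charge_difference (m1 m2 : {finite_measure set T -> \bar R}) :
  exists rho, forall f, bmeas f ->
    charge_integral rho f = Rintegral m1 setT f - Rintegral m2 setT f.
Proof.
exists (cadd (charge_of_finite_measure m1) (cscale (-1) (charge_of_finite_measure m2))) => f.
apply: (bfunctional_eq (L2 := fun f => Rintegral m1 setT f - Rintegral m2 setT f)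
  (bfunctional_charge _)).
  by apply: bfunctionalB; exact: bfunctional_Rintegral.
move=> A mA; rewrite charge_integral_indic// !Rint_indic//.
have f1 : m1 A \is a fin_num by exact: fin_num_measure.
have f2 : m2 A \is a fin_num by exact: fin_num_measure.
by rewrite -(fineB f1 f2); congr fine; congr (_ + _)%E; exact: mulN1e.
Qed.

Lemma charge_integral_induced (mu : {finite_measure set T -> \bar R}) g
    (ig : mu.-integrable setT (fun x => (g x)%:E)) f : bmeas g -> bmeas f ->
  charge_integral (induced_charge ig) f = Rintegral mu setT (fun x => f x * g x).
Proof.
move=> bg; apply: (bfunctional_eq (L2 := fun f => Rintegral mu setT (fun x => f x * g x))
  (bfunctional_charge _)).
  by apply: bfunctional_density => //; exact: bfunctional_Rintegral.
move=> A mA; rewrite charge_integral_indic// /induced_charge.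
rewrite -[LHS]/(Rintegral mu A g) Rintegral_mkcond patch_indic.
by congr Rintegral; apply/funext => x; rewrite /GRing.mul /= mulrC.
Qed.

End charges.

Section plane_charges.
Context {R : realType}.
Implicit Types (rho : {charge set (R * R)%type -> \bar R}) (z w : CC R) (p : R * R).

Lemma charge_uniqueness rho rho' (a b : R) : 0 < a -> 0 < b ->
  (forall z w, cones a b z -> cones a b w ->
    charge_cintegral rho (plane_kernel z w) = charge_cintegral rho' (plane_kernel z w)) ->
  eq_meas rho rho'.
Proof.
move=> a0 b0 h; apply: eq_meas_charge => A mA.
exact: (plane_uniqueness (bfunctional_charge rho) (bfunctional_charge rho') a0 b0 h).
Qed.

Definition unit_density p : R := p.1 * p.2 / (sqrt1p p.1 * sqrt1p p.2).

Lemma rho_densityE k p : rho_density k p = k%:R * unit_density p.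
Proof. by []. Qed.

Lemma unit_densityE p : unit_density p = (p.1 / sqrt1p p.1) * (p.2 / sqrt1p p.2).
Proof. by rewrite /unit_density invfM mulrACA. Qed.

Lemma cbound_unit_density : cbound unit_density.
Proof.
have cs (c : R * R -> R) : continuous c -> continuous (fun p => c p / sqrt1p (c p)).
  move=> cc p; apply: cvgM; first exact: cc.
  apply: cvgV; first by rewrite gt_eqF// sqrt1p_gt0.
  apply: (continuous_comp (f := fun p => 1 + c p ^+ 2)); last exact: sqrt_continuous.
  apply: cvgD; first exact: cvg_cst.
  exact: (cvgM (cc p) (cc p)).
have le1 (s : R) : `|s / sqrt1p s| <= 1.
  rewrite normrM normfV (gtr0_norm (sqrt1p_gt0 s)) ler_pdivrMr ?sqrt1p_gt0// mul1r.
  by rewrite -sqrtr_sqr ler_wsqrtr// lerDr.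
split; last first.
  by exists 1 => p; rewrite unit_densityE normrM mulr_ile1.
rewrite (funext unit_densityE).
by move=> p; apply: cvgM; [apply: (cs fst) => q; exact: cvg_fst|apply: (cs snd) => q; exact: cvg_snd].
Qed.

Lemma charge_integral_rho_tilde k mu (f : R * R -> R) : bmeas f ->
  charge_integral (rho_tilde k mu) f =
  k%:R * Rintegral mu setT (fun p => f p * unit_density p).
Proof.
move=> bf; have bu := cbound_bmeas cbound_unit_density.
have br : bmeas (rho_density k) := bmeasZ k%:R bu.
rewrite /rho_tilde charge_integral_induced// -RintZ; last exact: bmeasM.
by congr Rintegral; apply/funext => p; rewrite rho_densityE mulrCA.
Qed.

End plane_charges.

(** * Limits of the scaled charges *)

Section charge_limits.
Context {R : realType} {k : nat -> nat} {mu_ : nat -> probability (R * R)%type R}.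
Implicit Types (z w : CC R) (p : R * R) (f : R * R -> R) (u : R * R -> CC R).

Lemma bmeas_fst (f : R -> R) : bmeas f -> bmeas (fun p => f p.1).
Proof. exact: (bmeas_comp (@measurable_fst _ _ R R)). Qed.

Lemma bmeas_snd (f : R -> R) : bmeas f -> bmeas (fun p => f p.2).
Proof. exact: (bmeas_comp (@measurable_snd _ _ R R)). Qed.

Lemma Rint_marg1 (sigma : probability (R * R)%type R) (f : R -> R) : bmeas f ->
  Rintegral (marg1 sigma) setT f = Rintegral sigma setT (fun p => f p.1).
Proof.
have [D Z l] := bfunctional_Rintegral sigma.
apply: (bfunctional_eq (L2 := fun f : R -> R => Rintegral sigma setT (fun p => f p.1))
  (bfunctional_Rintegral (marg1 sigma))).
  split.
  - by move=> g h bg bh; apply: (D (fun p => g p.1) (fun p => h p.1)); exact: bmeas_fst.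
  - by move=> c g bg; apply: (Z c (fun p => g p.1)); exact: bmeas_fst.
  - move=> g_ g M bg gM gg; apply: (l (fun n p => g_ n p.1) (fun p => g p.1) M) => //.
    by move=> n; exact: bmeas_fst.
move=> A mA; rewrite Rint_indic// -[RHS]/(Rintegral sigma setT \1_(fst @^-1` A)) Rint_indic//.
by rewrite -[X in measurable X]setTI; exact: measurable_fst.
Qed.

Lemma Rint_marg2 (sigma : probability (R * R)%type R) (f : R -> R) : bmeas f ->
  Rintegral (marg2 sigma) setT f = Rintegral sigma setT (fun p => f p.2).
Proof.
have [D Z l] := bfunctional_Rintegral sigma.
apply: (bfunctional_eq (L2 := fun f : R -> R => Rintegral sigma setT (fun p => f p.2))
  (bfunctional_Rintegral (marg2 sigma))).
  split.
  - by move=> g h bg bh; apply: (D (fun p => g p.2) (fun p => h p.2)); exact: bmeas_snd.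
  - by move=> c g bg; apply: (Z c (fun p => g p.2)); exact: bmeas_snd.
  - move=> g_ g M bg gM gg; apply: (l (fun n p => g_ n p.2) (fun p => g p.2) M) => //.
    by move=> n; exact: bmeas_snd.
move=> A mA; rewrite Rint_indic// -[RHS]/(Rintegral sigma setT \1_(snd @^-1` A)) Rint_indic//.
by rewrite -[X in measurable X]setTI; exact: measurable_snd.
Qed.

Lemma unit_density_sqweight p :
  `|unit_density p| <= (sqweight p.1 + sqweight p.2) / 2.
Proof.
have sq (s : R) : sqweight s = (s / sqrt1p s) ^+ 2.
  by rewrite expr_div_n sqr_sqrtr// addr_ge0// sqr_ge0.
rewrite unit_densityE !sq normrM ler_pdivlMr//.
rewrite -(real_normK (num_real (p.1 / sqrt1p p.1))) -(real_normK (num_real (p.2 / sqrt1p p.2))).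
have := sqr_ge0 (`|p.1 / sqrt1p p.1| - `|p.2 / sqrt1p p.2|); nra.
Qed.

Lemma unit_density_le1 p : `|unit_density p| <= 1.
Proof.
apply: le_trans (unit_density_sqweight p) _.
have /andP[_ h1] := sqweight_bounds p.1; have /andP[_ h2] := sqweight_bounds p.2.
by rewrite ler_pdivrMr//; lra.
Qed.

Lemma charge_cintegral_rho_tilde n (mu : probability (R * R)%type R) u : cbmeas u ->
  charge_cintegral (rho_tilde n mu) u =
  n%:R * cintegral mu (fun p => (unit_density p)%:C * u p).
Proof.
move=> [u1 u2]; apply: complex_eqP => /=.
  rewrite charge_integral_rho_tilde// -[n%:R : CC R](rmorph_nat (real_complex R)) cReZ /=.
  by congr (_ * Rintegral _ _ _); apply/funext => p; rewrite cReZ mulrC.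
rewrite charge_integral_rho_tilde// -[n%:R : CC R](rmorph_nat (real_complex R)) cImZ /=.
by congr (_ * Rintegral _ _ _); apply/funext => p; rewrite cImZ mulrC.
Qed.

Lemma plane_kernel_density z w p : nonreal z -> nonreal w ->
  (p.1 * p.2)%:C / ((z - p.1%:C) * (w - p.2%:C)) = (unit_density p)%:C * plane_kernel z w p.
Proof.
move=> z0 w0; rewrite plane_kernelE mulrA -rmorphM divfK// mulf_neq0 ?gt_eqF//; exact: sqrt1p_gt0.
Qed.

Context (bd1 : exists K : R, \forall n \near \oo, (k n)%:R * sqmass (marg1 (mu_ n)) <= K)
  (bd2 : exists K : R, \forall n \near \oo, (k n)%:R * sqmass (marg2 (mu_ n)) <= K)
  (tl1 : forall e : R, 0 < e -> exists2 M : R, 0 < M &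
     \forall n \near \oo, (k n)%:R * tail (marg1 (mu_ n)) M <= e)
  (tl2 : forall e : R, 0 < e -> exists2 M : R, 0 < M &
     \forall n \near \oo, (k n)%:R * tail (marg2 (mu_ n)) M <= e).

Definition rho_n n := rho_tilde (k n) (mu_ n).

Let bud : bmeas (fun p => `|unit_density p|).
Proof. by apply: bmeas_norm; apply: cbound_bmeas; exact: cbound_unit_density. Qed.

Lemma variation_bounded : exists2 K : R, 0 <= K & \forall n \near \oo,
  (k n)%:R * Rintegral (mu_ n) setT (fun p => `|unit_density p|) <= K.
Proof.
have [K1 h1] := bd1; have [K2 h2] := bd2.
have q1 : bmeas (fun p : R * R => sqweight p.1) := bmeas_fst bmeas_sqweight.
have q2 : bmeas (fun p : R * R => sqweight p.2) := bmeas_snd bmeas_sqweight.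
exists (Num.max 0 ((K1 + K2) / 2)); first by rewrite le_max lexx.
apply: filterS2 h1 h2 => n h1 h2; rewrite le_max; apply/orP; right.
apply: (@le_trans _ _ ((k n)%:R * ((sqmass (marg1 (mu_ n)) + sqmass (marg2 (mu_ n))) / 2))).
  rewrite ler_wpM2l ?ler0n// /sqmass Rint_marg1 ?Rint_marg2; try exact: bmeas_sqweight.
  rewrite -RintD// mulrC -RintZ; last exact: bmeasD.
  apply: Rint_le => //; first by apply: bmeasZ; exact: bmeasD.
  by move=> p; rewrite mulrC; exact: unit_density_sqweight.
by rewrite mulrA mulrDr ler_pM2r//; exact: lerD.
Qed.

Lemma charge_kernel_bound n u (M : R) : cbmeas u -> (forall p, nm (u p) <= M) ->
  nm (charge_cintegral (rho_n n) u) <=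
  (k n)%:R * Rintegral (mu_ n) setT (fun p => `|unit_density p|) * M.
Proof.
move=> cu uM; rewrite charge_cintegral_rho_tilde// nmM nm_nat -mulrA ler_wpM2l ?ler0n//.
rewrite mulrC -RintZ//; apply: nm_cint_le.
- by apply: cbmeasM => //; apply: cbmeas_real; apply: cbound_bmeas; exact: cbound_unit_density.
- exact: bmeasZ.
- by move=> p; rewrite nmM nmR mulrC ler_wpM2r.
Qed.

(** The density is at most 1 in modulus, so the scaled mass outside a box is at most the sum of the
    two scaled marginal tails. *)
Lemma limit_part U (g : R * R -> R) : free_ultra U -> bmeas g ->
  (forall p, 0 <= g p <= `|unit_density p|) ->
  exists m : {finite_measure set (R * R)%type -> \bar R}, forall f, cbound f ->
    (k n)%:R * Rintegral (mu_ n) setT (fun p => f p * g p) @[n --> U] --> Rintegral m setT f.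
Proof.
move=> fU bg g01; have FU := free_ultra_proper fU.
have [K K0 hK] := variation_bounded.
have bw n : bmeas (fun p => (k n)%:R * g p) by exact: bmeasZ.
have w0 n p : 0 <= (k n)%:R * g p by rewrite mulr_ge0//; case/andP: (g01 p).
have wK : \forall n \near U, Rintegral (mu_ n) setT (fun p => (k n)%:R * g p) <= K.
  apply: filterS (free_ultra_near fU hK) => n hn; apply: le_trans hn.
  rewrite RintZ// ler_wpM2l ?ler0n//; apply: Rint_le => // p.
  by case/andP: (g01 p).
have wt (e : R) : 0 < e -> exists M : R, \forall n \near U,
    Rintegral (mu_ n) setT (fun p => (k n)%:R * g p * \1_(outbox M) p) <= e.
  move=> e0; have e2 : 0 < e / 2 by rewrite divr_gt0.
  have [M1 M10 h1] := tl1 e2; have [M2 M20 h2] := tl2 e2.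
  exists (Num.max M1 M2); set M := Num.max M1 M2.
  apply: filterS2 (free_ultra_near fU h1) (free_ultra_near fU h2) => n {}h1 {}h2.
  have b1 : bmeas (\1_(outside M) : R -> R) by apply: bmeas_indic; exact: measurable_outside.
  have c1 : bmeas (fun p : R * R => \1_(outside M) p.1 : R) := bmeas_fst b1.
  have c2 : bmeas (fun p : R * R => \1_(outside M) p.2 : R) := bmeas_snd b1.
  apply: (@le_trans _ _ ((k n)%:R * (tail (marg1 (mu_ n)) M + tail (marg2 (mu_ n)) M))).
    rewrite !tailE Rint_marg1// Rint_marg2// -RintD// -RintZ; last exact: bmeasD.
    apply: Rint_le.
    - by apply: bmeasM => //; apply: bmeas_indic; exact: measurable_outbox.
    - by apply: bmeasZ; exact: bmeasD.
    - move=> p; rewrite -mulrA ler_wpM2l ?ler0n//.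
      have /andP[g0 g1] := g01 p; have {}g1 := le_trans g1 (unit_density_le1 p).
      rewrite !indicE; have [|_] := boolP (p \in outbox M); last first.
        by rewrite mulr0 addr_ge0.
      rewrite inE => -[] /= h; rewrite (mem_set h) mulr1.
        by rewrite (le_trans g1)// lerDl.
      by rewrite (le_trans g1)// lerDr.
  have t1 : tail (marg1 (mu_ n)) M <= tail (marg1 (mu_ n)) M1 by apply: tail_le; rewrite le_max lexx.
  have t2 : tail (marg2 (mu_ n)) M <= tail (marg2 (mu_ n)) M2.
    by apply: tail_le; rewrite le_max lexx orbT.
  rewrite mulrDr [e]splitr; apply: lerD.
    by apply: le_trans h1; rewrite ler_wpM2l ?ler0n.
  by apply: le_trans h2; rewrite ler_wpM2l ?ler0n.
have [m hm] := limit_measure bw w0 fU wK wt.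
exists m => f cf; have bf := cbound_bmeas cf.
have := hm f cf; apply: cvg_trans; apply: near_eq_cvg; apply: nearW => n.
rewrite -RintZ; last exact: bmeasM.
by congr Rintegral; apply/funext => p; rewrite mulrCA.
Qed.

(** The representation theorem concerns positive functionals, so the positive and negative parts of
    the density pass to the limit separately. Their limits may overlap, yet their difference is
    still a charge. *)
Lemma ultra_limit_charge U : free_ultra U ->
  exists rho : {charge set (R * R)%type -> \bar R}, forall f, cbound f ->
    charge_integral (rho_n n) f @[n --> U] --> charge_integral rho f.
Proof.
move=> fU; have FU := free_ultra_proper fU.
have bd := cbound_bmeas (@cbound_unit_density R).
pose gp p := Num.max (unit_density p) 0; pose gn p := Num.max (- unit_density p) 0.
have bp : bmeas gp by apply: bmeas_max => //; exact: bmeas_cst.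
have bn : bmeas gn by apply: bmeas_max; [exact: bmeasN|exact: bmeas_cst].
have [m1 h1] : exists m : {finite_measure set (R * R)%type -> \bar R}, forall f, cbound f ->
    (k n)%:R * Rintegral (mu_ n) setT (fun p => f p * gp p) @[n --> U] --> Rintegral m setT f.
  apply: limit_part => // p; rewrite /gp le_max lexx orbT ge_max normr_ge0 andbT.
  exact: ler_norm.
have [m2 h2] : exists m : {finite_measure set (R * R)%type -> \bar R}, forall f, cbound f ->
    (k n)%:R * Rintegral (mu_ n) setT (fun p => f p * gn p) @[n --> U] --> Rintegral m setT f.
  apply: limit_part => // p; rewrite /gn le_max lexx orbT ge_max normr_ge0 andbT.
  by rewrite -normrN; exact: ler_norm.
have [rho hrho] := charge_difference m1 m2; exists rho => f cf; have bf := cbound_bmeas cf.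
rewrite hrho//; apply: cvg_trans (cvgB (h1 f cf) (h2 f cf)).
apply: near_eq_cvg; apply: nearW => n.
rewrite /rho_n charge_integral_rho_tilde//.
transitivity ((k n)%:R * (Rintegral (mu_ n) setT (fun p => f p * gp p) -
  Rintegral (mu_ n) setT (fun p => f p * gn p))); first by rewrite mulrBr.
rewrite -RintB; [|exact: bmeasM|exact: bmeasM].
congr (_ * Rintegral _ _ _); apply/funext => p; rewrite -mulrBr; congr (_ * _).
have e (x : R) : Num.max x 0 - Num.max (- x) 0 = x.
  have [h|/ltW h] := lerP 0 x.
    by rewrite [Num.max (- x) 0]max_r ?subr0 ?oppr_le0.
  by rewrite [Num.max (- x) 0]max_l ?oppr_ge0// sub0r opprK.
exact: e.
Qed.

End charge_limits.

(** * Kernel integrals of the scaled charges *)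

Section kernel_limits.
Context {R : realType} {k : nat -> nat} {mu_ : nat -> probability (R * R)%type R}.
Implicit Types (z w : CC R) (p : R * R) (f : R * R -> R) (u v : R * R -> CC R).

Local Notation L n := (charge_cintegral (rho_tilde (k n) (mu_ n))).

Lemma charge_cintegralB n (mu : probability (R * R)%type R) u v : cbmeas u -> cbmeas v ->
  charge_cintegral (rho_tilde n mu) u - charge_cintegral (rho_tilde n mu) v =
  charge_cintegral (rho_tilde n mu) (fun p => u p - v p).
Proof.
move=> cu cv; have cd : cbmeas (fun p : R * R => (unit_density p)%:C : CC R).
  by apply: cbmeas_real; apply: cbound_bmeas; exact: cbound_unit_density.
rewrite !charge_cintegral_rho_tilde//; last exact: cbmeasB.
rewrite -mulrBr -cintB; [|exact: cbmeasM|exact: cbmeasM].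
by congr (_ * cintegral _ _); apply/funext => p; rewrite mulrBr.
Qed.

Definition kernel_bound z : R := (1 + nm z) / `|complex.Im z| + 1.

Lemma kernel_bound_ge0 z : 0 <= kernel_bound z.
Proof. by rewrite addr_ge0// divr_ge0// addr_ge0// nm_ge0. Qed.

Lemma root_kernel_sub z z' (s : R) : nonreal z -> nonreal z' ->
  root_kernel z' s - root_kernel z s = - (z' - z) * (root_kernel z s * (z' - s%:C)^-1).
Proof.
move=> z0 z'0; rewrite /root_kernel -mulrBr (resolvent_sub s z0 z'0); ring.
Qed.

(** A bound, uniform in [s], for the change of [root_kernel] from [z] to a point [z'] at distance at
    most |Im z|/2. *)
Definition kernel_shift z z' : R := nm (z' - z) * (kernel_bound z * (2 / `|complex.Im z|)).

Lemma kernel_shift_ge0 z z' : 0 <= kernel_shift z z'.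
Proof. by rewrite mulr_ge0 ?nm_ge0// mulr_ge0 ?kernel_bound_ge0// divr_ge0. Qed.

Lemma near_resolvent_bound z z' (s : R) : nonreal z -> nm (z' - z) <= `|complex.Im z| / 2 ->
  nm ((z' - s%:C)^-1 : CC R) <= 2 / `|complex.Im z|.
Proof.
move=> z0 zz; have [z'0 h] := nonreal_near z0 zz.
have p : 0 < `|complex.Im z| by rewrite normr_gt0.
apply: le_trans (nm_resolvent s z'0) _.
rewrite -[2]invrK -invfM lef_pV2 ?posrE ?mulr_gt0 ?normr_gt0//; lra.
Qed.

Lemma root_kernel_dist z z' (s : R) : nonreal z -> nm (z' - z) <= `|complex.Im z| / 2 ->
  nm (root_kernel z' s - root_kernel z s) <= kernel_shift z z'.
Proof.
move=> z0 zz; have [z'0 _] := nonreal_near z0 zz.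
rewrite root_kernel_sub// nmM nmN [X in _ * X]nmM ler_wpM2l ?nm_ge0// ler_pM ?nm_ge0//.
  exact: nm_root_kernel.
exact: near_resolvent_bound.
Qed.

Lemma plane_kernel_dist z w z' w' p : nonreal z -> nonreal w ->
  nm (z' - z) <= `|complex.Im z| / 2 -> nm (w' - w) <= `|complex.Im w| / 2 ->
  nm (plane_kernel z' w' p - plane_kernel z w p) <=
  kernel_shift z z' * (kernel_bound w + kernel_shift w w') + kernel_bound z * kernel_shift w w'.
Proof.
move=> z0 w0 zz ww.
have h1 := root_kernel_dist p.1 z0 zz; have h2 := root_kernel_dist p.2 w0 ww.
have b1 := nm_root_kernel p.1 z0; have b2 := nm_root_kernel p.2 w0.
rewrite /plane_kernel; set X := root_kernel z p.1 in h1 b1 *; set Y := root_kernel w p.2 in h2 b2 *.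
set X' := root_kernel z' p.1 in h1 *; set Y' := root_kernel w' p.2 in h2 *.
have -> : X' * Y' - X * Y = (X' - X) * (Y + (Y' - Y)) + X * (Y' - Y) by ring.
apply: le_trans (nmD _ _) _; rewrite nmM (nmM X); apply: lerD; apply: ler_pM; rewrite ?nm_ge0//.
by apply: le_trans (nmD _ _) _; exact: lerD.
Qed.

Lemma cvg_kernel_shift (z_ : nat -> CC R) z : z_ @ \oo --> z ->
  kernel_shift z (z_ n) @[n --> \oo] --> (0 : R).
Proof.
move=> zz; rewrite -(mul0r (kernel_bound z * (2 / `|complex.Im z|))).
by apply: cvgM; [exact: cvg_dist0 zz|exact: cvg_cst].
Qed.

Lemma kernel_near (z_ : nat -> CC R) z : nonreal z -> z_ @ \oo --> z ->
  \forall n \near \oo, nm (z_ n - z) <= `|complex.Im z| / 2.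
Proof.
move=> z0 zz; have p : 0 < `|complex.Im z| / 2 by rewrite divr_gt0// normr_gt0.
by have /cvgCP /(_ _ p) := zz; apply: filterS => n; rewrite nm_dist => /ltW.
Qed.

Context (vb : exists2 K : R, 0 <= K & \forall n \near \oo,
  (k n)%:R * Rintegral (mu_ n) setT (fun p => `|unit_density p|) <= K).

(** The kernels at the moving points converge uniformly on the plane, and a uniform limit is
    harmless for charges of bounded total variation. *)
Lemma charge_kernel_shift (z_ w_ : nat -> CC R) z w : z_ @ \oo --> z -> w_ @ \oo --> w ->
  nonreal z -> nonreal w ->
  L n (plane_kernel (z_ n) (w_ n)) - L n (plane_kernel z w) @[n --> \oo] --> (0 : CC R).
Proof.
move=> zz ww z0 w0; have [K K0 hK] := vb.
pose e n := kernel_shift z (z_ n) * (kernel_bound w + kernel_shift w (w_ n)) +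
  kernel_bound z * kernel_shift w (w_ n).
apply: (@cvgC_le _ _ _ _ _ (fun n => K * e n)); last first.
  rewrite -[X in _ --> X](mulr0 K); apply: cvgM; first exact: cvg_cst.
  have -> : 0 = 0 * (kernel_bound w + 0) + kernel_bound z * 0 :> R by rewrite mul0r mulr0 addr0.
  apply: cvgD; apply: cvgM; try exact: cvg_cst; try exact: cvg_kernel_shift.
  by apply: cvgD; [exact: cvg_cst|exact: cvg_kernel_shift].
apply: filterS3 hK (kernel_near z0 zz) (kernel_near w0 ww) => n hK zn wn.
have [z'0 _] := nonreal_near z0 zn; have [w'0 _] := nonreal_near w0 wn.
have e0 : 0 <= e n.
  rewrite /e addr_ge0// mulr_ge0 ?kernel_shift_ge0 ?kernel_bound_ge0//.
  by rewrite addr_ge0 ?kernel_shift_ge0 ?kernel_bound_ge0.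
rewrite subr0 charge_cintegralB; [|exact: cbmeas_plane_kernel|exact: cbmeas_plane_kernel].
apply: le_trans (charge_kernel_bound _ _ _) _.
- by apply: cbmeasB; exact: cbmeas_plane_kernel.
- by move=> p; exact: plane_kernel_dist.
- by rewrite ler_wpM2r.
Qed.

Lemma cvg_plane_kernel z w (p : R * R) : nonreal z -> nonreal w ->
  plane_kernel z w q @[q --> p] --> plane_kernel z w p.
Proof.
move=> z0 w0.
have h (c : R * R -> R) (x : CC R) : nonreal x -> continuous c ->
    (root_kernel x (c q) : CC R) @[q --> p] --> (root_kernel x (c p) : CC R).
  move=> x0 cc; apply: (@cvgCM _ _ (nbhs p)).
    apply: (@cvg_realC _ _ (nbhs p)).
    apply: (continuous_comp (f := fun q => 1 + c q ^+ 2)); last exact: sqrt_continuous.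
    by apply: cvgD; [exact: cvg_cst|exact: (cvgM (cc p) (cc p))].
  apply: (@cvgCV _ _ (nbhs p)); first exact: subrC_neq0.
  apply: (@cvgCB _ _ (nbhs p)); first exact: (@cvgC_cst _ _ (nbhs p)).
  exact: (@cvg_realC _ _ (nbhs p) _ c _ (cc p)).
apply: (@cvgCM _ _ (nbhs p)).
  by apply: (h fst) => // q; exact: cvg_fst.
by apply: (h snd) => // q; exact: cvg_snd.
Qed.

Lemma cbound_plane_kernel z w : nonreal z -> nonreal w ->
  cbound (fun p => complex.Re (plane_kernel z w p)) /\
  cbound (fun p => complex.Im (plane_kernel z w p)).
Proof.
move=> z0 w0; have [[_ b1] [_ b2]] := cbmeas_plane_kernel z0 w0.
split; split => // p.
  by apply: (@cvg_Re _ _ (nbhs p)); exact: cvg_plane_kernel.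
by apply: (@cvg_Im _ _ (nbhs p)); exact: cvg_plane_kernel.
Qed.

Lemma charge_limit_transform {F : set_system nat} {FF : Filter F}
    (rho : {charge set (R * R)%type -> \bar R}) z w :
  (forall f, cbound f ->
     charge_integral (rho_tilde (k n) (mu_ n)) f @[n --> F] --> charge_integral rho f) ->
  nonreal z -> nonreal w ->
  L n (plane_kernel z w) @[n --> F] --> charge_cintegral rho (plane_kernel z w).
Proof.
move=> h z0 w0; have [c1 c2] := cbound_plane_kernel z0 w0.
by apply: cvg_ReIm; exact: h.
Qed.

Context (ul : forall U, free_ultra U ->
  exists rho : {charge set (R * R)%type -> \bar R}, forall f, cbound f ->
    charge_integral (rho_tilde (k n) (mu_ n)) f @[n --> U] --> charge_integral rho f).

Lemma transforms_determine_limit (a b : R) (Phi : CC R -> CC R -> CC R) : 0 < a -> 0 < b ->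
  (forall z w, cones a b z -> cones a b w -> L n (plane_kernel z w) @[n --> \oo] --> Phi z w) ->
  exists rho : {charge set (R * R)%type -> \bar R}, forall f, cbound f ->
    charge_integral (rho_tilde (k n) (mu_ n)) f @[n --> \oo] --> charge_integral rho f.
Proof.
move=> a0 b0 hL; have [U0 fU0] := free_ultra_exists.
have [rho hrho] := ul fU0; exists rho => f cf.
have key U (rho' : {charge set (R * R)%type -> \bar R}) : free_ultra U ->
    (forall f, cbound f ->
      charge_integral (rho_tilde (k n) (mu_ n)) f @[n --> U] --> charge_integral rho' f) ->
    forall z w, cones a b z -> cones a b w -> charge_cintegral rho' (plane_kernel z w) = Phi z w.
  move=> fU h z w zc wc; have PU := free_ultra_proper fU.
  have z0 := cones_nonreal (ltW b0) zc; have w0 := cones_nonreal (ltW b0) wc.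
  have h1 := @charge_limit_transform U (@filter_filter _ _ PU) rho' z w h z0 w0.
  exact: (@cvgC_unique _ _ U PU _ _ _ h1 (free_ultra_cvg fU (hL z w zc wc))).
apply: cvg_free_ultra => U fU; have [rho' hrho'] := ul fU.
suff -> : charge_integral rho f = charge_integral rho' f by exact: hrho'.
have eqm : eq_meas rho rho'.
  by apply: (charge_uniqueness a0 b0) => z w zc wc; rewrite (key U0)// (key U).
apply: (bfunctional_eq (bfunctional_charge rho) (bfunctional_charge rho')).
  by move=> A mA; rewrite !charge_integral_indic// eqm.
exact: cbound_bmeas.
Qed.

End kernel_limits.

(** * Two-variable transforms *)

Section two_variable_limits.
Context {R : realType}.
Implicit Types (u v z w : CC R) (sigma : probability (R * R)%type R) (p : R * R).

Lemma cint_marg1 sigma (g : R -> CC R) : cbmeas g ->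
  cintegral (marg1 sigma) g = cintegral sigma (fun p => g p.1).
Proof. by move=> [g1 g2]; apply: complex_eqP; exact: Rint_marg1. Qed.

Lemma cint_marg2 sigma (g : R -> CC R) : cbmeas g ->
  cintegral (marg2 sigma) g = cintegral sigma (fun p => g p.2).
Proof. by move=> [g1 g2]; apply: complex_eqP; exact: Rint_marg2. Qed.

Definition mixed sigma u v : CC R :=
  cintegral sigma (fun p : R * R => (p.1 * p.2)%:C / ((u - p.1%:C) * (v - p.2%:C))).

Let ratio u (s : R) : CC R := u * (u - s%:C)^-1 - 1.

Let cratio u : nonreal u -> cbmeas (ratio u).
Proof. by move=> u0; apply: cbmeasB; [exact: cbmeas_ures|exact: cbmeas_cst]. Qed.

Let cratio1 u : nonreal u -> cbmeas (fun p : R * R => ratio u p.1).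
Proof. by move=> /cratio[r1 r2]; split; [exact: (bmeas_fst r1)|exact: (bmeas_fst r2)]. Qed.

Let cratio2 u : nonreal u -> cbmeas (fun p : R * R => ratio u p.2).
Proof. by move=> /cratio[r1 r2]; split; [exact: (bmeas_snd r1)|exact: (bmeas_snd r2)]. Qed.

Let mixedE u v p : nonreal u -> nonreal v ->
  (p.1 * p.2)%:C / ((u - p.1%:C) * (v - p.2%:C)) = ratio u p.1 * ratio v p.2.
Proof.
move=> u0 v0; have h1 := subrC_neq0 p.1 u0; have h2 := subrC_neq0 p.2 v0.
by rewrite /ratio rmorphM /=; field; rewrite h1 h2.
Qed.

(** The integrand is the product of u/(u - s) = 1 + s/(u - s) and of its analogue in the second
    variable. *)
Lemma Gtransform2_expansion sigma u v : nonreal u -> nonreal v ->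
  u * v * Gtransform2 sigma u v =
  1 + uG1 (marg1 sigma) u + uG1 (marg2 sigma) v + mixed sigma u v.
Proof.
move=> u0 v0; have r1 := cratio1 u0; have r2 := cratio2 v0.
have c1 := cbmeas_resolvent (@measurable_fst _ _ R R) u0.
have c2 := cbmeas_resolvent (@measurable_snd _ _ R R) v0.
rewrite /uG1 uG_sub1// uG_sub1// cint_marg1; last exact: cratio.
rewrite cint_marg2; last exact: cratio.
have cc : cbmeas (fun _ : R * R => (1 : CC R)) by exact: cbmeas_cst.
have -> : mixed sigma u v = cintegral sigma (fun p => ratio u p.1 * ratio v p.2).
  by rewrite /mixed; congr cintegral; apply/funext => p; rewrite mixedE.
have e1 : (1 : CC R) = cintegral sigma (fun=> 1).
  by rewrite (cint_cst sigma) mul1r (_ : fine _ = 1)//= probability_setT.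
rewrite [X in X + _ + _ + _]e1 /Gtransform2 -(@cintD _ _ _ sigma _ _ cc r1).
rewrite -(@cintD _ _ _ sigma _ _ (cbmeasD cc r1) r2).
rewrite -(@cintD _ _ _ sigma _ _ (cbmeasD (cbmeasD cc r1) r2) (cbmeasM r1 r2)).
rewrite -(@cintZ _ _ _ sigma (u * v)).
  congr cintegral; apply/funext => p; rewrite /ratio.
  have h1 := subrC_neq0 p.1 u0; have h2 := subrC_neq0 p.2 v0.
  by field; rewrite h1 h2.
by under [X in cbmeas X]eq_fun do rewrite invfM; exact: cbmeasM.
Qed.

Lemma mixed_bound sigma c1 c2 eta (M : R) u v : 0 <= c1 -> 0 < eta -> 0 < M ->
  region c1 eta u -> region c2 eta v ->
  nm (mixed sigma u v) <= ntbound (marg1 sigma) c1 eta M * (c2 + 1).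
Proof.
move=> c0 e0 M0 ru rv.
have u0 := region_nonreal e0 ru; have v0 := region_nonreal e0 rv.
have c20 : 0 <= c2.
  by have [h1 h2] := rv; have := le_trans (nm_ge0 _) h1; rewrite pmulr_lge0// (lt_le_trans e0).
have c2p : 0 <= c2 + 1 by rewrite addr_ge0.
apply: le_trans (ler_wpM2r c2p (Rint_resolvent_bound (marg1 sigma) c0 e0 M0 ru)).
rewrite Rint_marg1; last by apply: cbmeas_nm; exact: cratio.
rewrite mulrC -RintZ; last by apply: cbmeas_nm; exact: cratio1.
rewrite /mixed; under [fun p : R * R => _]eq_fun do rewrite mixedE//.
apply: nm_cint_le.
- by apply: cbmeasM; [exact: cratio1|exact: cratio2].
- by apply: bmeasZ; apply: cbmeas_nm; exact: cratio1.
- move=> p; rewrite nmM mulrC ler_wpM2r ?nm_ge0//.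
  apply: le_trans (nmB _ _) _; rewrite nm1 lerD2r; exact: resolvent_bound1 rv.
Qed.

(** The mixed integrand is the product of s/(u - s), whose modulus has a small integral by
    concentration at 0, and of t/(v - t), bounded on a sector that eventually contains the
    points. *)
Lemma mixed_vanishes (nu_ : nat -> probability (R * R)%type R) (u_ v_ : nat -> CC R) z w :
  u_ @ \oo --> z -> v_ @ \oo --> w -> nonreal z -> nonreal w ->
  (forall M e : R, 0 < M -> 0 < e -> \forall n \near \oo, tail (marg1 (nu_ n)) M <= e) ->
  mixed (nu_ n) (u_ n) (v_ n) @[n --> \oo] --> (0 : CC R).
Proof.
move=> uz vw z0 w0 atoms.
pose eta := Num.min (`|complex.Im z| / 2) (`|complex.Im w| / 2).
have e0 : 0 < eta by rewrite lt_min !divr_gt0 ?normr_gt0.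
pose c (x : CC R) := (nm x + 1) / eta.
have c0 x : 0 <= c x by rewrite divr_ge0 ?(ltW e0)// addr_ge0 ?nm_ge0.
have reg (x_ : nat -> CC R) x : x_ @ \oo --> x -> nonreal x -> eta <= `|complex.Im x| / 2 ->
    \forall n \near \oo, region (c x) eta (x_ n).
  move=> xx x0 ex; have /cvgCP/(_ _ ltr01) hx := xx.
  apply: filterS2 hx (cvg_nonreal_near xx x0) => n h1 [h2 h3].
  have h4 : eta <= `|complex.Im (x_ n)| := le_trans ex h3.
  split => //; rewrite /c; apply: (@le_trans _ _ (nm x + 1)).
    have := nm_triangle (x_ n) x 0; rewrite !subr0 => h5.
    lra.
  by rewrite mulrAC ler_pdivlMr// ler_wpM2l// addr_ge0// nm_ge0.
have ez : eta <= `|complex.Im z| / 2 by rewrite ge_min lexx.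
have ew : eta <= `|complex.Im w| / 2 by rewrite ge_min lexx orbT.
apply/cvgCP => e ep.
have cp x : 0 < 1 + c x by rewrite ltr_pwDl.
(* [ntbound] contributes [d] from each of its two terms; with the bound 1 + c w on the second factor
   the total is e/2. *)
pose d := e / (1 + c w) / 4; have d0 : 0 < d by rewrite !divr_gt0.
have M0 : 0 < d * eta by rewrite mulr_gt0.
have t0 : 0 < d / (1 + c z) by rewrite divr_gt0.
apply: filterS3 (reg _ _ uz z0 ez) (reg _ _ vw w0 ew) (atoms _ _ M0 t0) => n ru rv ht.
rewrite subr0; apply: le_lt_trans (mixed_bound (nu_ n) (c0 z) e0 M0 ru rv) _.
have h1 : ntbound (marg1 (nu_ n)) (c z) eta (d * eta) <= 2 * d.
  have -> : 2 * d = d + d by ring.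
  rewrite /ntbound mulfK ?gt_eqF// lerD2l.
  by rewrite mulrC -ler_pdivlMr.
have -> : c w + 1 = 1 + c w by rewrite addrC.
apply: le_lt_trans (ler_wpM2r (ltW (cp w)) h1) _.
have -> : 2 * d * (1 + c w) = e / 2.
  by rewrite /d; field; rewrite gt_eqF.
by rewrite ltr_pdivrMr// ltr_pMr// ltr1n.
Qed.

End two_variable_limits.

Section transform_asymptotics.
Context {R : realType} {k : nat -> nat} (k_gt0 : forall n, (0 < k n)%N)
  (k_cvg : k n @[n --> \oo] --> \oo) {mu_ nu_ : nat -> probability (R * R)%type R}
  {z w alpha beta : CC R} (z0 : nonreal z) (w0 : nonreal w).

Let u n := Finv (marg1 (nu_ n)) z.
Let v n := Finv (marg2 (nu_ n)) w.
Let A n := uG1 (marg1 (mu_ n)) (u n).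
Let B n := uG1 (marg2 (mu_ n)) (v n).

Context (uz : u @ \oo --> z) (vw : v @ \oo --> w)
  (uP : forall n, nonreal (u n) /\ Ftransform (marg1 (nu_ n)) (u n) = z)
  (vP : forall n, nonreal (v n) /\ Ftransform (marg2 (nu_ n)) (v n) = w)
  (kA : (k n)%:R * A n @[n --> \oo] --> alpha)
  (kB : (k n)%:R * B n @[n --> \oo] --> beta)
  (atoms : forall M e : R, 0 < M -> 0 < e ->
     \forall n \near \oo, tail (marg1 (nu_ n)) M <= e).

Lemma nonreal_neq0 (x : CC R) : nonreal x -> x != 0.
Proof. by rewrite /nonreal /=; apply: contraNneq => ->. Qed.

Let D n := z * w * G2_inverse (nu_ n) (nu_ n) z w.

Let A0 : A @ \oo --> (0 : CC R). Proof. exact: (cvg_unscale k_gt0 k_cvg kA). Qed.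

Let B0 : B @ \oo --> (0 : CC R). Proof. exact: (cvg_unscale k_gt0 k_cvg kB). Qed.

Let Q n := ((1 + A n) * (1 + B n) * D n)^-1.

(** The part of k_n times the c-bi-free transform whose limit is known from [kA] and [kB]. The rest
    is k_n times the mixed integral times [Q], and [Q] tends to 1, so the two limits exist
    together. *)
Let P n := z^-1 * (u n * ((k n)%:R * A n) * (1 + A n)^-1)
  + w^-1 * (v n * ((k n)%:R * B n) * (1 + B n)^-1) - (k n)%:R * A n * B n * Q n.

(** As F(u_n) = z, the number u_n G(u_n) - 1 for the first marginal of [nu_] is u_n/z - 1, and
    likewise for the second; the expansion of the two-variable transform then tends to 1. *)
Let cvgD1 : D @ \oo --> (1 : CC R).
Proof.
have zn0 := nonreal_neq0 z0; have wn0 := nonreal_neq0 w0.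
have E : D = fun n => z * (u n)^-1 * (w * (v n)^-1) *
    ((u n / z + (v n / w - 1)) + mixed (nu_ n) (u n) (v n)).
  apply/funext => n; have [un0 Fu] := uP n; have [vn0 Fv] := vP n.
  have h1 := nonreal_neq0 un0; have h2 := nonreal_neq0 vn0.
  have e1 : uG1 (marg1 (nu_ n)) (u n) = u n / z - 1.
    by rewrite /uG1 -{1}Fu /Ftransform invrK.
  have e2 : uG1 (marg2 (nu_ n)) (v n) = v n / w - 1.
    by rewrite /uG1 -{1}Fv /Ftransform invrK.
  have := Gtransform2_expansion (nu_ n) un0 vn0; rewrite e1 e2 => e3.
  have -> : u n / z + (v n / w - 1) + mixed (nu_ n) (u n) (v n) =
    u n * v n * Gtransform2 (nu_ n) (u n) (v n) by rewrite e3; ring.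
  by rewrite /D /G2_inverse -/(u n) -/(v n); field; rewrite h1 h2.
have c (x : CC R) : (fun _ : nat => x) @ \oo --> x by exact: cvgC_cst.
have h1 : u n / z @[n --> \oo] --> z / z by exact (cvgCM uz (c z^-1)).
have h2 : v n / w - 1 @[n --> \oo] --> w / w - 1 by exact (cvgCB (cvgCM vw (c w^-1)) (c 1)).
have h3 : z * (u n)^-1 @[n --> \oo] --> z * z^-1 by exact (cvgCM (c z) (cvgCV zn0 uz)).
have h4 : w * (v n)^-1 @[n --> \oo] --> w * w^-1 by exact (cvgCM (c w) (cvgCV wn0 vw)).
have e1 : z * z^-1 * (w * w^-1) * ((z / z + (w / w - 1)) + 0) = 1.
  by rewrite !mulfV// subrr !addr0 !mulr1.
rewrite E -[X in _ --> X]e1.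
exact (cvgCM (cvgCM h3 h4) (cvgCD (cvgCD h1 h2) (mixed_vanishes uz vw z0 w0 atoms))).
Qed.

Let cvg1A : 1 + A n @[n --> \oo] --> (1 : CC R).
Proof. by rewrite -[X in _ --> X]addr0; apply: cvgCD; [exact: cvgC_cst|exact: A0]. Qed.

Let cvg1B : 1 + B n @[n --> \oo] --> (1 : CC R).
Proof. by rewrite -[X in _ --> X]addr0; apply: cvgCD; [exact: cvgC_cst|exact: B0]. Qed.

Let cvgQ : Q @ \oo --> (1 : CC R).
Proof.
have e1 : (1 * 1 * 1 : CC R)^-1 = 1 by rewrite !mulr1 invr1.
rewrite -[X in _ --> X]e1; apply: cvgCV; first by rewrite !mulr1 oner_neq0.
exact (cvgCM (cvgCM cvg1A cvg1B) cvgD1).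
Qed.

Let cvgP : P @ \oo --> alpha + beta.
Proof.
have zn0 := nonreal_neq0 z0; have wn0 := nonreal_neq0 w0.
have e1 : z^-1 * (z * alpha * 1^-1) + w^-1 * (w * beta * 1^-1) - alpha * 0 * 1 = alpha + beta.
  by rewrite invr1 !mulr1 mulr0 subr0 !mulKf.
rewrite -[X in _ --> X]e1.
apply: cvgCB.
  apply: cvgCD; (apply: cvgCM; first exact: cvgC_cst); apply: cvgCM.
  - exact: (cvgCM uz kA).
  - by apply: cvgCV; [exact: oner_neq0|exact: cvg1A].
  - exact: (cvgCM vw kB).
  - by apply: cvgCV; [exact: oner_neq0|exact: cvg1B].
by apply: cvgCM; [exact: (cvgCM kA B0)|exact: cvgQ].
Qed.

Lemma scaled_cvoiculescu2 n : (k n)%:R * cvoiculescu2 (mu_ n) (nu_ n) z w =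
  P n + (k n)%:R * mixed (mu_ n) (u n) (v n) * Q n.
Proof.
have [un0 _] := uP n; have [vn0 _] := vP n.
have h1 := nonreal_neq0 un0; have h2 := nonreal_neq0 vn0.
have g1 := Gtransform_neq0 (marg1 (mu_ n)) un0; have g2 := Gtransform_neq0 (marg2 (mu_ n)) vn0.
have eA : 1 + A n = u n * Gtransform (marg1 (mu_ n)) (u n) by rewrite /A /uG1 addrC subrK.
have eB : 1 + B n = v n * Gtransform (marg2 (mu_ n)) (v n) by rewrite /B /uG1 addrC subrK.
have a1 : 1 + A n != 0 by rewrite eA mulf_neq0.
have b1 : 1 + B n != 0 by rewrite eB mulf_neq0.
have F1 : Ftransform (marg1 (mu_ n)) (u n) = u n / (1 + A n).
  by rewrite eA /Ftransform; field; rewrite h1 g1.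
have F2 : Ftransform (marg2 (mu_ n)) (v n) = v n / (1 + B n).
  by rewrite eB /Ftransform; field; rewrite h2 g2.
have e3 : Ftransform (marg1 (mu_ n)) (u n) * Ftransform (marg2 (mu_ n)) (v n) *
    Gtransform2 (mu_ n) (u n) (v n) - 1 =
    (mixed (mu_ n) (u n) (v n) - A n * B n) / ((1 + A n) * (1 + B n)).
  have := Gtransform2_expansion (mu_ n) un0 vn0; rewrite -/(A n) -/(B n) => e3.
  rewrite F1 F2; have -> : u n / (1 + A n) * (v n / (1 + B n)) * Gtransform2 (mu_ n) (u n) (v n)
    = (u n * v n * Gtransform2 (mu_ n) (u n) (v n)) / ((1 + A n) * (1 + B n)).
    by field; rewrite a1 b1.
  by rewrite e3; field; rewrite a1 b1.
rewrite /cvoiculescu2 /cvoiculescu -/(D n) /G2_inverse -/(u n) -/(v n) e3 F1 F2.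
rewrite /P /Q !(invfM _ (D n)); set d := (D n)^-1.
have zn0 := nonreal_neq0 z0; have wn0 := nonreal_neq0 w0.
by field; rewrite a1 b1 zn0 wn0.
Qed.

Lemma cvoiculescu2_limit (gamma : CC R) :
  (k n)%:R * mixed (mu_ n) (u n) (v n) @[n --> \oo] --> gamma ->
  (k n)%:R * cvoiculescu2 (mu_ n) (nu_ n) z w @[n --> \oo] --> alpha + beta + gamma.
Proof.
move=> h; under eq_fun do rewrite scaled_cvoiculescu2.
by rewrite -[gamma]mulr1; exact: (cvgCD cvgP (cvgCM h cvgQ)).
Qed.

Lemma mixed_limit (Phi : CC R) :
  (k n)%:R * cvoiculescu2 (mu_ n) (nu_ n) z w @[n --> \oo] --> Phi ->
  (k n)%:R * mixed (mu_ n) (u n) (v n) @[n --> \oo] --> Phi - (alpha + beta).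
Proof.
move=> h.
have Qn0 : \forall n \near \oo, Q n != 0.
  have /cvgCP/(_ _ ltr01) := cvgQ; apply: filterS => n; apply: contraTneq => ->.
  by rewrite sub0r nmN nm1 ltxx.
have hl : ((k n)%:R * cvoiculescu2 (mu_ n) (nu_ n) z w - P n) * (Q n)^-1 @[n --> \oo] -->
    Phi - (alpha + beta).
  rewrite -[X in _ --> X]mulr1 -[X in _ * X]invr1; apply: cvgCM; first exact: (cvgCB h cvgP).
  by apply: cvgCV; [exact: oner_neq0|exact: cvgQ].
apply: cvg_trans hl; apply: near_eq_cvg; apply: filterS Qn0 => n Qn0.
by rewrite scaled_cvoiculescu2 addrC addKr mulfK.
Qed.

End transform_asymptotics.

(** * Analyticity of the limit *)

Section differentiability.
Context {R : realType}.
Local Notation CC2 := (CC R * CC R)%type.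
Implicit Types (z w h l : CC R) (rho : {charge set (R * R)%type -> \bar R}).

Definition linear2 (d e : CC R) (p : CC2) : CC R := p.1 * d + p.2 * e.

Lemma linear2_linear d e : linear (linear2 d e).
Proof. by move=> c [p1 p2] [q1 q2]; rewrite /linear2 /= -!/(_ * _); rewrite /GRing.scale /=; ring. Qed.

HB.instance Definition _ d e :=
  GRing.isLinear.Build (CC R) CC2 (CC R) *:%R (linear2 d e) (linear2_linear d e).

Lemma continuous_linear2 d e : continuous (linear2 d e).
Proof.
move=> p; apply: (@cvgCD _ _ (nbhs p)); apply: (@cvgCM _ _ (nbhs p)); try exact: (@cvgC_cst _ _ (nbhs p)).
  exact: cvg_fst.
exact: cvg_snd.
Qed.

Lemma pair_normE (p : CC2) : `|p| = (Num.max (nm p.1) (nm p.2))%:C.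
Proof.
by rewrite prod_normE !nmE !maxEle lecR; case: ifP.
Qed.

Lemma differentiable_quadratic (f : CC2 -> CC R) (x : CC2) (d e : CC R) (C delta : R) :
  0 < delta ->
  (forall h l, nm h <= delta -> nm l <= delta ->
    nm (f (h + x.1, l + x.2) - f x - (h * d + l * e)) <= C * (nm h ^+ 2 + nm l ^+ 2)) ->
  differentiable f x.
Proof.
move=> d0 H; have cl := @continuous_linear2 d e.
have o : f \o shift x = cst (f x) + linear2 d e +o_ (0 : CC2) id.
  apply/eqaddoP => eps eps0.
  have [e' e'0 ee] : exists2 e' : R, 0 < e' & eps = e'%:C.
    exists (complex.Re eps); last by apply/esym/RRe_real; rewrite realE ltW.
    by case: (eps) eps0 => a b; rewrite ltcE /= => /andP[].
  pose C' := Num.max C 1; have C0 : 0 < C' by rewrite lt_max ltr01 orbT.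
  (* On this radius the quadratic bound is at most [e'] times the larger of the two moduli, which is
     the norm of the pair. *)
  pose r := Num.min delta (e' / (2 * C')).
  have r0 : 0 < r by rewrite lt_min d0 divr_gt0// mulr_gt0.
  have n1 : \forall p \near (0 : CC2), nm (p.1 - 0 : CC R) < r.
    have c1 : (fun p : CC2 => p.1) @ nbhs (0 : CC2) --> (0 : CC R) by exact: cvg_fst.
    exact: ((@cvgCP _ _ (nbhs (0 : CC2)) _ _ _).1 c1 r r0).
  have n2 : \forall p \near (0 : CC2), nm (p.2 - 0 : CC R) < r.
    have c1 : (fun p : CC2 => p.2) @ nbhs (0 : CC2) --> (0 : CC R) by exact: cvg_snd.
    exact: ((@cvgCP _ _ (nbhs (0 : CC2)) _ _ _).1 c1 r r0).
  apply: filterS2 n1 n2 => -[h l] /=; rewrite !subr0 !lt_min => /andP[h1 h2] /andP[l1 l2].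
  rewrite pair_normE nmE ee -rmorphM lecR /=.
  rewrite -[X in nm X]/(f (h + x.1, l + x.2) - (f x + (h * d + l * e))) opprD addrA.
  apply: le_trans (H _ _ (ltW h1) (ltW l1)) _.
  set m := Num.max (nm h) (nm l).
  have hm : nm h <= m by rewrite le_max lexx.
  have lm : nm l <= m by rewrite le_max lexx orbT.
  have hn := nm_ge0 h; have ln := nm_ge0 l.
  have CC' : C <= C' by rewrite le_max lexx.
  have {}h2 : nm h * (2 * C') <= e' by rewrite -ler_pdivlMr ?mulr_gt0// ltW.
  have {}l2 : nm l * (2 * C') <= e' by rewrite -ler_pdivlMr ?mulr_gt0// ltW.
  apply: (@le_trans _ _ (C' * (nm h ^+ 2 + nm l ^+ 2))).
    by rewrite ler_wpM2r// addr_ge0// sqr_ge0.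
  have k1 : nm h * (2 * C') * nm h <= e' * m by apply: ler_pM => //; rewrite !mulr_ge0// ltW.
  have k2 : nm l * (2 * C') * nm l <= e' * m by apply: ler_pM => //; rewrite !mulr_ge0// ltW.
  by rewrite !expr2; nra.
by apply/diff_locallyP; rewrite (diff_unique cl o).
Qed.

Lemma charge_cintegralE rho (u : R * R -> CC R) : charge_cintegral rho u =
  cintegral (jordan_pos (hahnP rho)) u - cintegral (jordan_neg (hahnP rho)) u.
Proof. by []. Qed.

Lemma charge_cintegral_le rho : exists2 K : R, 0 <= K &
  forall (u : R * R -> CC R) (M : R), cbmeas u -> (forall p, nm (u p) <= M) ->
  nm (charge_cintegral rho u) <= K * M.
Proof.
exists (fine (jordan_pos (hahnP rho) setT) + fine (jordan_neg (hahnP rho) setT)).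
  by rewrite addr_ge0// fine_ge0.
move=> u M cu uM; rewrite charge_cintegralE; apply: le_trans (nmB _ _) _.
rewrite mulrDl; apply: lerD; rewrite mulrC -Rint_cst; apply: nm_cint_le => //; exact: bmeas_cst.
Qed.

Lemma differentiable_charge_transform rho z w : nonreal z -> nonreal w ->
  differentiable (fun p : CC2 => charge_cintegral rho (plane_kernel p.1 p.2)) (z, w).
Proof.
move=> z0 w0; have [K K0 hK] := charge_cintegral_le rho.
pose rz (p : R * R) : CC R := (z - p.1%:C)^-1; pose rw (p : R * R) : CC R := (w - p.2%:C)^-1.
have c1 : cbmeas rz by apply: cbmeas_resolvent => //; exact: measurable_fst.
have c2 : cbmeas rw by apply: cbmeas_resolvent => //; exact: measurable_snd.
have ck := cbmeas_plane_kernel z0 w0.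
pose u1 p := (-1) * (plane_kernel z w p * rz p); pose u2 p := (-1) * (plane_kernel z w p * rw p).
have cu1 : cbmeas u1 by apply: cbmeasM; [exact: cbmeas_cst|exact: cbmeasM].
have cu2 : cbmeas u2 by apply: cbmeasM; [exact: cbmeas_cst|exact: cbmeasM].
pose iz : R := 2 / `|complex.Im z|; pose iw : R := 2 / `|complex.Im w|.
pose C := K * (kernel_bound z * kernel_bound w * (2 * (iz ^+ 2 + iw ^+ 2))).
pose delta := Num.min (`|complex.Im z| / 2) (`|complex.Im w| / 2).
apply: (@differentiable_quadratic _ _ (charge_cintegral rho u1) (charge_cintegral rho u2) C delta).
  by rewrite lt_min !divr_gt0// normr_gt0.
move=> h l; rewrite !le_min => /andP[h1 h2] /andP[l1 l2] /=.
have hz : nm (h + z - z) <= `|complex.Im z| / 2 by rewrite addrK.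
have lw : nm (l + w - w) <= `|complex.Im w| / 2 by rewrite addrK.
have [z'0 _] := nonreal_near z0 hz; have [w'0 _] := nonreal_near w0 lw.
have ck' := cbmeas_plane_kernel z'0 w'0.
have -> : charge_cintegral rho (plane_kernel (h + z) (l + w)) - charge_cintegral rho (plane_kernel z w)
    - (h * charge_cintegral rho u1 + l * charge_cintegral rho u2) =
  charge_cintegral rho (fun p => plane_kernel (h + z) (l + w) p - plane_kernel z w p
    - (h * u1 p + l * u2 p)).
  have d1 := cbmeasM (cbmeas_cst h) cu1; have d2 := cbmeasM (cbmeas_cst l) cu2.
  rewrite !charge_cintegralE.
  rewrite !(cintB _ (cbmeasB ck' ck) (cbmeasD d1 d2)) !(cintB _ ck' ck) !(cintD _ d1 d2).
  by rewrite !(cintZ _ h cu1) !(cintZ _ l cu2); ring.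
rewrite /C -mulrA; apply: hK.
  apply: cbmeasB; first exact: cbmeasB.
  by apply: cbmeasD; apply: cbmeasM => //; exact: cbmeas_cst.
move=> p; rewrite /u1 /u2.
have e1 := root_kernel_sub p.1 z0 z'0; have e2 := root_kernel_sub p.2 w0 w'0.
have e3 := resolvent_sub p.1 z0 z'0; have e4 := resolvent_sub p.2 w0 w'0.
have b1 := near_resolvent_bound p.1 z0 hz; have b2 := near_resolvent_bound p.2 w0 lw.
have b3 : nm (rz p) <= iz.
  apply: near_resolvent_bound => //; rewrite subrr nm0 divr_ge0//.
have b4 : nm (rw p) <= iw.
  apply: near_resolvent_bound => //; rewrite subrr nm0 divr_ge0//.
rewrite !addrK in e1 e2 e3 e4.
have k1 := nm_root_kernel p.1 z0; have k2 := nm_root_kernel p.2 w0.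
rewrite /plane_kernel -/(rz p) -/(rw p) in e1 e2 e3 e4 *.
set rz' := (h + z - _)^-1 in e1 e3 b1; set rw' := (l + w - _)^-1 in e2 e4 b2.
set X := root_kernel z p.1 in e1 k1 *; set Y := root_kernel w p.2 in e2 k2 *.
move/eqP: e1; rewrite subr_eq => /eqP ->; move/eqP: e2; rewrite subr_eq => /eqP ->.
(* The expansion is exact: once the linear part is removed, a second use of the resolvent identity
   leaves only terms of order two in [h] and [l]. *)
have -> : (- h * (X * rz') + X) * (- l * (Y * rw') + Y) - X * Y -
    (h * (-1 * (X * Y * rz p)) + l * (-1 * (X * Y * rw p))) =
  X * Y * (h * - (rz' - rz p) + l * - (rw' - rw p) + h * l * (rz' * rw')) by ring.
rewrite e3 e4.
have -> : h * - (- h * (rz p * rz')) + l * - (- l * (rw p * rw')) + h * l * (rz' * rw') =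
  h * h * (rz p * rz') + l * l * (rw p * rw') + h * l * (rz' * rw') by ring.
rewrite nmM (nmM X) -[leRHS]mulrA; apply: ler_pM; rewrite ?nm_ge0 ?mulr_ge0 ?nm_ge0//.
  by apply: ler_pM; rewrite ?nm_ge0.
have hn := nm_ge0 h; have ln := nm_ge0 l.
have iz0 : 0 <= iz by rewrite divr_ge0. have iw0 : 0 <= iw by rewrite divr_ge0.
have t1 : nm (h * h * (rz p * rz')) <= nm h * nm h * (iz * iz).
  by rewrite nmM (nmM h) (nmM (rz p)); apply: ler_wpM2l; rewrite ?mulr_ge0//; apply: ler_pM; rewrite ?nm_ge0.
have t2 : nm (l * l * (rw p * rw')) <= nm l * nm l * (iw * iw).
  by rewrite nmM (nmM l) (nmM (rw p)); apply: ler_wpM2l; rewrite ?mulr_ge0//; apply: ler_pM; rewrite ?nm_ge0.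
have t3 : nm (h * l * (rz' * rw')) <= nm h * nm l * (iz * iw).
  by rewrite nmM (nmM h) (nmM rz'); apply: ler_wpM2l; rewrite ?mulr_ge0//; apply: ler_pM; rewrite ?nm_ge0.
have s1 := nmD (h * h * (rz p * rz') + l * l * (rw p * rw')) (h * l * (rz' * rw')).
have s2 := nmD (h * h * (rz p * rz')) (l * l * (rw p * rw')).
have q1 := sqr_ge0 (nm h * iz - nm l * iw); have q2 := sqr_ge0 (nm h * iw).
have q3 := sqr_ge0 (nm l * iz); rewrite !expr2 in q1 q2 q3 *; nra.
Qed.

End differentiability.

(** * Assembling the equivalence *)

Section marginal.
Context {R : realType} {k : nat -> nat} (k_gt0 : forall n, (0 < k n)%N)
  (k_cvg : k n @[n --> \oo] --> \oo)
  {nu_ m_ lam_ zeta_ : nat -> probability R R} {nu mu : probability R R}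
  {a b : R} (a0 : 0 < a) (b0 : 0 < b)
  (dn : forall n, inverse_defined (nu_ n) a b)
  (lam_pow : forall n, boxplus_pow (nu_ n) (k n) (lam_ n))
  (lam_cvg : weak_cvg lam_ nu)
  (zeta_pow : forall n, cboxplus_pow (m_ n) (nu_ n) (k n) (zeta_ n) (lam_ n))
  (zeta_cvg : weak_cvg zeta_ mu).

(** One function [Psi] serves all cones. The last clause admits any a', b' for which the inverses
    exist, since assertion (1) does not prescribe its domain. *)
Lemma marginal_continuation : exists Psi : CC R -> CC R,
  [/\ cvoiculescu_continuation mu nu Psi, twice_deriv (@nonreal R) Psi &
   forall a' b' : R, 0 < a' -> 0 < b' -> (forall n, inverse_defined (nu_ n) a' b') ->
   forall z : CC R, cones a' b' z -> (Finv (nu_ n) z @[n --> \oo] --> z) /\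
     ((k n)%:R * uG1 (m_ n) (Finv (nu_ n) z) @[n --> \oo] --> Psi z / z)].
Proof.
have bd := scaled_sqmass_bounded k_gt0 k_cvg a0 b0 dn lam_pow lam_cvg zeta_pow zeta_cvg.
have [B bB [nud H]] := scaled_uG1 k_gt0 k_cvg a0 b0 dn lam_pow lam_cvg zeta_pow zeta_cvg.
have B0 : 0 < B by apply: lt_le_trans bB.
have [Psi [tP eP lP]] := continuation_limit (u_ := fun n => Finv (nu_ n)) a0 B0 bd H.
exists Psi; split => //.
  split=> [z z0|a' b' a'0 b'0 nud' z zc].
    have [f1 [h1 _]] := tP; exact: cderiv_derivable (h1 z z0).
  apply: (cones_eq a'0 (ltW b'0) a0 _ _ eP zc); last exact: cvoiculescu_twice_deriv.
  by apply: twice_deriv_sub tP => y; exact: cones_nonreal (ltW b'0).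
move=> a' b' a'0 b'0 dn' z zc.
have uz := near_identity k_gt0 k_cvg a0 b0 dn lam_pow lam_cvg zeta_pow zeta_cvg a'0 b'0 dn' zc.
by split; [exact: uz|apply: (lP _ _ uz); exact: cones_nonreal (ltW b'0) zc].
Qed.

End marginal.

Section equivalences.
Context {R : realType} {k : nat -> nat} {mu_ nu_ : nat -> probability (R * R)%type R}.
Implicit Types (z w : CC R) (rho : {charge set (R * R)%type -> \bar R}).

Local Notation L n := (charge_cintegral (rho_tilde (k n) (mu_ n))).

Lemma scaled_mixed n z w : nonreal z -> nonreal w ->
  (k n)%:R * mixed (mu_ n) z w = L n (plane_kernel z w).
Proof.
move=> z0 w0; rewrite charge_cintegral_rho_tilde; last exact: cbmeas_plane_kernel.
by congr (_ * cintegral _ _); apply/funext => p; rewrite plane_kernel_density.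
Qed.

Lemma limit_chargesP rho : limit_charges mu_ k rho <->
  forall f, cbound f -> charge_integral (rho_tilde (k n) (mu_ n)) f @[n --> \oo] -->
    charge_integral rho f.
Proof.
split=> [h f [cf [M fM]]|h f cf bf].
  apply: h => //; exists M; split; first exact: num_real.
  by move=> N MN x _; exact: le_trans (fM x) (ltW MN).
apply: h; split => //; have [M [_ /(_ (M + 1))]] := bf.
by rewrite ltrDl ltr01 => /(_ isT) hM; exists (M + 1) => x; exact: hM.
Qed.

Lemma limit_charges_integrals rho : limit_charges mu_ k rho ->
  limit_integrals mu_ k (fun z w => charge_cintegral rho (plane_kernel z w)).
Proof.
move=> /limit_chargesP h z w z0 w0.
have -> : (fun n => (k n)%:R * cintegral (mu_ n) (fun p : R * R =>
       (p.1 * p.2)%:C / ((z - p.1%:C) * (w - p.2%:C)))) = fun n => L n (plane_kernel z w).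
  by apply/funext => n; rewrite -scaled_mixed.
exact: charge_limit_transform.
Qed.

Lemma limit_integrals_unique Phit Phit' : limit_integrals mu_ k Phit ->
  limit_integrals mu_ k Phit' -> forall z w, nonreal z -> nonreal w -> Phit z w = Phit' z w.
Proof. by move=> h h' z w z0 w0; exact: (cvgC_unique (h z w z0 w0) (h' z w z0 w0)). Qed.

Context (k_gt0 : forall n, (0 < k n)%N) (k_cvg : k n @[n --> \oo] --> \oo)
  {Psi1 Psi2 : CC R -> CC R}
  (vb : exists2 K : R, 0 <= K & \forall n \near \oo,
     (k n)%:R * Rintegral (mu_ n) setT (fun p => `|unit_density p|) <= K)
  (ul : forall U, free_ultra U ->
     exists rho : {charge set (R * R)%type -> \bar R}, forall f, cbound f ->
     charge_integral (rho_tilde (k n) (mu_ n)) f @[n --> U] --> charge_integral rho f)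
  (atoms : forall M e : R, 0 < M -> 0 < e ->
     \forall n \near \oo, tail (marg1 (nu_ n)) M <= e)
  (lim1 : forall a b : R, 0 < a -> 0 < b -> (forall n, inverse_defined (marg1 (nu_ n)) a b) ->
     forall z, cones a b z -> (Finv (marg1 (nu_ n)) z @[n --> \oo] --> z) /\
     ((k n)%:R * uG1 (marg1 (mu_ n)) (Finv (marg1 (nu_ n)) z) @[n --> \oo] --> Psi1 z / z))
  (lim2 : forall a b : R, 0 < a -> 0 < b -> (forall n, inverse_defined (marg2 (nu_ n)) a b) ->
     forall z, cones a b z -> (Finv (marg2 (nu_ n)) z @[n --> \oo] --> z) /\
     ((k n)%:R * uG1 (marg2 (mu_ n)) (Finv (marg2 (nu_ n)) z) @[n --> \oo] --> Psi2 z / z)).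

Lemma limit_integrals_charges Phit : limit_integrals mu_ k Phit ->
  exists rho, limit_charges mu_ k rho.
Proof.
move=> h; have [|rho hrho] := transforms_determine_limit ul ltr01 ltr01 (Phi := Phit).
  move=> z w /(cones_nonreal ler01) z0 /(cones_nonreal ler01) w0.
  by under eq_fun do rewrite -scaled_mixed//; exact: h.
by exists rho; apply/limit_chargesP.
Qed.

Section on_cones.
Context {a b : R} (a0 : 0 < a) (b0 : 0 < b) (dom : forall n, transform_domain (nu_ n) a b)
  {z w : CC R} (zc : cones a b z) (wc : cones a b w).

Let d1 n : inverse_defined (marg1 (nu_ n)) a b. Proof. by case: (dom n). Qed.
Let d2 n : inverse_defined (marg2 (nu_ n)) a b. Proof. by case: (dom n). Qed.
Let z0 : nonreal z. Proof. exact: cones_nonreal (ltW b0) zc. Qed.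
Let w0 : nonreal w. Proof. exact: cones_nonreal (ltW b0) wc. Qed.
Let uP n := FinvP a0 b0 (d1 n) zc.
Let vP n := FinvP a0 b0 (d2 n) wc.
Let l1 := lim1 a0 b0 d1 zc.
Let l2 := lim2 a0 b0 d2 wc.

Let u n := Finv (marg1 (nu_ n)) z.
Let v n := Finv (marg2 (nu_ n)) w.

Let shift : (k n)%:R * mixed (mu_ n) (u n) (v n) - L n (plane_kernel z w) @[n --> \oo] --> (0 : CC R).
Proof.
have -> : (fun n => (k n)%:R * mixed (mu_ n) (u n) (v n) - L n (plane_kernel z w)) =
    fun n => L n (plane_kernel (u n) (v n)) - L n (plane_kernel z w).
  by apply/funext => n; rewrite scaled_mixed//; [case: (uP n)|case: (vP n)].
exact: (charge_kernel_shift vb l1.1 l2.1 z0 w0).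
Qed.

Lemma cvoiculescu2_of_transform (gamma : CC R) :
  L n (plane_kernel z w) @[n --> \oo] --> gamma ->
  (k n)%:R * cvoiculescu2 (mu_ n) (nu_ n) z w @[n --> \oo] -->
  Psi1 z / z + Psi2 w / w + gamma.
Proof.
move=> h; apply: (cvoiculescu2_limit k_gt0 k_cvg z0 w0 l1.1 l2.1 uP vP l1.2 l2.2 atoms).
have -> : (fun n => (k n)%:R * mixed (mu_ n) (Finv (marg1 (nu_ n)) z) (Finv (marg2 (nu_ n)) w)) =
    fun n => ((k n)%:R * mixed (mu_ n) (u n) (v n) - L n (plane_kernel z w)) +
      L n (plane_kernel z w) by apply/funext => n; rewrite subrK.
by rewrite -[gamma]add0r; exact: (cvgCD shift h).
Qed.

Lemma transform_of_cvoiculescu2 (Phi : CC R) :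
  (k n)%:R * cvoiculescu2 (mu_ n) (nu_ n) z w @[n --> \oo] --> Phi ->
  L n (plane_kernel z w) @[n --> \oo] --> Phi - (Psi1 z / z + Psi2 w / w).
Proof.
move=> h; have h1 := mixed_limit k_gt0 k_cvg z0 w0 l1.1 l2.1 uP vP l1.2 l2.2 atoms h.
have -> : (fun n => L n (plane_kernel z w)) = fun n => (k n)%:R * mixed (mu_ n) (u n) (v n) -
    ((k n)%:R * mixed (mu_ n) (u n) (v n) - L n (plane_kernel z w)).
  by apply/funext => n; rewrite opprB addrC subrK.
by rewrite -[X in _ --> X]subr0; exact: (cvgCB h1 shift).
Qed.

End on_cones.

Lemma cvoiculescu2_charges a b Phi : limit_cvoiculescu2 mu_ nu_ k a b Phi ->
  exists rho, limit_charges mu_ k rho.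
Proof.
move=> [a0 b0 dom h].
have [|rho hrho] := transforms_determine_limit ul a0 b0
    (Phi := fun z w => Phi z w - (Psi1 z / z + Psi2 w / w)).
  by move=> z w zc wc; exact: (transform_of_cvoiculescu2 a0 b0 dom zc wc (h z w zc wc)).
by exists rho; apply/limit_chargesP.
Qed.

Lemma charges_cvoiculescu2 a b rho : 0 < a -> 0 < b ->
  (forall n, transform_domain (nu_ n) a b) -> limit_charges mu_ k rho ->
  limit_cvoiculescu2 mu_ nu_ k a b (fun z w => Psi1 z / z + Psi2 w / w +
    charge_cintegral rho (plane_kernel z w)).
Proof.
move=> a0 b0 dom /limit_chargesP h; split => // z w zc wc.
apply: (cvoiculescu2_of_transform a0 b0 dom zc wc).
by apply: charge_limit_transform => //; [exact: cones_nonreal (ltW b0) zc|exact: cones_nonreal (ltW b0) wc].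
Qed.

End equivalences.

Section inverse_terms.
Context {R : realType} {Psi : CC R -> CC R} (tP : twice_deriv (@nonreal R) Psi).
Implicit Types z w : CC R.

Lemma differentiable_inverse_mul z : nonreal z ->
  differentiable (fun x : CC R => x^-1 * Psi x) z.
Proof.
move=> z0; apply/derivable1_diffP; have [f1 [h1 _]] := tP.
have zn0 := nonreal_neq0 z0.
exact: cderiv_derivable (cderivM (cderivV zn0 (cderiv_id _)) (h1 z z0)).
Qed.

Lemma differentiable_inverse_mul_fst z w : nonreal z ->
  differentiable (fun p : CC R * CC R => p.1^-1 * Psi p.1) (z, w).
Proof.
move=> z0.
(* The first projection appears as [linear2 1 0], a continuous linear map and therefore
   differentiable. *)
have -> : (fun p : CC R * CC R => p.1^-1 * Psi p.1) =
    (fun x : CC R => x^-1 * Psi x) \o linear2 1 0.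
  by apply/funext => p; rewrite /= /linear2 mulr1 mulr0 addr0.
apply: differentiable_comp.
  by apply: linear_differentiable; exact: continuous_linear2.
by rewrite /linear2 /= mulr1 mulr0 addr0; exact: differentiable_inverse_mul.
Qed.

Lemma differentiable_inverse_mul_snd z w : nonreal w ->
  differentiable (fun p : CC R * CC R => p.2^-1 * Psi p.2) (z, w).
Proof.
move=> w0.
have -> : (fun p : CC R * CC R => p.2^-1 * Psi p.2) =
    (fun x : CC R => x^-1 * Psi x) \o linear2 0 1.
  by apply/funext => p; rewrite /= /linear2 mulr1 mulr0 add0r.
apply: differentiable_comp.
  by apply: linear_differentiable; exact: continuous_linear2.
by rewrite /linear2 /= mulr1 mulr0 add0r; exact: differentiable_inverse_mul.
Qed.

End inverse_terms.

Theorem theorem6p19 (R : realType)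
  (mu_ nu_ : nat -> probability (R * R)%type R) (k : nat -> nat)
  (k_gt0 : forall n, (0 < k n)%N) (k_cvg : k n @[n --> \oo] --> \oo)
  (nu : probability (R * R)%type R) (a b : R) (a_gt0 : 0 < a) (b_gt0 : 0 < b)
  (nu_domain : transform_domain nu a b)
  (nu_n_domain : forall n, transform_domain (nu_ n) a b)
  (phi_cvg : forall z w : CC R, cones a b z -> cones a b w ->
     (k n)%:R * voiculescu2 (nu_ n) z w @[n --> \oo] --> voiculescu2 nu z w)
  (lam1_ lam2_ : nat -> probability R R)
  (lam1_pow : forall n, boxplus_pow (marg1 (nu_ n)) (k n) (lam1_ n))
  (lam2_pow : forall n, boxplus_pow (marg2 (nu_ n)) (k n) (lam2_ n))
  (lam1_cvg : weak_cvg lam1_ (marg1 nu))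
  (lam2_cvg : weak_cvg lam2_ (marg2 nu))
  (zeta1_ zeta2_ : nat -> probability R R)
  (zeta1_pow : forall n,
     cboxplus_pow (marg1 (mu_ n)) (marg1 (nu_ n)) (k n) (zeta1_ n) (lam1_ n))
  (zeta2_pow : forall n,
     cboxplus_pow (marg2 (mu_ n)) (marg2 (nu_ n)) (k n) (zeta2_ n) (lam2_ n))
  (mu1 mu2 : probability R R)
  (zeta1_cvg : weak_cvg zeta1_ mu1) (zeta2_cvg : weak_cvg zeta2_ mu2) :
  [/\ (exists a' b' Phi, limit_cvoiculescu2 mu_ nu_ k a' b' Phi) <->
      (exists Phit, limit_integrals mu_ k Phit),
      (exists Phit, limit_integrals mu_ k Phit) <->
      (exists rho, limit_charges mu_ k rho)
    & forall (Phit : CC R -> CC R -> CC R)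
        (rho : {charge set (R * R)%type -> \bar R}),
      limit_integrals mu_ k Phit -> limit_charges mu_ k rho ->
      [/\ represents rho Phit,
          forall rho' : {charge set (R * R)%type -> \bar R},
            represents rho' Phit -> eq_meas rho' rho
        & exists Psi1 Psi2 : CC R -> CC R,
          [/\ cvoiculescu_continuation mu1 (marg1 nu) Psi1,
              cvoiculescu_continuation mu2 (marg2 nu) Psi2
            & forall a' b' Phi, limit_cvoiculescu2 mu_ nu_ k a' b' Phi ->
              exists Phih, continuation2 a' b' Phi Phih /\
                forall z w, nonreal z -> nonreal w ->
                  Phih z w = z^-1 * Psi1 z + w^-1 * Psi2 w + Phit z w]]].
Proof.
have d1 n : inverse_defined (marg1 (nu_ n)) a b by case: (nu_n_domain n).
have d2 n : inverse_defined (marg2 (nu_ n)) a b by case: (nu_n_domain n).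
have bd1 := scaled_sqmass_bounded k_gt0 k_cvg a_gt0 b_gt0 d1 lam1_pow lam1_cvg zeta1_pow zeta1_cvg.
have bd2 := scaled_sqmass_bounded k_gt0 k_cvg a_gt0 b_gt0 d2 lam2_pow lam2_cvg zeta2_pow zeta2_cvg.
have tl1 := scaled_tail k_gt0 k_cvg a_gt0 b_gt0 d1 lam1_pow lam1_cvg zeta1_pow zeta1_cvg.
have tl2 := scaled_tail k_gt0 k_cvg a_gt0 b_gt0 d2 lam2_pow lam2_cvg zeta2_pow zeta2_cvg.
have at1 := atom_limit k_gt0 k_cvg a_gt0 b_gt0 d1 lam1_pow lam1_cvg zeta1_pow zeta1_cvg.
have [Psi1 [cont1 twice1 lim1]] :=
  marginal_continuation k_gt0 k_cvg a_gt0 b_gt0 d1 lam1_pow lam1_cvg zeta1_pow zeta1_cvg.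
have [Psi2 [cont2 twice2 lim2]] :=
  marginal_continuation k_gt0 k_cvg a_gt0 b_gt0 d2 lam2_pow lam2_cvg zeta2_pow zeta2_cvg.
have vb := variation_bounded bd1 bd2.
have ul U (fU : free_ultra U) := ultra_limit_charge bd1 bd2 tl1 tl2 fU.
have i32 : (exists rho, limit_charges mu_ k rho) -> exists Phit, limit_integrals mu_ k Phit.
  by move=> [rho /limit_charges_integrals h]; eexists; exact: h.
have i23 : (exists Phit, limit_integrals mu_ k Phit) -> exists rho, limit_charges mu_ k rho.
  by move=> [Phit /(limit_integrals_charges ul)].
split.
- split=> [[a' [b' [Phi h]]]|/i23[rho h]].
    by apply: i32; exact: (cvoiculescu2_charges k_gt0 k_cvg vb ul at1 lim1 lim2 h).
  exists a, b; eexists.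
  exact: (charges_cvoiculescu2 k_gt0 k_cvg vb at1 lim1 lim2 a_gt0 b_gt0 nu_n_domain h).
- by split.
- move=> Phit rho hPhit hrho.
  have rep z w : nonreal z -> nonreal w -> Phit z w = charge_cintegral rho (plane_kernel z w).
    exact: (limit_integrals_unique hPhit (limit_charges_integrals hrho)).
  split.
  + move=> z w z0 w0; rewrite rep//; congr charge_cintegral; apply/funext => p.
    exact: plane_kernelE.
  + move=> rho' rep'; apply: (charge_uniqueness ltr01 ltr01).
    move=> z w /(cones_nonreal ler01) z0 /(cones_nonreal ler01) w0.
    rewrite -rep// rep'//; congr charge_cintegral; apply/funext => p.
    exact: plane_kernelE.
  + exists Psi1, Psi2; split => // a' b' Phi h; have [a'0 b'0 dom hl] := h.
    (* The continuation is written with the integral against [rho], whose differentiability is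
       known, rather than with [Phit], given only as a pointwise limit. *)
    exists (fun z w => z^-1 * Psi1 z + w^-1 * Psi2 w + charge_cintegral rho (plane_kernel z w)).
    split; last by move=> z w z0 w0; rewrite rep.
    split=> [z w z0 w0|z w zc wc].
      apply: differentiableD; last exact: differentiable_charge_transform.
      apply: differentiableD.
        exact: differentiable_inverse_mul_fst.
      exact: differentiable_inverse_mul_snd.
    (* On the cones both functions are limits of the same sequence. *)
    have [_ _ _ hl'] := charges_cvoiculescu2 k_gt0 k_cvg vb at1 lim1 lim2 a'0 b'0 dom hrho.
    rewrite [z^-1 * _]mulrC [w^-1 * _]mulrC.
    exact: (cvgC_unique (hl' z w zc wc) (hl z w zc wc)).
Qed.
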